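(* For $c\in\mathbb{C}$ with $\operatorname{Re} c>0$ let $\zeta_c(z)=\sum_{n,\ell=1}^\infty (c\ell+n)^{-z}$ (for $\operatorname{Re} z>2$, and extended by meromorphic continuation to a neighborhood of $z=0$), and let $\zeta_c'(0)$ denote the derivative of $\zeta_c(z)$ with respect to $z$ at $z=0$. Then the derivative with respect to $c$ of $\zeta_c'(0)$ is $$\frac{d}{dc}\zeta_c'(0)=\int_1^\infty \frac1t\,\frac{1}{e^t-1}\,\frac{-t e^{ct}}{(e^{ct}-1)^2}\,dt+\int_0^1\frac1t\left(\frac{-t e^{ct}}{(e^t-1)(e^{ct}-1)^2}+\frac{1}{c^2t^2}-\frac{1}{2c^2t}-\frac1{12}+\frac1{12c^2}\right)dt+\gamma_e\left(\frac1{12}-\frac1{12c^2}\right).$$ If $c=j>1$ is an integer, then this expression is equal to $$\left.\frac{d}{dc}\zeta_c'(0)\right|_{c=j}=-\frac1{12}-\frac1{8j^2}+\frac{1-j^2}{12j^2}\log j-\frac1{2j^3}\sum_{p=1}^{j}p(j-p)\,\psi\!\left(\frac pj\right).$$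
   Context: $\gamma_e$ is the Euler–Mascheroni constant, $\log$ is the natural logarithm, and $\psi(x)=\frac{d}{dx}\log\Gamma(x)$ is the digamma function. The series defining $\zeta_c(z)$ converges for $\operatorname{Re} z>2$; values and derivatives at $z=0$ are those of its meromorphic continuation. *)

(* Defs.v *)
From Stdlib Require Import Reals List.
From Coquelicot Require Import Coquelicot.
Import ListNotations.
Local Open Scope R_scope.

Definition Cexp (z : C) : C := (exp (Re z) * cos (Im z), exp (Re z) * sin (Im z)).

(* Principal logarithm on the half-plane [0 < Re w], the only place where it is
   used: there [Arg w = atan (Im w / Re w)]. *)
Definition Clog (w : C) : C := (ln (Cmod w), atan (Im w / Re w)).

Definition Cpower (w z : C) : C := Cexp (z * Clog w)%C.

Definition analytic_at (f : C -> C) (z0 : C) : Prop :=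
  exists (a : nat -> C) (r : posreal), forall z : C,
    Cmod (z - z0)%C < r ->
    is_pseries (K := C_AbsRing) (V := C_NormedModule) a (z - z0)%C (f z).

(* The value of [f] at [z0] itself is irrelevant, as for a pole. *)
Definition meromorphic_at (f : C -> C) (z0 : C) : Prop :=
  exists (n : nat) (g : C -> C), analytic_at g z0 /\
    locally' (T := C_UniformSpace) z0 (fun z : C => f z = (g z / (z - z0) ^ n)%C).

(* Unconditional sum of a double series (limit over finite sets of indices). *)
Definition is_double_sum (a : nat -> nat -> C) (s : C) : Prop :=
  forall eps : posreal, exists L0 : list (nat * nat),
  forall L : list (nat * nat), NoDup L -> incl L0 L ->
    Cmod (fold_right Cplus (RtoC 0) (map (fun p => a (fst p) (snd p)) L) - s)%C < eps.

(* Indices are shifted so that [n] and [l] start from 1. *)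
Definition zeta_term (c z : C) (n l : nat) : C :=
  Cpower (c * INR (S l) + INR (S n))%C (- z)%C.

(* [F] continues the series meromorphically from [2 < Re z] to a half-plane
   containing 0, and is regular at 0.  As half-planes are connected, the germ
   of [F] at 0 does not depend on the choice of [F] or [delta]. *)
Definition is_zeta_continuation (c : C) (F : C -> C) : Prop :=
  (forall z : C, 2 < Re z -> is_double_sum (zeta_term c z) (F z)) /\
  (exists delta : posreal, forall z : C, - delta < Re z -> meromorphic_at F z) /\
  analytic_at F (RtoC 0).

Definition euler_mascheroni : R :=
  real (Lim_seq (fun n => sum_n_m (fun k => / INR k) 1 n - ln (INR n))).

Definition Gamma (x : R) : R :=
  RInt_gen (fun t => Rpower t (x - 1) * exp (- t))
    (at_right 0) (Rbar_locally p_infty).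

Definition digamma (x : R) : R := Derive (fun y => ln (Gamma y)) x.

Definition integrand_infty (c : C) (t : R) : C :=
  (RtoC 1 / t * (RtoC 1 / (Cexp t - RtoC 1))
   * (- t * Cexp (c * t) / (Cexp (c * t) - RtoC 1) ^ 2))%C.

Definition integrand_unit (c : C) (t : R) : C :=
  (RtoC 1 / t
   * (- t * Cexp (c * t) / ((Cexp t - RtoC 1) * (Cexp (c * t) - RtoC 1) ^ 2)
      + RtoC 1 / (c ^ 2 * t ^ 2) - RtoC 1 / (RtoC 2 * c ^ 2 * t)
      - RtoC 1 / RtoC 12 + RtoC 1 / (RtoC 12 * c ^ 2)))%C.

(* The integrand on [0, 1] has a removable singularity at 0, so that the second
   integral is a proper one; its value at 0 plays no role. *)
Definition dzeta_integral (c : C) : C :=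
  (RInt_gen (V := C_R_CompleteNormedModule) (integrand_infty c)
     (at_point 1%R) (Rbar_locally p_infty)
   + RInt (V := C_R_CompleteNormedModule) (integrand_unit c) 0%R 1%R
   + euler_mascheroni * (RtoC 1 / RtoC 12 - RtoC 1 / (RtoC 12 * c ^ 2)))%C.

Definition dzeta_closed (j : nat) : R :=
  - (1 / 12) - 1 / (8 * INR j ^ 2)
  + (1 - INR j ^ 2) / (12 * INR j ^ 2) * ln (INR j)
  - 1 / (2 * INR j ^ 3)
    * sum_n_m (fun p => INR p * (INR j - INR p) * digamma (INR p / INR j)) 1 j.

(* Main.v *)
(* Comparing the lattice sum of [w ^ (- z)] over [w = c l + n] with mixed second differences
   (one difference in each lattice direction) of the antiderivatives [w ^ (2 - z)],
   [w ^ (1 - z)], [w ^ (- z)] leaves a double series that converges for [Re z > -1] by Taylor's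
   formula.  This continues [zeta_c], up to the denominator [(z - 1) (z - 2)], and expresses
   [zeta_c'(0)] as a regularised sum of logarithms.  Frullani's integral
   [- log w = int (e^(-w t) - e^(-t)) / t dt] and geometric series turn that sum into the
   regularised integral of [1 / (t (e^t - 1) (e^(c t) - 1))], whose divergences on [[1/N, N]] are
   removed by the Laurent expansion at 0, the coefficient of [log N] producing Euler's constant.
   A bound quadratic in [h] on the increment [c -> c + h] of the integrand gives the derivative.

   For [c = j], put [q = e^(-j t)] and expand [1 / (e^t - 1)] as the sum over [p = 1 .. j] of
   [e^(-p t) / (1 - q)].  Two integrations by parts reduce the integrand to the terms
   [p (j - p) e^(-p t) / (1 - q)], whose integrals are given by Gauss's formula for
   [digamma (p / j)]; the boundary terms give the rational part.  As [digamma] is defined from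
   Euler's integral, Gauss's formula is obtained from the log-convexity of [Gamma], which
   squeezes the difference quotients of [ln Gamma] between harmonic sums. *)

Require Import Defs.
From Stdlib Require Import Reals Factorial List Lra Lia Classical ClassicalEpsilon.
From Coquelicot Require Import Coquelicot.
Local Open Scope R_scope.

(** The mixed difference in the directions [1] and [c] acts on [exp (- w t)] as multiplication by
    [(1 - exp (- t)) (1 - exp (- c t))]. The inverse of this factor, cut after its constant Laurent
    term, tells which combination of antiderivatives to subtract; the error has relative order
    [t ^ 3], that is three further powers of [1 / w], hence the bound [Re z > -1]. The same three
    coefficients then govern the sum of logarithms and the divergences of the integral. Interchanges
    of limits rest on explicit bounds: improper integrals are truncated to [[1 / (n + 1), n + 1]],
    errors are bounded uniformly, and the limit in [n] is taken last. Analyticity being the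
    existence of a power series, differentiating the double series term by term requires bounds on
    Taylor coefficients; these come from averaging over roots of unity in place of contour
    integrals. As the continuation in the statement is arbitrary, it is compared with the
    constructed one along the segment from 3 to 0, on which both may have poles. *)

(** * Moduli and finite sums *)

Lemma C_eq (x y : C) : Re x = Re y -> Im x = Im y -> x = y.
Proof. destruct x, y; unfold Re, Im; simpl; now intros -> ->. Qed.

Lemma Re_plus (x y : C) : Re (x + y)%C = Re x + Re y.
Proof. reflexivity. Qed.

Lemma Im_plus (x y : C) : Im (x + y)%C = Im x + Im y.
Proof. reflexivity. Qed.

Lemma Re_opp (x : C) : Re (- x)%C = - Re x.
Proof. reflexivity. Qed.

Lemma Re_scal (a : R) (x : C) : Re (x * a)%C = Re x * a.
Proof. unfold Re; simpl; ring. Qed.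

Lemma Cmod_minus_sym (x y : C) : Cmod (x - y)%C = Cmod (y - x)%C.
Proof. rewrite <- Cmod_opp; f_equal; ring. Qed.

Lemma Cmod_minus_le (x y : C) : Cmod (x - y)%C <= Cmod x + Cmod y.
Proof. unfold Cminus; rewrite <- (Cmod_opp y); apply Cmod_triangle. Qed.

Lemma Cmod_triangle_inv (x y : C) : Cmod x - Cmod y <= Cmod (x - y)%C.
Proof.
  pose proof (Cmod_triangle (x - y) y) as H.
  replace (x - y + y)%C with x in H by ring. lra.
Qed.

Lemma Cmod_RtoC_pos (x : R) : 0 <= x -> Cmod x = x.
Proof. intros H; rewrite Cmod_R; now apply Rabs_pos_eq. Qed.

Lemma Re_neq_0 (w : C) : 0 < Re w -> w <> 0%C.
Proof. intros H ->; simpl in H; lra. Qed.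

Lemma im_le_Cmod (c : C) : Rabs (Im c) <= Cmod c.
Proof.
  eapply Rle_trans; [apply Rmax_r|apply Rmax_Cmod].
Qed.

Lemma Cmod_le_sum (z : C) : Cmod z <= Rabs (Re z) + Rabs (Im z).
Proof.
  destruct z as [x y]; simpl.
  replace (x, y) with (RtoC x + Ci * RtoC y)%C by (apply C_eq; simpl; ring).
  eapply Rle_trans; [apply Cmod_triangle|].
  rewrite Cmod_mult, Cmod_Ci, !Cmod_R. lra.
Qed.

Lemma Re_le_Cmod_pos (w : C) : Re w <= Cmod w.
Proof. eapply Rle_trans; [apply Rle_abs|apply re_le_Cmod]. Qed.

Lemma RtoC_neq_0 (x : R) : x <> 0 -> RtoC x <> 0%C.
Proof. intros H E; apply H; now apply RtoC_inj. Qed.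

(** Half-open sums with an empty sum at [n = 0]: telescoping, splitting and shifting then hold
    without side conditions. *)
Fixpoint Csum (f : nat -> C) (n : nat) : C :=
  match n with O => RtoC 0 | S k => (Csum f k + f k)%C end.

Fixpoint Rsum (f : nat -> R) (n : nat) : R :=
  match n with O => 0 | S k => Rsum f k + f k end.

Lemma Csum_ext (f g : nat -> C) (n : nat) :
  (forall k, (k < n)%nat -> f k = g k) -> Csum f n = Csum g n.
Proof.
  induction n as [|n IH]; intros H; simpl; [easy|].
  rewrite IH, H; auto with arith.
Qed.

Lemma Rsum_ext (f g : nat -> R) (n : nat) :
  (forall k, (k < n)%nat -> f k = g k) -> Rsum f n = Rsum g n.
Proof.
  induction n as [|n IH]; intros H; simpl; [easy|].
  rewrite IH, H; auto with arith.
Qed.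

Lemma Csum_plus (f g : nat -> C) (n : nat) :
  Csum (fun k => f k + g k)%C n = (Csum f n + Csum g n)%C.
Proof. induction n as [|n IH]; simpl; [ring|]. rewrite IH; ring. Qed.

Lemma Csum_minus (f g : nat -> C) (n : nat) :
  Csum (fun k => f k - g k)%C n = (Csum f n - Csum g n)%C.
Proof. induction n as [|n IH]; simpl; [ring|]. rewrite IH; ring. Qed.

Lemma Csum_scal (a : C) (f : nat -> C) (n : nat) :
  Csum (fun k => a * f k)%C n = (a * Csum f n)%C.
Proof. induction n as [|n IH]; simpl; [ring|]. rewrite IH; ring. Qed.

Lemma Rsum_plus (f g : nat -> R) (n : nat) :
  Rsum (fun k => f k + g k) n = Rsum f n + Rsum g n.
Proof. induction n as [|n IH]; simpl; [ring|]. rewrite IH; ring. Qed.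

Lemma Rsum_scal (a : R) (f : nat -> R) (n : nat) :
  Rsum (fun k => a * f k) n = a * Rsum f n.
Proof. induction n as [|n IH]; simpl; [ring|]. rewrite IH; ring. Qed.

Lemma Csum_shift (f : nat -> C) (n : nat) :
  Csum f (S n) = (f O + Csum (fun k => f (S k)) n)%C.
Proof. induction n as [|n IH]; simpl in *; [ring|]. rewrite IH; ring. Qed.

Lemma Rsum_shift (f : nat -> R) (n : nat) :
  Rsum f (S n) = f O + Rsum (fun k => f (S k)) n.
Proof. induction n as [|n IH]; simpl in *; [ring|]. rewrite IH; ring. Qed.

Lemma Cmod_Csum_le (f : nat -> C) (g : nat -> R) (n : nat) :
  (forall k, (k < n)%nat -> Cmod (f k) <= g k) -> Cmod (Csum f n) <= Rsum g n.
Proof.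
  induction n as [|n IH]; intros H; simpl; [rewrite Cmod_0; lra|].
  eapply Rle_trans; [apply Cmod_triangle|].
  apply Rplus_le_compat; [apply IH|apply H]; auto with arith.
Qed.

Lemma Csum_swap (f : nat -> nat -> C) (n m : nat) :
  Csum (fun i => Csum (f i) m) n = Csum (fun j => Csum (fun i => f i j) n) m.
Proof.
  induction n as [|n IH]; simpl.
  - induction m as [|m IH]; simpl; [ring|]. rewrite <- IH; ring.
  - rewrite IH, <- Csum_plus. now apply Csum_ext.
Qed.

Lemma Csum_const (a : C) (n : nat) : Csum (fun _ => a) n = (INR n * a)%C.
Proof.
  induction n as [|n IH]; [simpl; ring|].
  simpl Csum; rewrite IH, S_INR, RtoC_plus; ring.
Qed.

Lemma Csum_telescope (f : nat -> C) (n : nat) :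
  Csum (fun k => f k - f (S k))%C n = (f O - f n)%C.
Proof. induction n as [|n IH]; simpl; [ring|]. rewrite IH; ring. Qed.

Lemma Csum_geom (q : C) (n : nat) :
  ((RtoC 1 - q) * Csum (fun k => q ^ k) n = RtoC 1 - q ^ n)%C.
Proof.
  induction n as [|n IH]; simpl; [ring|].
  rewrite Cmult_plus_distr_l, IH; ring.
Qed.

Lemma Rsum_const (a : R) (n : nat) : Rsum (fun _ => a) n = INR n * a.
Proof. induction n as [|n IH]; [simpl; ring|]. simpl Rsum; rewrite IH, S_INR; ring. Qed.

(** * Derivatives of complex functions of a real variable *)

(** Split into real and imaginary parts, so that theorems on real functions of one variable apply to
    each part. *)
Definition cderiv (f : R -> C) (t : R) (l : C) : Prop :=
  is_derive (fun s => Re (f s)) t (Re l) /\ is_derive (fun s => Im (f s)) t (Im l).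

Lemma cderiv_const (a : C) (t : R) : cderiv (fun _ => a) t (RtoC 0).
Proof. split; simpl; apply (is_derive_const (V := R_NormedModule)). Qed.

Lemma cderiv_RtoC (f : R -> R) (t l : R) : is_derive f t l -> cderiv (fun s => RtoC (f s)) t (RtoC l).
Proof. split; simpl; [easy|]. apply (is_derive_const (V := R_NormedModule)). Qed.

Lemma cderiv_eq (f : R -> C) (t : R) (l l' : C) : cderiv f t l -> l = l' -> cderiv f t l'.
Proof. now intros H <-. Qed.

Lemma cderiv_ext (f g : R -> C) (t : R) (l : C) :
  (forall s, f s = g s) -> cderiv f t l -> cderiv g t l.
Proof.
  intros E [H1 H2]; split.
  - apply (is_derive_ext (fun s => Re (f s))); [intros; now rewrite E|easy].
  - apply (is_derive_ext (fun s => Im (f s))); [intros; now rewrite E|easy].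
Qed.

Lemma cderiv_plus (f g : R -> C) (t : R) (lf lg : C) :
  cderiv f t lf -> cderiv g t lg -> cderiv (fun s => f s + g s)%C t (lf + lg)%C.
Proof. intros [A B] [A' B']; split; simpl; apply (is_derive_plus (V := R_NormedModule)); easy. Qed.

Lemma cderiv_opp (f : R -> C) (t : R) (lf : C) :
  cderiv f t lf -> cderiv (fun s => - f s)%C t (- lf)%C.
Proof. intros [A B]; split; simpl; apply (is_derive_opp (V := R_NormedModule)); easy. Qed.

Lemma cderiv_minus (f g : R -> C) (t : R) (lf lg : C) :
  cderiv f t lf -> cderiv g t lg -> cderiv (fun s => f s - g s)%C t (lf - lg)%C.
Proof. intros A B; apply cderiv_plus; [easy|now apply cderiv_opp]. Qed.

Lemma cderiv_mult (f g : R -> C) (t : R) (lf lg : C) :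
  cderiv f t lf -> cderiv g t lg ->
  cderiv (fun s => f s * g s)%C t (lf * g t + f t * lg)%C.
Proof.
  intros [A B] [A' B']; split; unfold Re, Im in *; simpl.
  - evar_last.
    + apply (is_derive_minus (V := R_NormedModule)); apply Derive.is_derive_mult; eassumption.
    + unfold minus, plus, opp; simpl; ring.
  - evar_last.
    + apply (is_derive_plus (V := R_NormedModule)); apply Derive.is_derive_mult; eassumption.
    + unfold minus, plus, opp; simpl; ring.
Qed.

Lemma cderiv_scal (a : C) (f : R -> C) (t : R) (l : C) :
  cderiv f t l -> cderiv (fun s => a * f s)%C t (a * l)%C.
Proof.
  intros H. eapply cderiv_eq; [apply cderiv_mult; [apply cderiv_const|exact H]|cbv beta; ring].
Qed.

Lemma sum_sqr_neq_0 (z : C) : z <> 0%C -> Re z * Re z + Im z * Im z <> 0.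
Proof.
  intros H E. apply H.
  pose proof (Rle_0_sqr (Re z)); pose proof (Rle_0_sqr (Im z)); unfold Rsqr in *.
  apply C_eq; apply Rsqr_0_uniq; unfold Rsqr; simpl (Re 0); simpl (Im 0); lra.
Qed.

Lemma Cinv_pair (x y : R) : x * x + y * y <> 0 ->
  (/ (x, y))%C = ((x, (- y)%R) * RtoC (/ (x * x + y * y))%R)%C.
Proof. intros N; apply C_eq; simpl; field; easy. Qed.

Lemma cderiv_inv (f : R -> C) (t : R) (l : C) :
  cderiv f t l -> f t <> 0%C -> cderiv (fun s => / f s)%C t (- l / (f t * f t))%C.
Proof.
  intros [A B] Hf. pose proof (sum_sqr_neq_0 _ Hf) as N.
  set (x := fun s => Re (f s)) in *. set (y := fun s => Im (f s)) in *.
  change (is_derive x t (Re l)) in A. change (is_derive y t (Im l)) in B.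
  assert (Ux : Derive (fun s : R => x s) t = Re l) by (apply is_derive_unique, A).
  assert (Uy : Derive (fun s : R => y s) t = Im l) by (apply is_derive_unique, B).
  assert (Ea : ex_derive x t) by (eexists; exact A).
  assert (Eb : ex_derive y t) by (eexists; exact B).
  change (Re (f t)) with (x t) in N. change (Im (f t)) with (y t) in N.
  replace (f t) with (x t, y t) by (unfold x, y; now destruct (f t)).
  assert (M : (x t, y t) <> RtoC 0) by (intros E; apply N; injection E; intros -> ->; ring).
  replace (- l / ((x t, y t) * (x t, y t)))%C
    with (- l * (/ (x t, y t) * / (x t, y t)))%C by (field; easy).
  rewrite (Cinv_pair _ _ N).
  split.
  - apply (is_derive_ext (fun s => x s / (x s * x s + y s * y s))).
    { intros s; unfold x, y, Re, Im; simpl; now rewrite !Rmult_1_r. }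
    auto_derive; [easy|].
    rewrite Ux, Uy.
    destruct l as [p q]; simpl. field. easy.
  - apply (is_derive_ext (fun s => - y s / (x s * x s + y s * y s))).
    { intros s; unfold x, y, Re, Im; simpl; now rewrite !Rmult_1_r. }
    auto_derive; [easy|].
    rewrite Ux, Uy.
    destruct l as [p q]; simpl. field. easy.
Qed.

Lemma cderiv_div (f g : R -> C) (t : R) (lf lg : C) :
  cderiv f t lf -> cderiv g t lg -> g t <> 0%C ->
  cderiv (fun s => f s / g s)%C t ((lf * g t - f t * lg) / (g t * g t))%C.
Proof.
  intros A B N. eapply cderiv_eq.
  - apply cderiv_mult; [exact A|apply cderiv_inv; eassumption].
  - cbv beta; field; easy.
Qed.

Lemma cderiv_pow (f : R -> C) (t : R) (l : C) (n : nat) :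
  cderiv f t l -> cderiv (fun s => f s ^ n)%C t (INR n * f t ^ pred n * l)%C.
Proof.
  intros H; induction n as [|n IH].
  - simpl. eapply cderiv_eq; [apply cderiv_const|ring].
  - eapply cderiv_eq; [simpl; apply cderiv_mult; [exact H|exact IH]|].
    cbv beta; rewrite S_INR, RtoC_plus. destruct n; [change (INR 0) with 0; simpl; ring|].
    cbv [pred]; generalize (RtoC (INR (S n))); intros; simpl; ring.
Qed.

Lemma cderiv_Cexp (f : R -> C) (t : R) (l : C) :
  cderiv f t l -> cderiv (fun s => Cexp (f s)) t (Cexp (f t) * l)%C.
Proof.
  intros [A B].
  set (x := fun s => Re (f s)) in *. set (y := fun s => Im (f s)) in *.
  change (is_derive x t (Re l)) in A. change (is_derive y t (Im l)) in B.
  assert (Ux : Derive (fun s : R => x s) t = Re l) by (apply is_derive_unique, A).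
  assert (Uy : Derive (fun s : R => y s) t = Im l) by (apply is_derive_unique, B).
  assert (Ea : ex_derive x t) by (eexists; exact A).
  assert (Eb : ex_derive y t) by (eexists; exact B).
  split.
  - change (is_derive (fun s => exp (x s) * cos (y s)) t (Re (Cexp (f t) * l)%C)).
    auto_derive; [easy|].
    rewrite Ux, Uy.
    unfold x, y, Cexp, Re, Im; simpl; ring.
  - change (is_derive (fun s => exp (x s) * sin (y s)) t (Im (Cexp (f t) * l)%C)).
    auto_derive; [easy|].
    rewrite Ux, Uy.
    unfold x, y, Cexp, Re, Im; simpl; ring.
Qed.

Lemma Cmod_sqr (w : C) : Cmod w = sqrt (Re w * Re w + Im w * Im w).
Proof. unfold Cmod, Re, Im; f_equal; simpl; ring. Qed.

Lemma cderiv_Clog (f : R -> C) (t : R) (l : C) :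
  cderiv f t l -> 0 < Re (f t) -> cderiv (fun s => Clog (f s)) t (l / f t)%C.
Proof.
  intros [A B] P.
  set (x := fun s => Re (f s)) in *. set (y := fun s => Im (f s)) in *.
  change (is_derive x t (Re l)) in A. change (is_derive y t (Im l)) in B.
  assert (Ux : Derive (fun s : R => x s) t = Re l) by (apply is_derive_unique, A).
  assert (Uy : Derive (fun s : R => y s) t = Im l) by (apply is_derive_unique, B).
  assert (Ea : ex_derive x t) by (eexists; exact A).
  assert (Eb : ex_derive y t) by (eexists; exact B).
  change (Re (f t)) with (x t) in P.
  assert (S : 0 < x t * x t + y t * y t) by nra.
  replace (f t) with (x t, y t) by (unfold x, y; now destruct (f t)).
  unfold Cdiv; rewrite Cinv_pair by lra.
  split.
  - apply (is_derive_ext (fun s => ln (sqrt (x s * x s + y s * y s)))).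
    { intros s; unfold x, y; simpl; now rewrite Cmod_sqr. }
    auto_derive; [repeat split; auto; now apply sqrt_lt_R0|].
    rewrite Ux, Uy.
    pose proof (sqrt_lt_R0 _ S) as S'. pose proof (sqrt_sqrt _ (Rlt_le _ _ S)) as E.
    set (q := sqrt _) in *. rewrite <- E.
    destruct l as [p r]; simpl. field. lra.
  - change (is_derive (fun s => atan (y s / x s)) t (Im (l * ((x t, (- y t)%R) * RtoC (/ (x t * x t + y t * y t))%R))%C)).
    auto_derive; [repeat split; auto; lra|].
    rewrite Ux, Uy.
    destruct l as [p r]; unfold Rsqr; simpl.
    field. split; nra.
Qed.

Lemma cderiv_Cpower (f : R -> C) (e : C) (t : R) (l : C) :
  cderiv f t l -> 0 < Re (f t) ->
  cderiv (fun s => Cpower (f s) e) t (e * Cpower (f t) e / f t * l)%C.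
Proof.
  intros A P. unfold Cpower. eapply cderiv_eq.
  - apply cderiv_Cexp, cderiv_scal, cderiv_Clog; eassumption.
  - cbv beta; field. now apply Re_neq_0.
Qed.

(** * Exponential, principal logarithm and powers *)

Lemma Cexp_plus (x y : C) : Cexp (x + y) = (Cexp x * Cexp y)%C.
Proof.
  unfold Cexp. rewrite Re_plus, Im_plus, exp_plus, cos_plus, sin_plus.
  apply C_eq; unfold Re, Im; simpl; ring.
Qed.

Lemma Cexp_0 : Cexp 0 = RtoC 1.
Proof. apply C_eq; simpl; rewrite ?exp_0, ?cos_0, ?sin_0; ring. Qed.

Lemma Cmod_Cexp (z : C) : Cmod (Cexp z) = exp (Re z).
Proof.
  rewrite Cmod_sqr; simpl.
  replace (exp (Re z) * cos (Im z) * (exp (Re z) * cos (Im z)) + exp (Re z) * sin (Im z) * (exp (Re z) * sin (Im z)))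
    with (Rsqr (exp (Re z)) * (Rsqr (sin (Im z)) + Rsqr (cos (Im z)))) by (unfold Rsqr; ring).
  rewrite sin2_cos2, Rmult_1_r. apply sqrt_Rsqr, Rlt_le, exp_pos.
Qed.

Lemma Cexp_neq_0 (z : C) : Cexp z <> 0%C.
Proof. apply Cmod_gt_0. rewrite Cmod_Cexp. apply exp_pos. Qed.

Lemma Cexp_opp (z : C) : Cexp (- z) = (/ Cexp z)%C.
Proof.
  assert (H : (Cexp (- z) * Cexp z = 1)%C).
  { rewrite <- Cexp_plus. replace (- z + z)%C with (RtoC 0) by ring. apply Cexp_0. }
  rewrite <- (Cmult_1_l (/ Cexp z)), <- H. field. apply Cexp_neq_0.
Qed.

Lemma Cexp_RtoC (x : R) : Cexp x = RtoC (exp x).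
Proof. apply C_eq; simpl; rewrite ?cos_0, ?sin_0; ring. Qed.

Lemma Cexp_INR (n : nat) (z : C) : Cexp (INR n * z) = (Cexp z ^ n)%C.
Proof.
  induction n as [|n IH]; [simpl; rewrite Cmult_0_l; apply Cexp_0|].
  rewrite S_INR, RtoC_plus, Cmult_plus_distr_r, Cexp_plus, IH, Cmult_1_l. simpl; ring.
Qed.

Lemma Cexp_Clog (w : C) : 0 < Re w -> Cexp (Clog w) = w.
Proof.
  intros P. assert (N : 0 < Cmod w) by (apply Cmod_gt_0, Re_neq_0, P).
  assert (E : sqrt (1 + Rsqr (Im w / Re w)) = Cmod w / Re w).
  { rewrite Cmod_sqr. rewrite <- (sqrt_Rsqr (Re w)) at 4 by lra.
    rewrite <- sqrt_div_alt by (unfold Rsqr; nra). f_equal. unfold Rsqr. field. lra. }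
  apply C_eq; simpl; rewrite exp_ln, ?cos_atan, ?sin_atan, E by easy; field; lra.
Qed.

Lemma Clog_pos (x : R) : 0 < x -> Clog x = RtoC (ln x).
Proof.
  intros P. unfold Clog. rewrite Cmod_RtoC_pos by lra. apply C_eq; simpl; [easy|].
  unfold Rdiv; rewrite Rmult_0_l. apply atan_0.
Qed.

Lemma Cpower_plus (w a b : C) : Cpower w (a + b) = (Cpower w a * Cpower w b)%C.
Proof. unfold Cpower. rewrite <- Cexp_plus. f_equal. ring. Qed.

Lemma Cpower_INR (w : C) (n : nat) : 0 < Re w -> Cpower w (INR n) = (w ^ n)%C.
Proof. intros P. unfold Cpower. now rewrite Cexp_INR, Cexp_Clog. Qed.

(** The argument of [w] stays between [- PI / 2] and [PI / 2], so the imaginary part of the exponent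
    changes the modulus by a factor that is bounded uniformly in [w]. *)
Lemma Cmod_Cpower_le (w e : C) : 0 < Re w ->
  Cmod (Cpower w e) <= Rpower (Cmod w) (Re e) * exp (Rabs (Im e) * (PI / 2)).
Proof.
  intros P. unfold Cpower, Rpower. rewrite Cmod_Cexp, <- exp_plus.
  destruct (atan_bound (Im w / Re w)) as [A1 A2].
  set (a := atan _) in *.
  assert (H : Re (e * Clog w) <= Re e * ln (Cmod w) + Rabs (Im e) * (PI / 2)).
  { unfold Re at 1; simpl. fold (Re e) (Im e). fold a.
    cut (- (Im e * a) <= Rabs (Im e) * (PI / 2)); [lra|].
    eapply Rle_trans; [apply Rle_abs|]. rewrite Rabs_Ropp, Rabs_mult.
    apply Rmult_le_compat_l; [apply Rabs_pos|]. apply Rabs_le; lra. }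
  destruct H as [H|H]; [left; now apply exp_increasing|right; now rewrite H].
Qed.

(** * Mean value and Taylor estimates *)

(** The mean value equality fails for complex values. Projecting [F] on the direction of [F b - F a]
    gives the real function [m * g - Re (v * F)], whose derivative is nonnegative because
    [Re (v * F') <= m * Cmod F']. *)
Lemma cderiv_bound (F F' : R -> C) (g g' : R -> R) (a b : R) : a <= b ->
  (forall s, a <= s <= b -> cderiv F s (F' s)) ->
  (forall s, a <= s <= b -> is_derive g s (g' s)) ->
  (forall s, a <= s <= b -> Cmod (F' s) <= g' s) ->
  Cmod (F b - F a)%C <= g b - g a.
Proof.
  intros ab HF Hg Hb.
  set (v := Cconj (F b - F a)%C). set (m := Cmod (F b - F a)%C).
  (* For [m = 0] the projection carries no information, and only the monotonicity of [g] is at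
     stake. *)
  destruct (Req_dec m 0) as [Z|NZ].
  { rewrite Z.
    destruct (MVT_gen g a b g') as [c [Hc E]].
    - rewrite Rmin_left, Rmax_right by lra. intros; apply Hg; lra.
    - rewrite Rmin_left, Rmax_right by lra. intros x Hx.
      apply derivable_continuous_pt. exists (g' x). apply is_derive_Reals, Hg; lra.
    - rewrite Rmin_left, Rmax_right in Hc by lra.
      rewrite E. apply Rmult_le_pos; [|lra].
      eapply Rle_trans; [apply Cmod_ge_0|apply Hb; lra]. }
  assert (mp : 0 < m) by (pose proof (Cmod_ge_0 (F b - F a)%C) as G; fold m in G; lra).
  set (phi := fun s => m * g s - Re (v * F s)%C).
  set (phi' := fun s => m * g' s - Re (v * F' s)%C).
  assert (D : forall s, a <= s <= b -> is_derive phi s (phi' s)).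
  { intros s Hs. unfold phi, phi'. apply (is_derive_minus (V := R_NormedModule)).
    - apply is_derive_scal, Hg; easy.
    - apply (cderiv_scal v). now apply HF. }
  destruct (MVT_gen phi a b phi') as [c [Hc E]].
  - rewrite Rmin_left, Rmax_right by lra. intros; apply D; lra.
  - rewrite Rmin_left, Rmax_right by lra. intros x Hx.
    apply derivable_continuous_pt. exists (phi' x). apply is_derive_Reals, D; lra.
  - rewrite Rmin_left, Rmax_right in Hc by lra.
    assert (P : 0 <= phi' c).
    { unfold phi'. pose proof (Re_le_Cmod_pos (v * F' c)%C) as Q.
      rewrite Cmod_mult in Q. unfold v in Q at 2; rewrite Cmod_conj in Q. fold m in Q.
      pose proof (Rmult_le_compat_l m _ _ (Rlt_le _ _ mp) (Hb c Hc)). lra. }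
    assert (E2 : Re (v * F b)%C - Re (v * F a)%C = m * m).
    { unfold m. rewrite Cmod_sqr, sqrt_sqrt by nra. unfold v, Re, Im; simpl; ring. }
    assert (Q : 0 <= phi b - phi a) by (rewrite E; apply Rmult_le_pos; lra).
    unfold phi in Q. apply Rmult_le_reg_l with m; [easy|]. fold m. lra.
Qed.

Lemma cderiv_lipschitz (F F' : R -> C) (M : R) :
  (forall s, 0 <= s <= 1 -> cderiv F s (F' s)) ->
  (forall s, 0 <= s <= 1 -> Cmod (F' s) <= M) ->
  Cmod (F 1 - F 0)%C <= M.
Proof.
  intros HF HM. replace M with (M * 1 - M * 0) by ring.
  apply (cderiv_bound F F' (fun s => M * s) (fun _ => M)); auto; [lra|].
  intros s _. auto_derive; [easy|ring].
Qed.

Lemma is_derive_pow_fact (m : nat) (u : R) :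
  is_derive (fun s => s ^ S m / INR (fact (S m))) u (u ^ m / INR (fact m)).
Proof.
  rewrite fact_simpl, mult_INR.
  pose proof (INR_fact_neq_0 m). pose proof (not_0_INR (S m) (Nat.neq_succ_0 m)).
  auto_derive; [easy|].
  change (match m with 0%nat => 1 | S _ => INR m + 1 end) with (INR (S m)).
  field; now split.
Qed.

(** [g] lists a function and its successive derivatives. The derivative of the remainder of order
    [n + 1] of [g 0] is the remainder of order [n] of [g 1], so induction and the mean value
    inequality integrate the bound [s ^ n / n!]. *)
Lemma taylor_aux (n : nat) (M : R) : forall g : nat -> R -> C,
  (forall k s, (k < n)%nat -> 0 <= s <= 1 -> cderiv (g k) s (g (S k) s)) ->
  (forall s, 0 <= s <= 1 -> Cmod (g n s) <= M) ->
  forall s, 0 <= s <= 1 ->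
  Cmod (g O s - Csum (fun k => RtoC (s ^ k / INR (fact k)) * g k 0) n)%C <= M * (s ^ n / INR (fact n)).
Proof.
  induction n as [|n IH]; intros g Hd Hb s Hs.
  - simpl. replace (g O s - 0)%C with (g O s) by ring.
    replace (M * (1 / 1)) with M by field. now apply Hb.
  - pose (F := fun s => (g O s - Csum (fun k => RtoC (s ^ k / INR (fact k)) * g k 0) (S n))%C).
    pose (F' := fun s => (g 1%nat s - Csum (fun k => RtoC (s ^ k / INR (fact k)) * g (S k) 0) n)%C).
    assert (E0 : F 0 = 0%C).
    { unfold F. rewrite Csum_shift. simpl.
      rewrite (Csum_ext _ (fun _ => RtoC 0)).
      - rewrite Csum_const. replace (1/1) with 1 by field. ring.
      - intros k _. rewrite Rmult_0_l. unfold Rdiv. rewrite Rmult_0_l. ring. }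
    assert (H : Cmod (F s - F 0)%C <= M * (s ^ S n / INR (fact (S n))) - M * (0 ^ S n / INR (fact (S n)))).
    { apply (cderiv_bound F F' (fun s => M * (s ^ S n / INR (fact (S n)))) (fun s => M * (s ^ n / INR (fact n)))); [easy| | |].
      - intros u Hu. unfold F, F'. apply cderiv_minus; [apply Hd; [lia|lra]|].
        assert (G : forall m, cderiv (fun s => Csum (fun k => RtoC (s ^ k / INR (fact k)) * g k 0)%C (S m)) u
                      (Csum (fun k => RtoC (u ^ k / INR (fact k)) * g (S k) 0)%C m)).
        { clear. induction m as [|m IHm].
          - simpl. apply (cderiv_ext (fun _ => 0 + RtoC (1 / 1) * g O 0)%C); [easy|apply cderiv_const].
          - change (cderiv (fun s => Csum (fun k => RtoC (s ^ k / INR (fact k)) * g k 0)%C (S m) + RtoC (s ^ S m / INR (fact (S m))) * g (S m) 0)%C u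
              (Csum (fun k => RtoC (u ^ k / INR (fact k)) * g (S k) 0)%C m + RtoC (u ^ m / INR (fact m)) * g (S m) 0)%C).
            apply cderiv_plus; [exact IHm|].
            eapply cderiv_eq; [apply cderiv_mult; [apply (cderiv_RtoC _ _ (u ^ m / INR (fact m)))|apply cderiv_const]|cbv beta; ring].
            apply is_derive_pow_fact. }
        apply G.
      - intros u Hu. apply is_derive_scal, is_derive_pow_fact.
      - intros u Hu. apply (IH (fun k => g (S k))); [|easy|lra].
        intros k v Hk Hv. apply Hd; [lia|easy]. }
    rewrite E0 in H. fold (F s). replace (F s - 0)%C with (F s) in H by ring.
    simpl (0 ^ S n) in H. replace (M * (0 * 0 ^ n / INR (fact (S n)))) with 0 in H by (unfold Rdiv; ring). lra.
Qed.

(** The case [s = 1], with [1 / n!] bounded by 1; where decay in [n] counts, [taylor_aux] serves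
    directly. *)
Lemma taylor_bound (n : nat) (M : R) (g : nat -> R -> C) :
  (forall k s, (k < n)%nat -> 0 <= s <= 1 -> cderiv (g k) s (g (S k) s)) ->
  (forall s, 0 <= s <= 1 -> Cmod (g n s) <= M) ->
  Cmod (g O 1 - Csum (fun k => RtoC (/ INR (fact k)) * g k 0) n)%C <= M.
Proof.
  intros Hd Hb. eapply Rle_trans.
  - rewrite (Csum_ext _ (fun k => RtoC (1 ^ k / INR (fact k)) * g k 0)%C).
    + apply (taylor_aux n M g Hd Hb 1); lra.
    + intros k _. rewrite pow1. unfold Rdiv. now rewrite Rmult_1_l.
  - rewrite pow1. assert (P : 0 <= M) by (eapply Rle_trans; [apply Cmod_ge_0|apply (Hb 0); lra]).
    rewrite <- (Rmult_1_r M) at 2. apply Rmult_le_compat_l; [easy|].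
    assert (1 <= INR (fact n)).
    { apply (le_INR 1), lt_O_fact. }
    unfold Rdiv; rewrite Rmult_1_l, <- Rinv_1. apply Rinv_le_contravar; lra.
Qed.

Lemma Cexp_taylor (n : nat) (u : C) :
  Cmod (Cexp u - Csum (fun k => RtoC (/ INR (fact k)) * u ^ k) n)%C <= Cmod u ^ n * exp (Cmod u).
Proof.
  pose proof (taylor_bound n (Cmod u ^ n * exp (Cmod u)) (fun k s => u ^ k * Cexp (RtoC s * u))%C) as T.
  simpl in T. rewrite !Cmult_1_l in T.
  rewrite (Csum_ext (fun k => RtoC (/ INR (fact k)) * u ^ k)%C (fun k => (/ INR (fact k))%R * (u ^ k * Cexp (0 * u)))%C).
  - apply T.
    + intros k s _ _. eapply cderiv_eq.
      * apply cderiv_scal, cderiv_Cexp, cderiv_mult; [apply cderiv_RtoC, (is_derive_id (K := R_AbsRing))|apply cderiv_const].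
      * unfold one; simpl; cbv beta; ring.
    + intros s Hs. rewrite Cmod_mult, Cmod_pow, Cmod_Cexp.
      apply Rmult_le_compat_l; [apply pow_le, Cmod_ge_0|].
      assert (H : Re (s * u)%C <= Cmod u).
      { eapply Rle_trans; [apply Re_le_Cmod_pos|]. rewrite Cmod_mult, Cmod_RtoC_pos by lra.
        pose proof (Cmod_ge_0 u); nra. }
      destruct H as [H|H]; [left; now apply exp_increasing|right; now rewrite H].
  - intros k _. rewrite Cmult_0_l, Cexp_0. ring.
Qed.

(** * Limits and power series *)

(** Convergence measured by [Cmod], to avoid passing through the product structure of the plane at
    each use. *)
Definition clim (u : nat -> C) (l : C) : Prop :=
  forall eps, 0 < eps -> exists N, forall n, (N <= n)%nat -> Cmod (u n - l)%C < eps.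

Lemma clim_ext (u v : nat -> C) (l : C) : (forall n, u n = v n) -> clim u l -> clim v l.
Proof.
  intros E H eps He; destruct (H eps He) as [N HN]; exists N; intros n Hn.
  rewrite <- E; now apply HN.
Qed.

Lemma clim_const (l : C) : clim (fun _ => l) l.
Proof.
  intros eps He; exists O; intros n _.
  replace (l - l)%C with (RtoC 0) by ring. now rewrite Cmod_0.
Qed.

Lemma clim_plus (u v : nat -> C) (l m : C) :
  clim u l -> clim v m -> clim (fun n => u n + v n)%C (l + m)%C.
Proof.
  intros Hu Hv eps He.
  destruct (Hu (eps / 2)) as [N1 H1]; [lra|]. destruct (Hv (eps / 2)) as [N2 H2]; [lra|].
  exists (N1 + N2)%nat; intros n Hn.
  replace (u n + v n - (l + m))%C with ((u n - l) + (v n - m))%C by ring.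
  eapply Rle_lt_trans; [apply Cmod_triangle|].
  specialize (H1 n ltac:(lia)). specialize (H2 n ltac:(lia)). lra.
Qed.

Lemma clim_scal (a : C) (u : nat -> C) (l : C) :
  clim u l -> clim (fun n => a * u n)%C (a * l)%C.
Proof.
  intros Hu eps He. pose proof (Cmod_ge_0 a) as P.
  destruct (Hu (eps / (Cmod a + 1))) as [N1 H1]; [apply Rdiv_lt_0_compat; lra|].
  exists N1; intros n Hn. replace (a * u n - a * l)%C with (a * (u n - l))%C by ring.
  rewrite Cmod_mult. specialize (H1 n Hn). pose proof (Cmod_ge_0 (u n - l)%C).
  apply Rle_lt_trans with ((Cmod a + 1) * Cmod (u n - l)%C); [nra|].
  apply Rmult_lt_compat_l with (r := Cmod a + 1) in H1; [|lra].
  replace ((Cmod a + 1) * (eps / (Cmod a + 1))) with eps in H1 by (field; lra). lra.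
Qed.

Lemma clim_minus (u v : nat -> C) (l m : C) :
  clim u l -> clim v m -> clim (fun n => u n - v n)%C (l - m)%C.
Proof.
  intros Hu Hv. apply (clim_ext (fun n => u n + (- (1)) * v n)%C); [intros; ring|].
  replace (l - m)%C with (l + (- (1)) * m)%C by ring.
  apply clim_plus; [easy|now apply clim_scal].
Qed.

Lemma clim_unique (u : nat -> C) (l m : C) : clim u l -> clim u m -> l = m.
Proof.
  intros Hl Hm. destruct (Req_dec (Cmod (l - m)%C) 0) as [E|N].
  - apply Cmod_eq_0 in E. replace l with ((l - m) + m)%C by ring. rewrite E; ring.
  - pose proof (Cmod_ge_0 (l - m)%C).
    destruct (Hl (Cmod (l - m)%C / 2)) as [N1 H1]; [lra|].
    destruct (Hm (Cmod (l - m)%C / 2)) as [N2 H2]; [lra|].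
    specialize (H1 (N1 + N2)%nat ltac:(lia)). specialize (H2 (N1 + N2)%nat ltac:(lia)).
    set (w := u (N1 + N2)%nat) in *.
    pose proof (Cmod_minus_le (w - m)%C (w - l)%C) as T.
    replace (w - m - (w - l))%C with (l - m)%C in T by ring. lra.
Qed.

Lemma clim_bound (u : nat -> C) (l : C) (c : C) (M : R) (N : nat) :
  clim u l -> (forall n, (N <= n)%nat -> Cmod (u n - c)%C <= M) -> Cmod (l - c)%C <= M.
Proof.
  intros H HM. apply Rnot_lt_le; intros L.
  destruct (H (Cmod (l - c)%C - M)) as [N1 H1]; [lra|].
  specialize (H1 (N + N1)%nat ltac:(lia)). specialize (HM (N + N1)%nat ltac:(lia)).
  set (w := u (N + N1)%nat) in *.
  pose proof (Cmod_minus_le (w - c)%C (w - l)%C) as T.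
  replace (w - c - (w - l))%C with (l - c)%C in T by ring. lra.
Qed.

Lemma clim_shift (u : nat -> C) (l : C) : clim (fun n => u (S n)) l <-> clim u l.
Proof.
  split; intros H eps He; destruct (H eps He) as [N HN].
  - exists (S N); intros [|n] Hn; [lia|]. apply HN; lia.
  - exists N; intros n Hn; apply HN; lia.
Qed.

(** The uniform structure on pairs uses squares, the modulus uses discs; they contain one another up
    to the factor [sqrt 2]. *)
Lemma locally_Cmod (z : C) (P : C -> Prop) :
  locally (T := C_UniformSpace) z P <->
  exists d, 0 < d /\ forall y, Cmod (y - z)%C < d -> P y.
Proof.
  split.
  - intros [e He]. exists e; split; [apply cond_pos|]. intros y Hy.
    apply He. apply C_NormedModule_mixin_compat1. exact Hy.
  - intros [d [Hd H]].
    assert (S2 : 0 < sqrt 2) by (apply sqrt_lt_R0; lra).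
    exists (mkposreal (d / sqrt 2) (Rdiv_lt_0_compat _ _ Hd S2)).
    intros y Hy. apply H. apply C_NormedModule_mixin_compat2 in Hy. simpl in Hy.
    replace (sqrt 2 * (d / sqrt 2)) with d in Hy by (field; lra). exact Hy.
Qed.

Lemma sum_n_Csum (a : nat -> C) (n : nat) :
  sum_n (G := C_NormedModule) a n = Csum a (S n).
Proof.
  induction n as [|n IH].
  - rewrite sum_O. simpl. ring.
  - rewrite sum_Sn, IH. reflexivity.
Qed.

Lemma is_series_clim (a : nat -> C) (l : C) :
  is_series (K := C_AbsRing) (V := C_NormedModule) a l <-> clim (Csum a) l.
Proof.
  rewrite <- clim_shift. unfold is_series. split.
  - intros H eps He.
    destruct (H (fun y => Cmod (y - l)%C < eps)) as [N HN].
    { apply locally_Cmod. now exists eps. }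
    exists N; intros n Hn. rewrite <- sum_n_Csum. now apply HN.
  - intros H P HP. apply locally_Cmod in HP. destruct HP as [d [Hd HP]].
    destruct (H d Hd) as [N HN]. exists N. intros n Hn. apply HP.
    rewrite sum_n_Csum. now apply HN.
Qed.

Lemma Cpow_pow_n (x : C) (k : nat) : pow_n (K := C_Ring) x k = (x ^ k)%C.
Proof. induction k as [|k IH]; [reflexivity|]. simpl. now rewrite IH. Qed.

Lemma is_pseries_clim (a : nat -> C) (x l : C) :
  is_pseries (K := C_AbsRing) (V := C_NormedModule) a x l <->
  clim (Csum (fun k => a k * x ^ k)%C) l.
Proof.
  unfold is_pseries. rewrite is_series_clim.
  assert (E : forall n, Csum (fun k => scal (V := C_NormedModule) (pow_n (K := C_Ring) x k) (a k)) n
      = Csum (fun k => a k * x ^ k)%C n).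
  { intros n; apply Csum_ext; intros k _. rewrite Cpow_pow_n. apply Cmult_comm. }
  split; apply clim_ext; intros n; now rewrite E.
Qed.

Lemma geom_tail (q : R) (n m : nat) : 0 <= q < 1 ->
  Rsum (fun k => q ^ (n + k)) m <= q ^ n / (1 - q).
Proof.
  intros Hq.
  assert (E : Rsum (fun k => q ^ (n + k)) m = (q ^ n - q ^ (n + m)) / (1 - q)).
  { induction m as [|m IH]; simpl.
    - rewrite Nat.add_0_r. field; lra.
    - rewrite IH, Nat.add_succ_r. simpl. field; lra. }
  rewrite E. apply Rmult_le_compat_r; [left; apply Rinv_0_lt_compat; lra|].
  assert (0 <= q ^ (n + m)) by (apply pow_le; lra). lra.
Qed.

Lemma Csum_split (f : nat -> C) (n m : nat) :
  Csum f (n + m) = (Csum f n + Csum (fun k => f (n + k)%nat) m)%C.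
Proof.
  induction m as [|m IH]; simpl; [rewrite Nat.add_0_r; ring|].
  rewrite Nat.add_succ_r. simpl. rewrite IH. ring.
Qed.

Lemma Rsum_split (f : nat -> R) (n m : nat) :
  Rsum f (n + m) = Rsum f n + Rsum (fun k => f (n + k)%nat) m.
Proof.
  induction m as [|m IH]; simpl; [rewrite Nat.add_0_r; ring|].
  rewrite Nat.add_succ_r. simpl. rewrite IH. ring.
Qed.

Lemma coef_term_bound (a : nat -> C) (x : C) (rho M : R) (k : nat) : 0 < rho ->
  (forall k, Cmod (a k) * rho ^ k <= M) ->
  Cmod (a k * x ^ k)%C <= M * (Cmod x / rho) ^ k.
Proof.
  intros Hr Hb. rewrite Cmod_mult, Cmod_pow.
  unfold Rdiv. rewrite Rpow_mult_distr, pow_inv.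
  assert (P : 0 < rho ^ k) by now apply pow_lt.
  replace (Cmod (a k) * Cmod x ^ k) with ((Cmod (a k) * rho ^ k) * (Cmod x ^ k * / rho ^ k)) by (field; lra).
  apply Rmult_le_compat_r; [|apply Hb].
  apply Rmult_le_pos; [apply pow_le, Cmod_ge_0|left; now apply Rinv_0_lt_compat].
Qed.

(** The bound [Cmod (a k) * rho ^ k <= M] compares the tail with a geometric series. Such an
    inequality on the coefficients takes the place of a radius of convergence throughout. *)
Lemma pseries_tail (a : nat -> C) (x l : C) (rho M : R) (n : nat) :
  (forall k, Cmod (a k) * rho ^ k <= M) -> Cmod x < rho ->
  clim (Csum (fun k => a k * x ^ k)%C) l ->
  Cmod (l - Csum (fun k => a k * x ^ k)%C n)%C <= M * ((Cmod x / rho) ^ n / (1 - Cmod x / rho)).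
Proof.
  intros Hb Hx Hl. pose proof (Cmod_ge_0 x) as P.
  assert (Hq : 0 <= Cmod x / rho < 1).
  { split; [apply Rmult_le_pos; [easy|left; apply Rinv_0_lt_compat; lra]|].
    apply Rmult_lt_reg_r with rho; [lra|]. unfold Rdiv; rewrite Rmult_assoc, Rinv_l; lra. }
  assert (HM : 0 <= M).
  { eapply Rle_trans; [|apply (Hb O)]. apply Rmult_le_pos; [apply Cmod_ge_0|simpl; lra]. }
  apply (clim_bound _ _ _ _ n Hl). intros m Hm.
  replace m with (n + (m - n))%nat by lia. rewrite Csum_split.
  match goal with |- Cmod (?u + ?v - ?u)%C <= _ => replace (u + v - u)%C with v by ring end.
  eapply Rle_trans; [apply Cmod_Csum_le; intros k _; apply (coef_term_bound a x rho M); [lra|easy]|].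
  rewrite Rsum_scal. apply Rmult_le_compat_l; [easy|]. now apply geom_tail.
Qed.

(** Terms of a convergent series are bounded: beyond [N] consecutive partial sums are within 2 of
    each other, and an earlier term is at most the sum of the first [N] moduli. *)
Lemma pseries_coef_bound (a : nat -> C) (x l : C) :
  clim (Csum (fun k => a k * x ^ k)%C) l -> exists M, forall k, Cmod (a k) * Cmod x ^ k <= M.
Proof.
  intros H. destruct (H 1 Rlt_0_1) as [N HN].
  exists (Rsum (fun k => Cmod (a k * x ^ k)%C) N + 2). intros k.
  rewrite <- Cmod_pow, <- Cmod_mult.
  assert (Pos : forall n, 0 <= Rsum (fun k => Cmod (a k * x ^ k)%C) n).
  { induction n as [|n IH]; simpl; [lra|]. pose proof (Cmod_ge_0 (a n * x ^ n)%C). lra. }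
  destruct (Nat.le_gt_cases N k) as [L|L].
  - pose proof (HN k L) as H1. pose proof (HN (S k) ltac:(lia)) as H2. simpl in H2.
    set (s := Csum _ k) in *. set (t := (a k * x ^ k)%C) in *.
    pose proof (Cmod_minus_le (s + t - l)%C (s - l)%C) as T.
    replace (s + t - l - (s - l))%C with t in T by ring. specialize (Pos N). lra.
  - replace N with (k + S (N - S k))%nat by lia. rewrite Rsum_split, Rsum_shift, Nat.add_0_r.
    assert (0 <= Rsum (fun j => Cmod (a (k + S j)%nat * x ^ (k + S j))%C) (N - S k)).
    { generalize (N - S k)%nat as m; induction m as [|m IH]; simpl; [lra|].
      match goal with |- _ <= _ + Cmod ?z => pose proof (Cmod_ge_0 z) end. lra. }
    specialize (Pos k). lra.
Qed.

(** * Germs of analytic functions *)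

(** Convergence at the single point [r / 2] already yields the coefficient bound, and with it all
    estimates on the smaller disc. *)
Lemma analytic_coefs (f : C -> C) (z0 : C) : analytic_at f z0 ->
  exists (a : nat -> C) (rho M : R), 0 < rho /\ (forall k, Cmod (a k) * rho ^ k <= M) /\
    forall x, Cmod x < rho -> clim (Csum (fun k => a k * x ^ k)%C) (f (z0 + x)%C).
Proof.
  intros (a & [r Hr] & H). simpl in H.
  assert (C1 : forall x, Cmod x < r -> clim (Csum (fun k => a k * x ^ k)%C) (f (z0 + x)%C)).
  { intros x Hx. specialize (H (z0 + x)%C). replace (z0 + x - z0)%C with x in H by ring.
    now apply is_pseries_clim, H. }
  assert (Hm : Cmod (RtoC (r / 2)) = r / 2) by (apply Cmod_RtoC_pos; lra).
  destruct (pseries_coef_bound a (RtoC (r / 2)) (f (z0 + RtoC (r / 2))%C)) as [M HM].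
  { apply C1. rewrite Hm. lra. }
  rewrite Hm in HM.
  exists a, (r / 2), M; repeat split; [lra|exact HM|]. intros x Hx; apply C1; lra.
Qed.

Lemma analytic_intro (f : C -> C) (z0 : C) (a : nat -> C) (rho : R) : 0 < rho ->
  (forall x, Cmod x < rho -> clim (Csum (fun k => a k * x ^ k)%C) (f (z0 + x)%C)) ->
  analytic_at f z0.
Proof.
  intros Hr H. exists a, (mkposreal _ Hr). intros z Hz. simpl in Hz.
  apply is_pseries_clim. specialize (H _ Hz).
  now replace (z0 + (z - z0))%C with z in H by ring.
Qed.

Lemma analytic_ext (f g : C -> C) (z0 : C) (d : R) : 0 < d ->
  (forall z, Cmod (z - z0)%C < d -> f z = g z) -> analytic_at f z0 -> analytic_at g z0.
Proof.
  intros Hd E H. destruct (analytic_coefs _ _ H) as (a & rho & M & Hr & _ & Hc).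
  apply (analytic_intro g z0 a (Rmin d rho)); [now apply Rmin_glb_lt|].
  intros x Hx. rewrite <- E.
  - apply Hc. eapply Rlt_le_trans; [exact Hx|apply Rmin_r].
  - replace (z0 + x - z0)%C with x by ring. eapply Rlt_le_trans; [exact Hx|apply Rmin_l].
Qed.

Lemma analytic_minus (f g : C -> C) (z0 : C) :
  analytic_at f z0 -> analytic_at g z0 -> analytic_at (fun z => f z - g z)%C z0.
Proof.
  intros Hf Hg.
  destruct (analytic_coefs _ _ Hf) as (a & r & M & Hr & _ & Hc).
  destruct (analytic_coefs _ _ Hg) as (b & r' & M' & Hr' & _ & Hc').
  apply (analytic_intro _ z0 (fun k => a k - b k)%C (Rmin r r')); [now apply Rmin_glb_lt|].
  intros x Hx. eapply clim_ext; [|apply clim_minus; [apply Hc|apply Hc']].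
  - intros n. cbv beta. rewrite <- Csum_minus. apply Csum_ext; intros; ring.
  - eapply Rlt_le_trans; [exact Hx|apply Rmin_l].
  - eapply Rlt_le_trans; [exact Hx|apply Rmin_r].
Qed.

Lemma analytic_mult_center (f : C -> C) (z0 : C) :
  analytic_at f z0 -> analytic_at (fun z => (z - z0) * f z)%C z0.
Proof.
  intros Hf. destruct (analytic_coefs _ _ Hf) as (a & r & M & Hr & _ & Hc).
  apply (analytic_intro _ z0 (fun k => match k with O => RtoC 0 | S k => a k end) r Hr).
  intros x Hx. replace (z0 + x - z0)%C with x by ring. apply clim_shift.
  eapply clim_ext; [|apply (clim_scal x), Hc, Hx].
  intros n. rewrite Csum_shift, <- Csum_scal. rewrite Cmult_0_l, Cplus_0_l.
  apply Csum_ext; intros; simpl; ring.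
Qed.

Lemma analytic_mult_center_pow (f : C -> C) (z0 : C) (n : nat) :
  analytic_at f z0 -> analytic_at (fun z => (z - z0) ^ n * f z)%C z0.
Proof.
  intros Hf; induction n as [|n IH].
  - apply (analytic_ext f _ _ 1); [lra| |easy]. intros; simpl; ring.
  - eapply analytic_ext; [exact Rlt_0_1| |apply (analytic_mult_center _ _ IH)].
    intros; simpl; ring.
Qed.

Lemma analytic_scal (c : C) (f : C -> C) (z0 : C) :
  analytic_at f z0 -> analytic_at (fun z => c * f z)%C z0.
Proof.
  intros Hf. destruct (analytic_coefs _ _ Hf) as (a & r & M & Hr & _ & Hc).
  apply (analytic_intro _ z0 (fun k => c * a k)%C r Hr). intros x Hx.
  eapply clim_ext; [|apply (clim_scal c), Hc, Hx].
  intros n; cbv beta. rewrite <- Csum_scal. apply Csum_ext; intros; ring.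
Qed.

Lemma clim_0_of_bound (u : nat -> C) (l : C) (K q : R) : 0 <= q < 1 ->
  (forall n, Cmod (u n - l)%C <= K * q ^ n) -> clim u l.
Proof.
  intros Hq H eps He.
  assert (A : Rabs q < 1) by (rewrite Rabs_pos_eq; lra).
  destruct (pow_lt_1_zero q A (eps / (Rabs K + 1))) as [N HN].
  { apply Rdiv_lt_0_compat; [easy|]. pose proof (Rabs_pos K); lra. }
  exists N; intros n Hn. specialize (HN n Hn). specialize (H n).
  rewrite Rabs_pos_eq in HN by (apply pow_le; lra).
  pose proof (Rle_abs K). pose proof (Rabs_pos K). assert (0 <= q ^ n) by (apply pow_le; lra).
  apply Rle_lt_trans with ((Rabs K + 1) * q ^ n); [nra|].
  apply Rmult_lt_compat_l with (r := Rabs K + 1) in HN; [|lra].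
  replace ((Rabs K + 1) * (eps / (Rabs K + 1))) with eps in HN by (field; lra). lra.
Qed.

(** Taylor coefficients of the quotient by [x - d], found by comparing coefficients in
    [(x - d) * sum e_k x^k = sum a_k x^k]. *)
Fixpoint divide_coefs (a : nat -> C) (d : C) (k : nat) : C :=
  match k with
  | O => (- (a O / d))%C
  | S j => ((divide_coefs a d j - a (S j)) / d)%C
  end.

(** As [rho <= Cmod d / 2], one step of the recursion at most halves the inherited part and adds at
    most [M / Cmod d]; the value [2 * M / Cmod d] is preserved. *)
Lemma divide_coefs_bound (a : nat -> C) (d : C) (rho M : R) :
  0 < rho -> rho <= Cmod d / 2 -> (forall k, Cmod (a k) * rho ^ k <= M) ->
  forall k, Cmod (divide_coefs a d k) * rho ^ k <= 2 * M / Cmod d.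
Proof.
  intros Hr Hd Hb.
  assert (D0 : d <> 0%C) by (apply Cmod_gt_0; lra).
  assert (HM : 0 <= M).
  { eapply Rle_trans; [|apply (Hb O)]. apply Rmult_le_pos; [apply Cmod_ge_0|simpl; lra]. }
  assert (I : 0 < / Cmod d) by (apply Rinv_0_lt_compat; lra).
  induction k as [|k IH]; simpl.
  - rewrite Cmod_opp, Cmod_div by easy. specialize (Hb O). simpl in Hb.
    unfold Rdiv. nra.
  - rewrite Cmod_div by easy. specialize (Hb (S k)). simpl in Hb.
    pose proof (Cmod_minus_le (divide_coefs a d k) (a (S k))) as T.
    assert (P : 0 < rho ^ k) by now apply pow_lt.
    set (e := Cmod (divide_coefs a d k)) in *. set (b := Cmod (a (S k))) in *.
    apply Rle_trans with ((e + b) / Cmod d * (rho * rho ^ k)).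
    { apply Rmult_le_compat_r; [nra|]. apply Rmult_le_compat_r; lra. }
    replace ((e + b) / Cmod d * (rho * rho ^ k)) with ((e * rho ^ k) * (rho / Cmod d) + b * (rho * rho ^ k) / Cmod d) by (field; lra).
    assert (Q : rho / Cmod d <= / 2).
    { apply Rmult_le_reg_r with (Cmod d); [lra|]. unfold Rdiv. rewrite Rmult_assoc, Rinv_l; lra. }
    assert (Q0 : 0 <= rho / Cmod d) by (apply Rmult_le_pos; lra).
    apply Rle_trans with (2 * M / Cmod d * / 2 + M / Cmod d).
    + apply Rplus_le_compat.
      * apply Rmult_le_compat; [|easy|easy|easy].
        apply Rmult_le_pos; [apply Cmod_ge_0|lra].
      * apply Rmult_le_compat_r; lra.
    + right; field; lra.
Qed.

Lemma divide_coefs_sum (a : nat -> C) (d x : C) (n : nat) : d <> 0%C ->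
  ((x - d) * Csum (fun k => divide_coefs a d k * x ^ k) n
   = Csum (fun k => a k * x ^ k) n
     + match n with O => 0 | S m => divide_coefs a d m * x ^ n end)%C.
Proof.
  intros D0. induction n as [|n IH]; [simpl; ring|].
  simpl Csum. rewrite Cmult_plus_distr_l, IH. destruct n as [|n]; simpl; field; easy.
Qed.

Lemma analytic_div (f : C -> C) (z0 b : C) : z0 <> b ->
  analytic_at f z0 -> analytic_at (fun z => f z / (z - b))%C z0.
Proof.
  intros Hn Hf. destruct (analytic_coefs _ _ Hf) as (a & r & M & Hr & Hb & Hc).
  set (d := (b - z0)%C).
  assert (D0 : d <> 0%C).
  { intros E; apply Hn. replace b with (d + z0)%C by (unfold d; ring). rewrite E; ring. }
  assert (Dp : 0 < Cmod d) by now apply Cmod_gt_0.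
  set (rho := Rmin r (Cmod d / 2)).
  assert (Hrho : 0 < rho) by (apply Rmin_glb_lt; lra).
  assert (R1 : rho <= r) by apply Rmin_l. assert (R2 : rho <= Cmod d / 2) by apply Rmin_r.
  assert (Hb' : forall k, Cmod (a k) * rho ^ k <= M).
  { intros k. eapply Rle_trans; [|apply (Hb k)]. apply Rmult_le_compat_l; [apply Cmod_ge_0|].
    apply pow_incr; lra. }
  pose proof (divide_coefs_bound a d rho M Hrho R2 Hb') as He.
  apply (analytic_intro _ z0 (divide_coefs a d) rho Hrho). intros x Hx.
  assert (X0 : (x - d)%C <> 0%C).
  { intros E. assert (Cmod x = Cmod d); [|lra]. f_equal.
    replace x with ((x - d) + d)%C by ring. rewrite E; ring. }
  replace (z0 + x - b)%C with (x - d)%C by (unfold d; ring).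
  pose proof (Cmod_ge_0 x) as Px.
  assert (Hq : 0 <= Cmod x / rho < 1).
  { split; [apply Rmult_le_pos; [easy|left; apply Rinv_0_lt_compat; lra]|].
    apply Rmult_lt_reg_r with rho; [lra|]. unfold Rdiv; rewrite Rmult_assoc, Rinv_l; lra. }
  (* [B n] is the single term left over by [divide_coefs_sum] when the quotient series is cut; it is
     geometrically small. *)
  set (B := fun n => match n with O => RtoC 0 | S m => (divide_coefs a d m * x ^ n)%C end).
  assert (HM : 0 <= M).
  { eapply Rle_trans; [|apply (Hb O)]. apply Rmult_le_pos; [apply Cmod_ge_0|simpl; lra]. }
  assert (I : 0 <= 2 * M / Cmod d) by (apply Rmult_le_pos; [lra|left; now apply Rinv_0_lt_compat]).
  assert (HB : clim B 0).
  { apply (clim_0_of_bound _ _ (2 * M / Cmod d * rho) (Cmod x / rho) Hq). intros [|n]; unfold B.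
    - replace (RtoC 0 - RtoC 0)%C with (RtoC 0) by ring. rewrite Cmod_0. simpl. nra.
    - replace (divide_coefs a d n * x ^ S n - 0)%C with (x * (divide_coefs a d n * x ^ n))%C by (simpl; ring).
      rewrite Cmod_mult.
      pose proof (coef_term_bound (divide_coefs a d) x rho _ n Hrho He) as T.
      apply Rmult_le_compat_l with (r := Cmod x) in T; [|easy].
      eapply Rle_trans; [exact T|]. simpl. right; field; lra. }
  assert (Hx' : Cmod x < r) by lra.
  pose proof (clim_scal (/ (x - d)) _ _ (clim_plus _ _ _ _ (Hc x Hx') HB)) as L.
  replace (f (z0 + x) / (x - d))%C with (/ (x - d) * (f (z0 + x) + 0))%C by (field; easy).
  revert L. apply clim_ext. intros n. unfold B. rewrite <- divide_coefs_sum by easy. field. easy.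
Qed.

(** The difference is the tail from degree 2 on, and [Cmod x <= rho / 2] makes the geometric factor
    at most 2. *)
Lemma analytic_deriv_bound (f : C -> C) (z0 : C) (a : nat -> C) (rho M : R) : 0 < rho ->
  (forall k, Cmod (a k) * rho ^ k <= M) ->
  (forall x, Cmod x < rho -> clim (Csum (fun k => a k * x ^ k)%C) (f (z0 + x)%C)) ->
  forall x, Cmod x <= rho / 2 ->
  Cmod (f (z0 + x) - f z0 - a 1%nat * x)%C <= 2 * M / rho ^ 2 * Cmod x ^ 2.
Proof.
  intros Hr Hb Hc x Hx.
  assert (E0 : f z0 = a O).
  { apply (clim_unique (Csum (fun k => a k * (RtoC 0) ^ k)%C)).
    - replace (f z0) with (f (z0 + 0)%C) by (f_equal; ring). apply Hc. rewrite Cmod_0; lra.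
    - apply clim_shift. apply (clim_ext (fun _ => a O)); [|apply clim_const].
      intros n. rewrite Csum_shift, (Csum_ext _ (fun _ => RtoC 0)); [rewrite Csum_const; simpl; ring|].
      intros; simpl; ring. }
  pose proof (pseries_tail a x (f (z0 + x)%C) rho M 2 Hb ltac:(lra) (Hc x ltac:(lra))) as T.
  simpl Csum in T. rewrite E0.
  replace (f (z0 + x) - a O - a 1%nat * x)%C with (f (z0 + x) - (0 + a O * 1 + a 1%nat * (x * 1)))%C by ring.
  eapply Rle_trans; [exact T|].
  assert (HM : 0 <= M).
  { eapply Rle_trans; [|apply (Hb O)]. apply Rmult_le_pos; [apply Cmod_ge_0|simpl; lra]. }
  assert (Q : Cmod x / rho <= / 2).
  { apply Rmult_le_reg_r with rho; [lra|]. unfold Rdiv; rewrite Rmult_assoc, Rinv_l; lra. }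
  replace (2 * M / rho ^ 2 * Cmod x ^ 2) with (M * ((Cmod x / rho) ^ 2 * 2)) by (field; lra).
  apply Rmult_le_compat_l; [easy|]. apply Rmult_le_compat_l; [apply pow2_ge_0|].
  rewrite <- (Rinv_inv 2). apply Rinv_le_contravar; lra.
Qed.

(** Either all coefficients vanish, or the first nonzero one outweighs the tail on a small punctured
    disc. A first index exists by strong induction and excluded middle. *)
Lemma analytic_isolated (f : C -> C) (z0 : C) : analytic_at f z0 ->
  (exists d, 0 < d /\ forall z, Cmod (z - z0)%C < d -> f z = RtoC 0) \/
  (exists d, 0 < d /\ forall z, 0 < Cmod (z - z0)%C < d -> f z <> RtoC 0).
Proof.
  intros Hf. destruct (analytic_coefs _ _ Hf) as (a & r & M & Hr & Hb & Hc).
  destruct (classic (exists k, a k <> RtoC 0)) as [[k Hk]|N].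
  - right.
    assert (L : exists n, a n <> RtoC 0 /\ forall m, (m < n)%nat -> a m = RtoC 0).
    { revert Hk. induction k as [k IH] using (well_founded_induction Nat.lt_wf_0). intros Hk.
      destruct (classic (exists m, (m < k)%nat /\ a m <> RtoC 0)) as [[m [Hm Ham]]|N].
      - now apply (IH m).
      - exists k; split; [easy|]. intros m Hm. apply NNPP. intros Ha. apply N. now exists m. }
    clear k Hk. destruct L as [n [Hn Hz]].
    assert (A : 0 < Cmod (a n)) by now apply Cmod_gt_0.
    assert (HM : 0 <= M).
    { eapply Rle_trans; [|apply (Hb O)]. apply Rmult_le_pos; [apply Cmod_ge_0|simpl; lra]. }
    assert (Rn : 0 < r ^ S n) by now apply pow_lt.
    (* Below [d2] the leading term exceeds the tail; the 2 comes from [Cmod x / r <= 1 / 2] in the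
       geometric series, and the [+ 1] keeps the divisor positive. *)
    set (d2 := Cmod (a n) * r ^ S n / (2 * M + 1)).
    assert (D2 : 0 < d2) by (apply Rdiv_lt_0_compat; [now apply Rmult_lt_0_compat|lra]).
    exists (Rmin (r / 2) d2); split; [apply Rmin_glb_lt; lra|].
    intros z [Z1 Z2] E.
    assert (Z3 : Cmod (z - z0)%C < r / 2) by (eapply Rlt_le_trans; [exact Z2|apply Rmin_l]).
    assert (Z4 : Cmod (z - z0)%C < d2) by (eapply Rlt_le_trans; [exact Z2|apply Rmin_r]).
    set (x := (z - z0)%C) in *.
    pose proof (pseries_tail a x (f (z0 + x)%C) r M (S n) Hb ltac:(lra) (Hc x ltac:(lra))) as T.
    replace (z0 + x)%C with z in T by (unfold x; ring). rewrite E in T. simpl Csum in T.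
    rewrite (Csum_ext _ (fun _ => RtoC 0)), Csum_const in T by (intros j Hj; rewrite Hz by easy; ring).
    replace (0 - (INR n * 0 + a n * x ^ n))%C with (- (a n * x ^ n))%C in T by ring.
    rewrite Cmod_opp, Cmod_mult, Cmod_pow in T.
    assert (Q : / (1 - Cmod x / r) <= 2).
    { rewrite <- (Rinv_inv 2). apply Rinv_le_contravar; [lra|].
      assert (Cmod x / r <= / 2); [|lra].
      apply Rmult_le_reg_r with r; [lra|]. unfold Rdiv; rewrite Rmult_assoc, Rinv_l; lra. }
    assert (X : 0 < Cmod x ^ n) by now apply pow_lt.
    assert (T2 : Cmod (a n) * Cmod x ^ n <= M * (Cmod x ^ S n / r ^ S n * 2)).
    { eapply Rle_trans; [exact T|]. apply Rmult_le_compat_l; [easy|].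
      unfold Rdiv. rewrite Rpow_mult_distr, pow_inv.
      apply Rmult_le_compat_l; [|exact Q].
      apply Rmult_le_pos; [apply pow_le; lra|left; now apply Rinv_0_lt_compat]. }
    simpl (Cmod x ^ S n) in T2.
    assert (T3 : Cmod (a n) * r ^ S n <= 2 * M * Cmod x).
    { apply Rmult_le_reg_r with (Cmod x ^ n / r ^ S n); [now apply Rdiv_lt_0_compat|].
      replace (Cmod (a n) * r ^ S n * (Cmod x ^ n / r ^ S n)) with (Cmod (a n) * Cmod x ^ n) by (field; lra).
      eapply Rle_trans; [exact T2|]. right; field; lra. }
    unfold d2 in Z4. apply Rmult_lt_compat_r with (r := 2 * M + 1) in Z4; [|lra].
    replace (Cmod (a n) * r ^ S n / (2 * M + 1) * (2 * M + 1)) with (Cmod (a n) * r ^ S n) in Z4 by (field; lra).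
    lra.
  - left. exists r; split; [easy|]. intros z Hz.
    specialize (Hc _ Hz). replace (z0 + (z - z0))%C with z in Hc by ring.
    apply (clim_unique _ _ _ Hc). apply (clim_ext (fun _ => RtoC 0)); [|apply clim_const].
    intros n. rewrite (Csum_ext _ (fun _ => RtoC 0)); [rewrite Csum_const; ring|].
    intros k _. destruct (classic (a k = RtoC 0)) as [->|K]; [ring|]. exfalso; apply N; now exists k.
Qed.

(** * Uniqueness of the continuation *)

(** The form in which the derivative in [c] will arrive: an error quadratic in the increment. *)
Lemma is_derive_C_intro (f : C -> C) (z l : C) (K d : R) : 0 < d ->
  (forall h, Cmod h < d -> Cmod (f (z + h) - f z - l * h)%C <= K * Cmod h ^ 2) ->
  is_derive (K := C_AbsRing) (V := C_NormedModule) f z l.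
Proof.
  intros Hd H. split; [apply is_linear_scal_l|].
  intros y Hy. apply (is_filter_lim_locally_unique (K := C_AbsRing) (V := AbsRing_NormedModule C_AbsRing) z y) in Hy.
  subst y. intros eps.
  assert (P : 0 < Rmin d (eps / (Rabs K + 1))).
  { apply Rmin_glb_lt; [easy|]. apply Rdiv_lt_0_compat; [apply cond_pos|]. pose proof (Rabs_pos K); lra. }
  exists (mkposreal _ P). intros y Hy.
  change (Cmod (y - z)%C < Rmin d (eps / (Rabs K + 1))) in Hy.
  change (Cmod (f y - f z - (y - z) * l)%C <= eps * Cmod (y - z)%C).
  specialize (H (y - z)%C (Rlt_le_trans _ _ _ Hy (Rmin_l _ _))).
  assert (E : forall a b : C, (a + (b - a))%C = b) by (intros; ring).
  rewrite E in H. rewrite (Cmult_comm (y - z) l).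
  eapply Rle_trans; [exact H|].
  pose proof (Rlt_le_trans _ _ _ Hy (Rmin_r _ _)) as Hy2.
  pose proof (Cmod_ge_0 (y - z)%C). pose proof (Rle_abs K). pose proof (Rabs_pos K).
  replace (K * Cmod (y - z)%C ^ 2) with (K * Cmod (y - z)%C * Cmod (y - z)%C) by ring.
  apply Rmult_le_compat_r; [easy|].
  apply Rle_trans with ((Rabs K + 1) * (eps / (Rabs K + 1))); [|right; field; lra].
  apply Rle_trans with ((Rabs K + 1) * Cmod (y - z)%C); [nra|]. apply Rmult_le_compat_l; lra.
Qed.

Lemma is_derive_C_ext (f g : C -> C) (z l : C) (d : R) : 0 < d ->
  (forall y, Cmod (y - z)%C < d -> f y = g y) ->
  is_derive (K := C_AbsRing) (V := C_NormedModule) f z l ->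
  is_derive (K := C_AbsRing) (V := C_NormedModule) g z l.
Proof.
  intros Hd E. apply is_derive_ext_loc. exists (mkposreal _ Hd). intros y Hy. apply E, Hy.
Qed.

Definition pair_dec (x y : nat * nat) : {x = y} + {x <> y}.
Proof. decide equality; apply Nat.eq_dec. Defined.

Lemma NoDup_common_superset (L0 L1 : list (nat * nat)) :
  exists L, NoDup L /\ incl L0 L /\ incl L1 L.
Proof.
  exists (nodup pair_dec (L0 ++ L1)). split; [apply NoDup_nodup|].
  split; intros x Hx; apply nodup_In, in_or_app; auto.
Qed.

(** Two finite sets of indices have a common finite superset, on which both approximations hold. *)
Lemma is_double_sum_unique (a : nat -> nat -> C) (s s' : C) :
  is_double_sum a s -> is_double_sum a s' -> s = s'.
Proof.
  intros H H'. apply (clim_unique (fun _ => s)); [apply clim_const|].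
  intros eps He. exists O; intros _ _.
  assert (He2 : 0 < eps / 2) by lra.
  destruct (H (mkposreal _ He2)) as [L0 H0]. destruct (H' (mkposreal _ He2)) as [L1 H1].
  destruct (NoDup_common_superset L0 L1) as (L & N & I0 & I1).
  specialize (H0 L N I0). specialize (H1 L N I1). simpl in H0, H1.
  set (w := fold_right _ _ _) in *.
  pose proof (Cmod_minus_le (w - s')%C (w - s)%C) as T.
  replace (w - s' - (w - s))%C with (s - s')%C in T by ring. lra.
Qed.

(** Punctured, because the value at a pole is arbitrary. *)
Definition vanishes_near (H : C -> C) (z0 : C) : Prop :=
  exists d, 0 < d /\ forall z, 0 < Cmod (z - z0)%C < d -> H z = RtoC 0.

Lemma Cpow_neq_0 (z : C) (n : nat) : z <> RtoC 0 -> (z ^ n)%C <> RtoC 0.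
Proof. intros H. apply Cmod_gt_0. rewrite Cmod_pow. apply pow_lt. now apply Cmod_gt_0. Qed.

Lemma Cmod_minus_pos (z z0 : C) : z <> z0 <-> 0 < Cmod (z - z0)%C.
Proof.
  rewrite <- Cmod_gt_0. split; intros H E; apply H.
  - replace z with ((z - z0) + z0)%C by ring. rewrite E; ring.
  - rewrite E; ring.
Qed.

(** Multiplication by both pole factors turns [F - G] into an analytic function, to which the
    isolation of zeros applies. *)
Lemma meromorphic_dichotomy (F G : C -> C) (z0 : C) :
  meromorphic_at F z0 -> meromorphic_at G z0 ->
  vanishes_near (fun z => F z - G z)%C z0 \/
  exists d, 0 < d /\ forall z, 0 < Cmod (z - z0)%C < d -> (F z - G z)%C <> RtoC 0.
Proof.
  intros (n & f & Hf & LF) (m & g & Hg & LG).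
  apply locally_Cmod in LF. apply locally_Cmod in LG.
  destruct LF as (d1 & D1 & EF). destruct LG as (d2 & D2 & EG).
  pose (H := fun z => ((z - z0) ^ m * f z - (z - z0) ^ n * g z)%C).
  assert (AH : analytic_at H z0) by (apply analytic_minus; now apply analytic_mult_center_pow).
  assert (E : forall z, 0 < Cmod (z - z0)%C < Rmin d1 d2 ->
     (F z - G z = H z / ((z - z0) ^ n * (z - z0) ^ m))%C /\ ((z - z0) ^ n * (z - z0) ^ m <> 0)%C).
  { intros z [Z1 Z2]. apply Cmod_minus_pos in Z1.
    rewrite EF by first [easy | eapply Rlt_le_trans; [exact Z2|apply Rmin_l]].
    rewrite EG by first [easy | eapply Rlt_le_trans; [exact Z2|apply Rmin_r]].
    assert (N : (z - z0)%C <> RtoC 0) by (apply Cmod_gt_0, Cmod_minus_pos; easy).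
    pose proof (Cpow_neq_0 _ n N). pose proof (Cpow_neq_0 _ m N).
    split; [unfold H; field; split; easy|]. now apply Cmult_neq_0. }
  assert (Dm : 0 < Rmin d1 d2) by now apply Rmin_glb_lt.
  destruct (analytic_isolated _ _ AH) as [(d & Hd & Z)|(d & Hd & Z)]; [left|right];
    exists (Rmin d (Rmin d1 d2)); (split; [now apply Rmin_glb_lt|]); intros z [Z1 Z2];
    (destruct (E z) as [E1 E2]; [split; [easy|eapply Rlt_le_trans; [exact Z2|apply Rmin_r]]|]);
    rewrite E1.
  - rewrite Z; [unfold Cdiv; ring|]. eapply Rlt_le_trans; [exact Z2|apply Rmin_l].
  - intros K. apply (Z z); [split; [easy|eapply Rlt_le_trans; [exact Z2|apply Rmin_l]]|].
    rewrite <- (Cmult_1_r (H z)), <- (Cinv_l _ E2), Cmult_assoc.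
    change (H z * / ((z - z0) ^ n * (z - z0) ^ m))%C with (H z / ((z - z0) ^ n * (z - z0) ^ m))%C.
    rewrite K; ring.
Qed.

(** A disc around [y] of radius at most the distance to [p] misses the exceptional point [p]. *)
Lemma vanishes_near_propagates (H : C -> C) (y d : R) (p : C) :
  (forall z, 0 < Cmod (z - p)%C < d -> H z = RtoC 0) -> Cmod (y - p)%C < d ->
  vanishes_near H p -> vanishes_near H y.
Proof.
  intros Z Hy V. destruct (Req_dec (Cmod (y - p)%C) 0) as [E|N].
  - apply Cmod_eq_0 in E. replace (RtoC y) with p; [easy|].
    replace p with (y - (y - p))%C by ring. rewrite E; ring.
  - pose proof (Cmod_ge_0 (y - p)%C).
    exists (Rmin (Cmod (y - p)%C) (d - Cmod (y - p)%C)). split; [apply Rmin_glb_lt; lra|].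
    intros z [Z1 Z2]. apply Z.
    pose proof (Rlt_le_trans _ _ _ Z2 (Rmin_l _ _)). pose proof (Rlt_le_trans _ _ _ Z2 (Rmin_r _ _)).
    pose proof (Cmod_triangle (z - y)%C (y - p)%C) as T1.
    replace (z - y + (y - p))%C with (z - p)%C in T1 by ring.
    pose proof (Cmod_minus_le (z - p)%C (z - y)%C) as T2.
    replace (z - p - (z - y))%C with (y - p)%C in T2 by ring. lra.
Qed.

Lemma Cmod_RtoC_minus (x y : R) : Cmod (x - y)%C = Rabs (x - y).
Proof. rewrite <- RtoC_minus. apply Cmod_R. Qed.

(** Connectedness of [[0, 3]] as a supremum argument: [A] collects the lengths [u] for which [F - G]
    vanishes near each point of [[3 - u, 3]]. At the supremum the dichotomy leaves only vanishing,
    which then extends further unless the supremum is 3. *)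
Lemma identity_on_segment (F G : C -> C) :
  (forall x : R, 0 <= x <= 3 -> meromorphic_at F x /\ meromorphic_at G x) ->
  (forall z, 2 < Re z -> F z = G z) ->
  vanishes_near (fun z => F z - G z)%C (RtoC 0).
Proof.
  intros M E. set (V := fun x : R => vanishes_near (fun z => F z - G z)%C (RtoC x)).
  assert (V3 : forall x, 2 < x -> V x).
  { intros x Hx. exists (x - 2); split; [lra|]. intros z [_ Z]. rewrite E; [ring|].
    pose proof (re_le_Cmod (z - x)%C) as T. unfold Cminus in T at 1. rewrite Re_plus, Re_opp in T. simpl (Re (RtoC x)) in T.
    apply Rabs_le_between in T. lra. }
  pose (A := fun u => 0 <= u <= 3 /\ forall y, 3 - u <= y <= 3 -> V y).
  destruct (completeness A) as [m [Ub Lb]].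
  - exists 3. intros u [Hu _]. lra.
  - exists 0. split; [lra|]. intros y Hy. apply V3. lra.
  - assert (m3 : m <= 3) by (apply Lb; intros u [Hu _]; lra).
    assert (m1 : / 2 <= m) by (apply Ub; split; [lra|]; intros y Hy; apply V3; lra).
    assert (Vy : forall y, 3 - m < y <= 3 -> V y).
    { intros y Hy. apply NNPP. intros N. assert (m <= 3 - y); [|lra].
      apply Lb. intros u [Hu Au]. apply Rnot_lt_le; intros L. apply N, Au. lra. }
    assert (Vp : V (3 - m)).
    { destruct (M (3 - m)) as [MF MG]; [lra|].
      destruct (meromorphic_dichotomy F G _ MF MG) as [Z|(d & Hd & Z)]; [exact Z|].
      (* A point just to the right of [3 - m]: it lies in the punctured disc where [F - G] has no
         zero, although [F - G] vanishes near it. *)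
      exfalso. set (y := 3 - m + Rmin d m / 2).
      assert (0 < Rmin d m) by (apply Rmin_glb_lt; lra).
      pose proof (Rmin_l d m). pose proof (Rmin_r d m).
      destruct (Vy y) as (d' & Hd' & Z'); [unfold y; lra|].
      set (e := Rmin d' (Rmin d m) / 2).
      assert (0 < e) by (apply Rdiv_lt_0_compat; [apply Rmin_glb_lt; lra|lra]).
      assert (2 * e <= d') by (unfold e; pose proof (Rmin_l d' (Rmin d m)); lra).
      assert (2 * e <= Rmin d m) by (unfold e; pose proof (Rmin_r d' (Rmin d m)); lra).
      apply (Z (RtoC (y + e / 2))); [|apply Z'];
        rewrite Cmod_RtoC_minus, Rabs_pos_eq; unfold y; lra. }
    assert (m = 3); [|now replace (RtoC 0) with (RtoC (3 - m)) by (f_equal; lra)].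
    apply Rle_antisym; [easy|]. apply Rnot_lt_le; intros L.
    destruct Vp as (d & Hd & Z).
    assert (Amd : A (Rmin 3 (m + d / 2))).
    { pose proof (Rmin_l 3 (m + d / 2)). pose proof (Rmin_r 3 (m + d / 2)).
      split; [split; [|easy]; apply Rmin_glb; lra|].
      intros y Hy. destruct (Rlt_le_dec (3 - m) y) as [Y|Y]; [apply Vy; lra|].
      apply (vanishes_near_propagates _ y d (RtoC (3 - m)) Z); [|now exists d].
      rewrite Cmod_RtoC_minus, Rabs_left1; lra. }
    apply Ub in Amd. unfold Rmin in Amd. destruct (Rle_dec 3 (m + d / 2)); lra.
Qed.

(** The zeros of the analytic difference accumulate at the centre, so it vanishes there as well:
    regularity fills the puncture. *)
Lemma analytic_eq_at_center (F G : C -> C) (z0 : C) :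
  analytic_at F z0 -> analytic_at G z0 -> vanishes_near (fun z => F z - G z)%C z0 ->
  exists d, 0 < d /\ forall z, Cmod (z - z0)%C < d -> F z = G z.
Proof.
  intros HF HG (d & Hd & Z).
  destruct (analytic_isolated _ _ (analytic_minus _ _ _ HF HG)) as [(d' & Hd' & Z')|(d' & Hd' & Z')].
  - exists d'; split; [easy|]. intros z Hz. specialize (Z' z Hz).
    replace (F z) with ((F z - G z) + G z)%C by ring. rewrite Z'; ring.
  - exfalso. set (e := Rmin d d' / 2).
    assert (0 < Rmin d d') by now apply Rmin_glb_lt.
    pose proof (Rmin_l d d'). pose proof (Rmin_r d d').
    assert (Ce : Cmod (z0 + e - z0)%C = e).
    { replace (z0 + e - z0)%C with (RtoC e) by ring. apply Cmod_RtoC_pos. unfold e; lra. }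
    apply (Z' (z0 + e)%C); [|apply Z]; rewrite Ce; unfold e; lra.
Qed.

Lemma zeta_continuation_unique (c : C) (F G : C -> C) :
  is_zeta_continuation c F -> is_zeta_continuation c G ->
  exists d, 0 < d /\ forall z, Cmod (z - 0)%C < d -> F z = G z.
Proof.
  intros (SF & (d1 & MF) & AF) (SG & (d2 & MG) & AG).
  apply analytic_eq_at_center; try easy.
  apply identity_on_segment.
  - intros x Hx. pose proof (cond_pos d1). pose proof (cond_pos d2).
    split; [apply MF|apply MG]; simpl; lra.
  - intros z Hz. apply (is_double_sum_unique (zeta_term c z)); auto.
Qed.

(** * Dominated double series *)

Definition square_sum (a : nat -> nat -> C) (N : nat) : C := Csum (fun n => Csum (a n) N) N.

Definition sum_over_list (a : nat -> nat -> C) (L : list (nat * nat)) : C :=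
  fold_right Cplus (RtoC 0) (map (fun p => a (fst p) (snd p)) L).

Lemma clim_cauchy (u : nat -> C) :
  (forall eps, 0 < eps -> exists N, forall n m, (N <= n)%nat -> (N <= m)%nat ->
     Cmod (u n - u m)%C < eps) -> exists l, clim u l.
Proof.
  intros H.
  assert (HR : Cauchy_crit (fun n => Re (u n))).
  { intros eps He. destruct (H eps He) as [N HN]. exists N. intros n m Hn Hm.
    eapply Rle_lt_trans; [|apply (HN n m Hn Hm)]. apply (re_le_Cmod (u n - u m)%C). }
  assert (HI : Cauchy_crit (fun n => Im (u n))).
  { intros eps He. destruct (H eps He) as [N HN]. exists N. intros n m Hn Hm.
    eapply Rle_lt_trans; [|apply (HN n m Hn Hm)]. apply (im_le_Cmod (u n - u m)%C). }
  destruct (Rcomplete.R_complete _ HR) as [x Hx]. destruct (Rcomplete.R_complete _ HI) as [y Hy].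
  exists (x, y). intros eps He.
  destruct (Hx (eps / 2)) as [N1 H1]; [lra|]. destruct (Hy (eps / 2)) as [N2 H2]; [lra|].
  exists (N1 + N2)%nat. intros n Hn.
  eapply Rle_lt_trans; [apply Cmod_le_sum|].
  specialize (H1 n ltac:(lia)). specialize (H2 n ltac:(lia)). unfold Rdist in *.
  change (Rabs (Re (u n) - x) + Rabs (Im (u n) - y) < eps). lra.
Qed.

Lemma Csum_indicator (f : nat -> C) (M N : nat) : (M <= N)%nat ->
  Csum (fun k => if (k <? M)%nat then f k else RtoC 0) N = Csum f M.
Proof.
  intros H. replace N with (M + (N - M))%nat by lia. rewrite Csum_split.
  rewrite (Csum_ext (fun k => if (M + k <? M)%nat then _ else _) (fun _ => RtoC 0)), Csum_const.
  - rewrite (Csum_ext _ f); [ring|]. intros k Hk. now apply Nat.ltb_lt in Hk as ->.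
  - intros k _. replace (M + k <? M)%nat with false; [easy|]. symmetry; apply Nat.ltb_ge; lia.
Qed.

Lemma Rsum_indicator (f : nat -> R) (M N : nat) : (M <= N)%nat ->
  Rsum (fun k => if (k <? M)%nat then 0 else f k) N = Rsum f N - Rsum f M.
Proof.
  intros H. replace N with (M + (N - M))%nat by lia. rewrite !Rsum_split.
  rewrite (Rsum_ext (fun k => if (M + k <? M)%nat then _ else _) (fun k => f (M + k)%nat)).
  - rewrite (Rsum_ext _ (fun _ => 0)), Rsum_const; [ring|].
    intros k Hk. now apply Nat.ltb_lt in Hk as ->.
  - intros k _. replace (M + k <? M)%nat with false; [easy|]. symmetry; apply Nat.ltb_ge; lia.
Qed.

Lemma Rsum_product (f g : nat -> R) (N M : nat) :
  Rsum (fun n => Rsum (fun l => f n * g l) M) N = Rsum f N * Rsum g M.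
Proof.
  rewrite (Rsum_ext _ (fun n => Rsum g M * f n)), Rsum_scal; [ring|].
  intros n _. rewrite Rsum_scal. ring.
Qed.

(** Extension by zero, which makes a sum over a finite set a sum over a square. *)
Definition restrict (L : list (nat * nat)) (a : nat -> nat -> C) (n l : nat) : C :=
  if in_dec pair_dec (n, l) L then a n l else RtoC 0.

Lemma Csum_delta (f : nat -> C) (k N : nat) : (k < N)%nat ->
  Csum (fun n => if Nat.eq_dec n k then f n else RtoC 0) N = f k.
Proof.
  induction N as [|N IH]; intros H; [lia|]. simpl.
  destruct (Nat.eq_dec N k) as [->|D].
  - rewrite (Csum_ext _ (fun _ => RtoC 0)), Csum_const; [ring|].
    intros j Hj. destruct (Nat.eq_dec j k); [lia|easy].
  - rewrite IH by lia. ring.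
Qed.

(** By induction on the list: a new pair adds one Kronecker delta, and [NoDup] ensures that it was
    not counted before. *)
Lemma sum_over_list_square (a : nat -> nat -> C) (L : list (nat * nat)) (N : nat) : NoDup L ->
  (forall p, In p L -> (fst p < N)%nat /\ (snd p < N)%nat) ->
  sum_over_list a L = square_sum (restrict L a) N.
Proof.
  intros ND. induction ND as [|[n l] L Hp ND IH]; intros B.
  - unfold sum_over_list, square_sum; simpl.
    rewrite (Csum_ext _ (fun _ => RtoC 0)), Csum_const; [ring|].
    intros n _. rewrite (Csum_ext _ (fun _ => RtoC 0)), Csum_const; [ring|easy].
  - change (sum_over_list a ((n, l) :: L)) with (a n l + sum_over_list a L)%C.
    rewrite IH by (intros; apply B; now right). unfold square_sum.
    destruct (B (n, l)) as [B1 B2]; [now left|]. simpl in B1, B2.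
    assert (D : square_sum (fun i j => if Nat.eq_dec i n then if Nat.eq_dec j l then a i j else RtoC 0 else RtoC 0) N = a n l).
    { unfold square_sum. rewrite <- (Csum_delta (a n) l N B2).
      rewrite <- (Csum_delta (fun i => Csum (fun j => if Nat.eq_dec j l then a i j else RtoC 0) N) n N B1).
      apply Csum_ext. intros i _. destruct (Nat.eq_dec i n); [easy|]. rewrite Csum_const. ring. }
    rewrite <- D. unfold square_sum. rewrite <- Csum_plus. apply Csum_ext. intros i _.
    rewrite <- Csum_plus. apply Csum_ext. intros j _. unfold restrict.
    destruct (in_dec pair_dec (i, j) L) as [I|I];
      destruct (in_dec pair_dec (i, j) ((n, l) :: L)) as [I'|I'];
      destruct (Nat.eq_dec i n) as [Ei|Ei]; try destruct (Nat.eq_dec j l) as [Ej|Ej]; subst;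
      try ring; exfalso; try (now apply Hp); try (now apply I'; left); try (now apply I'; right);
      destruct I' as [E|I']; (injection E; intros; now subst) || easy.
Qed.

(** The majorant is a product, so that its double sums factor into single ones. *)
Definition dominated (a : nat -> nat -> C) (u : nat -> R) (K : R) : Prop :=
  forall n l, Cmod (a n l) <= K * (u n * u l).

(** Outside the square of side [M] one index is at least [M], so a term is at most
    [K * (w n * u l + u n * w l)] with [w] the weight cut off below [M]. *)
Lemma square_sum_defect (a : nat -> nat -> C) (u : nat -> R) (K : R) (L : list (nat * nat)) (M N : nat) :
  (forall n, 0 <= u n) -> 0 <= K -> dominated a u K -> (M <= N)%nat ->
  (forall n l, (n < M)%nat -> (l < M)%nat -> In (n, l) L) ->
  Cmod (square_sum (restrict L a) N - square_sum a M)%C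
    <= 2 * K * Rsum u N * (Rsum u N - Rsum u M).
Proof.
  intros Hu HK HD HMN HL.
  pose (b := fun n l => (restrict L a n l
    - if (n <? M)%nat then if (l <? M)%nat then a n l else RtoC 0 else RtoC 0)%C).
  assert (E : (square_sum (restrict L a) N - square_sum a M)%C = square_sum b N).
  { unfold square_sum. rewrite <- (Csum_indicator (fun n => Csum (a n) M) M N HMN), <- Csum_minus.
    apply Csum_ext. intros n _. unfold b. rewrite Csum_minus. f_equal.
    destruct (n <? M)%nat; [now rewrite Csum_indicator|]. rewrite Csum_const. ring. }
  rewrite E. unfold square_sum.
  pose (w := fun n => if (n <? M)%nat then 0 else u n).
  assert (Hw : forall n, 0 <= w n) by (intros n; unfold w; destruct (n <? M)%nat; [lra|easy]).
  eapply Rle_trans.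
  - apply Cmod_Csum_le. intros n _. apply Cmod_Csum_le. intros l _.
    instantiate (1 := fun l => K * (w n * u l) + K * (u n * w l)).
    assert (0 <= K * (w n * u l)) by (apply Rmult_le_pos; [easy|apply Rmult_le_pos; auto]).
    assert (0 <= K * (u n * w l)) by (apply Rmult_le_pos; [easy|apply Rmult_le_pos; auto]).
    specialize (HD n l).
    assert (G : Cmod (restrict L a n l) <= K * (u n * u l)).
    { unfold restrict. destruct (in_dec _ _ _); [easy|]. rewrite Cmod_0.
      apply Rmult_le_pos; [easy|apply Rmult_le_pos; auto]. }
    unfold b, w in *. destruct (n <? M)%nat eqn:En.
    + destruct (l <? M)%nat eqn:El.
      * apply Nat.ltb_lt in En, El. unfold restrict. destruct (in_dec _ _ _) as [_|I].
        -- replace (a n l - a n l)%C with (RtoC 0) by ring. rewrite Cmod_0. lra.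
        -- exfalso. apply I. now apply HL.
      * replace (restrict L a n l - 0)%C with (restrict L a n l) by ring. lra.
    + replace (restrict L a n l - 0)%C with (restrict L a n l) by ring. lra.
  - rewrite (Rsum_ext _ (fun n => Rsum (fun l => (K * w n) * u l) N + Rsum (fun l => (K * u n) * w l) N)).
    2:{ intros n _. rewrite <- Rsum_plus. apply Rsum_ext. intros; ring. }
    rewrite Rsum_plus, (Rsum_product (fun n => K * w n)), (Rsum_product (fun n => K * u n)), !Rsum_scal.
    unfold w. rewrite Rsum_indicator by easy. right. ring.
Qed.

Lemma Rsum_increasing_bound (u : nat -> R) (U : R) : (forall n, 0 <= u n) ->
  (forall n, Rsum u n <= U) ->
  exists V, 0 <= V /\ (forall n, Rsum u n <= V) /\
    forall eps, 0 < eps -> exists N, forall n, (N <= n)%nat -> V - Rsum u n < eps.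
Proof.
  intros Hu HU.
  destruct (Un_cv_crit (Rsum u)) as [V HV].
  - intros n. simpl. pose proof (Hu n). lra.
  - exists U. intros x [n ->]. apply HU.
  - pose proof (growing_ineq (Rsum u) V) as G.
    assert (Gr : Un_growing (Rsum u)) by (intros n; simpl; pose proof (Hu n); lra).
    specialize (G Gr HV).
    exists V. split; [apply (G O)|]. split; [exact G|].
    intros eps He. destruct (HV eps He) as [N HN]. exists N. intros n Hn.
    specialize (HN n Hn). unfold Rdist in HN. apply Rabs_def2 in HN. lra.
Qed.

Lemma square_full_list (M : nat) (n l : nat) :
  (n < M)%nat -> (l < M)%nat -> In (n, l) (list_prod (seq 0 M) (seq 0 M)).
Proof. intros H1 H2. apply in_prod; apply in_seq; lia. Qed.

Lemma dominated_square_cauchy (a : nat -> nat -> C) (u : nat -> R) (K : R) (M N : nat) :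
  (forall n, 0 <= u n) -> 0 <= K -> dominated a u K -> (M <= N)%nat ->
  Cmod (square_sum a N - square_sum a M)%C <= 2 * K * Rsum u N * (Rsum u N - Rsum u M).
Proof.
  intros Hu HK HD HMN.
  replace (square_sum a N) with (square_sum (restrict (list_prod (seq 0 N) (seq 0 N)) a) N).
  - apply square_sum_defect; auto. intros n l Hn Hl. apply square_full_list; lia.
  - unfold square_sum. apply Csum_ext; intros n Hn; apply Csum_ext; intros l Hl.
    unfold restrict. destruct (in_dec _ _ _) as [_|I]; [easy|]. exfalso; now apply I, square_full_list.
Qed.

Lemma dominated_square_limit (a : nat -> nat -> C) (u : nat -> R) (K U : R) :
  (forall n, 0 <= u n) -> (forall n, Rsum u n <= U) -> 0 <= K -> dominated a u K ->
  exists s, clim (square_sum a) s.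
Proof.
  intros Hu HU HK HD. destruct (Rsum_increasing_bound u U Hu HU) as (V & HV & HVb & HVl).
  apply clim_cauchy. intros eps He.
  (* [4 * K * V + 1] exceeds the factor [2 * K * Rsum u n] of the Cauchy bound and stays positive
     when [K] or [V] is zero. *)
  destruct (HVl (eps / (4 * K * V + 1))) as [N HN].
  { apply Rdiv_lt_0_compat; [easy|]. nra. }
  assert (Key : forall n m, (N <= m)%nat -> (m <= n)%nat -> Cmod (square_sum a n - square_sum a m)%C < eps).
  { intros n m Hm Hn. eapply Rle_lt_trans; [apply (dominated_square_cauchy a u K m n); auto|].
    specialize (HN m Hm). specialize (HVb n).
    assert (0 <= Rsum u n).
    { clear - Hu. induction n; simpl; [lra|]. specialize (Hu n). lra. }
    assert (Mono : Rsum u m <= Rsum u n).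
    { replace n with (m + (n - m))%nat by lia. rewrite Rsum_split.
      assert (0 <= Rsum (fun k => u (m + k)%nat) (n - m)); [|lra].
      clear - Hu. induction (n - m)%nat; simpl; [lra|]. specialize (Hu (m + n0)%nat). lra. }
    apply Rle_lt_trans with ((4 * K * V + 1) * (V - Rsum u m)).
    - assert (2 * K * Rsum u n <= 4 * K * V + 1) by nra.
      apply Rmult_le_compat; nra.
    - apply Rmult_lt_compat_l with (r := 4 * K * V + 1) in HN; [|nra].
      replace ((4 * K * V + 1) * (eps / (4 * K * V + 1))) with eps in HN by (field; nra). exact HN. }
  exists N. intros n m Hn Hm. destruct (Nat.le_ge_cases m n) as [L|L]; [now apply Key|].
  rewrite Cmod_minus_sym. now apply Key.
Qed.

Lemma list_bound (L : list (nat * nat)) :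
  exists N, forall p, In p L -> (fst p < N)%nat /\ (snd p < N)%nat.
Proof.
  induction L as [|[n l] L [N IH]]; [exists O; easy|].
  exists (N + S n + S l)%nat. intros p [<-|I]; simpl; [lia|]. specialize (IH p I). lia.
Qed.

(** A finite set of indices that contains a large square has nearly the same sum as that square, so
    the unordered sum is the limit over squares. *)
Lemma dominated_double_sum (a : nat -> nat -> C) (u : nat -> R) (K U : R) (s : C) :
  (forall n, 0 <= u n) -> (forall n, Rsum u n <= U) -> 0 <= K -> dominated a u K ->
  clim (square_sum a) s -> is_double_sum a s.
Proof.
  intros Hu HU HK HD Hs [eps He]. destruct (Rsum_increasing_bound u U Hu HU) as (V & HV & HVb & HVl).
  destruct (HVl (eps / 2 / (4 * K * V + 1))) as [N1 HN1].
  { apply Rdiv_lt_0_compat; [lra|]. nra. }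
  destruct (Hs (eps / 2)) as [N2 HN2]; [lra|].
  set (M := (N1 + N2)%nat).
  exists (list_prod (seq 0 M) (seq 0 M)). intros L ND HL. simpl.
  fold (sum_over_list a L). destruct (list_bound L) as [N0 HN0].
  set (N := (N0 + M)%nat).
  rewrite (sum_over_list_square a L N ND) by (intros p Hp; specialize (HN0 p Hp); unfold N; lia).
  assert (D : Cmod (square_sum (restrict L a) N - square_sum a M)%C < eps / 2).
  { eapply Rle_lt_trans; [apply (square_sum_defect a u K); auto; [unfold N; lia|]|].
    - intros n l Hn Hl. now apply HL, square_full_list.
    - specialize (HN1 M ltac:(unfold M; lia)). specialize (HVb N).
      assert (Pos : forall n, 0 <= Rsum u n).
      { clear - Hu. induction n; simpl; [lra|]. specialize (Hu n). lra. }
      pose proof (Pos N).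
      assert (Mono : Rsum u M <= Rsum u N).
      { unfold N. rewrite Nat.add_comm, Rsum_split.
        assert (0 <= Rsum (fun k => u (M + k)%nat) N0); [|lra].
        clear - Hu. induction N0 as [|n IH]; simpl; [lra|]. specialize (Hu (M + n)%nat). lra. }
      apply Rle_lt_trans with ((4 * K * V + 1) * (V - Rsum u M)).
      + assert (2 * K * Rsum u N <= 4 * K * V + 1) by nra.
        apply Rmult_le_compat; nra.
      + apply Rmult_lt_compat_l with (r := 4 * K * V + 1) in HN1; [|nra].
        replace ((4 * K * V + 1) * (eps / 2 / (4 * K * V + 1))) with (eps / 2) in HN1 by (field; nra). exact HN1. }
  specialize (HN2 M ltac:(unfold M; lia)).
  pose proof (Cmod_triangle (square_sum (restrict L a) N - square_sum a M)%C (square_sum a M - s)%C) as T.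
  replace (square_sum (restrict L a) N - square_sum a M + (square_sum a M - s))%C
    with (square_sum (restrict L a) N - s)%C in T by ring. lra.
Qed.

Lemma dominated_limit_bound (a : nat -> nat -> C) (u : nat -> R) (K U : R) (s : C) :
  (forall n, 0 <= u n) -> (forall n, Rsum u n <= U) -> 0 <= K -> dominated a u K ->
  clim (square_sum a) s -> Cmod s <= K * (U * U).
Proof.
  intros Hu HU HK HD Hs. replace s with (s - 0)%C by ring.
  apply (clim_bound _ _ _ _ O Hs). intros n _.
  replace (square_sum a n - 0)%C with (square_sum a n) by ring.
  assert (Pos : 0 <= Rsum u n).
  { clear - Hu. induction n; simpl; [lra|]. specialize (Hu n). lra. }
  eapply Rle_trans; [unfold square_sum; apply Cmod_Csum_le; intros i _; apply Cmod_Csum_le; intros j _; apply HD|].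
  rewrite (Rsum_ext _ (fun i => K * Rsum (fun j => u i * u j) n)).
  - rewrite Rsum_scal, Rsum_product. apply Rmult_le_compat_l; [easy|].
    specialize (HU n). apply Rmult_le_compat; lra.
  - intros i _. rewrite <- Rsum_scal. apply Rsum_ext; intros; ring.
Qed.

Lemma square_sum_plus (a b : nat -> nat -> C) (N : nat) :
  square_sum (fun n l => a n l + b n l)%C N = (square_sum a N + square_sum b N)%C.
Proof.
  unfold square_sum. rewrite <- Csum_plus. apply Csum_ext; intros; apply Csum_plus.
Qed.

Lemma square_sum_scal (c : C) (a : nat -> nat -> C) (N : nat) :
  square_sum (fun n l => c * a n l)%C N = (c * square_sum a N)%C.
Proof.
  unfold square_sum. rewrite <- Csum_scal. apply Csum_ext; intros; apply Csum_scal.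
Qed.

Lemma square_sum_ext (a b : nat -> nat -> C) (N : nat) :
  (forall n l, a n l = b n l) -> square_sum a N = square_sum b N.
Proof. intros E. apply Csum_ext; intros; apply Csum_ext; intros; apply E. Qed.

(** * Entire functions and Cauchy estimates *)

(** Expansions about every centre, convergent in the whole plane: each term of the lattice series
    has them, and Cauchy's estimate is then available on circles of any radius. *)
Definition entire (f : C -> C) : Prop :=
  forall z0, exists a, forall x, clim (Csum (fun k => a k * x ^ k)%C) (f (z0 + x)%C).

Lemma entire_ext (f g : C -> C) : (forall z, f z = g z) -> entire f -> entire g.
Proof. intros E H z0. destruct (H z0) as [a Ha]. exists a. intros x. rewrite <- E. apply Ha. Qed.

Lemma entire_plus (f g : C -> C) : entire f -> entire g -> entire (fun z => f z + g z)%C.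
Proof.
  intros Hf Hg z0. destruct (Hf z0) as [a Ha]. destruct (Hg z0) as [b Hb].
  exists (fun k => a k + b k)%C. intros x. eapply clim_ext; [|apply clim_plus; [apply Ha|apply Hb]].
  intros n. cbv beta. rewrite <- Csum_plus. apply Csum_ext; intros; ring.
Qed.

Lemma entire_scal (c : C) (f : C -> C) : entire f -> entire (fun z => c * f z)%C.
Proof.
  intros Hf z0. destruct (Hf z0) as [a Ha].
  exists (fun k => c * a k)%C. intros x. eapply clim_ext; [|apply (clim_scal c), Ha].
  intros n. cbv beta. rewrite <- Csum_scal. apply Csum_ext; intros; ring.
Qed.

Lemma entire_minus (f g : C -> C) : entire f -> entire g -> entire (fun z => f z - g z)%C.
Proof.
  intros Hf Hg. apply (entire_ext (fun z => f z + (- (1)) * g z)%C); [intros; ring|].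
  apply entire_plus; [easy|now apply entire_scal].
Qed.

Lemma entire_mult_id (f : C -> C) : entire f -> entire (fun z => z * f z)%C.
Proof.
  intros Hf z0. destruct (Hf z0) as [a Ha].
  exists (fun k => z0 * a k + match k with O => RtoC 0 | S j => a j end)%C. intros x.
  apply clim_shift. replace ((z0 + x) * f (z0 + x))%C with (z0 * f (z0 + x) + x * f (z0 + x))%C by ring.
  pose proof (proj2 (clim_shift (fun n => z0 * Csum (fun k => a k * x ^ k) n)%C _) (clim_scal z0 _ _ (Ha x))) as H1.
  eapply clim_ext; [|exact (clim_plus _ _ _ _ H1 (clim_scal x _ _ (Ha x)))].
  intros n. cbv beta.
  rewrite <- Csum_scal. rewrite (Csum_ext (fun k => (z0 * a k + match k with O => 0 | S j => a j end) * x ^ k)%C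
     (fun k => z0 * (a k * x ^ k) + match k with O => 0 | S j => a j end * x ^ k)%C) by (intros; ring).
  rewrite Csum_plus. f_equal. rewrite Csum_shift, <- Csum_scal, Cmult_0_l, Cplus_0_l.
  apply Csum_ext; intros; simpl; ring.
Qed.

Lemma entire_mult_affine (a b : C) (f : C -> C) : entire f -> entire (fun z => (a + b * z) * f z)%C.
Proof.
  intros Hf. apply (entire_ext (fun z => a * f z + b * (z * f z))%C); [intros; ring|].
  apply entire_plus; [now apply entire_scal|now apply entire_scal, entire_mult_id].
Qed.

Lemma pow_fact_small (x eps : R) : 0 <= x -> 0 < eps ->
  exists N, forall n, (N <= n)%nat -> x ^ n / INR (fact n) < eps.
Proof.
  intros Hx He. destruct (cv_speed_pow_fact x eps He) as [N HN]. exists N. intros n Hn.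
  specialize (HN n Hn). unfold Rdist in HN. rewrite Rminus_0_r in HN.
  eapply Rle_lt_trans; [apply Rle_abs|exact HN].
Qed.

(** The factorial is kept here, since the remainder has to tend to 0 with [n]. *)
Lemma taylor_exp_fact (n : nat) (u : C) :
  Cmod (Cexp u - Csum (fun k => RtoC (/ INR (fact k)) * u ^ k) n)%C
    <= exp (Cmod u) * (Cmod u ^ n / INR (fact n)).
Proof.
  pose proof (taylor_aux n (Cmod u ^ n * exp (Cmod u)) (fun k s => u ^ k * Cexp (RtoC s * u))%C) as T.
  specialize (T) as T1.
  assert (E : forall s : R, 0 <= s <= 1 -> Cmod (u ^ n * Cexp (s * u))%C <= Cmod u ^ n * exp (Cmod u)).
  { intros s Hs. rewrite Cmod_mult, Cmod_pow, Cmod_Cexp.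
    apply Rmult_le_compat_l; [apply pow_le, Cmod_ge_0|].
    assert (H : Re (s * u)%C <= Cmod u).
    { eapply Rle_trans; [apply Re_le_Cmod_pos|]. rewrite Cmod_mult, Cmod_RtoC_pos by lra.
      pose proof (Cmod_ge_0 u); nra. }
    destruct H as [H|H]; [left; now apply exp_increasing|right; now rewrite H]. }
  specialize (T1) as T2. clear T1.
  assert (D : forall k s, (k < n)%nat -> 0 <= s <= 1 ->
    cderiv (fun s : R => u ^ k * Cexp (s * u))%C s (u ^ S k * Cexp (s * u))%C).
  { intros k s _ _. eapply cderiv_eq.
    - apply cderiv_scal, cderiv_Cexp, cderiv_mult; [apply cderiv_RtoC, (is_derive_id (K := R_AbsRing))|apply cderiv_const].
    - unfold one; simpl; cbv beta; ring. }
  specialize (T2 D E 1 ltac:(lra)). simpl in T2. rewrite !Cmult_1_l in T2.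
  rewrite (Csum_ext _ (fun k => RtoC (1 ^ k / INR (fact k)) * (u ^ k * Cexp (0 * u)))%C).
  - eapply Rle_trans; [exact T2|]. rewrite pow1. right. unfold Rdiv. ring.
  - intros k _. rewrite Cmult_0_l, Cexp_0, pow1. unfold Rdiv; rewrite Rmult_1_l. ring.
Qed.

Lemma Cexp_series (u : C) : clim (Csum (fun k => RtoC (/ INR (fact k)) * u ^ k)%C) (Cexp u).
Proof.
  intros eps He. pose proof (exp_pos (Cmod u)) as P.
  destruct (pow_fact_small (Cmod u) (eps / exp (Cmod u))) as [N HN].
  - apply Cmod_ge_0.
  - now apply Rdiv_lt_0_compat.
  - exists N. intros n Hn. rewrite Cmod_minus_sym. eapply Rle_lt_trans; [apply taylor_exp_fact|].
    specialize (HN n Hn). apply Rmult_lt_compat_l with (r := exp (Cmod u)) in HN; [|easy].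
    replace (exp (Cmod u) * (eps / exp (Cmod u))) with eps in HN by (field; lra). exact HN.
Qed.

(** As a function of its exponent a power is an exponential: [w ^ (a - z0 - x) = w ^ (a - z0) * exp
    (- x * log w)]. *)
Lemma entire_Cpower (w a : C) : entire (fun z => Cpower w (a - z)).
Proof.
  intros z0. exists (fun k => Cpower w (a - z0) * (RtoC (/ INR (fact k)) * (- Clog w) ^ k))%C. intros x.
  replace (Cpower w (a - (z0 + x))) with (Cpower w (a - z0) * Cexp (- Clog w * x))%C.
  - eapply clim_ext; [|apply clim_scal, Cexp_series].
    intros n. cbv beta. rewrite <- Csum_scal. apply Csum_ext. intros k _.
    rewrite Cpow_mult_l. ring.
  - unfold Cpower. rewrite <- Cexp_plus. f_equal. ring.
Qed.

(** The real part is [1 - 2 * sin (PI d / N) ^ 2], and this sine is positive for [0 < d < N]. *)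
Lemma root_of_unity_neq_1 (d N : nat) : (0 < d < N)%nat ->
  Cexp (INR d * (0, 2 * PI / INR N)%R)%C <> RtoC 1.
Proof.
  intros Hd E.
  assert (HN : 0 < INR N) by (apply lt_0_INR; lia).
  assert (HdN : INR d < INR N) by (apply lt_INR; lia).
  assert (Hd0 : 0 < INR d) by (apply lt_0_INR; lia).
  apply (f_equal Re) in E. unfold Re in E; simpl in E. unfold Re, Im in E; simpl in E.
  replace (INR d * 0 - 0 * (2 * PI / INR N)) with 0 in E by ring.
  replace (INR d * (2 * PI / INR N) + 0 * 0) with (2 * (INR d * PI / INR N)) in E by (field; lra).
  rewrite exp_0, cos_2a_sin in E.
  assert (S : 0 < sin (INR d * PI / INR N)).
  { pose proof PI_RGT_0. apply sin_gt_0.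
    - apply Rdiv_lt_0_compat; [nra|easy].
    - apply Rmult_lt_reg_r with (INR N); [easy|]. unfold Rdiv. rewrite Rmult_assoc, Rinv_l by lra. nra. }
  nra.
Qed.

Lemma root_of_unity_pow (N : nat) : (0 < N)%nat -> (Cexp (0, 2 * PI / INR N)%R ^ N)%C = RtoC 1.
Proof.
  intros H. assert (HN : 0 < INR N) by (apply lt_0_INR; lia).
  rewrite <- Cexp_INR.
  replace (INR N * (0, 2 * PI / INR N)%R)%C with (RtoC 0 + (0, 2 * PI)%R)%C.
  - rewrite Cexp_plus, Cexp_0. apply C_eq; simpl; rewrite exp_0, ?cos_2PI, ?sin_2PI; ring.
  - apply C_eq; simpl; field; lra.
Qed.

(** [w ^ (N - k)] stands for [w ^ (- k)]. Off the diagonal the ratio of the geometric sum is an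
    [N]-th root of unity other than 1, so the sum vanishes. *)
Lemma root_of_unity_orthogonal (N m k : nat) : (m < N)%nat -> (k < N)%nat ->
  let w := Cexp (0, 2 * PI / INR N)%R in
  Csum (fun j => (w ^ m) ^ j * (w ^ (N - k)) ^ j)%C N = if Nat.eq_dec m k then RtoC (INR N) else RtoC 0.
Proof.
  intros Hm Hk w.
  assert (wN : (w ^ N)%C = RtoC 1) by (apply root_of_unity_pow; lia).
  rewrite (Csum_ext _ (fun j => (w ^ (m + (N - k))) ^ j)%C).
  2:{ intros j _. now rewrite Cpow_add_r, Cpow_mult_l. }
  destruct (Nat.eq_dec m k) as [->|D].
  - replace (k + (N - k))%nat with N by lia. rewrite wN.
    rewrite (Csum_ext _ (fun _ => RtoC 1)), Csum_const by (intros; apply Cpow_1_l). ring.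
  - set (q := (w ^ (m + (N - k)))%C).
    assert (Q1 : q <> RtoC 1).
    { unfold q. destruct (Nat.lt_ge_cases m k) as [L|L].
      - unfold w; rewrite <- Cexp_INR. apply root_of_unity_neq_1. lia.
      - replace (m + (N - k))%nat with ((m - k) + N)%nat by lia.
        rewrite Cpow_add_r, wN, Cmult_1_r. unfold w; rewrite <- Cexp_INR. apply root_of_unity_neq_1. lia. }
    pose proof (Csum_geom q N) as G.
    assert (QN : (q ^ N)%C = RtoC 1).
    { unfold q. rewrite <- Cpow_mult_r, Nat.mul_comm, Cpow_mult_r, wN. apply Cpow_1_l. }
    rewrite QN in G. replace (RtoC 1 - RtoC 1)%C with (RtoC 0) in G by ring.
    assert (D0 : (RtoC 1 - q)%C <> RtoC 0).
    { intros E. apply Q1. replace q with (RtoC 1 - (RtoC 1 - q))%C by ring. rewrite E; ring. }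
    replace (Csum (fun j => q ^ j)%C N) with (/ (RtoC 1 - q) * ((RtoC 1 - q) * Csum (fun j => q ^ j)%C N))%C by (field; easy).
    rewrite G. ring.
Qed.

(* Averaging over the [N]-th roots of unity extracts a coefficient of a
   polynomial of degree below [N]. *)
Lemma polynomial_coef_bound (a : nat -> C) (rho M : R) (N k : nat) : 0 < rho -> (k < N)%nat ->
  (forall x, Cmod x = rho -> Cmod (Csum (fun m => a m * x ^ m)%C N) <= M) ->
  Cmod (a k) * rho ^ k <= M.
Proof.
  intros Hr Hk HM. set (w := Cexp (0, 2 * PI / INR N)%R).
  assert (Cw : forall j, Cmod (w ^ j)%C = 1).
  { intros j. rewrite Cmod_pow. unfold w. rewrite Cmod_Cexp. simpl. rewrite exp_0. apply pow1. }
  assert (E : Csum (fun j => Csum (fun m => a m * (rho * w ^ j) ^ m)%C N * (w ^ (N - k)) ^ j)%C N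
     = (INR N * (a k * rho ^ k))%C).
  { rewrite (Csum_ext _ (fun j => Csum (fun m => (a m * RtoC rho ^ m) * ((w ^ m) ^ j * (w ^ (N - k)) ^ j)) N)%C).
    - rewrite Csum_swap.
      rewrite (Csum_ext _ (fun m => if Nat.eq_dec m k then (INR N * (a m * RtoC rho ^ m))%C else RtoC 0)).
      + rewrite Csum_delta by easy. reflexivity.
      + intros m Hm. rewrite Csum_scal. unfold w. rewrite root_of_unity_orthogonal by easy.
        destruct (Nat.eq_dec m k); ring.
    - intros j _. rewrite Cmult_comm, <- Csum_scal. apply Csum_ext. intros m _.
      rewrite Cpow_mult_l, <- !Cpow_mult_r, (Nat.mul_comm j m). ring. }
  assert (B : Cmod (INR N * (a k * rho ^ k))%C <= INR N * M).
  { rewrite <- E, <- Rsum_const. apply Cmod_Csum_le. intros j _.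
    rewrite Cmod_mult, <- Cpow_mult_r, Cw, Rmult_1_r. apply HM.
    rewrite Cmod_mult, Cw, Cmod_RtoC_pos; lra. }
  rewrite !Cmod_mult, Cmod_pow, !Cmod_RtoC_pos in B by (try apply pos_INR; lra).
  apply Rmult_le_reg_l with (INR N); [apply lt_0_INR; lia|]. lra.
Qed.

(** A truncation of the series is a polynomial, for which averaging gives the estimate. Convergence
    on the circle of radius [2 * rho] makes the truncation error at radius [rho] of order
    [2 ^ (- n)], which beats the gap [e] of a supposed violation. *)
Lemma cauchy_estimate (f : C -> C) (z0 : C) (a : nat -> C) (rho M : R) : 0 < rho ->
  (forall x, clim (Csum (fun k => a k * x ^ k)%C) (f (z0 + x)%C)) ->
  (forall x, Cmod x = rho -> Cmod (f (z0 + x)%C) <= M) ->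
  forall k, Cmod (a k) * rho ^ k <= M.
Proof.
  intros Hr Ha HM k. apply Rnot_lt_le; intros L.
  destruct (pseries_coef_bound a (RtoC (2 * rho)) _ (Ha _)) as [M' HM'].
  rewrite Cmod_RtoC_pos in HM' by lra.
  set (e := Cmod (a k) * rho ^ k - M) in *.
  assert (He : 0 < e) by (unfold e; lra).
  destruct (pow_lt_1_zero (/ 2) ltac:(rewrite Rabs_pos_eq; lra) (e / (4 * (Rabs M' + 1)))) as [N HN].
  { apply Rdiv_lt_0_compat; [easy|]. pose proof (Rabs_pos M'); lra. }
  specialize (HN (N + S k)%nat ltac:(lia)). rewrite Rabs_pos_eq in HN by (apply pow_le; lra).
  set (n := (N + S k)%nat) in *.
  assert (T : Cmod (a k) * rho ^ k <= M + e / 2); [|unfold e in *; lra].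
  apply (polynomial_coef_bound a rho _ n k Hr); [unfold n; lia|]. intros x Hx.
  pose proof (pseries_tail a x _ (2 * rho) M' n HM' ltac:(lra) (Ha x)) as Ht.
  rewrite Hx in Ht. replace (rho / (2 * rho)) with (/ 2) in Ht by (field; lra).
  specialize (HM x Hx). set (s := Csum _ n) in *.
  pose proof (Cmod_minus_le (f (z0 + x)%C) (f (z0 + x) - s)%C) as T.
  replace (f (z0 + x) - (f (z0 + x) - s))%C with s in T by ring.
  assert (Bd : M' * ((/ 2) ^ n / (1 - / 2)) <= e / 2); [|lra].
  assert (P : 0 < (/ 2) ^ n) by (apply pow_lt; lra).
  replace (M' * ((/ 2) ^ n / (1 - / 2))) with (2 * M' * (/ 2) ^ n) by field.
  pose proof (Rle_abs M'). pose proof (Rabs_pos M').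
  apply Rle_trans with (2 * (Rabs M' + 1) * (/ 2) ^ n); [apply Rmult_le_compat_r; lra|].
  apply Rmult_lt_compat_l with (r := 2 * (Rabs M' + 1)) in HN; [|lra].
  replace (2 * (Rabs M' + 1) * (e / (4 * (Rabs M' + 1)))) with (e / 2) in HN by (field; lra). lra.
Qed.

Lemma square_sum_Csum (a : nat -> nat -> nat -> C) (x : C) (K N : nat) :
  square_sum (fun n l => Csum (fun k => a n l k * x ^ k)%C K) N
  = Csum (fun k => square_sum (fun n l => a n l k) N * x ^ k)%C K.
Proof.
  induction K as [|K IH]; simpl.
  - unfold square_sum. rewrite (Csum_ext _ (fun _ => RtoC 0)), Csum_const; [ring|].
    intros; rewrite Csum_const; ring.
  - rewrite square_sum_plus, IH. f_equal.
    rewrite (Cmult_comm (square_sum _ N)), <- square_sum_scal. apply square_sum_ext; intros; ring.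
Qed.

Lemma clim_Csum (u : nat -> nat -> C) (l : nat -> C) (m : nat) :
  (forall k, (k < m)%nat -> clim (u k) (l k)) -> clim (fun n => Csum (fun k => u k n) m) (Csum l m).
Proof.
  induction m as [|m IH]; intros H; [apply (clim_const (RtoC 0))|].
  apply (clim_plus (fun n => Csum (fun k => u k n) m) (u m)); [|apply H; lia].
  apply IH. intros; apply H; lia.
Qed.
(** Weierstrass's theorem for dominated double series. Cauchy's estimate turns domination on a disc
    into domination of each Taylor coefficient, with constant [K / rho ^ k]; hence the double sums
    [b k] exist, and the tails of all series are controlled together. *)
Lemma double_sum_pseries (f : C -> nat -> nat -> C) (G : C -> C) (z0 : C) (u : nat -> R) (rho K U : R) :
  0 < rho -> 0 <= K -> (forall n, 0 <= u n) -> (forall n, Rsum u n <= U) ->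
  (forall n l, entire (fun z => f z n l)) ->
  (forall x, Cmod x <= rho -> dominated (f (z0 + x)%C) u K) ->
  (forall x, Cmod x < rho -> clim (square_sum (f (z0 + x)%C)) (G (z0 + x)%C)) ->
  exists (a : nat -> nat -> nat -> C) (b : nat -> C) (M : R),
    (forall n l x, clim (Csum (fun k => a n l k * x ^ k)%C) (f (z0 + x)%C n l)) /\
    (forall k, clim (square_sum (fun n l => a n l k)) (b k)) /\
    (forall k, Cmod (b k) * rho ^ k <= M) /\
    (forall x, Cmod x < rho -> clim (Csum (fun k => b k * x ^ k)%C) (G (z0 + x)%C)).
Proof.
  intros Hr HK Hu HU He Hd HG.
  set (a := fun n l => proj1_sig (constructive_indefinite_description _ (He n l z0))).
  assert (Ha : forall n l x, clim (Csum (fun k => a n l k * x ^ k)%C) (f (z0 + x)%C n l)).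
  { intros n l. unfold a. now destruct (constructive_indefinite_description _ (He n l z0)). }
  assert (Hab : forall n l k, Cmod (a n l k) * rho ^ k <= K * (u n * u l)).
  { intros n l. apply (cauchy_estimate (fun z => f z n l) z0 (a n l) rho _ Hr (Ha n l)).
    intros x Hx. apply Hd. lra. }
  assert (Hdk : forall k, dominated (fun n l => a n l k) u (K / rho ^ k)).
  { intros k n l. assert (P : 0 < rho ^ k) by now apply pow_lt.
    apply Rmult_le_reg_r with (rho ^ k); [easy|]. eapply Rle_trans; [apply Hab|]. right; field; lra. }
  assert (HKk : forall k, 0 <= K / rho ^ k).
  { intros k. apply Rmult_le_pos; [easy|]. left. apply Rinv_0_lt_compat. now apply pow_lt. }
  set (b := fun k => proj1_sig (constructive_indefinite_description _
     (dominated_square_limit _ u _ U Hu HU (HKk k) (Hdk k)))).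
  assert (Hb : forall k, clim (square_sum (fun n l => a n l k)) (b k)).
  { intros k. unfold b. now destruct (constructive_indefinite_description _ _). }
  exists a, b, (K * (U * U)). repeat split; auto.
  - intros k. assert (P : 0 < rho ^ k) by now apply pow_lt.
    pose proof (dominated_limit_bound _ u _ U _ Hu HU (HKk k) (Hdk k) (Hb k)) as T.
    apply Rmult_le_compat_r with (r := rho ^ k) in T; [|lra].
    eapply Rle_trans; [exact T|]. right; field; lra.
  - intros x Hx. pose proof (Cmod_ge_0 x) as Px.
    assert (Hq : 0 <= Cmod x / rho < 1).
    { split; [apply Rmult_le_pos; [easy|left; apply Rinv_0_lt_compat; lra]|].
      apply Rmult_lt_reg_r with rho; [lra|]. unfold Rdiv; rewrite Rmult_assoc, Rinv_l; lra. }
    apply (clim_0_of_bound _ _ (K / (1 - Cmod x / rho) * (U * U)) (Cmod x / rho) Hq). intros n.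
    rewrite Cmod_minus_sym.
    replace (K / (1 - Cmod x / rho) * (U * U) * (Cmod x / rho) ^ n)
      with ((K * ((Cmod x / rho) ^ n / (1 - Cmod x / rho))) * (U * U)) by (unfold Rdiv; ring).
    apply (dominated_limit_bound (fun i j => f (z0 + x) i j - Csum (fun k => a i j k * x ^ k) n)%C u _ U _ Hu HU).
    + apply Rmult_le_pos; [easy|]. apply Rmult_le_pos; [apply pow_le; lra|left; apply Rinv_0_lt_compat; lra].
    + intros i j. eapply Rle_trans; [apply (pseries_tail _ _ _ rho (K * (u i * u j)) n); auto|].
      right; ring.
    + eapply clim_ext; [|apply (clim_minus (square_sum (f (z0 + x)%C)) (fun N => Csum (fun k => square_sum (fun n l => a n l k) N * x ^ k)%C n)); [apply HG, Hx|]].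
      * intros N. cbv beta. symmetry.
        rewrite (square_sum_ext _ (fun i j => f (z0 + x) i j + (- (1)) * Csum (fun k => a i j k * x ^ k) n)%C) by (intros; ring).
        rewrite square_sum_plus, square_sum_scal, square_sum_Csum.
        ring.
      * apply (clim_Csum (fun k N => square_sum (fun n l => a n l k) N * x ^ k)%C).
        intros k _. rewrite (Cmult_comm (b k)). eapply clim_ext; [|apply (clim_scal (x ^ k)%C), (Hb k)].
        intros N. cbv beta. ring.
Qed.

(** * Euler-Maclaurin summation over the lattice *)

Lemma Rpower_decr (x y p : R) : 0 < x -> x <= y -> 0 <= p -> Rpower y (- p) <= Rpower x (- p).
Proof.
  intros Hx Hxy Hp. unfold Rpower.
  assert (L : ln x <= ln y).
  { destruct Hxy as [H|H]; [left; now apply ln_increasing|right; now rewrite H]. }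
  assert (E : - p * ln y <= - p * ln x) by nra.
  destruct E as [E|E]; [left; now apply exp_increasing|right; now rewrite E].
Qed.

Lemma Rpower_pos (x y : R) : 0 < Rpower x y.
Proof. apply exp_pos. Qed.

(** Comparison with the integral of [x ^ (- s)], by the mean value theorem for [x ^ (1 - s)] and
    telescoping. *)
Lemma p_series_bound (s : R) : 1 < s ->
  forall N, Rsum (fun n => Rpower (INR (S n)) (- s)) N <= 1 + 1 / (s - 1).
Proof.
  intros Hs.
  assert (E1 : Rpower 1 (- s) = 1) by (unfold Rpower; rewrite ln_1, Rmult_0_r; apply exp_0).
  assert (E1' : Rpower 1 (1 - s) = 1) by (unfold Rpower; rewrite ln_1, Rmult_0_r; apply exp_0).
  assert (Step : forall n, Rpower (INR (S (S n))) (- s) <=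
     (Rpower (INR (S n)) (1 - s) - Rpower (INR (S (S n))) (1 - s)) / (s - 1)).
  { intros n. set (x := INR (S n)).
    assert (Hx : 0 < x) by (apply lt_0_INR; lia).
    rewrite (S_INR (S n)). fold x.
    destruct (MVT_gen (fun y => Rpower y (1 - s)) x (x + 1) (fun y => (1 - s) * Rpower y (1 - s - 1))) as [y [Hy E]].
    - intros y Hy. rewrite Rmin_left, Rmax_right in Hy by lra.
      apply is_derive_Reals, derivable_pt_lim_power. lra.
    - intros y Hy. rewrite Rmin_left, Rmax_right in Hy by lra.
      apply derivable_continuous_pt. eexists. apply derivable_pt_lim_power. lra.
    - rewrite Rmin_left, Rmax_right in Hy by lra.
      replace (x + 1 - x) with 1 in E by ring. rewrite Rmult_1_r in E.
      replace (1 - s - 1) with (- s) in E by ring.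
      assert (T : Rpower (x + 1) (- s) <= Rpower y (- s)) by (apply Rpower_decr; lra).
      apply Rmult_le_reg_r with (s - 1); [lra|]. unfold Rdiv. rewrite Rmult_assoc, Rinv_l by lra.
      nra. }
  intros [|N]; [simpl; assert (0 < 1 / (s - 1)) by (apply Rdiv_lt_0_compat; lra); lra|].
  rewrite Rsum_shift. simpl INR at 1. rewrite E1.
  apply Rplus_le_compat_l.
  assert (B : Rsum (fun n => Rpower (INR (S (S n))) (- s)) N <=
     (Rpower 1 (1 - s) - Rpower (INR (S N)) (1 - s)) / (s - 1)).
  { induction N as [|N IH].
    - simpl. right; field; lra.
    - change (Rsum (fun n => Rpower (INR (S (S n))) (- s)) (S N)) with
        (Rsum (fun n => Rpower (INR (S (S n))) (- s)) N + Rpower (INR (S (S N))) (- s)).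
      specialize (Step N). unfold Rdiv in *. nra. }
  eapply Rle_trans; [exact B|]. rewrite E1'.
  apply Rmult_le_compat_r; [left; apply Rinv_0_lt_compat; lra|].
  pose proof (Rpower_pos (INR (S N)) (1 - s)). lra.
Qed.

Definition lattice (c : C) (n l : nat) : C := (c * INR (S l) + INR (S n))%C.

Lemma Re_lattice (c : C) (n l : nat) : Re (lattice c n l) = Re c * INR (S l) + INR (S n).
Proof. unfold lattice. rewrite Re_plus, Re_scal. reflexivity. Qed.

(** Lower bound for the growth of [Re (c l + n)] per unit of [l + n]. *)
Definition slope (c : C) : R := Rmin 1 (Re c).

Lemma slope_pos (c : C) : 0 < Re c -> 0 < slope c <= 1.
Proof. intros H; unfold slope; split; [apply Rmin_glb_lt; lra|apply Rmin_l]. Qed.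

Lemma Re_lattice_ge (c : C) (n l : nat) : 0 < Re c ->
  slope c * (INR (S n) + INR (S l)) <= Re (lattice c n l).
Proof.
  intros H. rewrite Re_lattice. unfold slope.
  pose proof (Rmin_l 1 (Re c)). pose proof (Rmin_r 1 (Re c)).
  pose proof (pos_INR (S l)). pose proof (pos_INR (S n)). nra.
Qed.

Lemma Re_lattice_pos (c : C) (n l : nat) : 0 < Re c -> 0 < Re (lattice c n l).
Proof.
  intros H. pose proof (Re_lattice_ge c n l H). pose proof (slope_pos c H).
  assert (0 < INR (S l)) by (apply lt_0_INR; lia). assert (0 < INR (S n)) by (apply lt_0_INR; lia).
  nra.
Qed.

(* [m + n >= sqrt (m n)] splits the lattice sum into a product of two series. *)
Lemma lattice_power_bound (c : C) (p0 p1 p : R) (n l : nat) (v : C) : 0 < Re c ->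
  2 < p0 -> p0 <= p <= p1 -> Re (lattice c n l) <= Re v ->
  Rpower (Cmod v) (- p) <= Rpower (slope c) (- p1) *
     (Rpower (INR (S n)) (- (p0 / 2)) * Rpower (INR (S l)) (- (p0 / 2))).
Proof.
  intros Hc Hp0 Hp Hv.
  pose proof (slope_pos c Hc) as [K0 K1]. pose proof (Re_lattice_ge c n l Hc) as Hl.
  assert (A : 1 <= INR (S l)) by (apply (le_INR 1); lia).
  assert (B : 1 <= INR (S n)) by (apply (le_INR 1); lia).
  set (x := INR (S n)) in *. set (y := INR (S l)) in *.
  assert (Q : sqrt (x * y) <= x + y).
  { rewrite <- (sqrt_Rsqr (x + y)) by lra. apply sqrt_le_1_alt. unfold Rsqr. nra. }
  assert (Q1 : 1 <= sqrt (x * y)) by (rewrite <- sqrt_1; apply sqrt_le_1_alt; nra).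
  apply Rle_trans with (Rpower (slope c * sqrt (x * y)) (- p)).
  - apply Rpower_decr; [nra| |lra].
    eapply Rle_trans; [|apply Re_le_Cmod_pos]. nra.
  - rewrite <- Rpower_mult_distr by lra.
    apply Rmult_le_compat; try (left; apply Rpower_pos).
    + unfold Rpower. assert (L : ln (slope c) <= 0).
      { rewrite <- ln_1. destruct K1 as [K1|K1]; [left; now apply ln_increasing|right; now rewrite K1]. }
      assert (E : - p * ln (slope c) <= - p1 * ln (slope c)) by nra.
      destruct E as [E|E]; [left; now apply exp_increasing|right; now rewrite E].
    + rewrite Rpower_mult_distr by lra.
      apply Rle_trans with (Rpower (sqrt (x * y)) (- p0)).
      * unfold Rpower. assert (L : 0 <= ln (sqrt (x * y))).
        { rewrite <- ln_1. destruct Q1 as [Q1|Q1]; [left; apply ln_increasing; lra|right; now rewrite Q1 at 1]. }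
        assert (E : - p * ln (sqrt (x * y)) <= - p0 * ln (sqrt (x * y))) by nra.
        destruct E as [E|E]; [left; now apply exp_increasing|right; now rewrite E].
      * right. rewrite <- Rpower_sqrt by nra. rewrite Rpower_mult. f_equal. field.
Qed.

(** The product [(2 - z) (1 - z) ... (3 - k - z)], produced by [k] differentiations of
    [v ^ (2 - z)]. *)
Fixpoint falling (k : nat) (z : C) : C :=
  match k with O => RtoC 1 | S j => (falling j z * (RtoC 2 - INR j - z))%C end.

(* The [k]-th derivative of [v ^ (2 - z)] in [v]; the second one is [(2 - z) (1 - z) v ^ (- z)],
   which explains the denominator of [zeta_ext]. *)
Definition power_derivative (k : nat) (z v : C) : C :=
  (falling k z * Cpower v (RtoC 2 - INR k - z))%C.

Lemma power_derivative_deriv (k : nat) (z w th : C) (s : R) : 0 < Re (w + s * th)%C ->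
  cderiv (fun s : R => power_derivative k z (w + s * th)) s (th * power_derivative (S k) z (w + s * th))%C.
Proof.
  intros H. unfold power_derivative. eapply cderiv_eq.
  - apply cderiv_scal. apply (cderiv_Cpower (fun s : R => w + s * th)%C); [|exact H].
    apply cderiv_plus; [apply cderiv_const|].
    apply cderiv_mult; [apply cderiv_RtoC, (is_derive_id (K := R_AbsRing))|apply cderiv_const].
  - unfold one; simpl. cbv beta.
    set (v := (w + s * th)%C) in *.
    change (match k with O => 1 | S _ => INR k + 1 end) with (INR (S k)).
    replace (RtoC 2 - INR k - z)%C with ((RtoC 2 - INR (S k) - z) + RtoC (INR 1))%C at 2.
    + rewrite Cpower_plus, Cpower_INR by easy. simpl Cpow. field. now apply Re_neq_0.
    + rewrite S_INR, RtoC_plus. simpl. ring.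
Qed.

Lemma power_derivative_taylor (j m : nat) (z w th : C) (B : R) : 0 < Re w -> 0 <= Re th ->
  (forall s, 0 <= s <= 1 -> Cmod (power_derivative (j + m) z (w + s * th)) <= B) ->
  Cmod (power_derivative j z (w + th)
    - Csum (fun k => RtoC (/ INR (fact k)) * (th ^ k * power_derivative (j + k) z w)) m)%C
  <= Cmod th ^ m * B.
Proof.
  intros Hw Ht HB.
  pose proof (taylor_bound m (Cmod th ^ m * B) (fun k s => th ^ k * power_derivative (j + k) z (w + RtoC s * th))%C) as T.
  cbv beta in T. rewrite Nat.add_0_r, Cmult_1_l in T. simpl (th ^ 0)%C in T. rewrite Cmult_1_l in T.
  rewrite (Csum_ext (fun k => RtoC (/ INR (fact k)) * (th ^ k * power_derivative (j + k) z w))%C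
     (fun k => RtoC (/ INR (fact k)) * (th ^ k * power_derivative (j + k) z (w + RtoC 0 * th)))%C).
  - apply T.
    + intros k s _ Hs. eapply cderiv_eq.
      * apply cderiv_scal, power_derivative_deriv.
        rewrite Re_plus, (Cmult_comm s), Re_scal. nra.
      * rewrite Nat.add_succ_r. simpl. ring.
    + intros s Hs. rewrite Cmod_mult, Cmod_pow.
      apply Rmult_le_compat_l; [apply pow_le, Cmod_ge_0|now apply HB].
  - intros k _. rewrite Cmult_0_l, Cplus_0_r. reflexivity.
Qed.

(* Laurent coefficients at 0 of [1 / ((1 - exp (- t)) (1 - exp (- c t)))]. *)
Definition coef2 (c : C) : C := (/ c)%C.
Definition coef1 (c : C) : C := ((1 + c) / (2 * c))%C.
Definition coef0 (c : C) : C := (1 / 4 + c / 12 + 1 / (12 * c))%C.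

(** The mixed second difference, with symbol [(1 - exp (- t)) (1 - exp (- c t))] on
    [exp (- w t)]. *)
Definition corner (c : C) (g : C -> C) (w : C) : C :=
  (g w - g (w + 1) - g (w + c) + g (w + (1 + c)))%C.

(** The truncated inverse of [corner] applied to the second derivative. A derivative in [w]
    contributes the factor [- t] on [exp (- w t)], hence the sign of the middle term. *)
Definition em_main (c z w : C) : C :=
  (coef2 c * power_derivative 0 z w - coef1 c * power_derivative 1 z w
   + coef0 c * power_derivative 2 z w)%C.

Definition em_rest (c z w : C) : C :=
  (power_derivative 2 z w - corner c (em_main c z) w)%C.

Definition taylor_rest (j m : nat) (z w th : C) : C :=
  (power_derivative j z (w + th)
    - Csum (fun k => RtoC (/ INR (fact k)) * (th ^ k * power_derivative (j + k) z w)) m)%C.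

Definition em_taylor_rest (c z w th : C) : C :=
  (coef2 c * taylor_rest 0 5 z w th - coef1 c * taylor_rest 1 4 z w th
   + coef0 c * taylor_rest 2 3 z w th)%C.

(** The Laurent coefficients make all derivatives of order at most 4 cancel in the expansions at
    [w]. The orders 5, 4, 3 are staggered so that each of the three remainders involves the fifth
    derivative. *)
Lemma em_rest_taylor (c z w : C) : c <> 0%C ->
  em_rest c z w = (em_taylor_rest c z w 1 + em_taylor_rest c z w c - em_taylor_rest c z w (1 + c))%C.
Proof.
  intros Hc. unfold em_rest, corner, em_main, em_taylor_rest, taylor_rest.
  simpl Csum. simpl INR. simpl Nat.add. simpl fact. simpl INR.
  rewrite !RtoC_inv by lra. rewrite !RtoC_plus.
  unfold coef2, coef1, coef0.
  generalize (power_derivative 0 z w) (power_derivative 1 z w) (power_derivative 2 z w)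
    (power_derivative 3 z w) (power_derivative 4 z w).
  intros. simpl Cpow. field. easy.
Qed.

Definition taylor_weight (c th : C) : R :=
  Cmod (coef2 c) * Cmod th ^ 5 + Cmod (coef1 c) * Cmod th ^ 4 + Cmod (coef0 c) * Cmod th ^ 3.

Lemma taylor_weight_pos (c th : C) : 0 <= taylor_weight c th.
Proof.
  unfold taylor_weight.
  assert (P : forall a k, 0 <= Cmod a * Cmod th ^ k).
  { intros; apply Rmult_le_pos; [apply Cmod_ge_0|apply pow_le, Cmod_ge_0]. }
  pose proof (P (coef2 c) 5%nat). pose proof (P (coef1 c) 4%nat). pose proof (P (coef0 c) 3%nat). lra.
Qed.

Lemma em_taylor_rest_bound (c z w th : C) (B : R) : 0 < Re w -> 0 <= Re th ->
  (forall v, Re w <= Re v -> Cmod (power_derivative 5 z v) <= B) ->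
  Cmod (em_taylor_rest c z w th) <= taylor_weight c th * B.
Proof.
  intros Hw Ht HB.
  assert (P : forall s : R, 0 <= s <= 1 -> Cmod (power_derivative 5 z (w + s * th)) <= B).
  { intros s Hs. apply HB. rewrite Re_plus, (Cmult_comm s), Re_scal. nra. }
  pose proof (power_derivative_taylor 0 5 z w th B Hw Ht P) as T0.
  pose proof (power_derivative_taylor 1 4 z w th B Hw Ht P) as T1.
  pose proof (power_derivative_taylor 2 3 z w th B Hw Ht P) as T2.
  fold (taylor_rest 0 5 z w th) in T0. fold (taylor_rest 1 4 z w th) in T1. fold (taylor_rest 2 3 z w th) in T2.
  unfold em_taylor_rest, taylor_weight.
  eapply Rle_trans; [apply Cmod_triangle|].
  eapply Rle_trans; [apply Rplus_le_compat_r, Cmod_minus_le|]. rewrite !Cmod_mult.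
  pose proof (Rmult_le_compat_l _ _ _ (Cmod_ge_0 (coef2 c)) T0).
  pose proof (Rmult_le_compat_l _ _ _ (Cmod_ge_0 (coef1 c)) T1).
  pose proof (Rmult_le_compat_l _ _ _ (Cmod_ge_0 (coef0 c)) T2). lra.
Qed.

Lemma em_rest_bound (c z w : C) (B : R) : 0 < Re c -> 0 < Re w ->
  (forall v, Re w <= Re v -> Cmod (power_derivative 5 z v) <= B) ->
  Cmod (em_rest c z w) <= (taylor_weight c 1 + taylor_weight c c + taylor_weight c (1 + c)) * B.
Proof.
  intros Hc Hw HB. rewrite em_rest_taylor by now apply Re_neq_0.
  pose proof (em_taylor_rest_bound c z w 1 B Hw ltac:(simpl; lra) HB).
  pose proof (em_taylor_rest_bound c z w c B Hw ltac:(lra) HB).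
  pose proof (em_taylor_rest_bound c z w (1 + c) B Hw ltac:(rewrite Re_plus; simpl; lra) HB).
  eapply Rle_trans; [apply Cmod_minus_le|].
  eapply Rle_trans; [apply Rplus_le_compat_r, Cmod_triangle|]. lra.
Qed.

Lemma falling_bound (z : C) (K k : nat) : (k <= K)%nat ->
  Cmod (falling k z) <= (Cmod z + 2 + INR K) ^ k.
Proof.
  induction k as [|k IH]; intros H; simpl; [rewrite Cmod_1; lra|].
  pose proof (Cmod_ge_0 z). pose proof (pos_INR K).
  rewrite Cmod_mult, Rmult_comm. apply Rmult_le_compat; try apply Cmod_ge_0; [|apply IH; lia].
  eapply Rle_trans; [apply Cmod_minus_le|]. eapply Rle_trans; [apply Rplus_le_compat_r, Cmod_minus_le|].
  rewrite !Cmod_RtoC_pos by (try apply pos_INR; lra).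
  assert (INR k <= INR K) by (apply le_INR; lia). lra.
Qed.

(** Half of the decay exponent [p] goes to each direction; the single series converges for
    [p > 2]. *)
Definition lattice_weight (p : R) (n : nat) : R := Rpower (INR (S n)) (- (p / 2)).

Lemma lattice_weight_pos (p : R) (n : nat) : 0 <= lattice_weight p n.
Proof. left; apply Rpower_pos. Qed.

Lemma lattice_weight_sum (p : R) : 2 < p ->
  forall N, Rsum (lattice_weight p) N <= 1 + 1 / (p / 2 - 1).
Proof. intros H. apply p_series_bound. lra. Qed.

Lemma Re_plus_bound (z0 x : C) (rho : R) : Cmod x <= rho ->
  Re z0 - rho <= Re (z0 + x)%C <= Re z0 + rho /\ Rabs (Im (z0 + x)%C) <= Cmod z0 + rho.
Proof.
  intros H. rewrite Re_plus, Im_plus.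
  pose proof (re_le_Cmod x) as A. pose proof (im_le_Cmod x) as B. pose proof (im_le_Cmod z0) as D.
  apply Rabs_le_between in A. split; [lra|].
  eapply Rle_trans; [apply Rabs_triang|]. lra.
Qed.

Lemma Rmult_nonneg3 (a b c : R) : 0 <= a -> 0 <= b -> 0 <= c -> 0 <= a * b * c.
Proof. intros; apply Rmult_le_pos; [apply Rmult_le_pos|]; easy. Qed.

(** The fifth derivative has size [Cmod w ^ (- 3 - Re z)]. The weakest decay on the disc is [p0],
    and [p0 > 2] says exactly that [Re z0 - rho > -1]. *)
Lemma em_rest_dominated (c z0 : C) (rho : R) : 0 < Re c -> 0 <= rho -> -1 < Re z0 - rho ->
  exists K, 0 <= K /\ forall x, Cmod x <= rho ->
    dominated (fun n l => em_rest c (z0 + x) (lattice c n l))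
      (lattice_weight (3 + Re z0 - rho)) K.
Proof.
  intros Hc Hr Hz. set (p0 := 3 + Re z0 - rho). set (p1 := 3 + Re z0 + rho).
  set (K1 := taylor_weight c 1 + taylor_weight c c + taylor_weight c (1 + c)).
  set (K2 := (Cmod z0 + rho + 2 + INR 5) ^ 5).
  set (K3 := exp ((Cmod z0 + rho) * (PI / 2))).
  (* Since [slope c <= 1], the largest exponent [p1] gives the largest constant. *)
  set (K4 := Rpower (slope c) (- p1)).
  assert (K1p : 0 <= K1).
  { unfold K1. pose proof (taylor_weight_pos c 1). pose proof (taylor_weight_pos c c).
    pose proof (taylor_weight_pos c (1 + c)). lra. }
  assert (K2p : 0 <= K2).
  { apply pow_le. pose proof (Cmod_ge_0 z0). pose proof (pos_INR 5). lra. }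
  assert (K3p : 0 <= K3) by (left; apply exp_pos).
  assert (K4p : 0 <= K4) by (left; apply Rpower_pos).
  exists (K1 * (K2 * K3 * K4)). split; [apply Rmult_le_pos; [easy|now apply Rmult_nonneg3]|].
  intros x Hx n l. rewrite Rmult_assoc. destruct (Re_plus_bound z0 x rho Hx) as [R1 R2].
  apply em_rest_bound; [easy|now apply Re_lattice_pos|]. intros v Hv.
  assert (Hv0 : 0 < Re v) by (pose proof (Re_lattice_pos c n l Hc); lra).
  unfold power_derivative. rewrite Cmod_mult, !Rmult_assoc.
  apply Rmult_le_compat; try apply Cmod_ge_0.
  - eapply Rle_trans; [apply (falling_bound _ 5); lia|]. apply pow_incr.
    pose proof (Cmod_ge_0 (z0 + x)%C). pose proof (Cmod_triangle z0 x). pose proof (pos_INR 5). lra.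
  - eapply Rle_trans; [apply (Cmod_Cpower_le v _ Hv0)|].
    rewrite (Rmult_comm K3).
    apply Rmult_le_compat.
    + left; apply Rpower_pos.
    + left; apply exp_pos.
    + replace (Re (2 - INR 5 - (z0 + x))%C) with (- (3 + Re (z0 + x)%C)).
      * apply (lattice_power_bound c p0 p1 _ n l v Hc); unfold p0, p1; lra.
      * unfold Re; simpl; ring.
    + assert (E : Rabs (Im (2 - INR 5 - (z0 + x))%C) * (PI / 2) <= (Cmod z0 + rho) * (PI / 2)).
      { apply Rmult_le_compat_r; [pose proof PI_RGT_0; lra|].
        replace (Im (2 - INR 5 - (z0 + x))%C) with (- Im (z0 + x)%C).
        - now rewrite Rabs_Ropp.
        - unfold Im; simpl; ring. }
      unfold K3. destruct E as [E|E]; [left; now apply exp_increasing|right; now rewrite E].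
Qed.

Lemma zeta_term_dominated (c z : C) : 0 < Re c -> 2 < Re z ->
  exists K, 0 <= K /\ dominated (zeta_term c z) (lattice_weight (Re z)) K.
Proof.
  intros Hc Hz. exists (exp (Rabs (Im (- z)%C) * (PI / 2)) * Rpower (slope c) (- Re z)).
  split; [apply Rmult_le_pos; left; apply exp_pos|]. intros n l.
  unfold zeta_term. fold (lattice c n l).
  pose proof (Re_lattice_pos c n l Hc) as P.
  eapply Rle_trans; [apply (Cmod_Cpower_le _ _ P)|].
  rewrite Rmult_comm, Rmult_assoc. apply Rmult_le_compat_l; [left; apply exp_pos|].
  rewrite Re_opp. apply (lattice_power_bound c (Re z) (Re z) _ n l); lra.
Qed.

(** Telescoping in both directions leaves the four corners of the square. *)
Lemma corner_square_sum (c : C) (g : C -> C) (N : nat) :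
  square_sum (fun n l => corner c g (lattice c n l)) N
  = (g (lattice c 0 0) - g (lattice c N 0) - g (lattice c 0 N) + g (lattice c N N))%C.
Proof.
  set (h := fun n l => g (lattice c n l)).
  rewrite (square_sum_ext _ (fun n l => (h n l - h n (S l)) - (h (S n) l - h (S n) (S l)))%C).
  - unfold square_sum.
    rewrite (Csum_ext _ (fun n => (h n O - h n N) - (h (S n) O - h (S n) N))%C).
    + rewrite (Csum_telescope (fun n => h n O - h n N)%C). unfold h. ring.
    + intros n _. rewrite Csum_minus, !Csum_telescope. reflexivity.
  - intros n l. unfold corner, h.
    replace (lattice c n l + 1)%C with (lattice c (S n) l).
    replace (lattice c n l + c)%C with (lattice c n (S l)).
    replace (lattice c n l + (1 + c))%C with (lattice c (S n) (S l)).
    ring.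
    all: unfold lattice; rewrite ?(S_INR (S n)), ?(S_INR (S l)), ?RtoC_plus; ring.
Qed.

Lemma clim_Cpower_0 (v : nat -> C) (e : C) (k : R) : 0 < k -> Re e < 0 ->
  (forall n, k * INR (S n) <= Re (v n)) -> clim (fun n => Cpower (v n) e) 0.
Proof.
  intros Hk He Hv eps Hp.
  set (E := exp (Rabs (Im e) * (PI / 2))). assert (PE : 0 < E) by apply exp_pos.
  (* [X] solves [X ^ Re e * E = eps / 2]. *)
  set (X := Rpower (eps / (2 * E)) (/ Re e)). assert (PX : 0 < X) by apply Rpower_pos.
  destruct (archimed_cor1 (k / X)) as [N [HN HN0]]; [now apply Rdiv_lt_0_compat|].
  exists N. intros n Hn. replace (Cpower (v n) e - 0)%C with (Cpower (v n) e) by ring.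
  assert (Pn : 0 < INR N) by (apply lt_0_INR; easy).
  assert (Big : X < k * INR N).
  { apply Rmult_lt_compat_r with (r := INR N * X) in HN; [|now apply Rmult_lt_0_compat].
    replace (/ INR N * (INR N * X)) with X in HN by (field; lra).
    replace (k / X * (INR N * X)) with (k * INR N) in HN by (field; lra). exact HN. }
  assert (Hle : INR N <= INR (S n)) by (apply le_INR; lia).
  specialize (Hv n). pose proof (Re_le_Cmod_pos (v n)).
  assert (V0 : 0 < Re (v n)) by nra.
  eapply Rle_lt_trans; [apply (Cmod_Cpower_le _ _ V0)|]. fold E.
  assert (T : Rpower (Cmod (v n)) (Re e) <= Rpower X (Re e)).
  { replace (Re e) with (- (- Re e)) by ring. apply Rpower_decr; nra. }
  unfold X in T. rewrite Rpower_mult, Rinv_l, Rpower_1 in T by (try apply Rdiv_lt_0_compat; lra).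
  apply Rle_lt_trans with (eps / (2 * E) * E); [apply Rmult_le_compat_r; lra|].
  replace (eps / (2 * E) * E) with (eps / 2) by (field; lra). lra.
Qed.

Lemma em_main_vanishes (c z : C) (v : nat -> C) (k : R) : 0 < k -> 2 < Re z ->
  (forall n, k * INR (S n) <= Re (v n)) -> clim (fun n => em_main c z (v n)) 0.
Proof.
  intros Hk Hz Hv.
  assert (P : forall j, clim (fun n => power_derivative j z (v n)) 0).
  { intros j. unfold power_derivative. replace (RtoC 0) with (falling j z * 0)%C by ring.
    apply clim_scal. apply (clim_Cpower_0 v _ k Hk); [|easy].
    unfold Re; simpl. fold (Re z). pose proof (pos_INR j). lra. }
  unfold em_main.
  replace (RtoC 0) with (coef2 c * 0 - coef1 c * 0 + coef0 c * 0)%C by ring.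
  apply clim_plus; [apply clim_minus|]; apply clim_scal, P.
Qed.

(** * The meromorphic continuation *)

(** Chosen as a total function of [z]; it is the limit wherever [Re z > -1]. *)
Definition rest_sum (c z : C) : C :=
  epsilon (inhabits (RtoC 0)) (fun s => clim (square_sum (fun n l => em_rest c z (lattice c n l))) s).

Lemma rest_sum_limit (c z : C) : 0 < Re c -> -1 < Re z ->
  clim (square_sum (fun n l => em_rest c z (lattice c n l))) (rest_sum c z).
Proof.
  intros Hc Hz. unfold rest_sum. apply epsilon_spec.
  destruct (em_rest_dominated c z 0 Hc) as (K & HK & D); [lra|lra|].
  specialize (D (RtoC 0) ltac:(rewrite Cmod_0; lra)).
  rewrite Cplus_0_r in D.
  apply (dominated_square_limit _ (lattice_weight (3 + Re z - 0)) K (1 + 1 / ((3 + Re z - 0) / 2 - 1)));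
    [| |exact HK|exact D].
  - intros; apply lattice_weight_pos.
  - apply lattice_weight_sum. lra.
Qed.

Definition base (c : C) : C := (1 + c)%C.

Definition zeta_numerator (c z : C) : C := (em_main c z (base c) + rest_sum c z)%C.

Definition zeta_ext (c z : C) : C := (zeta_numerator c z / ((z - 1) * (z - 2)))%C.

Lemma lattice_0_0 (c : C) : lattice c 0 0 = base c.
Proof. unfold lattice, base. simpl. ring. Qed.

(** For [Re z > 2] three corners of the telescoped sum tend to 0, and the fourth is [em_main] at
    [base c]. Together with the rest this sums the second derivatives
    [(z - 1) * (z - 2) * w ^ (- z)]. *)
Lemma zeta_ext_sum (c z : C) : 0 < Re c -> 2 < Re z -> is_double_sum (zeta_term c z) (zeta_ext c z).
Proof.
  intros Hc Hz. destruct (zeta_term_dominated c z Hc Hz) as (K & HK & D).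
  assert (N1 : (z - 1)%C <> RtoC 0).
  { apply Re_neq_0. unfold Re; simpl. fold (Re z). lra. }
  assert (N2 : (z - 2)%C <> RtoC 0).
  { apply Re_neq_0. unfold Re; simpl. fold (Re z). lra. }
  pose proof (slope_pos c Hc) as [K0 K1].
  apply (dominated_double_sum _ (lattice_weight (Re z)) K (1 + 1 / (Re z / 2 - 1)));
    [apply lattice_weight_pos|now apply lattice_weight_sum|exact HK|exact D|].
  assert (L1 : clim (square_sum (fun n l => corner c (em_main c z) (lattice c n l))) (em_main c z (base c))).
  { eapply clim_ext; [intros n; symmetry; apply corner_square_sum|]. rewrite lattice_0_0.
    assert (V : forall v : nat -> C, (forall n, exists i j, (n <= i + j)%nat /\ v n = lattice c i j) ->
      clim (fun n => em_main c z (v n)) 0).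
    { intros v Hv. apply (em_main_vanishes c z v (slope c)); [easy|easy|]. intros n.
      destruct (Hv n) as (i & j & Hij & ->). pose proof (Re_lattice_ge c i j Hc).
      assert (INR (S n) <= INR (S i) + INR (S j)); [|nra].
      rewrite <- plus_INR. apply le_INR. lia. }
    assert (V1 : clim (fun n => em_main c z (lattice c n 0)) 0).
    { apply V. intros n. exists n, O; split; [lia|easy]. }
    assert (V2 : clim (fun n => em_main c z (lattice c 0 n)) 0).
    { apply V. intros n. exists O, n; split; [lia|easy]. }
    assert (V3 : clim (fun n => em_main c z (lattice c n n)) 0).
    { apply V. intros n. exists n, n; split; [lia|easy]. }
    pose proof (clim_plus _ _ _ _ (clim_minus _ _ _ _ (clim_minus _ _ _ _
      (clim_const (em_main c z (base c))) V1) V2) V3) as L.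
    cbv beta in L.
    now replace (em_main c z (base c) - 0 - 0 + 0)%C with (em_main c z (base c)) in L by ring. }
  pose proof (rest_sum_limit c z Hc ltac:(lra)) as L2.
  pose proof (clim_scal (/ ((z - 1) * (z - 2))) _ _ (clim_plus _ _ _ _ L1 L2)) as L.
  unfold zeta_ext, zeta_numerator, Cdiv. rewrite (Cmult_comm (_ + _)).
  eapply clim_ext; [|exact L]. intros N. cbv beta.
  rewrite <- square_sum_plus, <- square_sum_scal. apply square_sum_ext. intros n l.
  unfold em_rest. change (zeta_term c z n l) with (Cpower (lattice c n l) (- z)).
  unfold power_derivative at 1. simpl falling.
  replace (2 - INR 2 - z)%C with (- z)%C by (simpl INR; rewrite RtoC_plus; ring).
  change (INR 1) with 1. change (INR 0) with 0.
  set (h := corner _ _ _). field. easy.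
Qed.

Lemma entire_analytic (f : C -> C) (z0 : C) : entire f -> analytic_at f z0.
Proof.
  intros H. destruct (H z0) as [a Ha]. apply (analytic_intro f z0 a 1); [lra|]. intros x _. apply Ha.
Qed.

Lemma entire_falling (k : nat) (g : C -> C) : entire g -> entire (fun z => falling k z * g z)%C.
Proof.
  revert g. induction k as [|k IH]; intros g Hg; simpl.
  - apply (entire_ext g); [intros; ring|easy].
  - apply (entire_ext (fun z => falling k z * (((RtoC 2 - INR k) + (- (1)) * z) * g z))%C); [intros; ring|].
    now apply IH, entire_mult_affine.
Qed.

Lemma entire_power_derivative (k : nat) (v : C) : entire (fun z => power_derivative k z v).
Proof. apply entire_falling, entire_Cpower. Qed.

Lemma entire_em_main (c w : C) : entire (fun z => em_main c z w).
Proof.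
  apply entire_plus; [apply entire_minus|]; apply entire_scal, entire_power_derivative.
Qed.

Lemma entire_em_rest (c w : C) : entire (fun z => em_rest c z w).
Proof.
  apply entire_minus; [apply entire_power_derivative|].
  apply entire_plus; [apply entire_minus; [apply entire_minus|]|]; apply entire_em_main.
Qed.

(** The coefficients are recorded as double sums of those of the terms, because the coefficient of
    degree 1 will give the derivative at 0. *)
Lemma rest_sum_pseries (c z0 : C) : 0 < Re c -> -1 < Re z0 ->
  exists rho (a : nat -> nat -> nat -> C) (b : nat -> C) (M : R), 0 < rho /\
    (forall n l x, clim (Csum (fun k => a n l k * x ^ k)%C) (em_rest c (z0 + x) (lattice c n l))) /\
    (forall k, clim (square_sum (fun n l => a n l k)) (b k)) /\
    (forall k, Cmod (b k) * rho ^ k <= M) /\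
    (forall x, Cmod x < rho -> clim (Csum (fun k => b k * x ^ k)%C) (rest_sum c (z0 + x))).
Proof.
  (* Half the distance from [z0] to the line [Re z = -1], so that the decay exponent stays above 2
     on the disc. *)
  intros Hc Hz. set (rho := (Re z0 + 1) / 2). assert (Hr : 0 < rho) by (unfold rho; lra).
  destruct (em_rest_dominated c z0 rho Hc) as (K & HK & D); [lra|unfold rho; lra|].
  destruct (double_sum_pseries (fun z n l => em_rest c z (lattice c n l)) (rest_sum c) z0
    (lattice_weight (3 + Re z0 - rho)) rho K (1 + 1 / ((3 + Re z0 - rho) / 2 - 1)))
    as (a & b & M & H1 & H2 & H3 & H4); auto.
  - apply lattice_weight_pos.
  - apply lattice_weight_sum. unfold rho; lra.
  - intros n l. apply entire_em_rest.
  - intros x Hx. apply rest_sum_limit; [easy|].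
    destruct (Re_plus_bound z0 x rho) as [[R1 _] _]; [lra|]. unfold rho in R1; lra.
  - exists rho, a, b, M. auto.
Qed.

Lemma analytic_zeta_numerator (c z0 : C) : 0 < Re c -> -1 < Re z0 -> analytic_at (zeta_numerator c) z0.
Proof.
  intros Hc Hz. destruct (rest_sum_pseries c z0 Hc Hz) as (rho & a & b & M & Hr & _ & _ & _ & H).
  apply (analytic_ext (fun z => em_main c z (base c) - (- (1)) * rest_sum c z)%C _ _ 1); [lra| |].
  - intros z _. unfold zeta_numerator. ring.
  - apply analytic_minus; [apply entire_analytic, entire_em_main|].
    apply analytic_scal. now apply (analytic_intro _ z0 b rho).
Qed.

Lemma meromorphic_intro (f g : C -> C) (z0 : C) (n : nat) (d : R) : 0 < d -> analytic_at g z0 ->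
  (forall z, Cmod (z - z0)%C < d -> z <> z0 -> f z = (g z / (z - z0) ^ n)%C) -> meromorphic_at f z0.
Proof.
  intros Hd Hg E. exists n, g. split; [easy|]. apply locally_Cmod. exists d. split; [easy|]. exact E.
Qed.

Lemma RtoC_neq (x y : R) : x <> y -> RtoC x <> RtoC y.
Proof. intros H E. now apply H, RtoC_inj. Qed.

Lemma minus_neq_0 (x y : C) : x <> y -> (x - y)%C <> RtoC 0.
Proof. intros H. now apply Cmod_gt_0, Cmod_minus_pos. Qed.

Lemma near_neq (z z0 b : C) : Cmod (z - z0)%C < Cmod (b - z0)%C -> z <> b.
Proof. intros H ->. lra. Qed.

(** For [Re z > -1] the numerator is analytic, so only 1 and 2 can be poles; at each of them the
    other factor of the denominator is invertible. *)
Lemma zeta_ext_continuation (c : C) : 0 < Re c -> is_zeta_continuation c (zeta_ext c).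
Proof.
  intros Hc.
  assert (An : forall z0, -1 < Re z0 -> z0 <> RtoC 1 -> z0 <> RtoC 2 -> analytic_at (zeta_ext c) z0).
  { intros z0 Hz N1 N2.
    set (d := Rmin (Cmod (1 - z0)%C) (Cmod (2 - z0)%C)).
    assert (Hd : 0 < d) by (apply Rmin_glb_lt; apply Cmod_minus_pos; auto).
    apply (analytic_ext (fun z => zeta_numerator c z / (z - 1) / (z - 2))%C _ _ d Hd).
    - intros z Hz'. unfold zeta_ext.
      pose proof (minus_neq_0 z 1 (near_neq z z0 1 (Rlt_le_trans _ _ _ Hz' (Rmin_l _ _)))).
      pose proof (minus_neq_0 z 2 (near_neq z z0 2 (Rlt_le_trans _ _ _ Hz' (Rmin_r _ _)))).
      field. easy.
    - apply analytic_div; [easy|]. apply analytic_div; [easy|]. now apply analytic_zeta_numerator. }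
  assert (C12 : Cmod (2 - 1)%C = 1).
  { rewrite <- RtoC_minus, Cmod_RtoC_pos; lra. }
  assert (C21 : Cmod (1 - 2)%C = 1).
  { now rewrite Cmod_minus_sym. }
  split; [intros z Hz; now apply zeta_ext_sum|]. split.
  - exists (mkposreal 1 Rlt_0_1). simpl. intros z0 Hz.
    destruct (classic (z0 = RtoC 1)) as [->|N1]; [|destruct (classic (z0 = RtoC 2)) as [->|N2]].
    + apply (meromorphic_intro _ (fun z => zeta_numerator c z / (z - 2))%C _ 1 1); [lra| |].
      * apply analytic_div; [apply RtoC_neq; lra|]. now apply analytic_zeta_numerator.
      * intros z Hz1 Hz2. unfold zeta_ext. simpl.
        pose proof (minus_neq_0 z 1 Hz2). pose proof (minus_neq_0 z 2 (near_neq z 1 2 ltac:(lra))).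
        field. easy.
    + apply (meromorphic_intro _ (fun z => zeta_numerator c z / (z - 1))%C _ 1 1); [lra| |].
      * apply analytic_div; [apply RtoC_neq; lra|]. now apply analytic_zeta_numerator.
      * intros z Hz1 Hz2. unfold zeta_ext. simpl.
        pose proof (minus_neq_0 z 2 Hz2). pose proof (minus_neq_0 z 1 (near_neq z 2 1 ltac:(lra))).
        field. easy.
    + apply (meromorphic_intro _ (zeta_ext c) _ 0 1); [lra|apply An; easy|].
      intros z _ _. simpl. unfold Cdiv. rewrite <- (Cmult_1_r (zeta_ext c z)) at 1. f_equal. field.
  - refine (An (RtoC 0) _ _ _); [simpl; lra|apply RtoC_neq; lra|apply RtoC_neq; lra].
Qed.

(** * The derivative at 0 as a lattice sum *)

Lemma cderiv_intro (f : R -> C) (t : R) (l : C) :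
  (forall eps, 0 < eps -> exists d, 0 < d /\ forall h, Rabs h < d ->
     Cmod (f (t + h)%R - f t - l * h)%C <= eps * Rabs h) -> cderiv f t l.
Proof.
  intros H. split; apply is_derive_Reals; intros eps He;
    (destruct (H (eps / 2)) as (d & Hd & B); [lra|]);
    exists (mkposreal d Hd); intros h Hh Hd'; simpl in Hd'; specialize (B h Hd').
  - assert (R1 : Rabs (Re (f (t + h)) - Re (f t) - Re l * h) <= eps / 2 * Rabs h).
    { eapply Rle_trans; [|exact B]. eapply Rle_trans; [|apply re_le_Cmod]. right. f_equal.
      unfold Re; simpl. ring. }
    replace ((Re (f (t + h)) - Re (f t)) / h - Re l) with ((Re (f (t + h)) - Re (f t) - Re l * h) / h) by (field; easy).
    unfold Rdiv. rewrite Rabs_mult, Rabs_inv.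
    pose proof (Rabs_pos_lt h Hh) as P.
    apply Rle_lt_trans with (eps / 2 * Rabs h * / Rabs h).
    + apply Rmult_le_compat_r; [left; now apply Rinv_0_lt_compat|exact R1].
    + rewrite Rmult_assoc, Rinv_r; lra.
  - assert (R1 : Rabs (Im (f (t + h)) - Im (f t) - Im l * h) <= eps / 2 * Rabs h).
    { eapply Rle_trans; [|exact B]. eapply Rle_trans; [|apply im_le_Cmod]. right. f_equal.
      unfold Im; simpl. ring. }
    replace ((Im (f (t + h)) - Im (f t)) / h - Im l) with ((Im (f (t + h)) - Im (f t) - Im l * h) / h) by (field; easy).
    unfold Rdiv. rewrite Rabs_mult, Rabs_inv.
    pose proof (Rabs_pos_lt h Hh) as P.
    apply Rle_lt_trans with (eps / 2 * Rabs h * / Rabs h).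
    + apply Rmult_le_compat_r; [left; now apply Rinv_0_lt_compat|exact R1].
    + rewrite Rmult_assoc, Rinv_r; lra.
Qed.

Lemma cderiv_unique (f : R -> C) (t : R) (l l' : C) : cderiv f t l -> cderiv f t l' -> l = l'.
Proof.
  intros [A B] [A' B']. apply C_eq.
  - rewrite <- (is_derive_unique _ _ _ A). now apply is_derive_unique.
  - rewrite <- (is_derive_unique _ _ _ B). now apply is_derive_unique.
Qed.

Lemma cderiv_quadratic (f : R -> C) (t : R) (l : C) (K d : R) : 0 < d ->
  (forall h, Rabs h < d -> Cmod (f (t + h)%R - f t - l * h)%C <= K * Rabs h ^ 2) -> cderiv f t l.
Proof.
  intros Hd H. apply cderiv_intro. intros eps He.
  pose proof (Rabs_pos K). pose proof (Rle_abs K).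
  exists (Rmin d (eps / (Rabs K + 1))). split.
  - apply Rmin_glb_lt; [easy|]. apply Rdiv_lt_0_compat; lra.
  - intros h Hh. pose proof (Rlt_le_trans _ _ _ Hh (Rmin_l _ _)) as L1.
    pose proof (Rlt_le_trans _ _ _ Hh (Rmin_r _ _)) as L2.
    eapply Rle_trans; [now apply H|]. pose proof (Rabs_pos h).
    replace (K * Rabs h ^ 2) with (K * Rabs h * Rabs h) by ring.
    apply Rmult_le_compat_r; [easy|].
    apply Rle_trans with ((Rabs K + 1) * (eps / (Rabs K + 1))); [|right; field; lra].
    apply Rle_trans with ((Rabs K + 1) * Rabs h); [nra|]. apply Rmult_le_compat_l; lra.
Qed.

(** Restriction to the real axis, enough to identify a derivative that exists in the complex
    sense. *)
Lemma is_derive_C_cderiv (f : C -> C) (l : C) :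
  is_derive (K := C_AbsRing) (V := C_NormedModule) f (RtoC 0) l -> cderiv (fun t => f (RtoC t)) 0 l.
Proof.
  intros [_ H]. apply cderiv_intro. intros eps He.
  specialize (H (RtoC 0) (fun P HP => HP) (mkposreal eps He)). destruct H as [d Hd].
  exists d. split; [apply cond_pos|]. intros h Hh. rewrite Rplus_0_l.
  assert (E : (RtoC h - RtoC 0)%C = RtoC h) by ring.
  specialize (Hd (RtoC h)). change (Cmod (RtoC h - RtoC 0)%C < d ->
    Cmod (f (RtoC h) - f (RtoC 0) - (RtoC h - RtoC 0) * l)%C <= eps * Cmod (RtoC h - RtoC 0)%C) in Hd.
  rewrite E, Cmod_R, (Cmult_comm h) in Hd. now apply Hd.
Qed.

Lemma pseries_cderiv (f : C -> C) (a : nat -> C) (rho M : R) : 0 < rho ->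
  (forall k, Cmod (a k) * rho ^ k <= M) ->
  (forall x, Cmod x < rho -> clim (Csum (fun k => a k * x ^ k)%C) (f (RtoC 0 + x)%C)) ->
  cderiv (fun t => f (RtoC t)) 0 (a 1%nat).
Proof.
  intros Hr Hb Hc. apply (cderiv_quadratic _ _ _ (2 * M / rho ^ 2) (rho / 2)); [lra|].
  intros h Hh. rewrite Rplus_0_l.
  pose proof (analytic_deriv_bound f (RtoC 0) a rho M Hr Hb Hc (RtoC h)) as T.
  rewrite Cmod_R, Cplus_0_l in T. apply T. lra.
Qed.

(** The combination of [em_main] built on the iterated antiderivatives of [- log]. It is the
    derivative at [z = 0] of [em_main c z w / ((z - 1) * (z - 2))]. *)
Definition log_main (c w : C) : C :=
  (coef2 c * (3 / 4 * (w * w) - w * w / 2 * Clog w) + coef1 c * (w * Clog w - w) - coef0 c * Clog w)%C.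

Definition log_rest (c w : C) : C := (- Clog w - corner c (log_main c) w)%C.

Lemma power_derivative_cderiv_0 (k : nat) (v l : C) : cderiv (fun t => falling k (RtoC t)) 0 l ->
  cderiv (fun t => power_derivative k (RtoC t) v) 0
    ((l - falling k 0 * Clog v) * Cpower v (2 - INR k))%C.
Proof.
  intros H. unfold power_derivative, Cpower. eapply cderiv_eq.
  - apply cderiv_mult; [exact H|]. apply cderiv_Cexp.
    apply (cderiv_mult (fun t => 2 - INR k - RtoC t)%C); [|apply cderiv_const].
    apply cderiv_minus; [apply cderiv_const|]. apply cderiv_RtoC, (is_derive_id (K := R_AbsRing)).
  - unfold one; simpl. cbv beta. replace (2 - INR k - 0)%C with (2 - INR k)%C by ring. ring.
Qed.

Lemma cderiv_falling (k : nat) (l : C) : cderiv (fun t => falling k (RtoC t)) 0 l ->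
  cderiv (fun t => falling (S k) (RtoC t)) 0 (l * (2 - INR k) - falling k 0)%C.
Proof.
  intros H. simpl. eapply cderiv_eq.
  - apply cderiv_mult; [exact H|].
    apply cderiv_minus; [apply cderiv_const|]. apply cderiv_RtoC, (is_derive_id (K := R_AbsRing)).
  - unfold one; simpl. cbv beta. ring.
Qed.

(** A multiple of [em_main c 0 w] is split off because the quotient rule cancels it: at 0 the
    denominator [(z - 1) * (z - 2)] is 2 with derivative -3. *)
Lemma em_main_cderiv_0 (c w : C) : 0 < Re w ->
  cderiv (fun t => em_main c (RtoC t) w) 0 (2 * log_main c w - 3 / 2 * em_main c 0 w)%C.
Proof.
  intros Hw. unfold em_main.
  pose proof (cderiv_const 1 0 : cderiv (fun t => falling 0 (RtoC t)) 0 0) as F0.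
  pose proof (cderiv_falling 0 _ F0) as F1. pose proof (cderiv_falling 1 _ F1) as F2.
  assert (E0 : Cpower w (2 - INR 0) = (w * w)%C).
  { replace (2 - INR 0)%C with (RtoC (INR 2)) by (simpl; rewrite RtoC_plus; ring).
    rewrite Cpower_INR by easy. simpl; ring. }
  assert (E1 : Cpower w (2 - INR 1) = w).
  { replace (2 - INR 1)%C with (RtoC (INR 1)) by (simpl; ring).
    rewrite Cpower_INR by easy. simpl; ring. }
  assert (E2 : Cpower w (2 - INR 2) = RtoC 1).
  { replace (2 - INR 2)%C with (RtoC (INR 0)) by (simpl; rewrite RtoC_plus; ring).
    rewrite Cpower_INR by easy. simpl; ring. }
  eapply cderiv_eq.
  - exact (cderiv_plus _ _ _ _ _ (cderiv_minus _ _ _ _ _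
      (cderiv_scal (coef2 c) _ _ _ (power_derivative_cderiv_0 0 w _ F0))
      (cderiv_scal (coef1 c) _ _ _ (power_derivative_cderiv_0 1 w _ F1)))
      (cderiv_scal (coef0 c) _ _ _ (power_derivative_cderiv_0 2 w _ F2))).
  - unfold power_derivative, log_main.
    replace (2 - INR 0 - 0)%C with (2 - INR 0)%C by ring.
    replace (2 - INR 1 - 0)%C with (2 - INR 1)%C by ring.
    replace (2 - INR 2 - 0)%C with (2 - INR 2)%C by ring.
    rewrite E0, E1, E2. simpl falling. change (INR 0) with 0. change (INR 1) with 1.
    generalize (coef2 c) (coef1 c) (coef0 c) (Clog w). intros. field.
Qed.

Lemma em_main_at_0 (c w : C) : 0 < Re w ->
  em_main c 0 w = (coef2 c * (w * w) - 2 * coef1 c * w + 2 * coef0 c)%C.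
Proof.
  intros Hw. unfold em_main, power_derivative. simpl falling.
  replace (2 - INR 0 - 0)%C with (RtoC (INR 2)) by (simpl; rewrite RtoC_plus; ring).
  replace (2 - INR 1 - 0)%C with (RtoC (INR 1)) by (simpl; ring).
  replace (2 - INR 2 - 0)%C with (RtoC (INR 0)) by (simpl; rewrite RtoC_plus; ring).
  rewrite !Cpower_INR by easy. change (INR 0) with 0. change (INR 1) with 1. simpl Cpow. ring.
Qed.

(** At [z = 0] the main term is a quadratic polynomial with leading part [w * w / c]; the mixed
    difference kills the lower terms and is exact on the square. *)
Lemma corner_em_main_at_0 (c w : C) : 0 < Re c -> 0 < Re w -> corner c (em_main c 0) w = RtoC 2.
Proof.
  intros Hc Hw. unfold corner.
  rewrite !em_main_at_0 by (rewrite ?Re_plus; simpl; lra).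
  unfold coef2. field. now apply Re_neq_0.
Qed.

Lemma em_rest_at_0 (c w : C) : 0 < Re c -> 0 < Re w -> em_rest c 0 w = RtoC 0.
Proof.
  intros Hc Hw. unfold em_rest. rewrite corner_em_main_at_0 by easy.
  unfold power_derivative. simpl falling.
  replace (2 - INR 2 - 0)%C with (RtoC (INR 0)) by (simpl; rewrite RtoC_plus; ring).
  rewrite Cpower_INR by easy. change (INR 0) with 0. change (INR 1) with 1. simpl Cpow. ring.
Qed.

Lemma em_rest_cderiv_0 (c w : C) : 0 < Re c -> 0 < Re w ->
  cderiv (fun t => em_rest c (RtoC t) w) 0 (2 * log_rest c w)%C.
Proof.
  intros Hc Hw. unfold em_rest, corner.
  pose proof (cderiv_const 1 0 : cderiv (fun t => falling 0 (RtoC t)) 0 0) as F0.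
  pose proof (cderiv_falling 0 _ F0) as F1. pose proof (cderiv_falling 1 _ F1) as F2.
  pose proof (corner_em_main_at_0 c w Hc Hw) as E. unfold corner in E.
  eapply cderiv_eq.
  - apply cderiv_minus.
    + exact (power_derivative_cderiv_0 2 w _ F2).
    + apply cderiv_plus; [apply cderiv_minus; [apply cderiv_minus|]|]; apply em_main_cderiv_0;
        rewrite ?Re_plus; simpl; lra.
  - replace (2 - INR 2)%C with (RtoC (INR 0)) by (simpl; rewrite RtoC_plus; ring).
    rewrite Cpower_INR by easy. simpl falling. change (INR 0) with 0. change (INR 1) with 1. simpl Cpow.
    unfold log_rest, corner.
    set (A := em_main c 0 (w + (1 + c))) in *.
    replace A with (RtoC 2 - em_main c 0 w + em_main c 0 (w + 1) + em_main c 0 (w + c))%C by (rewrite <- E; ring).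
    field.
Qed.

(** The coefficient of degree 1 of the rest is the double sum of the derivatives [2 * log_rest]. As
    the rest vanishes at 0, the denominator affects it only through its value 2. *)
Lemma zeta_ext_deriv (c : C) : 0 < Re c ->
  exists d, clim (square_sum (fun n l => log_rest c (lattice c n l))) d /\
    cderiv (fun t => zeta_ext c (RtoC t)) 0 (log_main c (base c) + d)%C.
Proof.
  intros Hc.
  destruct (rest_sum_pseries c (RtoC 0) Hc ltac:(simpl; lra)) as (rho & a & b & M & Hr & Ha & Hb & HM & HS).
  assert (Ea : forall n l, a n l 1%nat = (2 * log_rest c (lattice c n l))%C).
  { intros n l. pose proof (Re_lattice_pos c n l Hc) as P.
    apply (cderiv_unique (fun t => em_rest c (RtoC t) (lattice c n l)) 0); [|now apply em_rest_cderiv_0].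
    assert (E1 : Cmod (RtoC 1) = 1) by apply Cmod_1.
    destruct (pseries_coef_bound (a n l) (RtoC 1) _ (Ha n l (RtoC 1))) as [M' HM'].
    rewrite E1 in HM'.
    apply (pseries_cderiv (fun z => em_rest c z (lattice c n l)) (a n l) 1 M'); [lra|exact HM'|].
    intros x _. apply Ha. }
  exists (b 1%nat / 2)%C. split.
  - replace (b 1%nat / 2)%C with (/ 2 * b 1%nat)%C by (field; apply RtoC_neq; lra).
    eapply clim_ext; [|apply (clim_scal (/ 2)), (Hb 1%nat)].
    intros N. cbv beta. rewrite <- square_sum_scal. apply square_sum_ext. intros n l. rewrite Ea.
    field.
  - assert (S0 : rest_sum c 0 = RtoC 0).
    { pose proof (rest_sum_limit c 0 Hc ltac:(simpl; lra)) as L.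
      apply (clim_unique _ _ _ L). eapply clim_ext; [|apply clim_const].
      intros N. unfold square_sum. rewrite (Csum_ext _ (fun _ => RtoC 0)), Csum_const; [ring|].
      intros n _. rewrite (Csum_ext _ (fun _ => RtoC 0)), Csum_const; [ring|].
      intros l _. apply em_rest_at_0; [easy|now apply Re_lattice_pos]. }
    assert (Hw : 0 < Re (base c)) by (unfold base; rewrite Re_plus; simpl; lra).
    pose proof (pseries_cderiv (rest_sum c) b rho M Hr HM HS) as D1.
    pose proof (em_main_cderiv_0 c (base c) Hw) as D2.
    pose proof (cderiv_RtoC (fun t => t) 0 1 (is_derive_id (K := R_AbsRing) 0)) as D3.
    pose proof (cderiv_plus _ _ _ _ _ D2 D1) as D4.
    pose proof (cderiv_mult _ _ _ _ _
      (cderiv_minus _ _ _ _ _ D3 (cderiv_const 1 0)) (cderiv_minus _ _ _ _ _ D3 (cderiv_const 2 0))) as D5.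
    assert (N0 : ((RtoC 0 - 1) * (RtoC 0 - 2))%C <> RtoC 0).
    { replace ((RtoC 0 - 1) * (RtoC 0 - 2))%C with (RtoC 2) by ring. apply RtoC_neq; lra. }
    pose proof (cderiv_div _ _ _ _ _ D4 D5 N0) as D. cbv beta in D.
    rewrite S0 in D. eapply cderiv_eq; [exact D|].
    field.
Qed.

Lemma zeta_deriv_unique (c : C) (F : C -> C) (d0 : C) : 0 < Re c -> is_zeta_continuation c F ->
  is_derive (K := C_AbsRing) (V := C_NormedModule) F (RtoC 0) d0 ->
  exists d, clim (square_sum (fun n l => log_rest c (lattice c n l))) d /\
    d0 = (log_main c (base c) + d)%C.
Proof.
  intros Hc HF HD. destruct (zeta_ext_deriv c Hc) as (d & Hd & Dd). exists d. split; [easy|].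
  destruct (zeta_continuation_unique c F (zeta_ext c) HF (zeta_ext_continuation c Hc)) as (r & Hr & E).
  apply (is_derive_C_ext _ _ _ _ r Hr E) in HD.
  exact (cderiv_unique _ _ _ _ (is_derive_C_cderiv _ _ HD) Dd).
Qed.

(** * Integrals of complex functions of a real variable *)

(** Differentiability stands in for continuity of integrands: it is closed under all operations that
    occur and implies integrability. *)
Definition cdiff (f : R -> C) (t : R) : Prop := exists l, cderiv f t l.

Lemma cdiff_const (a : C) (t : R) : cdiff (fun _ => a) t.
Proof. eexists; apply cderiv_const. Qed.

Lemma cdiff_RtoC (f : R -> R) (t : R) : ex_derive f t -> cdiff (fun s => RtoC (f s)) t.
Proof. intros [l H]; exists (RtoC l); now apply cderiv_RtoC. Qed.

Lemma cdiff_id (t : R) : cdiff RtoC t.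
Proof. apply (cdiff_RtoC (fun s => s)). eexists; apply (is_derive_id (K := R_AbsRing)). Qed.

Lemma cdiff_plus (f g : R -> C) (t : R) : cdiff f t -> cdiff g t -> cdiff (fun s => f s + g s)%C t.
Proof. intros [a A] [b B]; eexists; apply cderiv_plus; eassumption. Qed.

Lemma cdiff_opp (f : R -> C) (t : R) : cdiff f t -> cdiff (fun s => - f s)%C t.
Proof. intros [a A]; eexists; apply cderiv_opp; eassumption. Qed.

Lemma cdiff_minus (f g : R -> C) (t : R) : cdiff f t -> cdiff g t -> cdiff (fun s => f s - g s)%C t.
Proof. intros [a A] [b B]; eexists; apply cderiv_minus; eassumption. Qed.

Lemma cdiff_mult (f g : R -> C) (t : R) : cdiff f t -> cdiff g t -> cdiff (fun s => f s * g s)%C t.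
Proof. intros [a A] [b B]; eexists; apply cderiv_mult; eassumption. Qed.

Lemma cdiff_div (f g : R -> C) (t : R) : cdiff f t -> cdiff g t -> g t <> RtoC 0 ->
  cdiff (fun s => f s / g s)%C t.
Proof. intros [a A] [b B] N; eexists; apply cderiv_div; eassumption. Qed.

Lemma cdiff_pow (f : R -> C) (n : nat) (t : R) : cdiff f t -> cdiff (fun s => f s ^ n)%C t.
Proof. intros [a A]; eexists; apply cderiv_pow; eassumption. Qed.

Lemma cdiff_Cexp (f : R -> C) (t : R) : cdiff f t -> cdiff (fun s => Cexp (f s)) t.
Proof. intros [a A]; eexists; apply cderiv_Cexp; eassumption. Qed.

Lemma cdiff_continuous (f : R -> C) (t : R) : cdiff f t ->
  continuous (U := C_R_CompleteNormedModule) f t.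
Proof.
  intros [l [A B]].
  assert (A' : continuous (fun s => Re (f s)) t) by (apply (ex_derive_continuous (V := R_NormedModule)); now exists (Re l)).
  assert (B' : continuous (fun s => Im (f s)) t) by (apply (ex_derive_continuous (V := R_NormedModule)); now exists (Im l)).
  intros P [e He].
  destruct (A' (fun y => ball (Re (f t)) e y)) as [d1 H1]; [now exists e|].
  destruct (B' (fun y => ball (Im (f t)) e y)) as [d2 H2]; [now exists e|].
  assert (Hd : 0 < Rmin d1 d2) by (apply Rmin_glb_lt; apply cond_pos).
  exists (mkposreal _ Hd). intros y Hy. apply He. split.
  - apply H1. eapply Rlt_le_trans; [exact Hy|apply Rmin_l].
  - apply H2. eapply Rlt_le_trans; [exact Hy|apply Rmin_r].
Qed.

Lemma norm_C_R (x : C) : norm (V := C_R_NormedModule) x = Cmod x.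
Proof.
  unfold norm; simpl. unfold prod_norm, norm; simpl. unfold abs; simpl.
  rewrite Cmod_sqr, !Rmult_1_r, <- !Rabs_mult, !Rabs_pos_eq by apply Rle_0_sqr. reflexivity.
Qed.

Notation is_CI := (is_RInt (V := C_R_NormedModule)).
Definition CI (f : R -> C) (a b : R) : C := RInt (V := C_R_CompleteNormedModule) f a b.

Lemma cdiff_ex_RInt (f : R -> C) (a b : R) : a <= b ->
  (forall t, a <= t <= b -> cdiff f t) -> ex_RInt (V := C_R_NormedModule) f a b.
Proof.
  intros ab H. apply (ex_RInt_continuous (V := C_R_CompleteNormedModule)).
  rewrite Rmin_left, Rmax_right by easy. intros z Hz. now apply cdiff_continuous, H.
Qed.

Lemma is_CI_CI (f : R -> C) (a b : R) : a <= b ->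
  (forall t, a <= t <= b -> cdiff f t) -> is_CI f a b (CI f a b).
Proof. intros ab H. apply (RInt_correct (V := C_R_CompleteNormedModule)). now apply cdiff_ex_RInt. Qed.

Lemma CI_unique (f : R -> C) (a b : R) (l : C) : is_CI f a b l -> CI f a b = l.
Proof. apply (is_RInt_unique (V := C_R_CompleteNormedModule)). Qed.

Lemma is_CI_scal (c : C) (f : R -> C) (a b : R) (l : C) :
  is_CI f a b l -> is_CI (fun t => c * f t)%C a b (c * l)%C.
Proof.
  intros H.
  pose proof (is_RInt_fct_extend_fst (U := R_NormedModule) (V := R_NormedModule) f a b l H) as H1.
  pose proof (is_RInt_fct_extend_snd (U := R_NormedModule) (V := R_NormedModule) f a b l H) as H2.
  apply (is_RInt_fct_extend_pair (U := R_NormedModule) (V := R_NormedModule)); simpl.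
  - apply (is_RInt_minus (V := R_NormedModule)); apply (is_RInt_scal (V := R_NormedModule)); assumption.
  - apply (is_RInt_plus (V := R_NormedModule)); apply (is_RInt_scal (V := R_NormedModule)); assumption.
Qed.

Lemma CI_scal (c : C) (f : R -> C) (a b : R) : a <= b ->
  (forall t, a <= t <= b -> cdiff f t) -> CI (fun t => c * f t)%C a b = (c * CI f a b)%C.
Proof. intros ab H. apply CI_unique, is_CI_scal. now apply is_CI_CI. Qed.

Lemma CI_plus (f g : R -> C) (a b : R) : a <= b ->
  (forall t, a <= t <= b -> cdiff f t) -> (forall t, a <= t <= b -> cdiff g t) ->
  CI (fun t => f t + g t)%C a b = (CI f a b + CI g a b)%C.
Proof.
  intros ab Hf Hg. apply CI_unique. apply (is_RInt_plus (V := C_R_NormedModule)); now apply is_CI_CI.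
Qed.

Lemma CI_minus (f g : R -> C) (a b : R) : a <= b ->
  (forall t, a <= t <= b -> cdiff f t) -> (forall t, a <= t <= b -> cdiff g t) ->
  CI (fun t => f t - g t)%C a b = (CI f a b - CI g a b)%C.
Proof.
  intros ab Hf Hg. apply CI_unique. apply (is_RInt_minus (V := C_R_NormedModule)); now apply is_CI_CI.
Qed.

Lemma CI_ext (f g : R -> C) (a b : R) : a <= b ->
  (forall t, a <= t <= b -> f t = g t) -> CI f a b = CI g a b.
Proof.
  intros ab H. apply (RInt_ext (V := C_R_CompleteNormedModule)).
  rewrite Rmin_left, Rmax_right by easy. intros t Ht. apply H; lra.
Qed.

Lemma CI_Chasles (f : R -> C) (a b c : R) : a <= b -> b <= c ->
  (forall t, a <= t <= c -> cdiff f t) -> CI f a c = (CI f a b + CI f b c)%C.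
Proof.
  intros ab bc H. symmetry. apply (RInt_Chasles (V := C_R_CompleteNormedModule));
    apply cdiff_ex_RInt; try easy; intros t Ht; apply H; lra.
Qed.

Lemma CI_bound (f : R -> C) (g : R -> R) (a b l : R) : a <= b ->
  (forall t, a <= t <= b -> cdiff f t) -> is_RInt g a b l ->
  (forall t, a <= t <= b -> Cmod (f t) <= g t) -> Cmod (CI f a b) <= l.
Proof.
  intros ab Hf Hg H. rewrite <- norm_C_R.
  apply (norm_RInt_le (V := C_R_NormedModule) f g a b); [easy| |now apply is_CI_CI|easy].
  intros t Ht. rewrite norm_C_R. now apply H.
Qed.

Lemma CI_bound_const (f : R -> C) (a b K : R) : a <= b ->
  (forall t, a <= t <= b -> cdiff f t) ->
  (forall t, a <= t <= b -> Cmod (f t) <= K) -> Cmod (CI f a b) <= K * (b - a).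
Proof.
  intros ab Hf H. apply (CI_bound f (fun _ => K) a b); auto.
  replace (K * (b - a)) with (scal (b - a) K) by (unfold scal; simpl; unfold mult; simpl; ring).
  apply (is_RInt_const (V := R_NormedModule)).
Qed.

Lemma is_RInt_exp_decay (K q a b : R) : 0 < q ->
  is_RInt (fun t => K * exp (- (q * t))) a b (K / q * (exp (- (q * a)) - exp (- (q * b)))).
Proof.
  intros Hq.
  evar_last.
  { apply (is_RInt_derive (V := R_CompleteNormedModule) (fun t => - (K / q) * exp (- (q * t)))).
  - intros x _. auto_derive; [easy|]. field; lra.
  - intros x _. apply (ex_derive_continuous (V := R_NormedModule)). auto_derive. easy. }
  unfold minus, plus, opp; simpl; ring.
Qed.

Lemma CI_bound_exp (f : R -> C) (K q a b : R) : a <= b -> 0 < q ->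
  (forall t, a <= t <= b -> cdiff f t) ->
  (forall t, a <= t <= b -> Cmod (f t) <= K * exp (- (q * t))) ->
  Cmod (CI f a b) <= K / q * (exp (- (q * a)) - exp (- (q * b))).
Proof.
  intros ab Hq Hf H. apply (CI_bound f (fun t => K * exp (- (q * t))) a b); auto. now apply is_RInt_exp_decay.
Qed.

Lemma CI_FTC (F f : R -> C) (a b : R) : a <= b ->
  (forall t, a <= t <= b -> cderiv F t (f t)) -> (forall t, a <= t <= b -> cdiff f t) ->
  CI f a b = (F b - F a)%C.
Proof.
  intros ab HF Hf. apply CI_unique.
  assert (D : forall t, a <= t <= b -> ex_derive (fun s => Re (f s)) t /\ ex_derive (fun s => Im (f s)) t).
  { intros t Ht. destruct (Hf t Ht) as [l [A B]]. split; eexists; eassumption. }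
  replace (F b - F a)%C with (minus (Re (F b)) (Re (F a)), minus (Im (F b)) (Im (F a)))
    by (apply C_eq; unfold minus, plus, opp; simpl; unfold Re, Im; ring).
  apply (is_RInt_fct_extend_pair (U := R_NormedModule) (V := R_NormedModule)).
  - apply (is_RInt_derive (V := R_CompleteNormedModule) (fun s => Re (F s)));
      rewrite Rmin_left, Rmax_right by easy; intros t Ht.
    + apply HF, Ht.
    + apply (ex_derive_continuous (V := R_NormedModule)), D, Ht.
  - apply (is_RInt_derive (V := R_CompleteNormedModule) (fun s => Im (F s)));
      rewrite Rmin_left, Rmax_right by easy; intros t Ht.
    + apply HF, Ht.
    + apply (ex_derive_continuous (V := R_NormedModule)), D, Ht.
Qed.

Lemma INR_S_ge_1 (n : nat) : 1 <= INR (S n).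
Proof. apply (le_INR 1); lia. Qed.

Lemma inv_INR_S (n : nat) : 0 < / INR (S n) <= 1.
Proof.
  pose proof (INR_S_ge_1 n). split; [apply Rinv_0_lt_compat; lra|].
  rewrite <- Rinv_1. apply Rinv_le_contravar; lra.
Qed.

Lemma inv_INR_S_small (eps : R) : 0 < eps -> exists N, forall n, (N <= n)%nat -> / INR (S n) < eps.
Proof.
  intros He. destruct (archimed_cor1 eps He) as [N [HN HN0]]. exists N. intros n Hn.
  eapply Rle_lt_trans; [|exact HN]. apply Rinv_le_contravar; [apply lt_0_INR; easy|apply le_INR; lia].
Qed.

Lemma exp_neg_le_inv (x : R) : 0 < x -> exp (- x) <= / x.
Proof.
  intros Hx. rewrite exp_Ropp. apply Rinv_le_contravar; [easy|].
  pose proof (exp_ineq1 x ltac:(lra)). lra.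
Qed.

Lemma clim_inv_bound (u : nat -> C) (l : C) (K : R) :
  (forall n, Cmod (u n - l)%C <= K * / INR (S n)) -> clim u l.
Proof.
  intros H eps He. pose proof (Rabs_pos K). pose proof (Rle_abs K).
  destruct (inv_INR_S_small (eps / (Rabs K + 1))) as [N HN]; [apply Rdiv_lt_0_compat; lra|].
  exists N. intros n Hn. specialize (HN n Hn). specialize (H n).
  pose proof (inv_INR_S n) as [P _].
  apply Rle_lt_trans with ((Rabs K + 1) * / INR (S n)); [nra|].
  apply Rmult_lt_compat_l with (r := Rabs K + 1) in HN; [|lra].
  replace ((Rabs K + 1) * (eps / (Rabs K + 1))) with eps in HN by (field; lra). lra.
Qed.

(** One index controls both ends of the half-line. *)
Definition int_seq (f : R -> C) (n : nat) : C := CI f (/ INR (S n)) (INR (S n)).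

Lemma int_seq_bound (f : R -> C) (K q : R) (n : nat) : 0 < q -> 0 <= K ->
  (forall t, 0 < t -> cdiff f t) -> (forall t, 0 < t -> Cmod (f t) <= K * exp (- (q * t))) ->
  Cmod (int_seq f n) <= K / q.
Proof.
  intros Hq HK Hf HB. pose proof (inv_INR_S n) as [P1 P2]. pose proof (INR_S_ge_1 n).
  eapply Rle_trans; [apply (CI_bound_exp f K q); auto; try lra|].
  - intros; apply Hf; lra.
  - intros; apply HB; lra.
  - assert (0 <= K / q) by (apply Rmult_le_pos; [easy|left; now apply Rinv_0_lt_compat]).
    assert (exp (- (q * / INR (S n))) <= 1).
    { rewrite <- exp_0. left. apply exp_increasing. nra. }
    pose proof (exp_pos (- (q * INR (S n)))). nra.
Qed.

(** Each end costs a multiple of [1 / n]: near 0 the integrand is bounded, at infinity it is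
    exponentially small. *)
Lemma int_seq_cauchy (f : R -> C) (K q : R) (n m : nat) : 0 < q -> 0 <= K -> (n <= m)%nat ->
  (forall t, 0 < t -> cdiff f t) -> (forall t, 0 < t -> Cmod (f t) <= K * exp (- (q * t))) ->
  Cmod (int_seq f m - int_seq f n)%C <= (K + K / q * / q) * / INR (S n).
Proof.
  intros Hq HK Hnm Hf HB. unfold int_seq.
  pose proof (inv_INR_S n) as [P1 P2]. pose proof (INR_S_ge_1 n) as P3.
  pose proof (inv_INR_S m) as [Q1 Q2]. pose proof (INR_S_ge_1 m).
  assert (L : INR (S n) <= INR (S m)) by (apply le_INR; lia).
  assert (L' : / INR (S m) <= / INR (S n)) by (apply Rinv_le_contravar; lra).
  rewrite (CI_Chasles f (/ INR (S m)) (/ INR (S n)) (INR (S m))) by (try lra; intros; apply Hf; lra).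
  rewrite (CI_Chasles f (/ INR (S n)) (INR (S n)) (INR (S m))) by (try lra; intros; apply Hf; lra).
  match goal with |- Cmod (?a + (?b + ?c) - ?b)%C <= _ => replace (a + (b + c) - b)%C with (a + c)%C by ring end.
  assert (HKq : 0 <= K / q) by (apply Rmult_le_pos; [easy|left; now apply Rinv_0_lt_compat]).
  eapply Rle_trans; [apply Cmod_triangle|]. rewrite Rmult_plus_distr_r. apply Rplus_le_compat.
  - eapply Rle_trans; [apply (CI_bound_const f _ _ K)|].
    + easy.
    + intros; apply Hf; lra.
    + intros t Ht. eapply Rle_trans; [apply HB; lra|].
      rewrite <- (Rmult_1_r K) at 2. apply Rmult_le_compat_l; [easy|].
      rewrite <- exp_0. left. apply exp_increasing. nra.
    + apply Rmult_le_compat_l; [easy|]. lra.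
  - eapply Rle_trans; [apply (CI_bound_exp f K q)|].
    + easy.
    + easy.
    + intros; apply Hf; lra.
    + intros; apply HB; lra.
    + rewrite Rmult_assoc. apply Rmult_le_compat_l; [easy|].
      pose proof (exp_pos (- (q * INR (S m)))).
      rewrite <- Rinv_mult. pose proof (exp_neg_le_inv (q * INR (S n)) ltac:(nra)). lra.
Qed.

Lemma int_seq_limit (f : R -> C) (K q : R) : 0 < q -> 0 <= K ->
  (forall t, 0 < t -> cdiff f t) -> (forall t, 0 < t -> Cmod (f t) <= K * exp (- (q * t))) ->
  exists v, clim (int_seq f) v.
Proof.
  intros Hq HK Hf HB. apply clim_cauchy. intros eps He.
  set (A := K + K / q * / q).
  assert (HA : 0 <= A).
  { unfold A. assert (0 < / q) by now apply Rinv_0_lt_compat. unfold Rdiv. nra. }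
  destruct (inv_INR_S_small (eps / (A + 1))) as [N HN]; [apply Rdiv_lt_0_compat; lra|].
  assert (Key : forall n m, (N <= n)%nat -> (n <= m)%nat -> Cmod (int_seq f m - int_seq f n)%C < eps).
  { intros n m Hn Hm. eapply Rle_lt_trans; [apply (int_seq_cauchy f K q n m); auto|]. fold A.
    specialize (HN n Hn). pose proof (inv_INR_S n) as [P _].
    apply Rle_lt_trans with ((A + 1) * / INR (S n)); [nra|].
    apply Rmult_lt_compat_l with (r := A + 1) in HN; [|lra].
    replace ((A + 1) * (eps / (A + 1))) with eps in HN by (field; lra). lra. }
  exists N. intros n m Hn Hm. destruct (Nat.le_ge_cases n m); [rewrite Cmod_minus_sym|]; now apply Key.
Qed.

Lemma int_seq_plus (f g : R -> C) (n : nat) :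
  (forall t, 0 < t -> cdiff f t) -> (forall t, 0 < t -> cdiff g t) ->
  int_seq (fun t => f t + g t)%C n = (int_seq f n + int_seq g n)%C.
Proof.
  intros Hf Hg. pose proof (inv_INR_S n). pose proof (INR_S_ge_1 n).
  apply CI_plus; [lra|intros; apply Hf; lra|intros; apply Hg; lra].
Qed.

Lemma int_seq_minus (f g : R -> C) (n : nat) :
  (forall t, 0 < t -> cdiff f t) -> (forall t, 0 < t -> cdiff g t) ->
  int_seq (fun t => f t - g t)%C n = (int_seq f n - int_seq g n)%C.
Proof.
  intros Hf Hg. pose proof (inv_INR_S n). pose proof (INR_S_ge_1 n).
  apply CI_minus; [lra|intros; apply Hf; lra|intros; apply Hg; lra].
Qed.

Lemma int_seq_scal (c : C) (f : R -> C) (n : nat) :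
  (forall t, 0 < t -> cdiff f t) -> int_seq (fun t => c * f t)%C n = (c * int_seq f n)%C.
Proof.
  intros Hf. pose proof (inv_INR_S n). pose proof (INR_S_ge_1 n).
  apply CI_scal; [lra|intros; apply Hf; lra].
Qed.

Lemma int_seq_ext (f g : R -> C) (n : nat) : (forall t, 0 < t -> f t = g t) -> int_seq f n = int_seq g n.
Proof.
  intros E. pose proof (inv_INR_S n). pose proof (INR_S_ge_1 n).
  apply CI_ext; [lra|intros; apply E; lra].
Qed.

Lemma cdiff_Csum (f : nat -> R -> C) (N : nat) (t : R) :
  (forall k, cdiff (f k) t) -> cdiff (fun s => Csum (fun k => f k s) N) t.
Proof.
  intros H. induction N as [|N IH]; simpl; [apply cdiff_const|]. now apply cdiff_plus.
Qed.

Lemma int_seq_Csum (f : nat -> R -> C) (N n : nat) :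
  (forall k t, 0 < t -> cdiff (f k) t) ->
  int_seq (fun t => Csum (fun k => f k t) N) n = Csum (fun k => int_seq (f k) n) N.
Proof.
  intros H. induction N as [|N IH]; simpl.
  - rewrite (int_seq_ext _ (fun t => RtoC 0 * RtoC 0)%C) by (intros; ring).
    rewrite (int_seq_scal (RtoC 0) (fun _ => RtoC 0)); [ring|]. intros; apply cdiff_const.
  - rewrite (int_seq_plus (fun t => Csum (fun k => f k t) N) (f N)), IH; [easy| |].
    + intros t Ht. apply cdiff_Csum. intros; now apply H.
    + intros; now apply H.
Qed.

(** Differentiation under the integral sign, from an error quadratic in [h] and uniform in [t]. *)
Lemma cderiv_CI (f : R -> R -> C) (g : R -> C) (s a b K : R) : a <= b -> 0 <= K ->
  (forall u t, a <= t <= b -> cdiff (f u) t) -> (forall t, a <= t <= b -> cdiff g t) ->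
  (forall h t, Rabs h < 1 -> a <= t <= b ->
     Cmod (f (s + h)%R t - f s t - h * g t)%C <= K * Rabs h ^ 2) ->
  cderiv (fun s => CI (f s) a b) s (CI g a b).
Proof.
  intros ab HK Hf Hg HB.
  apply (cderiv_quadratic _ _ _ (K * (b - a)) 1); [lra|]. intros h Hh.
  rewrite (Cmult_comm (CI g a b)), <- (CI_scal h g a b ab Hg).
  rewrite <- (CI_minus (f (s + h)) (f s) a b ab) by auto.
  rewrite <- (CI_minus (fun t => f (s + h)%R t - f s t)%C (fun t => h * g t)%C a b ab).
  - eapply Rle_trans; [apply (CI_bound_const _ a b (K * Rabs h ^ 2) ab)|].
    + intros t Ht. apply cdiff_minus; [apply cdiff_minus; auto|apply cdiff_mult; [apply cdiff_const|auto]].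
    + intros t Ht. now apply HB.
    + right; ring.
  - intros t Ht. apply cdiff_minus; auto.
  - intros t Ht. apply cdiff_mult; [apply cdiff_const|auto].
Qed.

(** * A calculus of bounded functions *)

(** Order estimates become polynomial identities: a quantity is rewritten as a polynomial in pieces
    known to be bounded. The index type is left open, as it ranges over integers, real [t] and
    complex [u]. *)
Definition bounded_on {T : Type} (P : T -> Prop) (f : T -> C) : Prop :=
  exists K, forall x, P x -> Cmod (f x) <= K.

Lemma bounded_on_const {T : Type} (P : T -> Prop) (a : C) : bounded_on P (fun _ => a).
Proof. exists (Cmod a). intros; lra. Qed.

Lemma bounded_on_plus {T : Type} (P : T -> Prop) (f g : T -> C) :
  bounded_on P f -> bounded_on P g -> bounded_on P (fun x => f x + g x)%C.
Proof.
  intros [A HA] [B HB]. exists (A + B). intros x Hx.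
  eapply Rle_trans; [apply Cmod_triangle|]. apply Rplus_le_compat; auto.
Qed.

Lemma bounded_on_minus {T : Type} (P : T -> Prop) (f g : T -> C) :
  bounded_on P f -> bounded_on P g -> bounded_on P (fun x => f x - g x)%C.
Proof.
  intros [A HA] [B HB]. exists (A + B). intros x Hx.
  eapply Rle_trans; [apply Cmod_minus_le|]. apply Rplus_le_compat; auto.
Qed.

Lemma bounded_on_opp {T : Type} (P : T -> Prop) (f : T -> C) :
  bounded_on P f -> bounded_on P (fun x => - f x)%C.
Proof. intros [A HA]. exists A. intros x Hx. rewrite Cmod_opp. auto. Qed.

Lemma bounded_on_mult {T : Type} (P : T -> Prop) (f g : T -> C) :
  bounded_on P f -> bounded_on P g -> bounded_on P (fun x => f x * g x)%C.
Proof.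
  intros [A HA] [B HB]. exists (A * B). intros x Hx. rewrite Cmod_mult.
  apply Rmult_le_compat; auto using Cmod_ge_0.
Qed.

Lemma bounded_on_pow {T : Type} (P : T -> Prop) (f : T -> C) (n : nat) :
  bounded_on P f -> bounded_on P (fun x => f x ^ n)%C.
Proof.
  intros H. induction n as [|n IH]; simpl; [apply bounded_on_const|]. now apply bounded_on_mult.
Qed.

Lemma bounded_on_ext {T : Type} (P : T -> Prop) (f g : T -> C) :
  (forall x, P x -> f x = g x) -> bounded_on P f -> bounded_on P g.
Proof. intros E [K H]. exists K. intros x Hx. rewrite <- E; auto. Qed.

Lemma bounded_on_pos {T : Type} (P : T -> Prop) (f : T -> C) : bounded_on P f ->
  exists K, 0 <= K /\ forall x, P x -> Cmod (f x) <= K.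
Proof.
  intros [K H]. exists (Rabs K). split; [apply Rabs_pos|]. intros x Hx.
  eapply Rle_trans; [now apply H|apply Rle_abs].
Qed.

Ltac bounded_tac :=
  lazymatch goal with
  | |- bounded_on ?P (fun _ => ?a) => apply (bounded_on_const P a)
  | |- bounded_on ?P (fun x => Cplus (@?f x) (@?g x)) => apply (bounded_on_plus P f g); bounded_tac
  | |- bounded_on ?P (fun x => Cminus (@?f x) (@?g x)) => apply (bounded_on_minus P f g); bounded_tac
  | |- bounded_on ?P (fun x => Cmult (@?f x) (@?g x)) => apply (bounded_on_mult P f g); bounded_tac
  | |- bounded_on ?P (fun x => Copp (@?f x)) => apply (bounded_on_opp P f); bounded_tac
  | |- bounded_on ?P (fun x => Cpow (@?f x) ?n) => apply (bounded_on_pow P f n); bounded_tac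
  | |- _ => try assumption
  end.

Ltac cdiff_tac :=
  lazymatch goal with
  | |- cdiff (fun _ => ?a) ?t => apply (cdiff_const a t)
  | |- cdiff (fun s => RtoC s) ?t => apply (cdiff_id t)
  | |- cdiff RtoC ?t => apply (cdiff_id t)
  | |- cdiff (fun s => Cplus (@?f s) (@?g s)) ?t => apply (cdiff_plus f g t); cdiff_tac
  | |- cdiff (fun s => Cminus (@?f s) (@?g s)) ?t => apply (cdiff_minus f g t); cdiff_tac
  | |- cdiff (fun s => Cmult (@?f s) (@?g s)) ?t => apply (cdiff_mult f g t); cdiff_tac
  | |- cdiff (fun s => Cdiv (@?f s) (@?g s)) ?t => apply (cdiff_div f g t); [cdiff_tac|cdiff_tac|try assumption]
  | |- cdiff (fun s => Copp (@?f s)) ?t => apply (cdiff_opp f t); cdiff_tac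
  | |- cdiff (fun s => Cexp (@?f s)) ?t => apply (cdiff_Cexp f t); cdiff_tac
  | |- cdiff (fun s => Cpow (@?f s) ?n) ?t => apply (cdiff_pow f n t); cdiff_tac
  | |- _ => try assumption
  end.

Lemma clim_0_of_bounded (u x : nat -> C) : bounded_on (fun _ => True) x ->
  (forall n, u n = (/ INR (S n) * x n)%C) -> clim u 0.
Proof.
  intros Hx E. destruct (bounded_on_pos _ _ Hx) as (K & HK & H).
  apply (clim_inv_bound _ _ K). intros n. pose proof (inv_INR_S n) as [P1 P2]. pose proof (INR_S_ge_1 n).
  replace (u n - 0)%C with (u n) by ring. rewrite E, <- RtoC_inv, Cmod_mult, Cmod_RtoC_pos by lra.
  specialize (H n I). nra.
Qed.

(** * Truncated exponential integrals *)

Definition exp_kernel (w : C) (t : R) : C := Cexp (- (w * t)).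

Lemma cdiff_exp_kernel (w : C) (t : R) : cdiff (exp_kernel w) t.
Proof. unfold exp_kernel. cdiff_tac. Qed.

Lemma cderiv_exp_kernel (w : C) (t : R) : cderiv (exp_kernel w) t (- w * exp_kernel w t)%C.
Proof.
  unfold exp_kernel. eapply cderiv_eq.
  - apply cderiv_Cexp, cderiv_opp, cderiv_scal, cderiv_RtoC, (is_derive_id (K := R_AbsRing)).
  - unfold one; simpl. ring.
Qed.

Lemma exp_kernel_plus (w v : C) (t : R) : exp_kernel (w + v) t = (exp_kernel w t * exp_kernel v t)%C.
Proof. unfold exp_kernel. rewrite <- Cexp_plus. f_equal. ring. Qed.

Lemma Cmod_exp_kernel (w : C) (t : R) : Cmod (exp_kernel w t) = exp (- (Re w * t)).
Proof. unfold exp_kernel. rewrite Cmod_Cexp, Re_opp, Re_scal. reflexivity. Qed.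

Lemma exp_le (x y : R) : x <= y -> exp x <= exp y.
Proof. intros [H|H]; [left; now apply exp_increasing|right; now rewrite H]. Qed.

Lemma exp_le_1 (x : R) : x <= 0 -> exp x <= 1.
Proof. intros H. rewrite <- exp_0. now apply exp_le. Qed.

Lemma Cexp_minus_1_bound (u : C) : Cmod (Cexp u - 1)%C <= Cmod u * exp (Cmod u).
Proof.
  pose proof (Cexp_taylor 1 u) as T. simpl in T. rewrite Rmult_1_r in T.
  replace (Cexp u - 1)%C with (Cexp u - (0 + (/ 1)%R * 1))%C by (rewrite Rinv_1; ring). exact T.
Qed.

Lemma Cexp_second_order (u : C) : Cmod (Cexp u - 1 - u)%C <= Cmod u ^ 2 * exp (Cmod u).
Proof.
  pose proof (Cexp_taylor 2 u) as T. simpl Csum in T. simpl fact in T. simpl INR in T.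
  replace (Cexp u - 1 - u)%C with (Cexp u - (0 + (/ 1)%R * 1 + (/ 1)%R * (u * 1)))%C by (rewrite Rinv_1; ring). exact T.
Qed.

Lemma RtoC_pos_neq_0 (t : R) : 0 < t -> RtoC t <> RtoC 0.
Proof. intros H. apply RtoC_neq_0. lra. Qed.

(** The truncated exponential integral. It diverges like [ln n]; only differences or compensated
    values converge. *)
Definition exp_integral (w : C) (n : nat) : C := int_seq (fun t => exp_kernel w t / t)%C n.

Lemma cdiff_exp_integrand (w : C) (t : R) : 0 < t -> cdiff (fun t => exp_kernel w t / t)%C t.
Proof. intros H. apply cdiff_div; [apply cdiff_exp_kernel|apply cdiff_id|now apply RtoC_pos_neq_0]. Qed.

Lemma CI_exp_kernel (w : C) (a b : R) : a <= b -> w <> RtoC 0 ->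
  CI (exp_kernel w) a b = ((exp_kernel w a - exp_kernel w b) / w)%C.
Proof.
  intros ab Hw. rewrite (CI_FTC (fun t => - / w * exp_kernel w t)%C _ a b ab).
  - field. easy.
  - intros t _. eapply cderiv_eq; [apply cderiv_scal, cderiv_exp_kernel|]. field. easy.
  - intros t _. apply cdiff_exp_kernel.
Qed.

(** Differentiation in the parameter removes the factor [1 / t], and the integral becomes
    elementary. *)
Lemma exp_integral_cderiv (w v : C) (s : R) (n : nat) : 0 < Re (w + s * v)%C ->
  cderiv (fun s => exp_integral (w + RtoC s * v) n) s
    (v / (w + s * v) * (exp_kernel (w + s * v) (INR (S n)) - exp_kernel (w + s * v) (/ INR (S n))))%C.
Proof.
  intros Hp. pose proof (inv_INR_S n) as [P1 P2]. pose proof (INR_S_ge_1 n) as P3.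
  set (a := / INR (S n)) in *. set (b := INR (S n)) in *.
  set (W := (w + s * v)%C) in *.
  eapply cderiv_eq.
  - unfold exp_integral, int_seq. fold a b.
    apply (cderiv_CI (fun s t => exp_kernel (w + RtoC s * v) t / t)%C (fun t => - v * exp_kernel W t)%C
       s a b (Cmod v ^ 2 * b * exp (Cmod v * b))).
    + lra.
    + apply Rmult_le_pos; [apply Rmult_le_pos; [apply pow_le, Cmod_ge_0|lra]|left; apply exp_pos].
    + intros u t Ht. apply cdiff_exp_integrand. lra.
    + intros t _. apply cdiff_mult; [apply cdiff_const|apply cdiff_exp_kernel].
    + intros h t Hh Ht. assert (T0 : RtoC t <> RtoC 0) by (apply RtoC_pos_neq_0; lra).
      replace (w + (s + h)%R * v)%C with (W + h * v)%C by (unfold W; rewrite RtoC_plus; ring).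
      fold W. rewrite exp_kernel_plus. unfold exp_kernel at 2. set (u := (- (h * v * t))%C).
      replace (exp_kernel W t * Cexp u / t - exp_kernel W t / t - h * (- v * exp_kernel W t))%C
        with (exp_kernel W t / t * (Cexp u - 1 - u))%C by (unfold u; field; easy).
      rewrite Cmod_mult, Cmod_div, Cmod_exp_kernel, (Cmod_RtoC_pos t) by (easy || lra).
      pose proof (Cexp_second_order u) as T.
      assert (Eu : Cmod u = Rabs h * Cmod v * t).
      { unfold u. rewrite Cmod_opp, !Cmod_mult, Cmod_R, (Cmod_RtoC_pos t) by lra. ring. }
      rewrite Eu in T. pose proof (Cmod_ge_0 v). pose proof (Rabs_pos h).
      apply Rle_trans with (1 / t * ((Rabs h * Cmod v * t) ^ 2 * exp (Cmod v * b))).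
      * apply Rmult_le_compat; [|apply Cmod_ge_0| |].
        -- apply Rmult_le_pos; [left; apply exp_pos|left; apply Rinv_0_lt_compat; lra].
        -- apply Rmult_le_compat_r; [left; apply Rinv_0_lt_compat; lra|]. apply exp_le_1. nra.
        -- eapply Rle_trans; [exact T|]. apply Rmult_le_compat_l; [apply pow2_ge_0|]. apply exp_le.
           apply Rle_trans with (1 * Cmod v * b); [|lra].
           apply Rmult_le_compat; try nra.
      * replace (1 / t * ((Rabs h * Cmod v * t) ^ 2 * exp (Cmod v * b)))
          with (Cmod v ^ 2 * exp (Cmod v * b) * Rabs h ^ 2 * t) by (field; lra).
        replace (Cmod v ^ 2 * b * exp (Cmod v * b) * Rabs h ^ 2)
          with (Cmod v ^ 2 * exp (Cmod v * b) * Rabs h ^ 2 * b) by ring.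
        apply Rmult_le_compat_l; [|lra].
        apply Rmult_le_pos; [apply Rmult_le_pos; [apply pow2_ge_0|left; apply exp_pos]|apply pow2_ge_0].
  - rewrite CI_scal by (try lra; intros; apply cdiff_exp_kernel).
    rewrite CI_exp_kernel by (try lra; now apply Re_neq_0). field. now apply Re_neq_0.
Qed.

(** Frullani's integral for complex [w], along the segment from 1 to [w]. In the derivative of
    [exp_integral] plus the logarithm, the lower end contributes [exp_kernel] close to 1 and cancels
    the derivative of the logarithm up to [O(1 / n)]. *)
Lemma exp_integral_limit (w : C) : 0 < Re w ->
  clim (fun n => exp_integral w n - exp_integral 1 n)%C (- Clog w)%C.
Proof.
  (* Along the segment [m] bounds the real part from below and [W] the modulus from above. *)
  intros Hw. set (v := (w - 1)%C). set (m := Rmin 1 (Re w)).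
  assert (Hm : 0 < m) by (apply Rmin_glb_lt; lra).
  assert (Hm1 : m <= 1) by apply Rmin_l. assert (Hm2 : m <= Re w) by apply Rmin_r.
  set (W := 1 + Cmod v). assert (HW : 0 <= W) by (unfold W; pose proof (Cmod_ge_0 v); lra).
  assert (Rw : forall s, 0 <= s <= 1 -> m <= Re (1 + RtoC s * v)%C).
  { intros s Hs. unfold v. rewrite Re_plus, (Cmult_comm s), Re_scal. unfold Cminus. rewrite Re_plus, Re_opp.
    simpl. nra. }
  apply (clim_inv_bound _ _ (Cmod v / m * (/ m + W * exp W))). intros n.
  pose proof (inv_INR_S n) as [P1 P2]. pose proof (INR_S_ge_1 n) as P3.
  set (a := / INR (S n)) in *.
  pose proof (cderiv_lipschitz (fun s => exp_integral (1 + RtoC s * v) n + Clog (1 + RtoC s * v))%C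
    (fun s => v / (1 + RtoC s * v) * (exp_kernel (1 + RtoC s * v) (INR (S n)) - exp_kernel (1 + RtoC s * v) a)
       + v / (1 + RtoC s * v))%C (Cmod v / m * (/ m + W * exp W) * a)) as L.
  cbv beta in L.
  replace (1 + RtoC 1 * v)%C with w in L by (unfold v; ring).
  replace (1 + RtoC 0 * v)%C with (RtoC 1) in L by ring.
  rewrite (Clog_pos 1), ln_1 in L by lra.
  replace (exp_integral w n - exp_integral 1 n - - Clog w)%C
    with (exp_integral w n + Clog w - (exp_integral 1 n + 0))%C by ring.
  apply L.
  - intros s Hs. specialize (Rw s Hs). apply cderiv_plus.
    + apply exp_integral_cderiv. lra.
    + apply (cderiv_Clog (fun s => 1 + RtoC s * v)%C); [|lra]. eapply cderiv_eq.
      * apply cderiv_plus; [apply cderiv_const|].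
        apply cderiv_mult; [apply cderiv_RtoC, (is_derive_id (K := R_AbsRing))|apply cderiv_const].
      * unfold one; simpl. cbv beta. ring.
  - intros s Hs. specialize (Rw s Hs). set (u := (1 + RtoC s * v)%C) in *.
    assert (U0 : u <> RtoC 0) by (apply Re_neq_0; lra).
    assert (Um : m <= Cmod u) by (pose proof (Re_le_Cmod_pos u); lra).
    assert (UW : Cmod u <= W).
    { unfold u, W. eapply Rle_trans; [apply Cmod_triangle|]. rewrite Cmod_1, Cmod_mult, Cmod_RtoC_pos by lra.
      pose proof (Cmod_ge_0 v). nra. }
    replace (v / u * (exp_kernel u (INR (S n)) - exp_kernel u a) + v / u)%C
      with (v / u * (exp_kernel u (INR (S n)) - (exp_kernel u a - 1)))%C by ring.
    rewrite Cmod_mult, Cmod_div, Rmult_assoc by easy.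
    pose proof (Cmod_ge_0 v) as Pv.
    apply Rmult_le_compat; [|apply Cmod_ge_0| |].
    + apply Rmult_le_pos; [easy|left; apply Rinv_0_lt_compat; lra].
    + apply Rmult_le_compat_l; [easy|]. apply Rinv_le_contravar; lra.
    + eapply Rle_trans; [apply Cmod_minus_le|]. rewrite Rmult_plus_distr_r. apply Rplus_le_compat.
      * rewrite Cmod_exp_kernel.
        apply Rle_trans with (exp (- (m * INR (S n)))); [apply exp_le; nra|].
        eapply Rle_trans; [apply exp_neg_le_inv; nra|]. rewrite Rinv_mult. fold a. lra.
      * unfold exp_kernel. eapply Rle_trans; [apply Cexp_minus_1_bound|].
        rewrite Cmod_opp, Cmod_mult, (Cmod_RtoC_pos a) by lra.
        assert (X : Cmod u * a <= W) by (pose proof (Cmod_ge_0 u); nra).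
        apply Rle_trans with (W * a * exp W); [|right; ring].
        pose proof (Cmod_ge_0 u). apply Rmult_le_compat; [nra|left; apply exp_pos|nra|now apply exp_le].
Qed.

(** * Regularised integrals against the Laurent part *)

(** The truncated Laurent expansion of [1 / ((1 - exp (- t)) (1 - exp (- c t)))] times
    [exp (- w t) / t]. *)
Definition laurent_integrand (c w : C) (t : R) : C :=
  (exp_kernel w t * (coef2 c / t ^ 2 + coef1 c / t + coef0 c) / t)%C.

Lemma cdiff_laurent_integrand (c w : C) (t : R) : 0 < t -> cdiff (laurent_integrand c w) t.
Proof.
  intros H. pose proof (RtoC_pos_neq_0 t H). unfold laurent_integrand, exp_kernel.
  cdiff_tac; try easy. now apply Cpow_neq_0.
Qed.

(** [E] stands for the truncated exponential integral and [N] for the truncation; this is the part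
    of the integral without a limit. *)
Definition divergent_part (c w E : C) (N : R) : C :=
  (coef2 c * (N ^ 2 / 2 - w * N + w * w / 2 * E) + coef1 c * (N - w * E) + coef0 c * E)%C.

(** Integration by parts reduces [1 / t ^ 3] and [1 / t ^ 2] to [1 / t]; [A] is the resulting
    coefficient of the exponential integral, [G] the boundary term. Expanding [G] at [1 / N] yields
    the powers of [N] and the terms of [log_main] free of logarithms. *)
Lemma laurent_integral_limit (c w : C) : 0 < Re w ->
  clim (fun n => int_seq (laurent_integrand c w) n
     - divergent_part c w (exp_integral 1 n) (INR (S n)))%C (log_main c w).
Proof.
  intros Hw.
  set (G := fun t : R => (coef2 c * (w * exp_kernel w t / (2 * t) - exp_kernel w t / (2 * t ^ 2))
     - coef1 c * (exp_kernel w t / t))%C).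
  set (A := (coef2 c * (w * w) / 2 - coef1 c * w + coef0 c)%C).
  assert (E : forall n, int_seq (laurent_integrand c w) n
     = (A * exp_integral w n + G (INR (S n)) - G (/ INR (S n))%R)%C).
  { intros n. pose proof (inv_INR_S n) as [P1 P2]. pose proof (INR_S_ge_1 n) as P3.
    set (f := fun t : R => (laurent_integrand c w t - A * (exp_kernel w t / t))%C).
    assert (Hf : forall t, 0 < t -> cdiff f t).
    { intros t Ht. apply cdiff_minus; [now apply cdiff_laurent_integrand|].
      apply cdiff_mult; [apply cdiff_const|now apply cdiff_exp_integrand]. }
    assert (FTC : int_seq f n = (G (INR (S n)) - G (/ INR (S n))%R)%C).
    { apply CI_FTC; [lra| |intros; apply Hf; lra].
      intros t Ht. assert (T0 : RtoC t <> RtoC 0) by (apply RtoC_pos_neq_0; lra).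
      assert (T2 : (2 * RtoC t)%C <> RtoC 0) by (apply Cmult_neq_0; [apply RtoC_neq; lra|easy]).
      assert (T3 : (2 * RtoC t ^ 2)%C <> RtoC 0).
      { simpl. rewrite Cmult_1_r. apply Cmult_neq_0; [apply RtoC_neq; lra|]. now apply Cmult_neq_0. }
      pose proof (cderiv_RtoC (fun t => t) t 1 (is_derive_id (K := R_AbsRing) t)) as DI.
      pose proof (cderiv_exp_kernel w t) as DE.
      pose proof (cderiv_pow _ _ _ 2 DI) as DP.
      eapply cderiv_eq.
      - exact (cderiv_minus _ _ _ _ _
          (cderiv_scal (coef2 c) _ _ _ (cderiv_minus _ _ _ _ _
             (cderiv_div _ _ _ _ _ (cderiv_scal w _ _ _ DE) (cderiv_scal 2 _ _ _ DI) T2)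
             (cderiv_div _ _ _ _ _ DE (cderiv_scal 2 _ _ _ DP) T3)))
          (cderiv_scal (coef1 c) _ _ _ (cderiv_div _ _ _ _ _ DE DI T0))).
      - cbv beta. unfold f, laurent_integrand, A. simpl pred. simpl INR. rewrite RtoC_plus. simpl Cpow.
        field. easy. }
    unfold exp_integral. rewrite <- int_seq_scal by (intros; now apply cdiff_exp_integrand).
    unfold f in FTC. rewrite int_seq_minus in FTC.
    - match goal with |- ?x = (?y + ?g - ?g')%C => replace (y + g - g')%C with (y + (g - g'))%C by ring end.
      rewrite <- FTC. ring.
    - intros; now apply cdiff_laurent_integrand.
    - intros; apply cdiff_mult; [apply cdiff_const|now apply cdiff_exp_integrand]. }
  (* [N ^ 3] times the third-order Taylor remainder of [exp (- w / N)]: a bounded sequence. *)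
  set (tau := fun n => (INR (S n) ^ 3 * (exp_kernel w (/ INR (S n)) - 1 + w / INR (S n) - w * w / 2 / (INR (S n) ^ 2)))%C).
  assert (Btau : bounded_on (fun _ => True) tau).
  { exists (Cmod w ^ 3 * exp (Cmod w)). intros n _. unfold tau.
    pose proof (inv_INR_S n) as [P1 P2]. pose proof (INR_S_ge_1 n) as P3.
    revert P1 P2 P3. generalize (INR (S n)). intros N P1 P2 P3.
    assert (N0 : RtoC (N) <> RtoC 0) by (apply RtoC_pos_neq_0; lra).
    pose proof (Cexp_taylor 3 (- (w * (/ N)%R))%C) as T.
    simpl Csum in T. simpl fact in T.
    fold (exp_kernel w (/ N)) in T.
    rewrite Cmod_opp, Cmod_mult, (Cmod_RtoC_pos (/ _)) in T by lra.
    match type of T with Cmod ?x <= _ => replace (exp_kernel w (/ N) - 1 + w / N - w * w / 2 / (N ^ 2))%C with x end.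
    - rewrite Cmod_mult, Cmod_pow, Cmod_RtoC_pos by lra.
      apply Rmult_le_compat_l with (r := N ^ 3) in T; [|apply pow_le; lra].
      eapply Rle_trans; [exact T|]. rewrite Rpow_mult_distr, pow_inv.
      replace (N ^ 3 * (Cmod w ^ 3 * / N ^ 3 * exp (Cmod w * / N)))
        with (Cmod w ^ 3 * exp (Cmod w * / N)) by (field; lra).
      apply Rmult_le_compat_l; [apply pow_le, Cmod_ge_0|]. apply exp_le.
      pose proof (Cmod_ge_0 w). nra.
    - rewrite !RtoC_inv by lra. rewrite RtoC_plus. simpl Cpow. field. easy. }
  assert (Binv : bounded_on (fun _ => True) (fun n => RtoC (/ INR (S n)))).
  { exists 1. intros n _. pose proof (inv_INR_S n). rewrite Cmod_RtoC_pos; lra. }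
  assert (Bexp : bounded_on (fun _ => True) (fun n => exp_kernel w (INR (S n)))).
  { exists 1. intros n _. pose proof (INR_S_ge_1 n). rewrite Cmod_exp_kernel. apply exp_le_1. nra. }
  (* [Z1 / N] is the contribution of the upper end, [Z2 / N] the vanishing part of that of the lower
     end. *)
  set (Z1 := fun n => (coef2 c * (w * exp_kernel w (INR (S n)) / 2 - exp_kernel w (INR (S n)) / 2 * (/ INR (S n))%R)
     - coef1 c * exp_kernel w (INR (S n)))%C).
  set (Z2 := fun n => (coef2 c * (tau n / 2 - w * w * w / 4 - w * tau n / 2 * (/ INR (S n))%R)
     + coef1 c * (w * w / 2 + tau n * (/ INR (S n))%R))%C).
  pose proof (exp_integral_limit w Hw) as LV.
  assert (L1 : clim (fun n => / INR (S n) * (Z1 n + Z2 n))%C 0).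
  { apply (clim_0_of_bounded _ (fun n => Z1 n + Z2 n)%C); [|easy].
    unfold Z1, Z2, Cdiv. bounded_tac. }
  pose proof (clim_plus _ _ _ _ (clim_plus _ _ _ _ (clim_scal A _ _ LV)
    (clim_const (coef2 c * (3 / 4 * (w * w)) - coef1 c * w)%C)) L1) as L.
  replace (log_main c w) with (A * - Clog w + (coef2 c * (3 / 4 * (w * w)) - coef1 c * w) + 0)%C
    by (unfold A, log_main; field).
  revert L. apply clim_ext. intros n. cbv beta. rewrite E.
  pose proof (INR_S_ge_1 n) as P3.
  assert (N0 : RtoC (INR (S n)) <> RtoC 0) by (apply RtoC_pos_neq_0; lra).
  unfold G, A, Z1, Z2, tau, divergent_part. rewrite !RtoC_inv by lra.
  revert P3 N0. generalize (INR (S n)). intros N P3 N0. simpl Cpow. field. easy.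
Qed.

(** * Remainder of the Bernoulli expansion *)

(** [1 / (exp u - 1)] minus its Laurent part through degree 1; [todd1] and [todd2] are the first and
    second derivatives. *)
Definition todd (u : C) : C := (1 / (Cexp u - 1) - 1 / u + 1 / 2 - u / 12)%C.
Definition todd1 (u : C) : C := (- Cexp u / (Cexp u - 1) ^ 2 + 1 / u ^ 2 - 1 / 12)%C.
Definition todd2 (u : C) : C := (Cexp u * (Cexp u + 1) / (Cexp u - 1) ^ 3 - 2 / u ^ 3)%C.

Lemma Cmod_Cexp_minus_1_ge (u : C) : Re u <= Cmod (Cexp u - 1)%C.
Proof.
  pose proof (Cmod_triangle_inv (Cexp u) 1) as T. rewrite Cmod_Cexp, Cmod_1 in T.
  pose proof (exp_ineq1_le (Re u)). lra.
Qed.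

Lemma Cexp_minus_1_neq_0 (u : C) : 0 < Re u -> (Cexp u - 1)%C <> RtoC 0.
Proof. intros H. apply Cmod_gt_0. pose proof (Cmod_Cexp_minus_1_ge u). lra. Qed.

(** From [Cmod (exp u - 1) >= exp (Re u) - 1 >= Re u]: on the ray [u = c t] the zeros of [exp u - 1]
    on the imaginary axis are kept away, for every [t]. *)
Lemma sector_quotient_bound (c : C) (t : R) : 0 < Re c -> 0 < t ->
  Cmod (c * t / (Cexp (c * t) - 1))%C <= Cmod c / Re c.
Proof.
  intros Hc Ht.
  assert (R : Re (c * t)%C = Re c * t) by apply Re_scal.
  assert (P : 0 < Re (c * t)%C) by (rewrite R; nra).
  pose proof (Cmod_Cexp_minus_1_ge (c * t)) as B. rewrite R in B.
  rewrite Cmod_div, Cmod_mult, (Cmod_RtoC_pos t) by (try lra; now apply Cexp_minus_1_neq_0).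
  assert (0 < Re c * t) by nra.
  apply Rle_trans with (Cmod c * t / (Re c * t)); [|right; field; lra].
  apply Rmult_le_compat_l; [apply Rmult_le_pos; [apply Cmod_ge_0|lra]|].
  apply Rinv_le_contravar; lra.
Qed.

(** Let [s] be the fifth-order remainder of [exp u] over [u ^ 5] and [y = u / (exp u - 1)]. Each
    function is a polynomial in [u] and [s], times a power of [y] and the expected power of [u].
    Bounding [y] by hypothesis replaces a restriction to [Cmod u < 2 PI]. *)
Lemma todd_bounds (A D : R) : exists K, 0 <= K /\
  forall u, u <> RtoC 0 -> (Cexp u - 1)%C <> RtoC 0 -> Cmod u <= A -> Cmod (u / (Cexp u - 1))%C <= D ->
    Cmod (todd u) <= K * Cmod u ^ 3 /\ Cmod (todd1 u) <= K * Cmod u ^ 2 /\ Cmod (todd2 u) <= K.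
Proof.
  set (Cond := fun u : C => u <> RtoC 0 /\ (Cexp u - 1)%C <> RtoC 0 /\ Cmod u <= A /\ Cmod (u / (Cexp u - 1))%C <= D).
  set (s := fun u : C => ((Cexp u - (1 + u + u * u / 2 + u * u * u / 6 + u * u * u * u / 24)) / (u * u * u * u * u))%C).
  set (y := fun u : C => (u / (Cexp u - 1))%C).
  assert (Bu : bounded_on Cond (fun u => u)) by (exists A; now intros u (_ & _ & H & _)).
  assert (By : bounded_on Cond y) by (exists D; now intros u (_ & _ & _ & H)).
  assert (Bs : bounded_on Cond s).
  { exists (exp A). intros u (U0 & _ & HA & _).
    pose proof (Cexp_taylor 5 u) as T. simpl Csum in T. simpl fact in T. simpl INR in T.
    assert (U5 : (u * u * u * u * u)%C <> RtoC 0) by now repeat apply Cmult_neq_0.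
    unfold s. rewrite Cmod_div by easy.
    apply Rmult_le_reg_r with (Cmod (u * u * u * u * u)%C); [now apply Cmod_gt_0|].
    unfold Rdiv at 1. rewrite Rmult_assoc, Rinv_l, Rmult_1_r by (apply Rgt_not_eq; now apply Cmod_gt_0).
    eapply Rle_trans; [|eapply Rle_trans; [exact T|]].
    - right. f_equal. rewrite !RtoC_inv by lra. rewrite !RtoC_plus. field.
    - rewrite !Cmod_mult. replace (Cmod u ^ 5) with (Cmod u * Cmod u * Cmod u * Cmod u * Cmod u) by ring.
      rewrite Rmult_comm. apply Rmult_le_compat_r.
      + repeat apply Rmult_le_pos; apply Cmod_ge_0.
      + now apply exp_le. }
  (* Over a common denominator the three numerators are divisible by [u ^ 5], [u ^ 6], [u ^ 6].
     These are the quotients up to a factor 12 in the first two; [N0], [N1], [N2] verify them. *)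
  pose (Q0 := fun u => (1 / 144 - 1 * s u - 1 / 288 * u + 1 / 2 * u * s u - 1 / 12 * u ^ 2 * s u)%C).
  pose (Q1 := fun u => (- (1 / 48) + 2 * s u - 1 / 144 * u - 7 / 1728 * u ^ 2 + 1 / 6 * u ^ 2 * s u - 1 / 864 * u ^ 3
    - 1 / 6912 * u ^ 4 - 1 / 36 * u ^ 4 * s u + 1 * u ^ 4 * s u ^ 2 - 1 / 144 * u ^ 5 * s u - 1 / 12 * u ^ 6 * s u ^ 2)%C).
  pose (Q2 := fun u => (1 / 24 * u - 6 * u * s u + 1 / 48 * u ^ 2 - 3 * u ^ 2 * s u + 7 / 864 * u ^ 3 - 3 / 2 * u ^ 3 * s u
    + 1 / 576 * u ^ 4 - 1 / 2 * u ^ 4 * s u - 1 / 12 * u ^ 5 * s u - 6 * u ^ 5 * s u ^ 2 - 1 / 6912 * u ^ 6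
    - 3 * u ^ 6 * s u ^ 2 - 1 / 96 * u ^ 7 * s u - 1 / 4 * u ^ 8 * s u ^ 2 - 2 * u ^ 9 * s u ^ 3)%C).
  assert (B0 : bounded_on Cond (fun u => Q0 u * y u)%C) by (unfold Q0; bounded_tac).
  assert (B1 : bounded_on Cond (fun u => Q1 u * y u ^ 2)%C) by (unfold Q1; bounded_tac).
  assert (B2 : bounded_on Cond (fun u => Q2 u * y u ^ 3)%C) by (unfold Q2; bounded_tac).
  destruct (bounded_on_pos _ _ B0) as (K0 & P0 & H0).
  destruct (bounded_on_pos _ _ B1) as (K1 & P1 & H1).
  destruct (bounded_on_pos _ _ B2) as (K2 & P2 & H2).
  exists (K0 + K1 + K2). split; [lra|]. intros u U0 X0 HA HD.
  assert (HC : Cond u) by now unfold Cond.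
  specialize (H0 u HC). specialize (H1 u HC). specialize (H2 u HC). cbv beta in H0, H1, H2.
  set (X := (Cexp u - 1)%C) in *.
  assert (E : X = (u + u * u / 2 + u * u * u / 6 + u * u * u * u / 24 + s u * (u * u * u * u * u))%C)
    by (unfold s, X; field; easy).
  assert (EX : Cexp u = (X + 1)%C) by (unfold X; ring).
  assert (N0 : (12 * u - 12 * X + 6 * u * X - u * u * X = 12 * Q0 u * u ^ 5)%C)
    by (unfold Q0; rewrite E; simpl Cpow; field).
  assert (N1 : (12 * (X * X) - 12 * (u * u) * (X + 1) - u * u * (X * X) = 12 * Q1 u * u ^ 6)%C)
    by (unfold Q1; rewrite E; simpl Cpow; field).
  assert (N2 : (u * u * u * (X + 1) * (X + 2) - 2 * (X * X * X) = Q2 u * u ^ 6)%C)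
    by (unfold Q2; rewrite E; simpl Cpow; field).
  clear E.
  assert (E0 : todd u = (Q0 u * y u * u ^ 3)%C).
  { unfold todd, y. fold X. transitivity ((12 * u - 12 * X + 6 * u * X - u * u * X) / (12 * u * X))%C.
    - field; repeat split; assumption.
    - rewrite N0. simpl Cpow. field; repeat split; assumption. }
  assert (E1 : todd1 u = (Q1 u * y u ^ 2 * u ^ 2)%C).
  { unfold todd1, y. fold X. rewrite EX.
    transitivity ((12 * (X * X) - 12 * (u * u) * (X + 1) - u * u * (X * X)) / (12 * u * u * (X * X)))%C.
    - simpl Cpow. field; repeat split; assumption.
    - rewrite N1. simpl Cpow. field; repeat split; assumption. }
  assert (E2 : todd2 u = (Q2 u * y u ^ 3)%C).
  { unfold todd2, y. fold X. rewrite EX.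
    transitivity ((u * u * u * (X + 1) * (X + 2) - 2 * (X * X * X)) / (u * u * u * (X * X * X)))%C.
    - simpl Cpow. field; repeat split; assumption.
    - rewrite N2. simpl Cpow. field; repeat split; assumption. }
  assert (U3 : 0 <= Cmod u ^ 3) by apply pow_le, Cmod_ge_0.
  assert (U2 : 0 <= Cmod u ^ 2) by apply pow_le, Cmod_ge_0.
  rewrite E0, E1, E2, !(Cmod_mult _ (u ^ _)%C), !Cmod_pow. repeat split; [| |lra]; apply Rmult_le_compat_r; lra.
Qed.

Lemma near_Re (c c' : C) : 0 < Re c -> Cmod (c' - c)%C <= Re c / 2 ->
  Re c / 2 <= Re c' /\ Cmod c' <= 2 * Cmod c.
Proof.
  intros Hc H. pose proof (re_le_Cmod (c' - c)%C) as T. unfold Cminus in T at 1. rewrite Re_plus, Re_opp in T.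
  apply Rabs_le_between in T. split; [lra|].
  pose proof (Cmod_triangle (c' - c)%C c) as T2. replace (c' - c + c)%C with c' in T2 by ring.
  pose proof (Re_le_Cmod_pos c). lra.
Qed.

Lemma Cmult_RtoC_neq_0 (c : C) (t : R) : 0 < Re c -> 0 < t -> (c * t)%C <> RtoC 0.
Proof. intros Hc Ht. apply Cmult_neq_0; [now apply Re_neq_0|now apply RtoC_pos_neq_0]. Qed.

Lemma Cexp_ct_neq_1 (c : C) (t : R) : 0 < Re c -> 0 < t -> (Cexp (c * t) - 1)%C <> RtoC 0.
Proof. intros Hc Ht. apply Cexp_minus_1_neq_0. rewrite Re_scal. nra. Qed.

Lemma Cexp_t_neq_1 (t : R) : 0 < t -> (Cexp t - 1)%C <> RtoC 0.
Proof. intros Ht. apply Cexp_minus_1_neq_0. exact Ht. Qed.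

Lemma todd_bounds_near (c : C) : 0 < Re c -> exists K, 0 <= K /\
  forall c' t, Cmod (c' - c)%C <= Re c / 2 -> 0 < t <= 1 ->
    Cmod (todd (c' * t)) <= K * t ^ 3 /\ Cmod (todd1 (c' * t)) <= K * t ^ 2 /\ Cmod (todd2 (c' * t)) <= K.
Proof.
  intros Hc. pose proof (Re_le_Cmod_pos c) as Rc.
  (* Bounds for [Cmod c'] and [Cmod c' / Re c'] on the disc of radius [Re c / 2] around [c]. *)
  destruct (todd_bounds (2 * Cmod c) (4 * Cmod c / Re c)) as (K & HK & H).
  assert (L : 0 <= 2 * Cmod c) by lra.
  exists (K * (1 + (2 * Cmod c) ^ 2 + (2 * Cmod c) ^ 3)).
  assert (P2 : 0 <= (2 * Cmod c) ^ 2) by now apply pow_le.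
  assert (P3 : 0 <= (2 * Cmod c) ^ 3) by now apply pow_le.
  split; [apply Rmult_le_pos; lra|]. intros c' t Hn Ht.
  destruct (near_Re c c' Hc Hn) as [R1 R2].
  assert (Hc' : 0 < Re c') by lra.
  pose proof (Cmod_ge_0 c') as Pc.
  assert (Eu : Cmod (c' * t)%C = Cmod c' * t) by (rewrite Cmod_mult, Cmod_RtoC_pos; lra).
  destruct (H (c' * t)%C) as (B0 & B1 & B2).
  - apply Cmult_RtoC_neq_0; lra.
  - apply Cexp_ct_neq_1; lra.
  - rewrite Eu. nra.
  - eapply Rle_trans; [apply sector_quotient_bound; lra|].
    apply Rle_trans with (2 * Cmod c / (Re c / 2)); [|right; field; lra].
    apply Rmult_le_compat; [easy|left; now apply Rinv_0_lt_compat|easy|apply Rinv_le_contravar; lra].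
  - rewrite Eu in B0, B1. rewrite Rpow_mult_distr in B0, B1.
    assert (Q2 : Cmod c' ^ 2 <= (2 * Cmod c) ^ 2) by (apply pow_incr; lra).
    assert (Q3 : Cmod c' ^ 3 <= (2 * Cmod c) ^ 3) by (apply pow_incr; lra).
    assert (T2 : 0 <= t ^ 2) by (apply pow_le; lra). assert (T3 : 0 <= t ^ 3) by (apply pow_le; lra).
    repeat split.
    + eapply Rle_trans; [exact B0|]. rewrite Rmult_assoc. apply Rmult_le_compat_l; [easy|].
      apply Rmult_le_compat_r; lra.
    + eapply Rle_trans; [exact B1|]. rewrite Rmult_assoc. apply Rmult_le_compat_l; [easy|].
      apply Rmult_le_compat_r; lra.
    + eapply Rle_trans; [exact B2|]. rewrite <- (Rmult_1_r K) at 1. apply Rmult_le_compat_l; lra.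
Qed.

Lemma todd_real_bounds : exists K, 0 <= K /\
  forall t : R, 0 < t <= 1 -> Cmod (todd t) <= K * t ^ 3.
Proof.
  destruct (todd_bounds_near 1) as (K & HK & H); [simpl; lra|]. exists K. split; [easy|]. intros t Ht.
  destruct (H 1%C t) as (B & _); [|easy|].
  - replace (1 - 1)%C with (RtoC 0) by ring. rewrite Cmod_0. simpl. lra.
  - now rewrite Cmult_1_l in B.
Qed.

(** * The double geometric kernel and its Laurent part *)

Definition bose (c : C) (t : R) : C := (1 / ((Cexp t - 1) * (Cexp (c * t) - 1)))%C.

(** Replacing [t] by [- t] turns [bose] into [1 / ((1 - exp (- t)) (1 - exp (- c t)))], hence the
    sign of [coef1]. *)
Definition laurent (c : C) (t : R) : C := (coef2 c / t ^ 2 - coef1 c / t + coef0 c)%C.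

Lemma cdiff_bose (c : C) (t : R) : 0 < Re c -> 0 < t -> cdiff (bose c) t.
Proof.
  intros Hc Ht. unfold bose. cdiff_tac.
  apply Cmult_neq_0; [now apply Cexp_t_neq_1|now apply Cexp_ct_neq_1].
Qed.

Lemma cdiff_laurent (c : C) (t : R) : 0 < t -> cdiff (laurent c) t.
Proof.
  intros Ht. pose proof (RtoC_pos_neq_0 t Ht). unfold laurent. cdiff_tac; try assumption. now apply Cpow_neq_0.
Qed.

Lemma bose_factor (u : C) : (1 / (Cexp u - 1) = todd u + 1 / u - 1 / 2 + u / 12)%C.
Proof. unfold todd. ring. Qed.

Lemma bounded_on_of_power (Cond : R -> Prop) (f : R -> C) (n : nat) (K : R) :
  (forall t, Cond t -> 0 < t) -> (forall t, Cond t -> Cmod (f t) <= K * t ^ n) ->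
  bounded_on Cond (fun t => f t / t ^ n)%C.
Proof.
  intros HC H. exists K. intros t Ht. pose proof (HC t Ht) as Pt.
  assert (P : 0 < t ^ n) by now apply pow_lt.
  rewrite Cmod_div, Cmod_pow, Cmod_RtoC_pos by (try apply Cpow_neq_0, RtoC_pos_neq_0; lra).
  apply Rmult_le_reg_r with (t ^ n); [easy|]. unfold Rdiv. rewrite Rmult_assoc, Rinv_l, Rmult_1_r by lra.
  now apply H.
Qed.

Lemma bose_minus_laurent (c : C) : 0 < Re c ->
  bounded_on (fun t => 0 < t <= 1) (fun t => (bose c t - laurent c t) / t)%C.
Proof.
  intros Hc. set (Cond := fun t : R => 0 < t <= 1).
  destruct (todd_bounds_near c Hc) as (K & HK & B). destruct todd_real_bounds as (K' & HK' & B').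
  assert (C0 : c <> RtoC 0) by now apply Re_neq_0.
  assert (Bt : bounded_on Cond RtoC) by (exists 1; intros t [H1 H2]; rewrite Cmod_RtoC_pos; lra).
  assert (B1 : bounded_on Cond (fun t => todd t / t ^ 3)%C).
  { apply (bounded_on_of_power Cond _ 3 K'); [now intros t [H _]|exact B']. }
  assert (B2 : bounded_on Cond (fun t => todd (c * t) / t ^ 3)%C).
  { apply (bounded_on_of_power Cond _ 3 K); [now intros t [H _]|]. intros t Ht. apply B; [|exact Ht].
    replace (c - c)%C with (RtoC 0) by ring. rewrite Cmod_0. lra. }
  set (T1 := fun t : R => (todd t / t ^ 3)%C) in *. set (T2 := fun t : R => (todd (c * t) / t ^ 3)%C) in *.
  apply (bounded_on_ext Cond (fun t : R => - ((1 + c) * / 24) + c * t * / 144 + t * (1 - t * / 2 + t ^ 2 * / 12) * T2 t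
     + t * (/ c - t * / 2 + c * t ^ 2 * / 12) * T1 t + t ^ 5 * T1 t * T2 t)%C); [|bounded_tac].
  intros t [Ht _]. assert (T0 : RtoC t <> RtoC 0) by now apply RtoC_pos_neq_0.
  assert (E1 : todd t = (T1 t * t ^ 3)%C) by (unfold T1; simpl Cpow; field; assumption).
  assert (E2 : todd (c * t) = (T2 t * t ^ 3)%C) by (unfold T2; simpl Cpow; field; assumption).
  assert (EB : bose c t = ((1 / (Cexp t - 1)) * (1 / (Cexp (c * t) - 1)))%C).
  { unfold bose. field. split; [now apply Cexp_ct_neq_1|now apply Cexp_t_neq_1]. }
  rewrite EB, !bose_factor, E1, E2. unfold laurent, coef2, coef1, coef0. simpl Cpow.
  field. split; assumption.
Qed.

(** [bose] is [exp_kernel (base c)] over [(1 - exp (- t)) (1 - exp (- c t))], so the two truncated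
    expansions have to agree to this order. *)
Lemma exp_laurent_minus_laurent (c : C) : 0 < Re c ->
  bounded_on (fun t => 0 < t <= 1)
    (fun t => (exp_kernel (base c) t * (coef2 c / t ^ 2 + coef1 c / t + coef0 c) - laurent c t) / t)%C.
Proof.
  intros Hc. set (Cond := fun t : R => 0 < t <= 1). set (w := base c).
  assert (C0 : c <> RtoC 0) by now apply Re_neq_0.
  assert (Bt : bounded_on Cond RtoC) by (exists 1; intros t [H1 H2]; rewrite Cmod_RtoC_pos; lra).
  assert (B1 : bounded_on Cond (fun t => (exp_kernel w t - (1 - w * t + w * w * t * t / 2)) / t ^ 3)%C).
  { apply (bounded_on_of_power Cond _ 3 (Cmod w ^ 3 * exp (Cmod w))); [now intros t [H _]|].
    intros t [H1 H2]. pose proof (Cexp_taylor 3 (- (w * t))%C) as T.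
    simpl Csum in T. simpl fact in T. simpl INR in T. fold (exp_kernel w t) in T.
    rewrite Cmod_opp, Cmod_mult, (Cmod_RtoC_pos t) in T by lra.
    match type of T with Cmod ?x <= _ => replace (exp_kernel w t - (1 - w * t + w * w * t * t / 2))%C with x end.
    - eapply Rle_trans; [exact T|]. rewrite Rpow_mult_distr.
      replace (Cmod w ^ 3 * exp (Cmod w) * t ^ 3) with (Cmod w ^ 3 * t ^ 3 * exp (Cmod w)) by ring.
      apply Rmult_le_compat_l; [apply Rmult_le_pos; apply pow_le; [apply Cmod_ge_0|lra]|].
      apply exp_le. pose proof (Cmod_ge_0 w). nra.
    - rewrite !RtoC_inv by lra. rewrite RtoC_plus. field. }
  set (tau := fun t : R => ((exp_kernel w t - (1 - w * t + w * w * t * t / 2)) / t ^ 3)%C) in *.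
  apply (bounded_on_ext Cond (fun t : R => (w * w * coef1 c * / 2 - w * coef0 c) + t * (w * w * coef0 c * / 2)
    + tau t * (coef2 c + coef1 c * t + coef0 c * t ^ 2))%C); [|bounded_tac].
  intros t [Ht _]. assert (T0 : RtoC t <> RtoC 0) by now apply RtoC_pos_neq_0.
  assert (E : exp_kernel w t = (1 - w * t + w * w * t * t / 2 + tau t * t ^ 3)%C)
    by (unfold tau; simpl Cpow; field; assumption).
  rewrite E. unfold laurent, w, base, coef2, coef1, coef0. simpl Cpow. field. split; assumption.
Qed.

(** The integrand that remains once the lattice sum of the rests is carried out under the
    integral. *)
Definition beta (c : C) (t : R) : C := (bose c t / t - laurent_integrand c (base c) t)%C.

Lemma cdiff_beta (c : C) (t : R) : 0 < Re c -> 0 < t -> cdiff (beta c) t.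
Proof.
  intros Hc Ht. apply cdiff_minus; [|now apply cdiff_laurent_integrand].
  apply cdiff_div; [now apply cdiff_bose|apply cdiff_id|now apply RtoC_pos_neq_0].
Qed.

Lemma inv_expm1_bound (t : R) : 1 <= t -> / (exp t - 1) <= 2 * exp (- t).
Proof.
  intros Ht. assert (E2 : 2 <= exp t) by (pose proof (exp_ineq1_le t); lra).
  rewrite exp_Ropp. replace (2 * / exp t) with (/ (exp t / 2)) by (field; lra).
  apply Rinv_le_contravar; lra.
Qed.

Lemma bose_tail_bound (c : C) (t : R) : 0 < Re c -> 1 <= t ->
  Cmod (bose c t) <= 2 / Re c * exp (- t).
Proof.
  intros Hc Ht.
  pose proof (Cmod_Cexp_minus_1_ge (c * t)%C) as B. rewrite Re_scal in B.
  assert (E1 : (Cexp t - 1)%C = RtoC (exp t - 1)) by (rewrite Cexp_RtoC; symmetry; apply RtoC_minus).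
  pose proof (exp_ineq1_le t) as E2.
  unfold bose. rewrite Cmod_div, Cmod_1, Cmod_mult, E1, Cmod_RtoC_pos by
    first [lra | apply Cmult_neq_0; [apply Cexp_t_neq_1; lra|apply Cexp_ct_neq_1; lra]].
  unfold Rdiv. rewrite Rmult_1_l, Rinv_mult.
  replace (2 * / Re c * exp (- t)) with (2 * exp (- t) * / Re c) by ring.
  apply Rmult_le_compat.
  - left. apply Rinv_0_lt_compat. lra.
  - left. apply Rinv_0_lt_compat. nra.
  - now apply inv_expm1_bound.
  - apply Rinv_le_contravar; nra.
Qed.

Lemma beta_bound (c : C) : 0 < Re c -> exists K, 0 <= K /\
  forall t, 0 < t -> Cmod (beta c t) <= K * exp (- (1 * t)).
Proof.
  intros Hc.
  assert (B : bounded_on (fun t => 0 < t <= 1) (beta c)).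
  { eapply bounded_on_ext; [|apply (bounded_on_minus _ _ _ (bose_minus_laurent c Hc) (exp_laurent_minus_laurent c Hc))].
    intros t [Ht _]. unfold beta, laurent_integrand. cbv beta.
    assert (T0 : RtoC t <> RtoC 0) by now apply RtoC_pos_neq_0. unfold Cdiv. ring. }
  destruct (bounded_on_pos _ _ B) as (K1 & P1 & H1).
  set (K2 := 2 / Re c + (Cmod (coef2 c) + Cmod (coef1 c) + Cmod (coef0 c))).
  assert (P2 : 0 <= K2).
  { unfold K2. assert (0 < 2 / Re c) by (apply Rdiv_lt_0_compat; lra).
    pose proof (Cmod_ge_0 (coef2 c)). pose proof (Cmod_ge_0 (coef1 c)). pose proof (Cmod_ge_0 (coef0 c)). lra. }
  exists (K1 * exp 1 + K2). split.
  - pose proof (exp_pos 1). nra.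
  - intros t Ht. rewrite Rmult_1_l. pose proof (exp_pos (- t)) as Pe.
    destruct (Rle_lt_dec t 1) as [L|L].
    + apply Rle_trans with K1; [apply H1; lra|].
      rewrite Rmult_plus_distr_r, Rmult_assoc, <- exp_plus.
      pose proof (exp_le 0 (1 + - t) ltac:(lra)) as E1. rewrite exp_0 in E1.
      assert (0 <= K2 * exp (- t)) by (apply Rmult_le_pos; lra). nra.
    + assert (Cmod (beta c t) <= K2 * exp (- t)); [|assert (0 <= K1 * exp 1 * exp (- t)) by (apply Rmult_nonneg3; try easy; left; apply exp_pos); lra].
      unfold beta, K2. eapply Rle_trans; [apply Cmod_minus_le|]. rewrite Rmult_plus_distr_r.
      assert (T0 : RtoC t <> RtoC 0) by now apply RtoC_pos_neq_0.
      assert (It : 0 < / t <= 1).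
      { split; [now apply Rinv_0_lt_compat|]. rewrite <- Rinv_1. apply Rinv_le_contravar; lra. }
      apply Rplus_le_compat.
      * rewrite Cmod_div, Cmod_RtoC_pos by (assumption || lra).
        pose proof (bose_tail_bound c t Hc ltac:(lra)). pose proof (Cmod_ge_0 (bose c t)). unfold Rdiv at 1. nra.
      * unfold laurent_integrand. rewrite Cmod_div, Cmod_mult, Cmod_exp_kernel, Cmod_RtoC_pos by (assumption || lra).
        assert (S : Cmod (coef2 c / t ^ 2 + coef1 c / t + coef0 c)%C <= Cmod (coef2 c) + Cmod (coef1 c) + Cmod (coef0 c)).
        { eapply Rle_trans; [apply Cmod_triangle|]. apply Rplus_le_compat_r.
          eapply Rle_trans; [apply Cmod_triangle|].
          rewrite !Cmod_div, Cmod_pow, Cmod_RtoC_pos by (assumption || lra || now apply Cpow_neq_0).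
          pose proof (Cmod_ge_0 (coef2 c)). pose proof (Cmod_ge_0 (coef1 c)).
          assert (It2 : 0 <= / t ^ 2 <= 1) by (rewrite <- pow_inv; nra).
          unfold Rdiv. apply Rplus_le_compat; nra. }
        assert (Ew : exp (- (Re (base c) * t)) <= exp (- t)).
        { apply exp_le. unfold base. rewrite Re_plus. simpl. nra. }
        pose proof (exp_pos (- (Re (base c) * t))).
        pose proof (Cmod_ge_0 (coef2 c / t ^ 2 + coef1 c / t + coef0 c)%C).
        set (S1 := Cmod (coef2 c / t ^ 2 + coef1 c / t + coef0 c)%C) in *.
        set (S2 := Cmod (coef2 c) + Cmod (coef1 c) + Cmod (coef0 c)) in *.
        apply Rle_trans with (exp (- t) * S2 * 1); [|lra]. unfold Rdiv.
        apply Rmult_le_compat; [nra|lra| |lra]. apply Rmult_le_compat; lra.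
Qed.

(** * From the lattice sum to an integral *)

Definition rest_integrand (c w : C) (t : R) : C :=
  (exp_kernel w t / t - corner c (fun v => laurent_integrand c v t) w)%C.

Lemma cdiff_corner (c w : C) (f : C -> R -> C) (t : R) :
  (forall v, cdiff (f v) t) -> cdiff (fun s => corner c (fun v => f v s) w) t.
Proof.
  intros H. unfold corner. cdiff_tac; apply H.
Qed.

Lemma cdiff_rest_integrand (c w : C) (t : R) : 0 < t -> cdiff (rest_integrand c w) t.
Proof.
  intros Ht. apply cdiff_minus; [now apply cdiff_exp_integrand|].
  apply cdiff_corner. intros v. now apply cdiff_laurent_integrand.
Qed.

Lemma int_seq_corner (c w : C) (f : C -> R -> C) (n : nat) :
  (forall v t, 0 < t -> cdiff (f v) t) ->
  int_seq (fun s => corner c (fun v => f v s) w) n = corner c (fun v => int_seq (f v) n) w.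
Proof.
  intros H. unfold corner.
  rewrite (int_seq_plus (fun s => f w s - f (w + 1) s - f (w + c) s)%C (f (w + (1 + c))%C)).
  - rewrite (int_seq_minus (fun s => f w s - f (w + 1) s)%C (f (w + c)%C)).
    + rewrite (int_seq_minus (f w) (f (w + 1)%C)) by auto. reflexivity.
    + intros; apply cdiff_minus; auto.
    + auto.
  - intros; apply cdiff_minus; [apply cdiff_minus|]; auto.
  - auto.
Qed.

(** The mixed difference annihilates the powers of [N] and reduces the coefficient of [E] to 1, so
    the divergences cancel against that of the exponential integral for [- log w]. *)
Lemma corner_divergent_part (c w E : C) (N : R) : c <> RtoC 0 ->
  corner c (fun v => divergent_part c v E N) w = E.
Proof. intros Hc. unfold corner, divergent_part, coef2, coef1, coef0. field. assumption. Qed.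

Lemma rest_integrand_limit (c w : C) : 0 < Re c -> 0 < Re w ->
  clim (int_seq (rest_integrand c w)) (log_rest c w).
Proof.
  intros Hc Hw.
  assert (L : forall v, 0 <= Re v -> clim (fun n => int_seq (laurent_integrand c (w + v)) n
     - divergent_part c (w + v) (exp_integral 1 n) (INR (S n)))%C (log_main c (w + v))).
  { intros v Hv. apply laurent_integral_limit. rewrite Re_plus. lra. }
  pose proof (L 1%C ltac:(simpl; lra)) as L1. pose proof (L c ltac:(lra)) as Lc.
  pose proof (L (1 + c)%C ltac:(rewrite Re_plus; simpl; lra)) as L1c.
  pose proof (laurent_integral_limit c w Hw) as L0.
  pose proof (clim_minus _ _ _ _ (exp_integral_limit w Hw)
    (clim_plus _ _ _ _ (clim_minus _ _ _ _ (clim_minus _ _ _ _ L0 L1) Lc) L1c)) as LL.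
  unfold log_rest, corner at 1. revert LL. apply clim_ext. intros n. cbv beta.
  unfold rest_integrand. rewrite int_seq_minus.
  - rewrite (int_seq_corner c w (laurent_integrand c)) by (intros; now apply cdiff_laurent_integrand).
    fold (exp_integral w n).
    pose proof (corner_divergent_part c w (exp_integral 1 n) (INR (S n)) (Re_neq_0 c Hc)) as E.
    unfold corner in *. rewrite <- E at 1. ring.
  - intros; now apply cdiff_exp_integrand.
  - intros; apply cdiff_corner; intros; now apply cdiff_laurent_integrand.
Qed.

Lemma exp_kernel_neq_0 (w : C) (t : R) : exp_kernel w t <> RtoC 0.
Proof. apply Cexp_neq_0. Qed.

Lemma one_minus_exp_kernel_neq_0 (w : C) (t : R) : 0 < Re w -> 0 < t ->
  (1 - exp_kernel w t)%C <> RtoC 0.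
Proof.
  intros Hw Ht E. apply (Cexp_ct_neq_1 w t Hw Ht).
  assert (X : (Cexp (w * t) * exp_kernel w t)%C = RtoC 1).
  { unfold exp_kernel. rewrite Cexp_opp. field. apply Cexp_neq_0. }
  replace (Cexp (w * t) - 1)%C with (Cexp (w * t) * (1 - exp_kernel w t) + (Cexp (w * t) * exp_kernel w t - 1))%C by ring.
  rewrite E, X. ring.
Qed.

Lemma bose_exp_kernel (c : C) (t : R) : 0 < Re c -> 0 < t ->
  bose c t = (exp_kernel (base c) t / ((1 - exp_kernel 1 t) * (1 - exp_kernel c t)))%C.
Proof.
  intros Hc Ht. unfold base. rewrite exp_kernel_plus.
  pose proof (one_minus_exp_kernel_neq_0 1 t ltac:(simpl; lra) Ht) as N1.
  pose proof (one_minus_exp_kernel_neq_0 c t Hc Ht) as Nc.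
  assert (X : forall w, Cexp (w * t) = (/ exp_kernel w t)%C).
  { intros w. unfold exp_kernel. rewrite Cexp_opp. field. apply Cexp_neq_0. }
  unfold bose. pose proof (Cexp_t_neq_1 t Ht) as M1. pose proof (Cexp_ct_neq_1 c t Hc Ht) as Mc.
  replace (Cexp t) with (/ exp_kernel 1 t)%C in * by (rewrite <- X; f_equal; ring).
  rewrite X in *.
  pose proof (exp_kernel_neq_0 1 t). pose proof (exp_kernel_neq_0 c t).
  field. repeat split; assumption.
Qed.

(** Each rest has as integrand a mixed difference, of [beta] times an exponential normalised to 1 at
    [base c]; the lattice sum therefore telescopes under the integral. *)
Lemma rest_integrand_corner (c w : C) (t : R) : 0 < Re c -> 0 < t ->
  rest_integrand c w t = corner c (fun v => beta c t * (exp_kernel v t / exp_kernel (base c) t))%C w.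
Proof.
  intros Hc Ht. unfold rest_integrand, beta, corner, laurent_integrand.
  rewrite bose_exp_kernel by easy. rewrite !exp_kernel_plus.
  pose proof (one_minus_exp_kernel_neq_0 1 t ltac:(simpl; lra) Ht) as N1.
  pose proof (one_minus_exp_kernel_neq_0 c t Hc Ht) as Nc.
  pose proof (exp_kernel_neq_0 (base c) t). pose proof (RtoC_pos_neq_0 t Ht).
  generalize (coef2 c) (coef1 c) (coef0 c). intros.
  simpl Cpow. field. repeat split; assumption.
Qed.

(** The corner at [base c] gives [beta]; the three others decay with [N]. *)
Lemma rest_square_sum_bound (c : C) (K t : R) (N : nat) : 0 < Re c -> 0 < t ->
  Cmod (beta c t) <= K ->
  Cmod (square_sum (fun n l => rest_integrand c (lattice c n l) t) N - beta c t)%C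
    <= 3 * K * exp (- (slope c * INR N * t)).
Proof.
  intros Hc Ht HK.
  rewrite (square_sum_ext _ (fun n l => corner c (fun v => beta c t * (exp_kernel v t / exp_kernel (base c) t))%C (lattice c n l)))
    by (intros; now apply rest_integrand_corner).
  rewrite corner_square_sum, lattice_0_0.
  pose proof (exp_kernel_neq_0 (base c) t) as N0. pose proof (slope_pos c Hc) as [S0 S1].
  assert (B : forall i j, (N <= i + j)%nat ->
    Cmod (beta c t * (exp_kernel (lattice c i j) t / exp_kernel (base c) t))%C <= K * exp (- (slope c * INR N * t))).
  { intros i j Hij. rewrite Cmod_mult, Cmod_div, !Cmod_exp_kernel by easy.
    apply Rmult_le_compat; [apply Cmod_ge_0| |easy|].
    - left. apply Rdiv_lt_0_compat; apply exp_pos.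
    - unfold Rdiv. rewrite <- exp_Ropp, <- exp_plus. apply exp_le.
      rewrite <- lattice_0_0, !Re_lattice. apply le_INR in Hij. rewrite plus_INR in Hij.
      rewrite !S_INR. change (INR 0) with 0. unfold slope in *.
      pose proof (Rmin_l 1 (Re c)). pose proof (Rmin_r 1 (Re c)). set (m := Rmin 1 (Re c)) in *.
      pose proof (pos_INR i). pose proof (pos_INR j).
      assert (m * INR N <= Re c * INR j + INR i) by nra.
      nra. }
  pose proof (B N O ltac:(lia)) as B1. pose proof (B O N ltac:(lia)) as B2. pose proof (B N N ltac:(lia)) as B3.
  match goal with |- Cmod (?a - ?b - ?d + ?e - ?f)%C <= _ =>
    replace (a - b - d + e - f)%C with (e - b - d)%C by (field; assumption) end.
  eapply Rle_trans; [apply Cmod_minus_le|]. eapply Rle_trans; [apply Rplus_le_compat_r, Cmod_minus_le|]. lra.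
Qed.

Lemma cdiff_square_sum (f : nat -> nat -> R -> C) (N : nat) (t : R) :
  (forall n l, cdiff (f n l) t) -> cdiff (fun s => square_sum (fun n l => f n l s) N) t.
Proof. intros H. apply cdiff_Csum. intros n. now apply cdiff_Csum. Qed.

Lemma int_seq_square_sum (f : nat -> nat -> R -> C) (N m : nat) :
  (forall n l t, 0 < t -> cdiff (f n l) t) ->
  int_seq (fun s => square_sum (fun n l => f n l s) N) m = square_sum (fun n l => int_seq (f n l) m) N.
Proof.
  intros H. unfold square_sum. rewrite (int_seq_Csum (fun n s => Csum (fun l => f n l s) N)).
  - apply Csum_ext. intros n _. apply int_seq_Csum. auto.
  - intros n t Ht. apply cdiff_Csum. auto.
Qed.

(** The sum over a square of side [N] differs from the integral of [beta] by at most
    [3 * K / (slope c * N)], uniformly in the truncation of the integrals; so both limits can be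
    taken. *)
Lemma log_rest_sum (c : C) : 0 < Re c ->
  exists v, clim (int_seq (beta c)) v /\ clim (square_sum (fun n l => log_rest c (lattice c n l))) v.
Proof.
  intros Hc. destruct (beta_bound c Hc) as (K & HK & HB).
  destruct (int_seq_limit (beta c) K 1) as [v Hv]; [lra|easy|intros; now apply cdiff_beta|exact HB|].
  exists v. split; [easy|]. apply clim_shift.
  pose proof (slope_pos c Hc) as [S0 S1].
  apply (clim_inv_bound _ _ (3 * K / slope c)). intros N.
  pose proof (INR_S_ge_1 N) as HN.
  set (D := fun t => (square_sum (fun n l => rest_integrand c (lattice c n l) t) (S N) - beta c t)%C).
  assert (CR : forall t, 0 < t -> cdiff (fun s => square_sum (fun n l => rest_integrand c (lattice c n l) s) (S N)) t).
  { intros t Ht. apply (cdiff_square_sum (fun n l => rest_integrand c (lattice c n l))).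
    intros; now apply cdiff_rest_integrand. }
  assert (L : clim (int_seq D) (square_sum (fun n l => log_rest c (lattice c n l)) (S N) - v)%C).
  { eapply clim_ext; [|apply (clim_minus (fun m => square_sum (fun n l => int_seq (rest_integrand c (lattice c n l)) m) (S N)));
      [|exact Hv]].
    - intros m. cbv beta. unfold D. rewrite int_seq_minus by (auto; intros; now apply cdiff_beta).
      rewrite <- (int_seq_square_sum (fun n l => rest_integrand c (lattice c n l))); [easy|].
      intros; now apply cdiff_rest_integrand.
    - unfold square_sum.
      apply (clim_Csum (fun n m => Csum (fun l => int_seq (rest_integrand c (lattice c n l)) m) (S N))). intros n _.
      apply (clim_Csum (fun l m => int_seq (rest_integrand c (lattice c n l)) m)). intros l _.
      apply rest_integrand_limit; [easy|now apply Re_lattice_pos]. }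
  match goal with |- Cmod ?x <= _ => replace x with (x - 0)%C by ring end.
  apply (clim_bound _ _ _ _ O L). intros m _.
  replace (int_seq D m - 0)%C with (int_seq D m) by ring.
  eapply Rle_trans; [apply (int_seq_bound D (3 * K) (slope c * INR (S N)))|].
  - nra.
  - lra.
  - intros t Ht. apply cdiff_minus; [now apply CR|now apply cdiff_beta].
  - intros t Ht. apply rest_square_sum_bound; [assumption|assumption|].
    eapply Rle_trans; [now apply HB|]. rewrite <- (Rmult_1_r K) at 2. apply Rmult_le_compat_l; [easy|].
    apply exp_le_1. lra.
  - right. unfold Rdiv. rewrite Rinv_mult. ring.
Qed.

(** At [w = base c] the divergent part simplifies, because [coef2 c * (1 + c) = 2 * coef1 c]. *)
Lemma zeta_deriv_limit (c : C) (F : C -> C) (d0 : C) : 0 < Re c -> is_zeta_continuation c F ->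
  is_derive (K := C_AbsRing) (V := C_NormedModule) F (RtoC 0) d0 ->
  clim (fun n => int_seq (fun t => bose c t / t) n
    - (coef2 c * (INR (S n) ^ 2 / 2) - coef1 c * INR (S n) + coef0 c * exp_integral 1 n))%C d0.
Proof.
  intros Hc HF HD. destruct (zeta_deriv_unique c F d0 Hc HF HD) as (d & Hd & ->).
  destruct (log_rest_sum c Hc) as (v & Hv & Hv').
  rewrite (clim_unique _ _ _ Hd Hv'). clear d Hd HD Hv'.
  assert (Hw : 0 < Re (base c)) by (unfold base; rewrite Re_plus; simpl; lra).
  pose proof (clim_plus _ _ _ _ (laurent_integral_limit c (base c) Hw) Hv) as L.
  revert L. apply clim_ext. intros n. cbv beta. unfold beta.
  rewrite int_seq_minus.
  - unfold divergent_part, base, coef2, coef1, coef0. generalize (INR (S n)). intros N. simpl Cpow.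
    field. now apply Re_neq_0.
  - intros t Ht. apply cdiff_div; [now apply cdiff_bose|apply cdiff_id|now apply RtoC_pos_neq_0].
  - intros t Ht. now apply cdiff_laurent_integrand.
Qed.

(** * Euler's constant and harmonic sums *)

Lemma clim_RtoC (u : nat -> R) (v : C) : clim (fun n => RtoC (u n)) v ->
  v = RtoC (Re v) /\ is_lim_seq u (Re v).
Proof.
  intros H. assert (L : is_lim_seq u (Re v)).
  { apply is_lim_seq_spec. intros eps. destruct (H eps (cond_pos eps)) as [N HN].
    exists N. intros n Hn. eapply Rle_lt_trans; [|apply (HN n Hn)].
    apply (re_le_Cmod (RtoC (u n) - v)%C). }
  split; [|exact L]. apply (clim_unique _ _ _ H). intros eps He.
  apply is_lim_seq_spec in L. destruct (L (mkposreal eps He)) as [N HN]. exists N. intros n Hn.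
  rewrite Cmod_RtoC_minus. now apply HN.
Qed.

Lemma exp_kernel_RtoC (x t : R) : exp_kernel x t = RtoC (exp (- (x * t))).
Proof. unfold exp_kernel. rewrite <- RtoC_mult, <- RtoC_opp. apply Cexp_RtoC. Qed.

Lemma one_minus_exp_bounds (t : R) : 0 < t -> 0 < 1 - exp (- t) <= t.
Proof.
  intros Ht. split.
  - pose proof (exp_increasing (- t) 0 ltac:(lra)) as H. rewrite exp_0 in H. lra.
  - pose proof (exp_ineq1_le (- t)). lra.
Qed.

Lemma bose_unit_bounds (t : R) : 0 < t -> 0 <= / (1 - exp (- t)) - / t <= 1.
Proof.
  intros Ht. pose proof (one_minus_exp_bounds t Ht) as [A B].
  pose proof (exp_pos (- t)) as P. split.
  - assert (/ t <= / (1 - exp (- t))) by (apply Rinv_le_contravar; lra). lra.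
  - assert (X : / (1 - exp (- t)) = 1 + exp (- t) * / (1 - exp (- t))) by (field; lra).
    assert (exp (- t) * / (1 - exp (- t)) <= / t); [|lra].
    replace (exp (- t) * / (1 - exp (- t))) with (/ (exp t - 1)).
    + apply Rinv_le_contravar; [lra|]. pose proof (exp_ineq1_le t). lra.
    + rewrite <- (Ropp_involutive t) at 1. rewrite (exp_Ropp (- t)). field. lra.
Qed.

Definition euler_integrand (t : R) : C := (exp_kernel 1 t / (1 - exp_kernel 1 t) - exp_kernel 1 t / t)%C.

Lemma cdiff_geometric (t : R) : 0 < t -> cdiff (fun t => exp_kernel 1 t / (1 - exp_kernel 1 t))%C t.
Proof.
  intros Ht. apply cdiff_div; [apply cdiff_exp_kernel| |].
  - apply cdiff_minus; [apply cdiff_const|apply cdiff_exp_kernel].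
  - apply one_minus_exp_kernel_neq_0; [simpl; lra|assumption].
Qed.

Lemma cdiff_euler_integrand (t : R) : 0 < t -> cdiff euler_integrand t.
Proof. intros Ht. apply cdiff_minus; [now apply cdiff_geometric|now apply cdiff_exp_integrand]. Qed.

Lemma RtoC_quotient_diff (t : R) : 0 < t ->
  (1 / (1 - exp_kernel 1 t) - 1 / t)%C = RtoC (/ (1 - exp (- t)) - / t).
Proof.
  intros Ht. pose proof (one_minus_exp_bounds t Ht) as [A B].
  rewrite exp_kernel_RtoC, Rmult_1_l, RtoC_minus, !RtoC_inv, RtoC_minus by lra. unfold Cdiv. ring.
Qed.

Lemma euler_integrand_bound (t : R) : 0 < t -> Cmod (euler_integrand t) <= 1 * exp (- (1 * t)).
Proof.
  intros Ht. unfold euler_integrand.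
  replace (exp_kernel 1 t / (1 - exp_kernel 1 t) - exp_kernel 1 t / t)%C
    with ((1 / (1 - exp_kernel 1 t) - 1 / t) * exp_kernel 1 t)%C by (unfold Cdiv; ring).
  pose proof (bose_unit_bounds t Ht).
  rewrite RtoC_quotient_diff, Cmod_mult, Cmod_exp_kernel, Cmod_RtoC_pos by lra. simpl (Re 1).
  apply Rmult_le_compat_r; [left; apply exp_pos|lra].
Qed.

(** The primitive [ln (1 - exp (- t))] tends to 0 at infinity and behaves like [ln t] at 0. *)
Lemma geometric_integral_limit :
  clim (fun n => int_seq (fun t => exp_kernel 1 t / (1 - exp_kernel 1 t))%C n - ln (INR (S n)))%C 0.
Proof.
  apply (clim_inv_bound _ _ 3). intros n.
  pose proof (inv_INR_S n) as [P1 P2]. pose proof (INR_S_ge_1 n) as P3.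
  set (N := INR (S n)) in *.
  assert (E : int_seq (fun t => exp_kernel 1 t / (1 - exp_kernel 1 t))%C n
     = RtoC (ln (1 - exp (- N)) - ln (1 - exp (- / N)))).
  { unfold int_seq. fold N. rewrite (CI_FTC (fun t => RtoC (ln (1 - exp (- t))))).
    - now rewrite RtoC_minus.
    - lra.
    - intros t Ht. pose proof (one_minus_exp_bounds t ltac:(lra)).
      rewrite exp_kernel_RtoC, Rmult_1_l, <- RtoC_minus, <- RtoC_div by lra.
      apply cderiv_RtoC. auto_derive; [lra|]. field. lra.
    - intros t Ht. apply cdiff_geometric. lra. }
  rewrite E, <- !RtoC_minus, Cmod_R.
  pose proof (one_minus_exp_bounds N ltac:(lra)) as [A1 A2].
  pose proof (one_minus_exp_bounds (/ N) P1) as [B1 B2].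
  assert (L1 : - (2 * / N) <= ln (1 - exp (- N)) <= 0).
  { split.
    - pose proof (exp_neg_le_inv N ltac:(lra)) as D.
      assert (H2 : exp (- N) <= / 2).
      { apply Rle_trans with (exp (Ropp 1)); [apply exp_le; lra|].
        rewrite exp_Ropp. apply Rinv_le_contravar; [lra|]. pose proof (exp_ineq1_le 1). lra. }
      assert (X : ln (/ (1 - exp (- N))) <= / (1 - exp (- N)) - 1).
      { pose proof (exp_ineq1_le (ln (/ (1 - exp (- N))))) as Y.
        rewrite exp_ln in Y by (now apply Rinv_0_lt_compat). lra. }
      rewrite ln_Rinv in X by lra.
      assert (/ (1 - exp (- N)) - 1 <= 2 * / N); [|lra].
      replace (/ (1 - exp (- N)) - 1) with (exp (- N) * / (1 - exp (- N))) by (field; lra).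
      rewrite Rmult_comm. apply Rmult_le_compat; try lra.
      + left; now apply Rinv_0_lt_compat.
      + left; apply exp_pos.
      + rewrite <- (Rinv_inv 2). apply Rinv_le_contravar; lra.
    - pose proof (exp_pos (- N)). rewrite <- ln_1. destruct (Rlt_dec (1 - exp (- N)) 1); [left; now apply ln_increasing|lra]. }
  assert (L2 : - / N <= ln (1 - exp (- / N)) + ln N <= 0).
  { rewrite <- ln_mult by lra. split.
    - rewrite <- (ln_exp (- / N)) at 1.
      assert (D : exp (- / N) <= (1 - exp (- / N)) * N).
      { apply Rmult_le_reg_l with (/ N); [easy|].
        replace (/ N * ((1 - exp (- / N)) * N)) with (1 - exp (- / N)) by (field; lra).
        pose proof (exp_ineq1_le (/ N)) as X. pose proof (exp_pos (- / N)).
        assert (Y : exp (/ N) * exp (- / N) = 1) by (rewrite <- exp_plus, Rplus_opp_r; apply exp_0).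
        nra. }
      destruct D as [D|D]; [left; apply ln_increasing; [apply exp_pos|exact D]|right; f_equal; exact D].
    - rewrite <- ln_1.
      assert (D : (1 - exp (- / N)) * N <= 1).
      { apply Rle_trans with (/ N * N); [apply Rmult_le_compat_r; lra|]. rewrite Rinv_l; lra. }
      destruct D as [D|D]; [left; apply ln_increasing; [nra|exact D]|right; f_equal; exact D]. }
  rewrite Rminus_0_r. apply Rabs_le. lra.
Qed.

Lemma exp_kernel_int_limit (w : C) : 0 < Re w -> clim (int_seq (exp_kernel w)) (/ w)%C.
Proof.
  intros Hw. assert (W0 : w <> RtoC 0) by now apply Re_neq_0.
  apply (clim_inv_bound _ _ (/ (Re w * Cmod w) + exp (Cmod w))). intros n.
  pose proof (inv_INR_S n) as [P1 P2]. pose proof (INR_S_ge_1 n) as P3.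
  unfold int_seq. rewrite CI_exp_kernel by (lra || assumption).
  replace ((exp_kernel w (/ INR (S n)) - exp_kernel w (INR (S n))) / w - / w)%C
    with (((exp_kernel w (/ INR (S n)) - 1) - exp_kernel w (INR (S n))) / w)%C by (field; assumption).
  pose proof (proj1 (Cmod_gt_0 w) W0) as Pw.
  rewrite Cmod_div by assumption. apply Rmult_le_reg_r with (Cmod w); [easy|].
  unfold Rdiv. rewrite Rmult_assoc, Rinv_l, Rmult_1_r by lra.
  eapply Rle_trans; [apply Cmod_minus_le|].
  replace ((/ (Re w * Cmod w) + exp (Cmod w)) * / INR (S n) * Cmod w)
    with (Cmod w * / INR (S n) * exp (Cmod w) + / (Re w * INR (S n))) by (field; lra).
  apply Rplus_le_compat.
  - unfold exp_kernel at 1. eapply Rle_trans; [apply Cexp_minus_1_bound|].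
    rewrite Cmod_opp, Cmod_mult, Cmod_RtoC_pos by lra.
    apply Rmult_le_compat_l; [nra|]. apply exp_le. nra.
  - rewrite Cmod_exp_kernel. apply exp_neg_le_inv. nra.
Qed.

Definition shifted_harmonic (x : R) (M : nat) : R := Rsum (fun k => / (INR k + x)) M.

Lemma shifted_harmonic_integral (x : R) (M : nat) : 0 < x ->
  clim (int_seq (fun t => Csum (fun k => exp_kernel (RtoC (INR k + x)) t) M)) (RtoC (shifted_harmonic x M)).
Proof.
  intros Hx.
  assert (E : RtoC (shifted_harmonic x M) = Csum (fun k => / RtoC (INR k + x))%C M).
  { unfold shifted_harmonic. induction M as [|M IH]; simpl; [easy|].
    pose proof (pos_INR M). rewrite RtoC_plus, IH, RtoC_inv by lra. reflexivity. }
  rewrite E. eapply clim_ext; [intros n; symmetry; apply int_seq_Csum|].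
  - intros k t _. apply cdiff_exp_kernel.
  - apply (clim_Csum (fun k n => int_seq (exp_kernel (RtoC (INR k + x))) n)). intros k _.
    apply exp_kernel_int_limit. simpl. pose proof (pos_INR k). lra.
Qed.

Lemma exp_kernel_sum (x t : R) (M : nat) : 0 < t ->
  Csum (fun k => exp_kernel (RtoC (INR k + x)) t) M
  = (exp_kernel x t / (1 - exp_kernel 1 t) * (1 - exp_kernel (RtoC (INR M)) t))%C.
Proof.
  intros Ht. pose proof (one_minus_exp_kernel_neq_0 1 t ltac:(simpl; lra) Ht) as N1.
  assert (P : forall k, exp_kernel (RtoC (INR k)) t = (exp_kernel 1 t ^ k)%C).
  { intros k. unfold exp_kernel. rewrite <- Cexp_INR. f_equal. ring. }
  rewrite P.
  rewrite (Csum_ext _ (fun k => exp_kernel x t * exp_kernel 1 t ^ k)%C).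
  - rewrite Csum_scal. pose proof (Csum_geom (exp_kernel 1 t) M) as G.
    replace (1 - exp_kernel 1 t ^ M)%C with ((1 - exp_kernel 1 t) * Csum (fun k => exp_kernel 1 t ^ k) M)%C
      by (rewrite <- G; reflexivity).
    change (Csum (Cpow (exp_kernel 1 t)) M) with (Csum (fun k => exp_kernel 1 t ^ k)%C M).
    field. assumption.
  - intros k _. rewrite RtoC_plus, exp_kernel_plus, P. ring.
Qed.

(** The harmonic sum is the integral of a finite geometric series and [ln M] is Frullani's integral;
    their difference misses the integral by that of a function bounded by [exp (- M t)]. Convergence
    has to be known before [Lim_seq] in the definition of the constant can be evaluated. *)
Lemma euler_limit : clim (fun M => RtoC (shifted_harmonic 1 (S M) - ln (INR (S M)))) (RtoC euler_mascheroni)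
  /\ clim (int_seq euler_integrand) (RtoC euler_mascheroni).
Proof.
  destruct (int_seq_limit euler_integrand 1 1) as [v Hv];
    [lra|lra|intros; now apply cdiff_euler_integrand|intros; now apply euler_integrand_bound|].
  assert (L : clim (fun M => RtoC (shifted_harmonic 1 (S M) - ln (INR (S M)))) v).
  { apply (clim_inv_bound _ _ 1). intros M. pose proof (INR_S_ge_1 M) as PM.
    set (R1 := fun t : R => ((1 / (1 - exp_kernel 1 t) - 1 / t - 1) * exp_kernel (RtoC (INR (S M))) t)%C).
    assert (CR : forall t, 0 < t -> cdiff R1 t).
    { intros t Ht. apply cdiff_mult; [|apply cdiff_exp_kernel].
      pose proof (one_minus_exp_kernel_neq_0 1 t ltac:(simpl; lra) Ht). pose proof (RtoC_pos_neq_0 t Ht).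
      unfold exp_kernel in *. cdiff_tac. }
    assert (LM : 0 < Re (RtoC (INR (S M)))) by (change (0 < INR (S M)); lra).
    pose proof (exp_integral_limit (RtoC (INR (S M))) LM) as LF.
    rewrite Clog_pos in LF by lra.
    pose proof (clim_minus _ _ _ _ (clim_plus _ _ _ _ (shifted_harmonic_integral 1 (S M) Rlt_0_1) LF) Hv) as L.
    replace (RtoC (shifted_harmonic 1 (S M) - ln (INR (S M))) - v)%C
      with (shifted_harmonic 1 (S M) + - ln (INR (S M)) - v - 0)%C by (rewrite RtoC_minus; ring).
    apply (clim_bound _ _ _ _ O L). intros m _.
    assert (E : (int_seq (fun t => Csum (fun k => exp_kernel (RtoC (INR k + 1)) t) (S M)) m
        + (exp_integral (RtoC (INR (S M))) m - exp_integral 1 m) - int_seq euler_integrand m - 0)%C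
        = (- (1) * int_seq R1 m)%C).
    { unfold exp_integral.
      rewrite <- int_seq_scal by exact CR.
      rewrite <- (int_seq_minus (fun t => exp_kernel (RtoC (INR (S M))) t / t)%C) by (intros; now apply cdiff_exp_integrand).
      rewrite <- int_seq_plus.
      - match goal with |- (?a - ?z)%C = _ => replace (a - z)%C with a by ring end.
        rewrite <- int_seq_minus.
        + apply int_seq_ext. intros t Ht. rewrite exp_kernel_sum by exact Ht. unfold euler_integrand, R1.
          pose proof (one_minus_exp_kernel_neq_0 1 t ltac:(simpl; lra) Ht). pose proof (RtoC_pos_neq_0 t Ht).
          field. split; assumption.
        + intros t Ht. apply cdiff_plus; [|apply cdiff_minus; now apply cdiff_exp_integrand].
          apply cdiff_Csum. intros; apply cdiff_exp_kernel.
        + intros; now apply cdiff_euler_integrand.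
      - intros; apply cdiff_Csum; intros; apply cdiff_exp_kernel.
      - intros; apply cdiff_minus; now apply cdiff_exp_integrand. }
    rewrite E, Cmod_mult, Cmod_m1, Rmult_1_l.
    eapply Rle_trans; [apply (int_seq_bound R1 1 (INR (S M))); [lra|lra|exact CR|]|].
    - intros t Ht. unfold R1. pose proof (bose_unit_bounds t Ht).
      rewrite RtoC_quotient_diff, <- RtoC_minus, Cmod_mult, Cmod_exp_kernel, Cmod_R by exact Ht.
      apply Rmult_le_compat_r; [left; apply exp_pos|]. apply Rabs_le. lra.
    - unfold Rdiv. lra. }
  destruct (clim_RtoC _ _ L) as [Ev LR].
  assert (EG : euler_mascheroni = Re v).
  { unfold euler_mascheroni. rewrite (is_lim_seq_unique _ (Re v)); [easy|].
    (* The shift skips the index 0, where the logarithm takes its default value. *)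
    apply is_lim_seq_incr_1. revert LR. apply is_lim_seq_ext. intros n. f_equal.
    unfold shifted_harmonic. induction n as [|n IH].
    - rewrite sum_n_n. simpl. field.
    - change (Rsum (fun k => / (INR k + 1)) (S (S n))) with (Rsum (fun k => / (INR k + 1)) (S n) + / (INR (S n) + 1)).
      rewrite sum_n_Sm by lia. rewrite IH, <- S_INR. reflexivity. }
  rewrite EG, <- Ev. now split.
Qed.

Lemma exp_integral_1_limit :
  clim (fun n => exp_integral 1 n - ln (INR (S n)))%C (- euler_mascheroni)%C.
Proof.
  pose proof (clim_minus _ _ _ _ geometric_integral_limit (proj2 euler_limit)) as L.
  replace (- euler_mascheroni)%C with (0 - euler_mascheroni)%C by ring.
  revert L. apply clim_ext. intros n. cbv beta. unfold euler_integrand, exp_integral.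
  rewrite int_seq_minus; [ring| |].
  - intros; now apply cdiff_geometric.
  - intros; now apply cdiff_exp_integrand.
Qed.

(** * Gauss's integral and the digamma series *)

Definition digamma_integrand (x t : R) : C := ((exp_kernel 1 t - exp_kernel x t) / (1 - exp_kernel 1 t))%C.

Lemma cdiff_digamma_integrand (x t : R) : 0 < t -> cdiff (digamma_integrand x) t.
Proof.
  intros Ht. pose proof (one_minus_exp_kernel_neq_0 1 t ltac:(simpl; lra) Ht).
  unfold digamma_integrand, exp_kernel in *. cdiff_tac.
Qed.

Lemma digamma_integrand_bound (x t : R) : 0 < x <= 1 -> 0 < t ->
  Cmod (digamma_integrand x t) <= 1 * exp (- (x * t)).
Proof.
  intros Hx Ht. pose proof (one_minus_exp_bounds t Ht) as [A B].
  unfold digamma_integrand. rewrite !exp_kernel_RtoC, !Rmult_1_l, <- !RtoC_minus, <- RtoC_div, Cmod_R by lra.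
  assert (E : exp (- t) = exp (- (x * t)) * exp (- ((1 - x) * t))) by (rewrite <- exp_plus; f_equal; ring).
  assert (E1 : exp (- ((1 - x) * t)) <= 1) by (apply exp_le_1; nra).
  assert (E2 : exp (- t) <= exp (- ((1 - x) * t))) by (apply exp_le; nra).
  pose proof (exp_pos (- (x * t))).
  unfold Rdiv. rewrite Rabs_mult, (Rabs_pos_eq (/ _)) by (left; now apply Rinv_0_lt_compat).
  apply Rmult_le_reg_r with (1 - exp (- t)); [easy|]. rewrite Rmult_assoc, Rinv_l, Rmult_1_r by lra.
  rewrite Rabs_left1 by nra. nra.
Qed.

(** The comparison made for Euler's constant, applied to the difference of two harmonic sums; the
    logarithm enters only through the limit that defines the constant. *)
Lemma digamma_series_integral (x : R) : 0 < x <= 1 ->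
  exists v : R, clim (int_seq (digamma_integrand x)) (RtoC v) /\
    is_lim_seq (fun M => ln (INR (S M)) - shifted_harmonic x (S M)) (v - euler_mascheroni).
Proof.
  intros Hx.
  destruct (int_seq_limit (digamma_integrand x) 1 x) as [v Hv];
    [lra|lra|intros; now apply cdiff_digamma_integrand|intros; now apply digamma_integrand_bound|].
  assert (L : clim (fun M => RtoC (shifted_harmonic 1 (S M) - shifted_harmonic x (S M))) v).
  { apply (clim_inv_bound _ _ 1). intros M. pose proof (INR_S_ge_1 M) as PM.
    set (R1 := fun t : R => (digamma_integrand x t * exp_kernel (RtoC (INR (S M))) t)%C).
    assert (CR : forall t, 0 < t -> cdiff R1 t).
    { intros t Ht. apply cdiff_mult; [now apply cdiff_digamma_integrand|apply cdiff_exp_kernel]. }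
    pose proof (clim_minus _ _ _ _ (clim_minus _ _ _ _ (shifted_harmonic_integral 1 (S M) Rlt_0_1)
      (shifted_harmonic_integral x (S M) (proj1 Hx))) Hv) as L.
    replace (RtoC (shifted_harmonic 1 (S M) - shifted_harmonic x (S M)) - v)%C
      with (shifted_harmonic 1 (S M) - shifted_harmonic x (S M) - v - 0)%C by (rewrite RtoC_minus; ring).
    apply (clim_bound _ _ _ _ O L). intros m _.
    assert (CS : forall y t, 0 < t -> cdiff (fun t => Csum (fun k => exp_kernel (RtoC (INR k + y)) t) (S M)) t).
    { intros; apply cdiff_Csum; intros; apply cdiff_exp_kernel. }
    match goal with |- Cmod ?a <= _ => replace a with (- (1) * int_seq R1 m)%C end.
    - rewrite Cmod_mult, Cmod_m1, Rmult_1_l.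
      eapply Rle_trans; [apply (int_seq_bound R1 1 (INR (S M))); [lra|lra|exact CR|]|].
      + intros t Ht. unfold R1. rewrite Cmod_mult, Cmod_exp_kernel. change (Re (RtoC (INR (S M)))) with (INR (S M)).
        apply Rmult_le_compat_r; [left; apply exp_pos|].
        eapply Rle_trans; [now apply digamma_integrand_bound|]. rewrite Rmult_1_l. apply exp_le_1. nra.
      + unfold Rdiv. lra.
    - rewrite <- int_seq_scal by exact CR.
      match goal with |- _ = (?a - ?z)%C => replace (a - z)%C with a by ring end.
      rewrite <- int_seq_minus by (intros; now apply CS).
      rewrite <- int_seq_minus.
      + apply int_seq_ext. intros t Ht. rewrite !exp_kernel_sum by exact Ht. unfold R1, digamma_integrand.
        pose proof (one_minus_exp_kernel_neq_0 1 t ltac:(simpl; lra) Ht). field. assumption.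
      + intros; apply cdiff_minus; now apply CS.
      + intros; now apply cdiff_digamma_integrand. }
  destruct (clim_RtoC _ _ L) as [Ev LR]. destruct (clim_RtoC _ _ (proj1 euler_limit)) as [_ LE].
  change (Re (RtoC euler_mascheroni)) with euler_mascheroni in LE.
  exists (Re v). rewrite <- Ev. split; [exact Hv|].
  pose proof (is_lim_seq_minus' _ _ _ _ LR LE) as LL.
  revert LL. apply is_lim_seq_ext. intros n. ring.
Qed.

(** * The two integrals *)

(** The bound [K / q * / (q * a)] on the tail beyond [a] gives a single limit for real and for
    integer upper ends. *)
Lemma tail_integral (f : R -> C) (K q : R) : 0 < q -> 0 <= K ->
  (forall t, 1 <= t -> cdiff f t) -> (forall t, 1 <= t -> Cmod (f t) <= K * exp (- (q * t))) ->
  exists v, is_RInt_gen (V := C_R_NormedModule) f (at_point 1) (Rbar_locally p_infty) v /\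
    clim (fun n => CI f 1 (INR (S n))) v.
Proof.
  intros Hq HK Hf HB.
  assert (HKq : 0 <= K / q) by (apply Rmult_le_pos; [easy|left; now apply Rinv_0_lt_compat]).
  assert (Diff : forall a b, 1 <= a -> a <= b -> Cmod (CI f 1 b - CI f 1 a)%C <= K / q * / (q * a)).
  { intros a b Ha Hab.
    rewrite (CI_Chasles f 1 a b) by (try lra; intros; apply Hf; lra).
    replace (CI f 1 a + CI f a b - CI f 1 a)%C with (CI f a b) by ring.
    eapply Rle_trans; [apply (CI_bound_exp f K q); try lra; intros; [apply Hf|apply HB]; lra|].
    apply Rmult_le_compat_l; [easy|].
    pose proof (exp_pos (- (q * b))). pose proof (exp_neg_le_inv (q * a) ltac:(nra)). lra. }
  assert (Key : forall eps, 0 < eps -> exists M, 1 <= M /\ forall a b, M <= a -> a <= b -> Cmod (CI f 1 b - CI f 1 a)%C < eps).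
  { intros eps He. exists (Rmax 1 ((K / q + 1) / (q * eps))). split; [apply Rmax_l|]. intros a b Ha Hab.
    pose proof (Rle_trans _ _ _ (Rmax_l _ _) Ha) as A1. pose proof (Rle_trans _ _ _ (Rmax_r _ _) Ha) as A2.
    eapply Rle_lt_trans; [now apply Diff|].
    assert (Q : 0 < q * eps) by nra.
    apply Rmult_le_compat_l with (r := q * eps) in A2; [|lra].
    replace (q * eps * ((K / q + 1) / (q * eps))) with (K / q + 1) in A2 by (field; lra).
    apply Rmult_lt_reg_r with (q * a); [nra|]. rewrite Rmult_assoc, Rinv_l by nra. nra. }
  destruct (clim_cauchy (fun n => CI f 1 (INR (S n)))) as [v Hv].
  { intros eps He. destruct (Key eps He) as (M & HM & H).
    destruct (INR_unbounded M) as [N HN].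
    assert (G : forall n m, (N <= n)%nat -> (n <= m)%nat -> Cmod (CI f 1 (INR (S m)) - CI f 1 (INR (S n)))%C < eps).
    { intros n m Hn Hm. apply H; [|apply le_INR; lia]. apply Rle_trans with (INR N); [lra|apply le_INR; lia]. }
    exists N. intros n m Hn Hm. destruct (Nat.le_ge_cases n m); [rewrite Cmod_minus_sym|]; now apply G. }
  exists v. split; [|exact Hv].
  intros P [e He].
  assert (He2 : 0 < e / 2) by (pose proof (cond_pos e); lra).
  destruct (Key (e / 2) He2) as (M & HM & H).
  exists (fun x => x = 1) (fun x => M < x); [easy|now exists M|].
  intros x y -> Hy. simpl. exists (CI f 1 y). split.
  - apply is_CI_CI; [lra|]. intros t Ht. apply Hf; lra.
  - apply He.
    assert (D : Cmod (CI f 1 y - v)%C < e).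
    { apply Rle_lt_trans with (e / 2); [|lra]. rewrite Cmod_minus_sym.
      destruct (INR_unbounded y) as [N HN].
      apply (clim_bound _ _ _ _ N Hv). intros n Hn. left. apply H; [lra|].
      apply Rle_trans with (INR N); [lra|apply le_INR; lia]. }
    split.
    + apply (Rle_lt_trans _ _ _ (re_le_Cmod (CI f 1 y - v)%C) D).
    + apply (Rle_lt_trans _ _ _ (im_le_Cmod (CI f 1 y - v)%C) D).
Qed.

Lemma continuous_lipschitz (f : R -> C) (t : R) (K : R) :
  (forall s, Cmod (f s - f t)%C <= K * Rabs (s - t)) -> continuous (U := C_R_CompleteNormedModule) f t.
Proof.
  intros H P [e He]. pose proof (Rabs_pos K). pose proof (Rle_abs K).
  assert (Hd : 0 < e / (Rabs K + 1)) by (apply Rdiv_lt_0_compat; [apply cond_pos|lra]).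
  exists (mkposreal _ Hd). intros y Hy. apply He.
  change (Rabs (y - t) < e / (Rabs K + 1)) in Hy.
  assert (D : Cmod (f y - f t)%C < e).
  { eapply Rle_lt_trans; [apply H|]. pose proof (Rabs_pos (y - t)).
    apply Rle_lt_trans with ((Rabs K + 1) * Rabs (y - t)); [nra|].
    apply Rmult_lt_compat_l with (r := Rabs K + 1) in Hy; [|lra].
    replace ((Rabs K + 1) * (e / (Rabs K + 1))) with (pos e) in Hy by (field; lra). exact Hy. }
  split.
  - apply (Rle_lt_trans _ _ _ (re_le_Cmod (f y - f t)%C) D).
  - apply (Rle_lt_trans _ _ _ (im_le_Cmod (f y - f t)%C) D).
Qed.

(** The singularity is removed by passing to [g], which takes the limit [L] for [t <= 0]; it is
    constant beyond 1, so that the linear bound holds on the whole line. *)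
Lemma unit_integral (f : R -> C) (L : C) (K : R) : 0 <= K -> (forall t, 0 < t -> cdiff f t) ->
  (forall t, 0 < t <= 1 -> Cmod (f t - L)%C <= K * t) ->
  ex_RInt (V := C_R_NormedModule) f 0 1 /\ clim (fun n => CI f (/ INR (S n)) 1) (CI f 0 1).
Proof.
  intros HK Hf HB.
  set (g := fun t => if Rle_dec t 0 then L else if Rle_dec 1 t then f 1 else f t).
  assert (Bg : forall t, Cmod (g t - L)%C <= K * Rabs t).
  { intros t. unfold g. destruct (Rle_dec t 0) as [T|T].
    - replace (L - L)%C with (RtoC 0) by ring. rewrite Cmod_0. apply Rmult_le_pos; [easy|apply Rabs_pos].
    - rewrite Rabs_pos_eq by lra. destruct (Rle_dec 1 t).
      + eapply Rle_trans; [apply HB; lra|]. apply Rmult_le_compat_l; lra.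
      + apply HB; lra. }
  assert (Cg : forall t, 0 <= t < 1 -> continuous (U := C_R_CompleteNormedModule) g t).
  { intros t [T0 T1]. destruct (Req_dec t 0) as [->|N].
    - apply (continuous_lipschitz g 0 K). intros s. rewrite Rminus_0_r.
      replace (g 0) with L; [apply Bg|]. unfold g. destruct (Rle_dec 0 0); [easy|lra].
    - apply (continuous_ext_loc _ f); [|apply cdiff_continuous, Hf; lra].
      assert (P : 0 < Rmin t (1 - t)) by (apply Rmin_glb_lt; lra).
      exists (mkposreal _ P). intros y Hy. change (Rabs (y - t) < Rmin t (1 - t)) in Hy.
      pose proof (Rlt_le_trans _ _ _ Hy (Rmin_l _ _)) as H1. pose proof (Rlt_le_trans _ _ _ Hy (Rmin_r _ _)) as H2.
      apply Rabs_def2 in H1. apply Rabs_def2 in H2. unfold g.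
      destruct (Rle_dec y 0); [lra|]. destruct (Rle_dec 1 y); [lra|easy]. }
  assert (E : forall b, 0 <= b -> b < 1 -> ex_RInt (V := C_R_NormedModule) f 0 b).
  { intros b B0 B1. apply (ex_RInt_ext (V := C_R_NormedModule) g).
    - rewrite Rmin_left, Rmax_right by easy. intros t Ht. unfold g.
      destruct (Rle_dec t 0); [lra|]. destruct (Rle_dec 1 t); [lra|easy].
    - apply (ex_RInt_continuous (V := C_R_CompleteNormedModule)).
      rewrite Rmin_left, Rmax_right by easy. intros t Ht. apply Cg; lra. }
  assert (E2 : forall b, 0 < b -> b <= 1 -> ex_RInt (V := C_R_NormedModule) f b 1).
  { intros b B0 B1. apply cdiff_ex_RInt; [easy|]. intros t Ht. apply Hf; lra. }
  assert (E1 : ex_RInt (V := C_R_NormedModule) f 0 1).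
  { apply (ex_RInt_Chasles (V := C_R_NormedModule) f 0 (/ 2) 1); [apply E; lra|apply E2; lra]. }
  split; [exact E1|].
  (* The shift makes the lower end strictly less than 1, the range in which [g] is known to be
     continuous. *)
  apply clim_shift.
  apply (clim_inv_bound _ _ (Cmod L + K)). intros n.
  set (b := / INR (S (S n))).
  pose proof (inv_INR_S n) as [Q1 Q2]. pose proof (inv_INR_S (S n)) as [P1 P2]. fold b in P1, P2.
  assert (b1 : b < / INR (S n)).
  { apply Rinv_lt_contravar; [|apply lt_INR; lia]. apply Rmult_lt_0_compat; apply lt_0_INR; lia. }
  assert (CH : CI f 0 1 = (CI f 0 b + CI f b 1)%C).
  { symmetry. apply (RInt_Chasles (V := C_R_CompleteNormedModule)); [apply E|apply E2]; lra. }
  rewrite CH. replace (CI f b 1 - (CI f 0 b + CI f b 1))%C with (- CI f 0 b)%C by ring.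
  rewrite Cmod_opp, <- norm_C_R.
  assert (Eg : CI f 0 b = CI g 0 b).
  { apply (RInt_ext (V := C_R_CompleteNormedModule)). rewrite Rmin_left, Rmax_right by lra.
    intros t Ht. unfold g. destruct (Rle_dec t 0); [lra|]. destruct (Rle_dec 1 t); [lra|easy]. }
  rewrite Eg.
  eapply Rle_trans; [apply (norm_RInt_le_const (V := C_R_NormedModule) g 0 b _ (Cmod L + K))|].
  - lra.
  - intros t Ht. rewrite norm_C_R. replace (g t) with (L + (g t - L))%C by ring.
    eapply Rle_trans; [apply Cmod_triangle|]. apply Rplus_le_compat_l. eapply Rle_trans; [apply Bg|].
    rewrite <- (Rmult_1_r K) at 2. apply Rmult_le_compat_l; [easy|]. rewrite Rabs_pos_eq; lra.
  - apply (RInt_correct (V := C_R_CompleteNormedModule)).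
    apply (ex_RInt_continuous (V := C_R_CompleteNormedModule)).
    rewrite Rmin_left, Rmax_right by lra. intros t Ht. apply Cg; lra.
  - rewrite Rminus_0_r, Rmult_comm. apply Rmult_le_compat_l; [|lra]. pose proof (Cmod_ge_0 L). lra.
Qed.

Lemma cdiff_integrand_infty (c : C) (t : R) : 0 < Re c -> 0 < t -> cdiff (integrand_infty c) t.
Proof.
  intros Hc Ht. unfold integrand_infty.
  pose proof (RtoC_pos_neq_0 t Ht). pose proof (Cexp_t_neq_1 t Ht). pose proof (Cexp_ct_neq_1 c t Hc Ht).
  cdiff_tac. now apply Cpow_neq_0.
Qed.

Lemma cdiff_integrand_unit (c : C) (t : R) : 0 < Re c -> 0 < t -> cdiff (integrand_unit c) t.
Proof.
  intros Hc Ht. unfold integrand_unit.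
  pose proof (RtoC_pos_neq_0 t Ht) as T0. pose proof (Cexp_t_neq_1 t Ht). pose proof (Cexp_ct_neq_1 c t Hc Ht).
  pose proof (Re_neq_0 c Hc) as C0. pose proof (Cpow_neq_0 c 2 C0) as C2.
  assert (T2 : RtoC 2 <> RtoC 0) by (apply RtoC_neq; lra).
  cdiff_tac.
  - apply Cmult_neq_0; [easy|now apply Cpow_neq_0].
  - apply Cmult_neq_0; [easy|now apply Cpow_neq_0].
  - apply Cmult_neq_0; [|easy]. now apply Cmult_neq_0.
Qed.

Lemma inv_Cexp_ct_bound (c : C) (t : R) : 0 < Re c -> 1 <= t -> Cmod (/ (Cexp (c * t) - 1))%C <= / Re c.
Proof.
  intros Hc Ht. pose proof (Cmod_Cexp_minus_1_ge (c * t)%C) as B. rewrite Re_scal in B.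
  rewrite Cmod_inv by (apply Cexp_ct_neq_1; lra). apply Rinv_le_contravar; nra.
Qed.

Lemma inv_Cexp_t_bound (t : R) : 1 <= t -> Cmod (/ (Cexp t - 1))%C <= 2 * exp (- t).
Proof.
  intros Ht. pose proof (exp_ineq1_le t).
  rewrite Cmod_inv by (apply Cexp_t_neq_1; lra). rewrite Cexp_RtoC, <- RtoC_minus, Cmod_RtoC_pos by lra.
  now apply inv_expm1_bound.
Qed.

Lemma integrand_infty_bound (c : C) : 0 < Re c ->
  exists K, 0 <= K /\ forall t, 1 <= t -> Cmod (integrand_infty c t) <= K * exp (- (1 * t)).
Proof.
  intros Hc. assert (I : 0 < / Re c) by now apply Rinv_0_lt_compat.
  exists (2 * ((1 + / Re c) * / Re c)). split; [nra|]. intros t Ht.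
  pose proof (RtoC_pos_neq_0 t ltac:(lra)) as T0. pose proof (Cexp_t_neq_1 t ltac:(lra)).
  pose proof (Cexp_ct_neq_1 c t Hc ltac:(lra)) as X0.
  pose proof (inv_Cexp_t_bound t Ht) as B1. pose proof (inv_Cexp_ct_bound c t Hc Ht) as B2.
  set (X := (Cexp (c * t) - 1)%C) in *.
  replace (integrand_infty c t) with (- (/ (Cexp t - 1) * ((1 + / X) * / X)))%C.
  2:{ unfold integrand_infty. fold X. replace (Cexp (c * t)) with (X + 1)%C by (unfold X; ring).
      simpl Cpow. field. repeat split; assumption. }
  rewrite Cmod_opp, !Cmod_mult, Rmult_1_l.
  assert (B3 : Cmod (1 + / X)%C <= 1 + / Re c).
  { eapply Rle_trans; [apply Cmod_triangle|]. rewrite Cmod_1. lra. }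
  pose proof (Cmod_ge_0 (/ X)%C). pose proof (Cmod_ge_0 (1 + / X)%C). pose proof (Cmod_ge_0 (/ (Cexp t - 1))%C).
  replace (2 * ((1 + / Re c) * / Re c) * exp (- t)) with (2 * exp (- t) * ((1 + / Re c) * / Re c)) by ring.
  apply Rmult_le_compat; try easy; [now apply Rmult_le_pos|]. apply Rmult_le_compat; easy.
Qed.

Lemma Cexp_over_square (u : C) : (Cexp u / (Cexp u - 1) ^ 2 = 1 / u ^ 2 - 1 / 12 - todd1 u)%C.
Proof. unfold todd1, Cdiv. ring. Qed.

(** Here the poles have cancelled against the counterterms: the value [- 1 / 24] at 0 becomes
    visible. *)
Lemma integrand_unit_todd (c : C) (t : R) : 0 < Re c -> 0 < t ->
  integrand_unit c t = (1 / (Cexp t - 1) * todd1 (c * t) - 1 / 24 + t / 144 + todd t / 12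
    - todd t / (c ^ 2 * t ^ 2))%C.
Proof.
  intros Hc Ht. pose proof (RtoC_pos_neq_0 t Ht) as T0. pose proof (Cexp_t_neq_1 t Ht) as X0.
  pose proof (Cexp_ct_neq_1 c t Hc Ht) as Y0. pose proof (Re_neq_0 c Hc) as C0.
  transitivity (1 / t * (- t * (1 / (Cexp t - 1)) * (Cexp (c * t) / (Cexp (c * t) - 1) ^ 2)
     + 1 / (c ^ 2 * t ^ 2) - 1 / (2 * c ^ 2 * t) - 1 / 12 + 1 / (12 * c ^ 2)))%C.
  - unfold integrand_unit. simpl Cpow. field. repeat split; assumption.
  - rewrite Cexp_over_square, bose_factor. simpl Cpow. field. split; assumption.
Qed.

Lemma integrand_unit_near_0 (c : C) : 0 < Re c ->
  exists K, 0 <= K /\ forall t, 0 < t <= 1 -> Cmod (integrand_unit c t - - (1 / 24))%C <= K * t.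
Proof.
  intros Hc. set (Cond := fun t : R => 0 < t <= 1).
  destruct (todd_bounds_near c Hc) as (K & HK & B). destruct todd_real_bounds as (K' & HK' & B').
  assert (C0 : c <> RtoC 0) by now apply Re_neq_0.
  assert (Bt : bounded_on Cond RtoC) by (exists 1; intros t [H1 H2]; rewrite Cmod_RtoC_pos; lra).
  assert (B1 : bounded_on Cond (fun t => todd t / t ^ 3)%C).
  { apply (bounded_on_of_power Cond _ 3 K'); [now intros t [H _]|exact B']. }
  assert (B2 : bounded_on Cond (fun t => todd1 (c * t) / t ^ 2)%C).
  { apply (bounded_on_of_power Cond _ 2 K); [now intros t [H _]|]. intros t Ht. apply B; [|exact Ht].
    replace (c - c)%C with (RtoC 0) by ring. rewrite Cmod_0. lra. }
  set (T1 := fun t : R => (todd t / t ^ 3)%C) in *. set (T2 := fun t : R => (todd1 (c * t) / t ^ 2)%C) in *.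
  assert (BB : bounded_on Cond (fun t : R => (1 - t * / 2 + t ^ 2 * / 12 + t ^ 4 * T1 t) * T2 t + / 144
     + t ^ 2 * T1 t * / 12 - T1 t * / c ^ 2)%C) by bounded_tac.
  destruct (bounded_on_pos _ _ BB) as (K2 & HK2 & H). exists K2. split; [easy|]. intros t Ht.
  specialize (H t Ht). cbv beta in H. destruct Ht as [Ht Ht1].
  assert (T0 : RtoC t <> RtoC 0) by now apply RtoC_pos_neq_0.
  assert (E1 : todd t = (T1 t * t ^ 3)%C) by (unfold T1; simpl Cpow; field; assumption).
  assert (E2 : todd1 (c * t) = (T2 t * t ^ 2)%C) by (unfold T2; simpl Cpow; field; assumption).
  rewrite integrand_unit_todd, bose_factor, E1, E2 by assumption.
  apply Rmult_le_compat_r with (r := Cmod t) in H; [|apply Cmod_ge_0].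
  rewrite <- Cmod_mult in H. rewrite (Cmod_RtoC_pos t) in H by lra.
  match type of H with Cmod ?x <= _ => match goal with |- Cmod ?y <= _ => replace y with x; [exact H|] end end.
  simpl Cpow. field. split; assumption.
Qed.

Lemma integrals_exist (c : C) : 0 < Re c ->
  ex_RInt_gen (V := C_R_NormedModule) (integrand_infty c) (at_point 1) (Rbar_locally p_infty) /\
  ex_RInt (V := C_R_NormedModule) (integrand_unit c) 0 1 /\
  clim (fun n => CI (integrand_unit c) (/ INR (S n)) 1 + CI (integrand_infty c) 1 (INR (S n)))%C
    (RInt_gen (V := C_R_CompleteNormedModule) (integrand_infty c) (at_point 1) (Rbar_locally p_infty)
     + RInt (V := C_R_CompleteNormedModule) (integrand_unit c) 0 1)%C.
Proof.
  intros Hc. destruct (integrand_infty_bound c Hc) as (K & HK & HB).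
  destruct (tail_integral (integrand_infty c) K 1) as (v & Hv & Lv);
    [lra|easy|intros; apply cdiff_integrand_infty; [easy|lra]|exact HB|].
  destruct (integrand_unit_near_0 c Hc) as (K' & HK' & HB').
  destruct (unit_integral (integrand_unit c) (- (1 / 24))%C K' HK') as [E L];
    [intros; now apply cdiff_integrand_unit|exact HB'|].
  split; [now exists v|]. split; [exact E|].
  rewrite (is_RInt_gen_unique (V := C_R_CompleteNormedModule) _ v Hv).
  change (RInt (V := C_R_CompleteNormedModule) (integrand_unit c) 0 1) with (CI (integrand_unit c) 0 1).
  rewrite (Cplus_comm v).
  now apply clim_plus.
Qed.

(** * Differentiation in [c] *)

Definition near_part (c : C) (t : R) : C := ((bose c t - laurent c t) / t)%C.
Definition far_part (c : C) (t : R) : C := (bose c t / t)%C.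

Lemma cdiff_far_part (c : C) (t : R) : 0 < Re c -> 0 < t -> cdiff (far_part c) t.
Proof.
  intros Hc Ht. apply cdiff_div; [now apply cdiff_bose|apply cdiff_id|now apply RtoC_pos_neq_0].
Qed.

Lemma cdiff_near_part (c : C) (t : R) : 0 < Re c -> 0 < t -> cdiff (near_part c) t.
Proof.
  intros Hc Ht. apply cdiff_div; [|apply cdiff_id|now apply RtoC_pos_neq_0].
  apply cdiff_minus; [now apply cdiff_bose|now apply cdiff_laurent].
Qed.

Definition split_integral (c : C) (n : nat) : C :=
  (CI (near_part c) (/ INR (S n)) 1 + CI (far_part c) 1 (INR (S n)))%C.

Lemma CI_laurent (c : C) (a : R) : 0 < a <= 1 ->
  CI (fun t => laurent c t / t)%C a 1
  = (coef2 c * ((/ a ^ 2 - 1) / 2) - coef1 c * (/ a - 1) - coef0 c * ln a)%C.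
Proof.
  intros Ha.
  rewrite (CI_FTC (fun t => coef2 c * RtoC (- / (2 * t ^ 2)) + coef1 c * RtoC (/ t) + coef0 c * RtoC (ln t))%C).
  - rewrite ln_1. rewrite !RtoC_opp, !RtoC_inv, !RtoC_mult, !RtoC_pow by nra.
    assert (A0 : RtoC a <> RtoC 0) by (apply RtoC_neq_0; lra). simpl Cpow. field. assumption.
  - lra.
  - intros t Ht.
    assert (D2 : is_derive (fun t => - / (2 * t ^ 2)) t (/ (t * t * t))) by (auto_derive; [nra|field; lra]).
    assert (D1 : is_derive (fun t => / t) t (- / (t * t))) by (auto_derive; [lra|field; lra]).
    assert (D0 : is_derive (fun t => ln t) t (/ t)) by (auto_derive; [lra|field; lra]).
    eapply cderiv_eq.
    + exact (cderiv_plus _ _ _ _ _ (cderiv_plus _ _ _ _ _ (cderiv_scal (coef2 c) _ _ _ (cderiv_RtoC _ _ _ D2))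
        (cderiv_scal (coef1 c) _ _ _ (cderiv_RtoC _ _ _ D1))) (cderiv_scal (coef0 c) _ _ _ (cderiv_RtoC _ _ _ D0))).
    + assert (T0 : RtoC t <> RtoC 0) by (apply RtoC_neq_0; lra).
      unfold laurent. rewrite RtoC_opp, !RtoC_inv, !RtoC_mult
        by (repeat apply Rmult_integral_contrapositive_currified; lra).
      simpl Cpow. field. assumption.
  - intros t Ht. apply cdiff_div; [apply cdiff_laurent; lra|apply cdiff_id|apply RtoC_pos_neq_0; lra].
Qed.

(** The constant [1 / 2] is [coef1 c - coef2 c / 2], from the primitive of the Laurent part at 1; it
    is independent of [c]. The exponential integral contributes Euler's constant with the factor
    [coef0 c]. *)
Lemma zeta_deriv_split (c : C) (F : C -> C) (d0 : C) : 0 < Re c -> is_zeta_continuation c F ->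
  is_derive (K := C_AbsRing) (V := C_NormedModule) F (RtoC 0) d0 ->
  clim (split_integral c) (d0 - 1 / 2 - coef0 c * euler_mascheroni)%C.
Proof.
  intros Hc HF HD. pose proof (zeta_deriv_limit c F d0 Hc HF HD) as L.
  pose proof (clim_plus _ _ _ _ L (clim_scal (coef0 c) _ _ exp_integral_1_limit)) as L2.
  pose proof (clim_minus _ _ _ _ L2 (clim_const (RtoC (1 / 2)))) as L3.
  replace (d0 - 1 / 2 - coef0 c * euler_mascheroni)%C
    with (d0 + coef0 c * - euler_mascheroni - RtoC (1 / 2))%C by (rewrite RtoC_div by lra; ring).
  revert L3. apply clim_ext. intros n. cbv beta.
  pose proof (inv_INR_S n) as [P1 P2]. pose proof (INR_S_ge_1 n) as P3.
  assert (E1 : int_seq (far_part c) n = (CI (far_part c) (/ INR (S n)) 1 + CI (far_part c) 1 (INR (S n)))%C).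
  { apply CI_Chasles; [lra|lra|]. intros t Ht. apply cdiff_far_part; lra. }
  assert (E2 : CI (near_part c) (/ INR (S n)) 1
     = (CI (far_part c) (/ INR (S n)) 1 - CI (fun t => laurent c t / t)%C (/ INR (S n)) 1)%C).
  { rewrite <- CI_minus.
    - apply CI_ext; [lra|]. intros t Ht. unfold near_part, far_part, Cdiv. ring.
    - lra.
    - intros t Ht. apply cdiff_far_part; lra.
    - intros t Ht. apply cdiff_div; [apply cdiff_laurent; lra|apply cdiff_id|apply RtoC_pos_neq_0; lra]. }
  unfold split_integral. rewrite E2, CI_laurent by lra.
  change (fun t => bose c t / t)%C with (far_part c). rewrite E1.
  rewrite ln_Rinv by lra.
  unfold coef2, coef1, coef0. assert (C0 : c <> RtoC 0) by now apply Re_neq_0.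
  revert P1 P2 P3 E1 E2. generalize (INR (S n)). intros N P1 P2 P3 _ _.
  assert (N0 : RtoC N <> RtoC 0) by (apply RtoC_neq_0; lra).
  rewrite RtoC_opp, RtoC_inv, RtoC_div by lra. simpl Cpow. field. split; assumption.
Qed.

Lemma todd_cderiv (u v : C) (s : R) : 0 < Re (u + s * v)%C ->
  cderiv (fun s : R => todd (u + s * v)) s (v * todd1 (u + s * v))%C.
Proof.
  intros H. set (w := (u + s * v)%C) in *.
  assert (W0 : w <> RtoC 0) by now apply Re_neq_0.
  assert (X0 : (Cexp w - 1)%C <> RtoC 0) by now apply Cexp_minus_1_neq_0.
  assert (T12 : RtoC 12 <> RtoC 0) by (apply RtoC_neq; lra).
  assert (D : cderiv (fun s : R => u + s * v)%C s v).
  { eapply cderiv_eq; [apply cderiv_plus; [apply cderiv_const|apply cderiv_mult;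
      [apply cderiv_RtoC, (is_derive_id (K := R_AbsRing))|apply cderiv_const]]|].
    unfold one; simpl. cbv beta. ring. }
  pose proof (cderiv_minus _ _ _ _ _ (cderiv_Cexp _ _ _ D) (cderiv_const 1 s)) as DX.
  pose proof (cderiv_minus _ _ _ _ _ (cderiv_plus _ _ _ _ _ (cderiv_minus _ _ _ _ _
     (cderiv_div _ _ _ _ _ (cderiv_const 1 s) DX X0) (cderiv_div _ _ _ _ _ (cderiv_const 1 s) D W0))
     (cderiv_const (1 / 2)%C s)) (cderiv_div _ _ _ _ _ D (cderiv_const 12 s) T12)) as DT.
  eapply cderiv_eq; [exact DT|]. cbv beta. fold w. unfold todd1. simpl Cpow. field. split; assumption.
Qed.

Lemma todd1_cderiv (u v : C) (s : R) : 0 < Re (u + s * v)%C ->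
  cderiv (fun s : R => todd1 (u + s * v)) s (v * todd2 (u + s * v))%C.
Proof.
  intros H. set (w := (u + s * v)%C) in *.
  assert (W0 : w <> RtoC 0) by now apply Re_neq_0.
  assert (X0 : (Cexp w - 1)%C <> RtoC 0) by now apply Cexp_minus_1_neq_0.
  assert (D : cderiv (fun s : R => u + s * v)%C s v).
  { eapply cderiv_eq; [apply cderiv_plus; [apply cderiv_const|apply cderiv_mult;
      [apply cderiv_RtoC, (is_derive_id (K := R_AbsRing))|apply cderiv_const]]|].
    unfold one; simpl. cbv beta. ring. }
  pose proof (cderiv_Cexp _ _ _ D) as DE.
  pose proof (cderiv_pow _ _ _ 2 (cderiv_minus _ _ _ _ _ DE (cderiv_const 1 s))) as DX.
  pose proof (cderiv_minus _ _ _ _ _ (cderiv_plus _ _ _ _ _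
     (cderiv_div _ _ _ _ _ (cderiv_opp _ _ _ DE) DX (Cpow_neq_0 _ 2 X0))
     (cderiv_div _ _ _ _ _ (cderiv_const 1 s) (cderiv_pow _ _ _ 2 D) (Cpow_neq_0 _ 2 W0)))
     (cderiv_const (1 / 12)%C s)) as DT.
  eapply cderiv_eq; [exact DT|]. cbv beta. fold w. unfold todd2. simpl INR. rewrite RtoC_plus.
  simpl Cpow. simpl pred. field. split; assumption.
Qed.

(** Taylor's formula along the segment from [c t] to [(c + h) t], on which [todd2] is uniformly
    bounded. *)
Lemma todd_second_order (c : C) : 0 < Re c -> exists K, 0 <= K /\
  forall h t, Cmod h <= Re c / 2 -> 0 < t <= 1 ->
    Cmod (todd ((c + h) * t) - todd (c * t) - h * t * todd1 (c * t))%C <= K * (Cmod h * t) ^ 2.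
Proof.
  intros Hc. destruct (todd_bounds_near c Hc) as (K & HK & B).
  exists K. split; [easy|]. intros h t Hh Ht.
  assert (Rp : forall s, 0 <= s <= 1 -> 0 < Re (c * t + RtoC s * (h * t))%C).
  { intros s Hs. replace (c * t + s * (h * t))%C with ((c + h * s) * t)%C by ring.
    rewrite Re_scal, Re_plus, Re_scal.
    pose proof (re_le_Cmod h) as Q. apply Rabs_le_between in Q.
    apply Rmult_lt_0_compat; nra. }
  pose proof (taylor_bound 2 (K * (Cmod h * t) ^ 2) (fun k s => (h * t) ^ k *
    match k with O => todd (c * t + RtoC s * (h * t)) | 1%nat => todd1 (c * t + RtoC s * (h * t))
      | _ => todd2 (c * t + RtoC s * (h * t)) end)%C) as T.
  simpl Csum in T. simpl fact in T. simpl INR in T. rewrite Rinv_1 in T.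
  match type of T with _ -> _ -> Cmod ?x <= _ =>
    replace (todd ((c + h) * t) - todd (c * t) - h * t * todd1 (c * t))%C with x end.
  - apply T.
    + intros [|[|k]] s Hk Hs; [| |lia].
      * eapply cderiv_eq; [apply cderiv_scal, todd_cderiv, Rp, Hs|simpl; ring].
      * eapply cderiv_eq; [apply cderiv_scal, todd1_cderiv, Rp, Hs|simpl; ring].
    + intros s Hs. rewrite Cmod_mult, Cmod_pow, Cmod_mult, (Cmod_RtoC_pos t) by lra.
      rewrite Rmult_comm. apply Rmult_le_compat_r; [apply pow_le, Rmult_le_pos; [apply Cmod_ge_0|lra]|].
      replace (c * t + s * (h * t))%C with ((c + s * h) * t)%C by ring.
      apply B; [|easy]. replace (c + s * h - c)%C with (s * h)%C by ring.
      rewrite Cmod_mult, Cmod_RtoC_pos by lra. pose proof (Cmod_ge_0 h). nra.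
  - replace (c * t + 1 * (h * t))%C with ((c + h) * t)%C by ring.
    replace (c * t + 0 * (h * t))%C with (c * t)%C by ring. simpl. ring.
Qed.

(** The increment of [todd (c t)] beyond first order is [O((h t) ^ 2)], which compensates the factor
    [1 / (t (exp t - 1))]. The other term comes from the exact second-order remainder of [1 / c]. *)
Lemma near_part_second_order (c : C) : 0 < Re c -> exists K, 0 <= K /\
  forall h t, Cmod h <= Re c / 2 -> 0 < t <= 1 ->
    Cmod (near_part (c + h) t - near_part c t - h * integrand_unit c t)%C <= K * Cmod h ^ 2.
Proof.
  intros Hc. destruct (todd_second_order c Hc) as (K & HK & B). destruct todd_real_bounds as (K' & HK' & B').
  pose proof (Re_le_Cmod_pos c) as Rc.
  set (A := Re c ^ 3 / 2). assert (HA : 0 < A) by (apply Rdiv_lt_0_compat; [now apply pow_lt|lra]).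
  exists (K + K' / A).
  assert (HKA : 0 <= K' / A) by (apply Rmult_le_pos; [easy|left; now apply Rinv_0_lt_compat]).
  split; [lra|]. intros h t Hh Ht.
  destruct (near_Re c (c + h)%C Hc) as [R1 R2]; [replace (c + h - c)%C with h by ring; easy|].
  assert (Hc' : 0 < Re (c + h)%C) by lra.
  pose proof (RtoC_pos_neq_0 t ltac:(lra)) as T0. pose proof (Cexp_t_neq_1 t ltac:(lra)) as X0.
  pose proof (Cexp_ct_neq_1 c t Hc ltac:(lra)) as Y0. pose proof (Cexp_ct_neq_1 (c + h) t Hc' ltac:(lra)) as Z0.
  pose proof (Re_neq_0 c Hc) as C0. pose proof (Re_neq_0 _ Hc') as C1.
  specialize (B h t Hh Ht). specialize (B' t Ht).
  set (p := (1 / (Cexp t - 1))%C).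
  assert (Hp : Cmod p <= / t).
  { unfold p. rewrite Cmod_div, Cmod_1 by assumption. unfold Rdiv. rewrite Rmult_1_l.
    apply Rinv_le_contravar; [lra|]. apply (Cmod_Cexp_minus_1_ge (RtoC t)). }
  assert (E : (near_part (c + h) t - near_part c t - h * integrand_unit c t)%C
     = (p / t * (todd ((c + h) * t) - todd (c * t) - h * t * todd1 (c * t))
        + h ^ 2 * todd t / (c ^ 2 * (c + h) * t ^ 2))%C).
  { assert (EB : forall d, 0 < Re d -> bose d t = (p * (todd (d * t) + 1 / (d * t) - 1 / 2 + d * t / 12))%C).
    { intros d Hd. rewrite <- bose_factor. unfold p, bose. field.
      split; [apply Cexp_ct_neq_1; lra|assumption]. }
    unfold near_part. rewrite !EB, integrand_unit_todd by lra. fold p.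
    assert (Ep : p = (todd t + 1 / t - 1 / 2 + t / 12)%C) by apply bose_factor.
    rewrite Ep. unfold laurent, coef2, coef1, coef0. simpl Cpow. field. repeat split; assumption. }
  rewrite E. clear E. eapply Rle_trans; [apply Cmod_triangle|]. rewrite Rmult_plus_distr_r.
  pose proof (Cmod_ge_0 h) as Ph. assert (It : 0 < / t) by (apply Rinv_0_lt_compat; lra).
  apply Rplus_le_compat.
  - rewrite Cmod_mult, Cmod_div, (Cmod_RtoC_pos t) by (assumption || lra).
    apply Rle_trans with (/ t * / t * (K * (Cmod h * t) ^ 2)).
    + apply Rmult_le_compat; [|apply Cmod_ge_0| |exact B].
      * apply Rmult_le_pos; [apply Cmod_ge_0|lra].
      * apply Rmult_le_compat_r; lra.
    + right. field. lra.
  - assert (D0 : (c ^ 2 * (c + h) * t ^ 2)%C <> RtoC 0).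
    { apply Cmult_neq_0; [apply Cmult_neq_0; [now apply Cpow_neq_0|assumption]|now apply Cpow_neq_0]. }
    rewrite Cmod_div, !Cmod_mult, !Cmod_pow, (Cmod_RtoC_pos t) by (assumption || lra).
    assert (Q1 : A <= Cmod c ^ 2 * Cmod (c + h)%C).
    { pose proof (Re_le_Cmod_pos (c + h)%C) as Q.
      replace A with (Re c ^ 2 * (Re c / 2)) by (unfold A; field).
      apply Rmult_le_compat; [apply pow2_ge_0|lra| |lra]. apply pow_incr; lra. }
    assert (T2 : 0 < t ^ 2) by (apply pow_lt; lra).
    set (Q := Cmod c ^ 2 * Cmod (c + h)%C) in *.
    apply Rle_trans with (Cmod h ^ 2 * (K' * t ^ 3) / (A * t ^ 2)).
    + apply Rmult_le_compat.
      * apply Rmult_le_pos; [apply pow2_ge_0|apply Cmod_ge_0].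
      * left. apply Rinv_0_lt_compat. apply Rmult_lt_0_compat; lra.
      * apply Rmult_le_compat_l; [apply pow2_ge_0|easy].
      * apply Rinv_le_contravar; [apply Rmult_lt_0_compat; lra|]. apply Rmult_le_compat_r; lra.
    + replace (Cmod h ^ 2 * (K' * t ^ 3) / (A * t ^ 2)) with (K' / A * Cmod h ^ 2 * t) by (field; lra).
      rewrite <- (Rmult_1_r (K' / A * Cmod h ^ 2)) at 2. apply Rmult_le_compat_l; [|lra].
      apply Rmult_le_pos; [easy|apply pow2_ge_0].
Qed.

(** The error factors exactly through [exp eta - 1] and [exp eta - 1 - eta] with [eta = h t]. For
    [Cmod h <= 1 / 4] their contribution grows at most like [t ^ 2 * exp (t / 2)], which
    [1 / (exp t - 1)] outweighs. *)
Lemma far_part_second_order (c : C) : 0 < Re c -> exists K, 0 <= K /\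
  forall h t, Cmod h <= Re c / 2 -> Cmod h <= / 4 -> 1 <= t ->
    Cmod (far_part (c + h) t - far_part c t - h * integrand_infty c t)%C
      <= K * Cmod h ^ 2 * exp (- (/ 4 * t)).
Proof.
  intros Hc. set (a := / Re c). assert (Ha : 0 < a) by now apply Rinv_0_lt_compat.
  assert (exists q, q = 1 + a) as [q Hq] by (now exists (1 + a)).
  set (K1 := q ^ 2 * (2 * a) + q * a).
  assert (HK1 : 0 <= K1) by (unfold K1; assert (0 <= q ^ 2) by apply pow2_ge_0; nra).
  exists (8 * K1). split; [lra|]. intros h t Hh Hh4 Ht.
  destruct (near_Re c (c + h)%C Hc) as [R1 R2]; [replace (c + h - c)%C with h by ring; easy|].
  assert (Hc' : 0 < Re (c + h)%C) by lra.
  pose proof (RtoC_pos_neq_0 t ltac:(lra)) as T0. pose proof (Cexp_t_neq_1 t ltac:(lra)) as X0.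
  pose proof (Cexp_ct_neq_1 c t Hc ltac:(lra)) as Y0. pose proof (Cexp_ct_neq_1 (c + h) t Hc' ltac:(lra)) as Z0.
  pose proof (inv_Cexp_t_bound t Ht) as Bp. pose proof (inv_Cexp_ct_bound c t Hc Ht) as BX. fold a in BX.
  pose proof (inv_Cexp_ct_bound (c + h) t Hc' Ht) as BX'.
  assert (BX2 : / Re (c + h)%C <= 2 * a).
  { unfold a. replace (2 * / Re c) with (/ (Re c / 2)) by (field; lra). apply Rinv_le_contravar; lra. }
  set (X := (Cexp (c * t) - 1)%C) in *. set (X' := (Cexp ((c + h) * t) - 1)%C) in *.
  set (eta := (h * t)%C).
  assert (EX' : X' = ((X + 1) * Cexp eta - 1)%C).
  { unfold X', X, eta. replace ((c + h) * t)%C with (c * t + h * t)%C by ring. rewrite Cexp_plus. ring. }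
  pose proof (Cexp_minus_1_bound eta) as B1. pose proof (Cexp_second_order eta) as B2.
  assert (Ee : Cmod eta = Cmod h * t) by (unfold eta; rewrite Cmod_mult, Cmod_RtoC_pos; lra).
  pose proof (Cmod_ge_0 h) as Ph.
  assert (Le : Cmod eta <= t / 4) by (rewrite Ee; nra).
  assert (BE : Cmod ((X + 1) * / X)%C <= q).
  { replace ((X + 1) * / X)%C with (1 + / X)%C by (field; assumption).
    eapply Rle_trans; [apply Cmod_triangle|]. rewrite Cmod_1. lra. }
  set (R := ((X + 1) * / X)%C) in *.
  assert (E : (far_part (c + h) t - far_part c t - h * integrand_infty c t)%C
     = (/ (Cexp t - 1) * / t * (R ^ 2 * / X' * (Cexp eta - 1) ^ 2 - R * / X * (Cexp eta - 1 - eta)))%C).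
  { unfold far_part, bose, integrand_infty. fold X X'.
    replace (Cexp (c * t)) with (X + 1)%C by (unfold X; ring).
    unfold R, eta in *. rewrite EX' in *. simpl Cpow. field. repeat split; assumption. }
  rewrite E. clear E.
  assert (B1' : Cmod (Cexp eta - 1)%C <= Cmod h * t * exp (t / 4)).
  { eapply Rle_trans; [exact B1|]. rewrite <- Ee. apply Rmult_le_compat_l; [apply Cmod_ge_0|now apply exp_le]. }
  assert (B2' : Cmod (Cexp eta - 1 - eta)%C <= (Cmod h * t) ^ 2 * exp (t / 2)).
  { eapply Rle_trans; [exact B2|]. rewrite <- Ee. apply Rmult_le_compat_l; [apply pow2_ge_0|apply exp_le; lra]. }
  assert (Main : Cmod (R ^ 2 * / X' * (Cexp eta - 1) ^ 2 - R * / X * (Cexp eta - 1 - eta))%C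
     <= K1 * (Cmod h * t) ^ 2 * exp (t / 2)).
  { eapply Rle_trans; [apply Cmod_minus_le|]. rewrite !Cmod_mult, !Cmod_pow.
    unfold K1. rewrite !Rmult_plus_distr_r. pose proof (Cmod_ge_0 R). pose proof (Cmod_ge_0 (/ X)%C).
    pose proof (Cmod_ge_0 (/ X')%C). apply Rplus_le_compat.
    - rewrite (Rmult_assoc (q ^ 2 * (2 * a))). apply Rmult_le_compat.
      + apply Rmult_le_pos; [apply pow2_ge_0|easy].
      + apply pow2_ge_0.
      + apply Rmult_le_compat; [apply pow2_ge_0|easy|apply pow_incr; lra|lra].
      + apply Rle_trans with ((Cmod h * t * exp (t / 4)) ^ 2); [apply pow_incr; split; [apply Cmod_ge_0|easy]|].
        rewrite Rpow_mult_distr. right. f_equal. simpl. rewrite Rmult_1_r, <- exp_plus. f_equal. field.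
    - rewrite (Rmult_assoc (q * a)). apply Rmult_le_compat.
      + now apply Rmult_le_pos.
      + apply Cmod_ge_0.
      + now apply Rmult_le_compat.
      + exact B2'. }
  rewrite Cmod_mult, Cmod_mult, (Cmod_inv t), (Cmod_RtoC_pos t) by (assumption || lra).
  apply Rle_trans with (2 * exp (- t) * / t * (K1 * (Cmod h * t) ^ 2 * exp (t / 2))).
  - apply Rmult_le_compat; [|apply Cmod_ge_0| |exact Main].
    + apply Rmult_le_pos; [apply Cmod_ge_0|left; apply Rinv_0_lt_compat; lra].
    + apply Rmult_le_compat_r; [left; apply Rinv_0_lt_compat; lra|exact Bp].
  (* Half of the remaining decay [exp (- t / 2)] is kept, the other half absorbs a factor [t]. *)
  - assert (Ex : exp (- t) * exp (t / 2) = exp (- (/ 4 * t)) * exp (- (t / 4))).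
    { rewrite <- !exp_plus. f_equal. field. }
    assert (Et : t * exp (- (t / 4)) <= 4).
    { pose proof (exp_neg_le_inv (t / 4) ltac:(lra)) as Q.
      apply Rmult_le_compat_l with (r := t) in Q; [|lra].
      replace (t * / (t / 4)) with 4 in Q by (field; lra). exact Q. }
    replace (2 * exp (- t) * / t * (K1 * (Cmod h * t) ^ 2 * exp (t / 2)))
      with (2 * K1 * Cmod h ^ 2 * t * (exp (- t) * exp (t / 2))) by (field; lra).
    rewrite Ex.
    replace (2 * K1 * Cmod h ^ 2 * t * (exp (- (/ 4 * t)) * exp (- (t / 4))))
      with (2 * K1 * Cmod h ^ 2 * exp (- (/ 4 * t)) * (t * exp (- (t / 4)))) by ring.
    replace (8 * K1 * Cmod h ^ 2 * exp (- (/ 4 * t))) with (2 * K1 * Cmod h ^ 2 * exp (- (/ 4 * t)) * 4) by ring.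
    apply Rmult_le_compat_l; [|exact Et].
    apply Rmult_le_pos; [|left; apply exp_pos]. apply Rmult_le_pos; [lra|apply pow2_ge_0].
Qed.

Lemma coef0_second_order (c h : C) : 0 < Re c -> Cmod h <= Re c / 2 ->
  Cmod (coef0 (c + h) - coef0 c - h * (1 / 12 - 1 / (12 * c ^ 2)))%C <= / Re c ^ 3 * Cmod h ^ 2.
Proof.
  intros Hc Hh.
  destruct (near_Re c (c + h)%C Hc) as [R1 R2]; [replace (c + h - c)%C with h by ring; easy|].
  assert (Hc' : 0 < Re (c + h)%C) by lra.
  pose proof (Re_neq_0 c Hc) as C0. pose proof (Re_neq_0 _ Hc') as C1.
  assert (D0 : (12 * (c ^ 2 * (c + h)))%C <> RtoC 0).
  { apply Cmult_neq_0; [apply RtoC_neq; lra|]. apply Cmult_neq_0; [now apply Cpow_neq_0|assumption]. }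
  replace (coef0 (c + h) - coef0 c - h * (1 / 12 - 1 / (12 * c ^ 2)))%C
    with (h ^ 2 / (12 * (c ^ 2 * (c + h))))%C by (unfold coef0; simpl Cpow; field; split; assumption).
  rewrite Cmod_div, !Cmod_mult, !Cmod_pow, (Cmod_RtoC_pos 12) by (assumption || lra).
  rewrite Rmult_comm. unfold Rdiv. rewrite Rmult_comm, (Rmult_comm (/ Re c ^ 3)), Rmult_comm.
  apply Rmult_le_compat_l; [apply pow2_ge_0|].
  pose proof (Re_le_Cmod_pos c) as Q1. pose proof (Re_le_Cmod_pos (c + h)%C) as Q2.
  apply Rinv_le_contravar; [now apply pow_lt|].
  assert (Re c ^ 2 * (Re c / 2) <= Cmod c ^ 2 * Cmod (c + h)%C).
  { apply Rmult_le_compat; [apply pow2_ge_0|lra| |lra]. apply pow_incr; lra. }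
  assert (0 < Re c ^ 3) by now apply pow_lt. simpl in *. lra.
Qed.

Lemma cdiff_increment (f1 f0 g : R -> C) (h : C) (t : R) :
  cdiff f1 t -> cdiff f0 t -> cdiff g t -> cdiff (fun t => f1 t - f0 t - h * g t)%C t.
Proof.
  intros H1 H0 Hg. apply (cdiff_minus (fun t => f1 t - f0 t)%C (fun t => h * g t)%C).
  - now apply cdiff_minus.
  - apply (cdiff_mult (fun _ => h)); [apply cdiff_const|easy].
Qed.

Lemma CI_increment (f1 f0 g : R -> C) (h : C) (a b : R) : a <= b ->
  (forall t, a <= t <= b -> cdiff f1 t) -> (forall t, a <= t <= b -> cdiff f0 t) ->
  (forall t, a <= t <= b -> cdiff g t) ->
  CI (fun t => f1 t - f0 t - h * g t)%C a b = (CI f1 a b - CI f0 a b - h * CI g a b)%C.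
Proof.
  intros ab H1 H0 Hg.
  rewrite (CI_minus (fun t => f1 t - f0 t)%C (fun t => h * g t)%C a b ab), (CI_minus f1 f0 a b ab H1 H0),
    (CI_scal h g a b ab Hg); [reflexivity| |].
  - intros t Ht. apply cdiff_minus; auto.
  - intros t Ht. apply (cdiff_mult (fun _ => h)); [apply cdiff_const|auto].
Qed.

(** At fixed truncation the error is an integral of quadratically small functions, bounded
    independently of [n], and so passes to the limit; the error [W] of [coef0] is added with Euler's
    constant as factor. *)
Lemma zeta_deriv_is_derive (zeta : C -> C -> C) (dzeta0 : C -> C) :
  (forall c, 0 < Re c -> is_zeta_continuation c (zeta c)) ->
  (forall c, 0 < Re c -> is_derive (K := C_AbsRing) (V := C_NormedModule) (zeta c) (RtoC 0) (dzeta0 c)) ->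
  forall c, 0 < Re c -> is_derive (K := C_AbsRing) (V := C_NormedModule) dzeta0 c (dzeta_integral c).
Proof.
  intros HZ HD c Hc.
  destruct (near_part_second_order c Hc) as (K1 & HK1 & B1).
  destruct (far_part_second_order c Hc) as (K2 & HK2 & B2).
  set (g := euler_mascheroni).
  assert (Hd : 0 < Rmin (Re c / 2) (/ 4)) by (apply Rmin_glb_lt; lra).
  apply (is_derive_C_intro _ _ _ (K1 + K2 / (/ 4) + / Re c ^ 3 * Cmod g) (Rmin (Re c / 2) (/ 4)) Hd).
  intros h Hh.
  pose proof (Rlt_le_trans _ _ _ Hh (Rmin_l _ _)) as Hh1. pose proof (Rlt_le_trans _ _ _ Hh (Rmin_r _ _)) as Hh2.
  destruct (near_Re c (c + h)%C Hc) as [R1 R2]; [replace (c + h - c)%C with h by ring; lra|].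
  assert (Hc' : 0 < Re (c + h)%C) by lra.
  pose proof (zeta_deriv_split c _ _ Hc (HZ c Hc) (HD c Hc)) as L0.
  pose proof (zeta_deriv_split (c + h) _ _ Hc' (HZ _ Hc') (HD _ Hc')) as L1.
  destruct (integrals_exist c Hc) as (_ & _ & L2).
  unfold dzeta_integral.
  match type of L2 with clim _ ?l => set (I := l) in * end. fold g. fold g in L0, L1.
  pose proof (clim_minus _ _ _ _ (clim_minus _ _ _ _ L1 L0) (clim_scal h _ _ L2)) as L.
  pose proof (coef0_second_order c h Hc ltac:(lra)) as B3.
  set (W := (coef0 (c + h) - coef0 c - h * (1 / 12 - 1 / (12 * c ^ 2)))%C) in *.
  match type of L with clim _ ?l =>
    replace (dzeta0 (c + h) - dzeta0 c - (I + g * (1 / 12 - 1 / (12 * c ^ 2))) * h)%C with (l + W * g)%C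
      by (unfold W, g; ring); set (lim := l) in * end.
  eapply Rle_trans; [apply Cmod_triangle|]. rewrite Rmult_plus_distr_r. apply Rplus_le_compat.
  - replace lim with (lim - 0)%C by ring. apply (clim_bound _ _ _ _ O L). intros n _.
    pose proof (inv_INR_S n) as [P1 P2]. pose proof (INR_S_ge_1 n) as P3.
    unfold split_integral.
    set (a := / INR (S n)) in *. set (b := INR (S n)) in *.
    assert (N1 : forall t, a <= t <= 1 -> cdiff (near_part (c + h)) t) by (intros; apply cdiff_near_part; lra).
    assert (N0 : forall t, a <= t <= 1 -> cdiff (near_part c) t) by (intros; apply cdiff_near_part; lra).
    assert (NU : forall t, a <= t <= 1 -> cdiff (integrand_unit c) t) by (intros; apply cdiff_integrand_unit; lra).
    assert (F1 : forall t, 1 <= t <= b -> cdiff (far_part (c + h)) t) by (intros; apply cdiff_far_part; lra).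
    assert (F0 : forall t, 1 <= t <= b -> cdiff (far_part c) t) by (intros; apply cdiff_far_part; lra).
    assert (FI : forall t, 1 <= t <= b -> cdiff (integrand_infty c) t) by (intros; apply cdiff_integrand_infty; lra).
    pose proof (CI_increment _ _ _ h a 1 P2 N1 N0 NU) as EN.
    pose proof (CI_increment _ _ _ h 1 b P3 F1 F0 FI) as EF.
    match goal with |- Cmod ?x <= _ => replace x with
      (CI (fun t => near_part (c + h) t - near_part c t - h * integrand_unit c t)%C a 1
       + CI (fun t => far_part (c + h) t - far_part c t - h * integrand_infty c t)%C 1 b)%C
      by (rewrite EN, EF; ring) end.
    clear EN EF. eapply Rle_trans; [apply Cmod_triangle|]. rewrite Rmult_plus_distr_r.
    apply Rplus_le_compat.
    + eapply Rle_trans; [apply (CI_bound_const _ _ _ (K1 * Cmod h ^ 2))|].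
      * lra.
      * intros t Ht. apply cdiff_increment; auto.
      * intros t Ht. apply B1; lra.
      * assert (0 <= K1 * Cmod h ^ 2) by (apply Rmult_le_pos; [easy|apply pow2_ge_0]). nra.
    + eapply Rle_trans; [apply (CI_bound_exp _ (K2 * Cmod h ^ 2) (/ 4))|].
      * lra.
      * lra.
      * intros t Ht. apply cdiff_increment; auto.
      * intros t Ht. apply B2; lra.
      * assert (0 <= K2 * Cmod h ^ 2) by (apply Rmult_le_pos; [easy|apply pow2_ge_0]).
        pose proof (exp_pos (- (/ 4 * b))). pose proof (exp_le_1 (- (/ 4 * 1)) ltac:(lra)).
        apply Rle_trans with (K2 * Cmod h ^ 2 / / 4 * 1); [|unfold Rdiv; lra].
        apply Rmult_le_compat_l; [|lra]. unfold Rdiv. lra.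
  - rewrite Cmod_mult. pose proof (Cmod_ge_0 g).
    apply Rmult_le_compat_r with (r := Cmod g) in B3; [|easy]. lra.
Qed.

(** * The digamma function *)

Lemma ex_RInt_pos_line (f : R -> R) (a b : R) : (forall t, 0 < t -> continuous f t) ->
  0 < a -> a <= b -> ex_RInt f a b.
Proof.
  intros Hf Ha Hab. apply (ex_RInt_continuous (V := R_CompleteNormedModule)).
  rewrite Rmin_left, Rmax_right by easy. intros; apply Hf; lra.
Qed.

Lemma RInt_nonneg_mono (f : R -> R) (a b a' b' : R) : (forall t, 0 < t -> continuous f t) ->
  (forall t, 0 < t -> 0 <= f t) -> 0 < a' -> a' <= a -> a <= b -> b <= b' ->
  RInt f a b <= RInt f a' b'.
Proof.
  intros Hf Hp P1 P2 P3 P4.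
  assert (E : forall x y, 0 < x -> x <= y -> ex_RInt f x y) by (intros; now apply ex_RInt_pos_line).
  assert (N : forall x y, 0 < x -> x <= y -> 0 <= RInt f x y).
  { intros x y Hx Hxy. apply RInt_ge_0; [easy|now apply E|]. intros; apply Hp; lra. }
  rewrite <- (RInt_Chasles f a' a b') by (apply E; lra).
  rewrite <- (RInt_Chasles f a b b') by (apply E; lra).
  unfold plus; simpl. pose proof (N a' a ltac:(lra) ltac:(lra)). pose proof (N b b' ltac:(lra) ltac:(lra)). lra.
Qed.

(** Monotone convergence: integrals of a nonnegative function grow with the interval, and every
    interval is contained in one of the truncations. *)
Lemma RInt_gen_nonneg (f : R -> R) (B : R) : (forall t, 0 < t -> continuous f t) ->
  (forall t, 0 < t -> 0 <= f t) -> (forall a b, 0 < a <= 1 -> 1 <= b -> RInt f a b <= B) ->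
  is_RInt_gen f (at_right 0) (Rbar_locally p_infty) (RInt_gen f (at_right 0) (Rbar_locally p_infty)) /\
  is_lim_seq (fun n => RInt f (/ INR (S n)) (INR (S n))) (RInt_gen f (at_right 0) (Rbar_locally p_infty)).
Proof.
  intros Hf Hp HB.
  set (u := fun n => RInt f (/ INR (S n)) (INR (S n))).
  assert (Inc : forall n, u n <= u (S n)).
  { intros n. pose proof (inv_INR_S n). pose proof (inv_INR_S (S n)). pose proof (INR_S_ge_1 n).
    apply RInt_nonneg_mono; auto; try lra.
    - apply Rinv_le_contravar; [lra|apply le_INR; lia].
    - apply le_INR; lia. }
  destruct (ex_finite_lim_seq_incr u B Inc) as [v Hv].
  { intros n. pose proof (inv_INR_S n). pose proof (INR_S_ge_1 n). apply HB; lra. }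
  assert (Le : forall n, u n <= v) by (intros n; apply (is_lim_seq_incr_compare u v Hv Inc)).
  assert (G : is_RInt_gen f (at_right 0) (Rbar_locally p_infty) v).
  { intros P [e He].
    apply is_lim_seq_spec in Hv. destruct (Hv e) as [N HN]. specialize (HN N (le_n N)).
    pose proof (inv_INR_S N) as [I1 I2]. pose proof (INR_S_ge_1 N) as I3.
    exists (fun x => 0 < x < / INR (S N)) (fun y => INR (S N) < y).
    - exists (mkposreal _ I1). intros y Hy H0. change (Rabs (y - 0) < / INR (S N)) in Hy.
      rewrite Rminus_0_r, Rabs_pos_eq in Hy by lra. lra.
    - now exists (INR (S N)).
    - intros x y Hx Hy. simpl. exists (RInt f x y). split.
      + apply (RInt_correct (V := R_CompleteNormedModule)), ex_RInt_pos_line; auto; lra.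
      + apply He. change (Rabs (RInt f x y - v) < e).
        assert (L1 : u N <= RInt f x y) by (apply RInt_nonneg_mono; auto; lra).
        assert (L2 : RInt f x y <= v).
        { destruct (INR_unbounded y) as [M1 HM1]. destruct (INR_unbounded (/ x)) as [M2 HM2].
          assert (Ix : 0 < / x) by (apply Rinv_0_lt_compat; lra).
          apply Rle_trans with (u (M1 + M2)%nat); [|apply Le].
          assert (Q1 : INR M1 <= INR (S (M1 + M2))) by (apply le_INR; lia).
          assert (Q2 : INR M2 <= INR (S (M1 + M2))) by (apply le_INR; lia).
          apply RInt_nonneg_mono; auto; try lra.
          - apply Rinv_0_lt_compat. lra.
          - rewrite <- (Rinv_inv x). apply Rinv_le_contravar; lra. }
        apply Rabs_def2 in HN. apply Rabs_def1; unfold u in *; lra. }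
  rewrite (is_RInt_gen_unique (V := R_CompleteNormedModule) f v G). now split.
Qed.

Definition gamma_integrand (x t : R) : R := Rpower t (x - 1) * exp (- t).

Lemma is_derive_Rpower (y t : R) : 0 < t -> is_derive (fun t => Rpower t y) t (y * Rpower t (y - 1)).
Proof. intros Ht. apply is_derive_Reals. now apply derivable_pt_lim_power. Qed.

Lemma continuous_gamma_integrand (x t : R) : 0 < t -> continuous (gamma_integrand x) t.
Proof.
  intros Ht. apply (ex_derive_continuous (V := R_NormedModule)).
  apply (ex_derive_mult (fun t => Rpower t (x - 1)) (fun t => exp (- t))).
  - eexists. now apply is_derive_Rpower.
  - auto_derive. easy.
Qed.

Lemma gamma_integrand_pos (x t : R) : 0 < gamma_integrand x t.
Proof. apply Rmult_lt_0_compat; apply exp_pos. Qed.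

(** [ln t <= t / (2 * M) + ln (2 * M)] with [M >= Rabs y] spends at most half of the exponential
    decay. *)
Lemma Rpower_exp_bound (y : R) : exists K, 0 < K /\ forall t, 1 <= t -> Rpower t y * exp (- t) <= K * exp (- (/ 2 * t)).
Proof.
  set (M := Rabs y + 1). pose proof (Rabs_pos y) as P. pose proof (Rle_abs y) as Q.
  assert (HM : 1 <= M) by (unfold M; lra).
  exists (exp (M * ln (2 * M))). split; [apply exp_pos|]. intros t Ht.
  unfold Rpower. rewrite <- !exp_plus. apply exp_le.
  assert (L0 : 0 <= ln t) by (rewrite <- ln_1; destruct Ht as [Ht|Ht]; [left; apply ln_increasing; lra|right; now rewrite Ht]).
  assert (L1 : ln t <= t / (2 * M) + ln (2 * M)).
  { pose proof (exp_ineq1_le (ln (t / (2 * M)))) as E.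
    assert (0 < t / (2 * M)) by (apply Rdiv_lt_0_compat; lra).
    rewrite exp_ln in E by easy. unfold Rdiv in E at 1. rewrite ln_mult, ln_Rinv in E by (try apply Rinv_0_lt_compat; lra). lra. }
  assert (L2 : y * ln t <= M * ln t) by (apply Rmult_le_compat_r; unfold M; lra).
  apply Rmult_le_compat_l with (r := M) in L1; [|lra].
  replace (M * (t / (2 * M) + ln (2 * M))) with (t / 2 + M * ln (2 * M)) in L1 by (field; lra). lra.
Qed.

Lemma gamma_integral (x : R) : 0 < x ->
  is_RInt_gen (gamma_integrand x) (at_right 0) (Rbar_locally p_infty) (Gamma x) /\
  is_lim_seq (fun n => RInt (gamma_integrand x) (/ INR (S n)) (INR (S n))) (Gamma x).
Proof.
  intros Hx. destruct (Rpower_exp_bound (x - 1)) as (K & HK & BK).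
  assert (C : forall t, 0 < t -> continuous (gamma_integrand x) t) by (intros; now apply continuous_gamma_integrand).
  apply (RInt_gen_nonneg (gamma_integrand x) (/ x + K / (/ 2))).
  - exact C.
  - intros; left; apply gamma_integrand_pos.
  - intros a b Ha Hb.
    rewrite <- (RInt_Chasles (gamma_integrand x) a 1 b) by (apply ex_RInt_pos_line; auto; lra).
    unfold plus; simpl. apply Rplus_le_compat.
    + assert (I : is_RInt (fun t => Rpower t (x - 1)) a 1 (minus (/ x * Rpower 1 x) (/ x * Rpower a x))).
      { apply (is_RInt_derive (V := R_CompleteNormedModule) (fun t => / x * Rpower t x));
          rewrite Rmin_left, Rmax_right by lra; intros t Ht.
        - replace (Rpower t (x - 1)) with (/ x * (x * Rpower t (x - 1))) by (field; lra).
          apply is_derive_scal, is_derive_Rpower. lra.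
        - apply (ex_derive_continuous (V := R_NormedModule)). eexists. apply is_derive_Rpower. lra. }
      apply Rle_trans with (minus (/ x * Rpower 1 x) (/ x * Rpower a x)).
      * rewrite <- (is_RInt_unique _ _ _ _ I). apply RInt_le; [lra|apply ex_RInt_pos_line; auto; lra|eexists; exact I|].
        intros t Ht. unfold gamma_integrand. rewrite <- (Rmult_1_r (Rpower t (x - 1))) at 2.
        apply Rmult_le_compat_l; [left; apply exp_pos|]. apply exp_le_1. lra.
      * unfold minus, plus, opp; simpl. pose proof (Rpower_pos a x).
        assert (E1 : Rpower 1 x = 1) by (unfold Rpower; rewrite ln_1, Rmult_0_r; apply exp_0).
        rewrite E1. assert (0 < / x) by now apply Rinv_0_lt_compat. nra.
    + pose proof (is_RInt_exp_decay K (/ 2) 1 b ltac:(lra)) as I.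
      apply Rle_trans with (K / (/ 2) * (exp (- (/ 2 * 1)) - exp (- (/ 2 * b)))).
      * rewrite <- (is_RInt_unique _ _ _ _ I). apply RInt_le; [lra|apply ex_RInt_pos_line; auto; lra|eexists; exact I|].
        intros t Ht. apply BK. lra.
      * pose proof (exp_le_1 (- (/ 2 * 1)) ltac:(lra)). pose proof (exp_pos (- (/ 2 * b))).
        assert (0 < K / / 2) by (apply Rdiv_lt_0_compat; lra). nra.
Qed.

Lemma Gamma_pos (x : R) : 0 < x -> 0 < Gamma x.
Proof.
  intros Hx. destruct (gamma_integral x Hx) as [_ L].
  assert (C : forall t, 0 < t -> continuous (gamma_integrand x) t) by (intros; now apply continuous_gamma_integrand).
  apply Rlt_le_trans with (RInt (gamma_integrand x) 1 2).
  - apply RInt_gt_0; [lra|intros; apply gamma_integrand_pos|intros; apply C; lra].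
  - refine (is_lim_seq_le_loc (fun _ => RInt (gamma_integrand x) 1 2) _ (Finite (RInt (gamma_integrand x) 1 2)) (Finite (Gamma x))
      _ (is_lim_seq_const _) L).
    exists 1%nat. intros n Hn.
    pose proof (inv_INR_S n). assert (INR 2 <= INR (S n)) by (apply le_INR; lia). simpl (INR 2) in *.
    apply RInt_nonneg_mono; auto; try lra. intros; left; apply gamma_integrand_pos.
Qed.

(** The average of two tangent-line inequalities at the intermediate point [m]. *)
Lemma exp_convex (p a b : R) : 0 <= p <= 1 -> exp (p * a + (1 - p) * b) <= p * exp a + (1 - p) * exp b.
Proof.
  intros Hp. set (m := p * a + (1 - p) * b).
  assert (T : forall z, exp m * (1 + (z - m)) <= exp z).
  { intros z. replace (exp z) with (exp m * exp (z - m)) by (rewrite <- exp_plus; f_equal; ring).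
    apply Rmult_le_compat_l; [left; apply exp_pos|]. apply exp_ineq1_le. }
  pose proof (T a) as Ta. pose proof (T b) as Tb.
  apply Rmult_le_compat_l with (r := p) in Ta; [|lra]. apply Rmult_le_compat_l with (r := 1 - p) in Tb; [|lra].
  replace (exp m) with (p * (exp m * (1 + (a - m))) + (1 - p) * (exp m * (1 + (b - m)))); [lra|].
  unfold m; ring.
Qed.

(* Young's inequality for the normalised integrands gives log-convexity. *)
Lemma ln_Gamma_convex (p x y : R) : 0 < x -> 0 < y -> 0 <= p <= 1 ->
  ln (Gamma (p * x + (1 - p) * y)) <= p * ln (Gamma x) + (1 - p) * ln (Gamma y).
Proof.
  intros Hx Hy Hp. assert (Hz : 0 < p * x + (1 - p) * y) by nra.
  set (z := p * x + (1 - p) * y) in *.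
  pose proof (Gamma_pos x Hx) as Px. pose proof (Gamma_pos y Hy) as Py. pose proof (Gamma_pos z Hz) as Pz.
  destruct (gamma_integral x Hx) as [_ Lx]. destruct (gamma_integral y Hy) as [_ Ly].
  destruct (gamma_integral z Hz) as [_ Lz].
  set (E := exp (p * ln (Gamma x) + (1 - p) * ln (Gamma y))). assert (PE : 0 < E) by apply exp_pos.
  assert (PW : forall t, 0 < t -> gamma_integrand z t <=
     E * (p / Gamma x) * gamma_integrand x t + E * ((1 - p) / Gamma y) * gamma_integrand y t).
  { intros t Ht.
    pose proof (exp_convex p (ln (gamma_integrand x t / Gamma x)) (ln (gamma_integrand y t / Gamma y)) Hp) as Q.
    pose proof (gamma_integrand_pos x t) as Gx. pose proof (gamma_integrand_pos y t) as Gy.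
    rewrite !exp_ln in Q by now apply Rdiv_lt_0_compat.
    apply Rmult_le_compat_l with (r := E) in Q; [|lra].
    replace (gamma_integrand z t) with (E * exp (p * ln (gamma_integrand x t / Gamma x) + (1 - p) * ln (gamma_integrand y t / Gamma y))).
    - eapply Rle_trans; [exact Q|]. right. field. split; lra.
    - unfold E, Rdiv. rewrite !ln_mult, !ln_Rinv by (try apply Rinv_0_lt_compat; easy).
      unfold gamma_integrand, Rpower. rewrite <- !exp_plus, !ln_exp. f_equal. unfold z. ring. }
  assert (C : forall w t, 0 < t -> continuous (gamma_integrand w) t) by (intros; now apply continuous_gamma_integrand).
  assert (GL : Gamma z <= E).
  { replace E with (E * (p / Gamma x) * Gamma x + E * ((1 - p) / Gamma y) * Gamma y) by (field; lra).
    assert (LR := is_lim_seq_plus' _ _ _ _ (is_lim_seq_scal_l _ (E * (p / Gamma x)) _ Lx)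
      (is_lim_seq_scal_l _ (E * ((1 - p) / Gamma y)) _ Ly)).
    refine (is_lim_seq_le _ _ (Finite _) (Finite _) _ Lz LR).
    intros n. pose proof (inv_INR_S n). pose proof (INR_S_ge_1 n).
    set (a := / INR (S n)) in *. set (b := INR (S n)) in *.
    assert (Ex : forall w, ex_RInt (gamma_integrand w) a b) by (intros; apply ex_RInt_pos_line; auto; lra).
    assert (IR : is_RInt (fun t => E * (p / Gamma x) * gamma_integrand x t + E * ((1 - p) / Gamma y) * gamma_integrand y t) a b
      (E * (p / Gamma x) * RInt (gamma_integrand x) a b + E * ((1 - p) / Gamma y) * RInt (gamma_integrand y) a b)).
    { apply (is_RInt_plus (V := R_NormedModule)); apply (is_RInt_scal (V := R_NormedModule));
        apply (RInt_correct (V := R_CompleteNormedModule)), Ex. }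
    rewrite <- (is_RInt_unique _ _ _ _ IR).
    apply RInt_le; [lra|apply Ex|eexists; exact IR|]. intros t Ht. apply PW. lra. }
  rewrite <- (ln_exp (p * ln (Gamma x) + (1 - p) * ln (Gamma y))). fold E.
  destruct GL as [GL|GL]; [left; now apply ln_increasing|right; now rewrite GL].
Qed.

(** Integration by parts; the boundary term vanishes at 0 because of [t ^ x] and at infinity because
    of the exponential. *)
Lemma Gamma_step (x : R) : 0 < x -> Gamma (x + 1) = x * Gamma x.
Proof.
  intros Hx. destruct (gamma_integral x Hx) as [_ L0]. destruct (gamma_integral (x + 1) ltac:(lra)) as [_ L1].
  assert (C : forall w t, 0 < t -> continuous (gamma_integrand w) t) by (intros; now apply continuous_gamma_integrand).
  destruct (Rpower_exp_bound x) as (K & HK & BK).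
  assert (E : forall n, RInt (gamma_integrand (x + 1)) (/ INR (S n)) (INR (S n))
     = x * RInt (gamma_integrand x) (/ INR (S n)) (INR (S n))
       + (gamma_integrand (x + 1) (/ INR (S n)) - gamma_integrand (x + 1) (INR (S n)))).
  { intros n. pose proof (inv_INR_S n). pose proof (INR_S_ge_1 n).
    set (a := / INR (S n)) in *. set (b := INR (S n)) in *.
    assert (Ex : forall w, ex_RInt (gamma_integrand w) a b) by (intros; apply ex_RInt_pos_line; auto; lra).
    assert (I : is_RInt (fun t => gamma_integrand (x + 1) t - x * gamma_integrand x t) a b
       (minus (- gamma_integrand (x + 1) b) (- gamma_integrand (x + 1) a))).
    { apply (is_RInt_derive (V := R_CompleteNormedModule) (fun t => - gamma_integrand (x + 1) t));
        rewrite Rmin_left, Rmax_right by lra; intros t Ht.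
      - evar_last.
        + apply (is_derive_opp (V := R_NormedModule)). unfold gamma_integrand.
          apply (Derive.is_derive_mult (fun t => Rpower t (x + 1 - 1)) (fun t => exp (- t))).
          * apply is_derive_Rpower. lra.
          * auto_derive; [easy|reflexivity].
        + unfold gamma_integrand. unfold opp; simpl. replace (x + 1 - 1) with x by ring. ring.
      - apply (continuous_minus (V := R_NormedModule)).
        + apply C; lra.
        + apply (continuous_scal_r (V := R_NormedModule)), C. lra. }
    pose proof (is_RInt_minus (V := R_NormedModule) _ _ _ _ _ _ (RInt_correct (V := R_CompleteNormedModule) _ _ _ (Ex (x + 1)))
      (is_RInt_scal (V := R_NormedModule) _ _ _ x _ (RInt_correct (V := R_CompleteNormedModule) _ _ _ (Ex x)))) as I2.
    pose proof (is_RInt_unique _ _ _ _ I) as U1. pose proof (is_RInt_unique _ _ _ _ I2) as U2.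
    unfold minus, plus, opp, scal in U1, U2; simpl in U1, U2. unfold mult in U2; simpl in U2.
    change (RInt (fun t => gamma_integrand (x + 1) t + - (x * gamma_integrand x t)) a b = - gamma_integrand (x + 1) b + - - gamma_integrand (x + 1) a) in U1.
    rewrite U1 in U2. lra. }
  assert (B1 : is_lim_seq (fun n => gamma_integrand (x + 1) (/ INR (S n))) 0).
  { apply is_lim_seq_spec. intros eps.
    set (d := Rpower eps (/ x)). assert (Pd : 0 < d) by apply exp_pos.
    destruct (inv_INR_S_small d Pd) as [N HN]. exists N. intros n Hn. specialize (HN n Hn).
    pose proof (inv_INR_S n) as [P1 P2].
    rewrite Rminus_0_r, Rabs_pos_eq by (left; apply gamma_integrand_pos).
    unfold gamma_integrand. replace (x + 1 - 1) with x by ring.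
    apply Rle_lt_trans with (Rpower (/ INR (S n)) x * 1).
    - apply Rmult_le_compat_l; [left; apply exp_pos|]. apply exp_le_1. lra.
    - rewrite Rmult_1_r. apply Rlt_le_trans with (Rpower d x).
      + apply exp_increasing. apply Rmult_lt_compat_l; [easy|]. now apply ln_increasing.
      + unfold d. rewrite Rpower_mult, Rinv_l, Rpower_1 by (lra || apply cond_pos). lra. }
  assert (B2 : is_lim_seq (fun n => gamma_integrand (x + 1) (INR (S n))) 0).
  { apply is_lim_seq_spec. intros eps.
    destruct (inv_INR_S_small (eps / (2 * K))) as [N HN]; [apply Rdiv_lt_0_compat; [apply cond_pos|lra]|].
    exists N. intros n Hn. specialize (HN n Hn). pose proof (INR_S_ge_1 n) as P.
    rewrite Rminus_0_r, Rabs_pos_eq by (left; apply gamma_integrand_pos).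
    unfold gamma_integrand. replace (x + 1 - 1) with x by ring.
    eapply Rle_lt_trans; [now apply BK|].
    pose proof (exp_neg_le_inv (/ 2 * INR (S n)) ltac:(lra)) as Q. rewrite Rinv_mult, Rinv_inv in Q.
    apply Rle_lt_trans with (K * (2 * / INR (S n))); [apply Rmult_le_compat_l; lra|].
    apply Rmult_lt_compat_l with (r := 2 * K) in HN; [|lra].
    replace (2 * K * (eps / (2 * K))) with (pos eps) in HN by (field; lra). lra. }
  assert (LR := is_lim_seq_plus' _ _ _ _ (is_lim_seq_scal_l _ x _ L0) (is_lim_seq_minus' _ _ _ _ B1 B2)).
  apply is_lim_seq_unique in L1. apply is_lim_seq_unique in LR.
  rewrite (Lim_seq_ext _ _ E) in L1. rewrite L1 in LR. injection LR. intros ->. ring.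
Qed.

Lemma ln_Gamma_step (x : R) : 0 < x -> ln (Gamma (x + 1)) = ln x + ln (Gamma x).
Proof. intros Hx. rewrite Gamma_step, ln_mult; auto using Gamma_pos. Qed.

Lemma ln_Gamma_slopes (u v w : R) : 0 < u -> u < v -> v < w ->
  (ln (Gamma v) - ln (Gamma u)) / (v - u) <= (ln (Gamma w) - ln (Gamma v)) / (w - v).
Proof.
  intros Hu Huv Hvw.
  pose proof (ln_Gamma_convex ((w - v) / (w - u)) u w Hu ltac:(lra)) as Q.
  assert (Hp : 0 <= (w - v) / (w - u) <= 1).
  { split; [apply Rmult_le_pos; [lra|left; apply Rinv_0_lt_compat; lra]|].
    apply Rmult_le_reg_r with (w - u); [lra|]. unfold Rdiv. rewrite Rmult_assoc, Rinv_l; lra. }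
  specialize (Q Hp).
  replace ((w - v) / (w - u) * u + (1 - (w - v) / (w - u)) * w) with v in Q by (field; lra).
  set (fu := ln (Gamma u)) in *. set (fv := ln (Gamma v)) in *. set (fw := ln (Gamma w)) in *.
  apply Rmult_le_compat_r with (r := w - u) in Q; [|lra].
  replace (((w - v) / (w - u) * fu + (1 - (w - v) / (w - u)) * fw) * (w - u))
    with ((w - v) * fu + (v - u) * fw) in Q by (field; lra).
  apply Rmult_le_reg_r with ((v - u) * (w - v)); [apply Rmult_lt_0_compat; lra|].
  replace ((fv - fu) / (v - u) * ((v - u) * (w - v))) with ((fv - fu) * (w - v)) by (field; lra).
  replace ((fw - fv) / (w - v) * ((v - u) * (w - v))) with ((fw - fv) * (v - u)) by (field; lra).
  lra.
Qed.

Lemma ln_Gamma_shift (x : R) (n : nat) : 0 < x ->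
  ln (Gamma (x + INR n)) = ln (Gamma x) + Rsum (fun k => ln (INR k + x)) n.
Proof.
  intros Hx. induction n as [|n IH].
  - simpl. rewrite !Rplus_0_r. reflexivity.
  - rewrite S_INR, <- Rplus_assoc, ln_Gamma_step, IH by (pose proof (pos_INR n); lra).
    simpl. rewrite (Rplus_comm x). ring.
Qed.

Lemma ln_diff_bounds (a b : R) : 0 < a -> a < b -> (b - a) / b <= ln b - ln a <= (b - a) / a.
Proof.
  intros Ha Hab.
  assert (T : forall z, 0 < z -> ln z <= z - 1).
  { intros z Hz. pose proof (exp_ineq1_le (ln z)) as Q. rewrite exp_ln in Q by easy. lra. }
  split.
  - pose proof (T (a / b) ltac:(apply Rdiv_lt_0_compat; lra)) as Q.
    unfold Rdiv in Q at 1. rewrite ln_mult, ln_Rinv in Q by (try apply Rinv_0_lt_compat; lra).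
    replace ((b - a) / b) with (1 - a / b) by (field; lra). lra.
  - pose proof (T (b / a) ltac:(apply Rdiv_lt_0_compat; lra)) as Q.
    unfold Rdiv in Q at 1. rewrite ln_mult, ln_Rinv in Q by (try apply Rinv_0_lt_compat; lra).
    replace ((b - a) / a) with (b / a - 1) by (field; lra). lra.
Qed.

(* Shifting the convexity inequality by [n] turns it into a two-sided estimate by
   partial sums of the digamma series. *)
Lemma ln_Gamma_slope_bounds (x y : R) (n : nat) : 0 < x -> x < y -> y <= 1 -> (0 < n)%nat ->
  ln (INR n) - ln (INR n / (INR n + x - 1)) - shifted_harmonic x n <= (ln (Gamma y) - ln (Gamma x)) / (y - x)
  /\ (ln (Gamma y) - ln (Gamma x)) / (y - x) <= ln (INR n) + ln ((INR n + y) / INR n) - shifted_harmonic y n.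
Proof.
  intros Hx Hxy Hy Hn. assert (N1 : 1 <= INR n) by (apply (le_INR 1); lia).
  assert (S1 : Rsum (fun k => ln (INR k + y)) n - Rsum (fun k => ln (INR k + x)) n <= (y - x) * shifted_harmonic x n).
  { unfold shifted_harmonic. clear - Hx Hxy. induction n as [|n IH]; simpl; [lra|].
    pose proof (pos_INR n). pose proof (ln_diff_bounds (INR n + x) (INR n + y) ltac:(lra) ltac:(lra)) as [_ Q].
    replace ((INR n + y - (INR n + x)) / (INR n + x)) with ((y - x) * / (INR n + x)) in Q by (unfold Rdiv; ring). lra. }
  assert (S2 : (y - x) * shifted_harmonic y n <= Rsum (fun k => ln (INR k + y)) n - Rsum (fun k => ln (INR k + x)) n).
  { unfold shifted_harmonic. clear - Hx Hxy. induction n as [|n IH]; simpl; [lra|].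
    pose proof (pos_INR n). pose proof (ln_diff_bounds (INR n + x) (INR n + y) ltac:(lra) ltac:(lra)) as [Q _].
    replace ((INR n + y - (INR n + x)) / (INR n + y)) with ((y - x) * / (INR n + y)) in Q by (unfold Rdiv; ring). lra. }
  pose proof (ln_Gamma_shift x n Hx) as Ex. pose proof (ln_Gamma_shift y n ltac:(lra)) as Ey.
  assert (P : 0 < y - x) by lra.
  split.
  - pose proof (ln_Gamma_slopes (x + INR n - 1) (x + INR n) (y + INR n) ltac:(lra) ltac:(lra) ltac:(lra)) as Q.
    replace (x + INR n - (x + INR n - 1)) with 1 in Q by ring. rewrite Rdiv_1_r in Q.
    pose proof (ln_Gamma_step (x + INR n - 1) ltac:(lra)) as St.
    replace (x + INR n - 1 + 1) with (x + INR n) in St by ring. rewrite St in Q.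
    replace (y + INR n - (x + INR n)) with (y - x) in Q by ring.
    unfold Rdiv at 1. rewrite ln_mult, ln_Rinv by (try apply Rinv_0_lt_compat; lra).
    replace (INR n + x - 1) with (x + INR n - 1) by ring.
    apply Rmult_le_reg_r with (y - x); [easy|].
    apply Rmult_le_compat_r with (r := y - x) in Q; [|lra].
    unfold Rdiv in *. rewrite Rmult_assoc, Rinv_l, Rmult_1_r in * by lra. rewrite St in Ex. nra.
  - pose proof (ln_Gamma_slopes (x + INR n) (y + INR n) (y + INR n + 1) ltac:(lra) ltac:(lra) ltac:(lra)) as Q.
    replace (y + INR n + 1 - (y + INR n)) with 1 in Q by ring. rewrite Rdiv_1_r in Q.
    rewrite ln_Gamma_step in Q by lra.
    replace (y + INR n - (x + INR n)) with (y - x) in Q by ring.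
    unfold Rdiv at 2. rewrite ln_mult, ln_Rinv by (try apply Rinv_0_lt_compat; lra).
    replace (INR n + y) with (y + INR n) by ring.
    apply Rmult_le_reg_r with (y - x); [easy|].
    apply Rmult_le_compat_r with (r := y - x) in Q; [|lra].
    unfold Rdiv in *. rewrite Rmult_assoc, Rinv_l, Rmult_1_r in * by lra. nra.
Qed.

Lemma is_lim_seq_0_of_inv (u : nat -> R) (K : R) :
  (forall n, 0 <= u n <= K * / INR (S n)) -> is_lim_seq u 0.
Proof.
  intros H.
  assert (L : clim (fun n => RtoC (u n)) 0).
  { apply (clim_inv_bound _ _ K). intros n. specialize (H n).
    replace (u n - 0)%C with (RtoC (u n)) by ring. rewrite Cmod_RtoC_pos; lra. }
  exact (proj2 (clim_RtoC _ _ L)).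
Qed.

(** The terms differ by at most [(y - x) / (k + x) ^ 2]; the term [k = 0] gives [/ x ^ 2], and the
    others are below [1 / k ^ 2], whose sum telescoping bounds by 2. *)
Lemma shifted_harmonic_lipschitz (x y : R) (n : nat) : 0 < x -> x < y ->
  shifted_harmonic x n - shifted_harmonic y n <= (y - x) * (/ x ^ 2 + 2).
Proof.
  intros Hx Hxy.
  assert (B : Rsum (fun k => / (INR k + x) ^ 2) n <= / x ^ 2 + 2).
  { assert (Ix : 0 < / x ^ 2) by (apply Rinv_0_lt_compat, pow_lt; lra).
    assert (S1 : forall m, Rsum (fun k => / (INR k + x) ^ 2) (S (S m)) <= / x ^ 2 + (2 - / INR (S m))).
    { induction m as [|m IH].
      - change (0 + / (0 + x) ^ 2 + / (1 + x) ^ 2 <= / x ^ 2 + (2 - / 1)).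
        rewrite !Rplus_0_l, Rinv_1. apply Rplus_le_compat_l. replace (2 - 1) with 1 by ring.
        apply Rle_trans with (/ 1); [|rewrite Rinv_1; lra]. apply Rinv_le_contravar; [lra|]. nra.
      - change (Rsum (fun k => / (INR k + x) ^ 2) (S (S (S m)))) with
          (Rsum (fun k => / (INR k + x) ^ 2) (S (S m)) + / (INR (S (S m)) + x) ^ 2).
        assert (/ (INR (S (S m)) + x) ^ 2 <= / INR (S m) - / INR (S (S m))); [|lra].
        rewrite (S_INR (S m)). pose proof (INR_S_ge_1 m) as P. set (N := INR (S m)) in *.
        replace (/ N - / (N + 1)) with (/ (N * (N + 1))) by (field; lra).
        apply Rinv_le_contravar; nra. }
    destruct n as [|[|m]].
    - change (0 <= / x ^ 2 + 2). lra.
    - change (0 + / (0 + x) ^ 2 <= / x ^ 2 + 2). rewrite !Rplus_0_l. lra.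
    - eapply Rle_trans; [apply S1|]. pose proof (inv_INR_S m). lra. }
  apply Rle_trans with ((y - x) * Rsum (fun k => / (INR k + x) ^ 2) n); [|apply Rmult_le_compat_l; lra].
  unfold shifted_harmonic. clear B. induction n as [|n IH]; [change (0 - 0 <= (y - x) * 0); lra|].
  cbn [Rsum].
  pose proof (pos_INR n) as P.
  assert (/ (INR n + x) - / (INR n + y) <= (y - x) * / (INR n + x) ^ 2); [|lra].
  replace (/ (INR n + x) - / (INR n + y)) with ((y - x) * / ((INR n + x) * (INR n + y))) by (field; lra).
  apply Rmult_le_compat_l; [lra|]. apply Rinv_le_contravar; nra.
Qed.

Definition digamma_limit (x l : R) : Prop :=
  is_lim_seq (fun M => ln (INR (S M)) - shifted_harmonic x (S M)) l.

(** In the two-sided estimate the logarithms of ratios tend to 0 as [n] grows. *)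
Lemma digamma_limit_slope (x y lx ly : R) : 0 < x -> x < y -> y <= 1 ->
  digamma_limit x lx -> digamma_limit y ly ->
  lx <= (ln (Gamma y) - ln (Gamma x)) / (y - x) <= ly.
Proof.
  intros Hx Hxy Hy Lx Ly.
  assert (E1 : is_lim_seq (fun M => ln (INR (S M) / (INR (S M) + x - 1))) 0).
  { apply (is_lim_seq_0_of_inv _ (/ x)). intros n. pose proof (INR_S_ge_1 n) as P.
    pose proof (ln_diff_bounds (INR (S n) + x - 1) (INR (S n)) ltac:(lra) ltac:(lra)) as [Q1 Q2].
    unfold Rdiv. rewrite ln_mult, ln_Rinv by (try apply Rinv_0_lt_compat; lra). split.
    - eapply Rle_trans; [|exact Q1]. apply Rmult_le_pos; [lra|left; apply Rinv_0_lt_compat; lra].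
    - eapply Rle_trans; [exact Q2|]. unfold Rdiv.
      apply Rle_trans with (1 * / (INR (S n) + x - 1)).
      + apply Rmult_le_compat_r; [left; apply Rinv_0_lt_compat|]; lra.
      + rewrite Rmult_1_l, <- Rinv_mult. apply Rinv_le_contravar; nra. }
  assert (E2 : is_lim_seq (fun M => ln ((INR (S M) + y) / INR (S M))) 0).
  { apply (is_lim_seq_0_of_inv _ 1). intros n. pose proof (INR_S_ge_1 n) as P.
    pose proof (ln_diff_bounds (INR (S n)) (INR (S n) + y) ltac:(lra) ltac:(lra)) as [Q1 Q2].
    unfold Rdiv. rewrite ln_mult, ln_Rinv by (try apply Rinv_0_lt_compat; lra). split.
    - eapply Rle_trans; [|exact Q1]. apply Rmult_le_pos; [lra|left; apply Rinv_0_lt_compat; lra].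
    - eapply Rle_trans; [exact Q2|]. unfold Rdiv.
      apply Rmult_le_compat_r; [left; apply Rinv_0_lt_compat|]; lra. }
  pose proof (fun M => ln_Gamma_slope_bounds x y (S M) Hx Hxy Hy (Nat.lt_0_succ M)) as B.
  set (sl := (ln (Gamma y) - ln (Gamma x)) / (y - x)) in *. split.
  - pose proof (is_lim_seq_minus' _ _ _ _ Lx E1) as L. rewrite Rminus_0_r in L.
    refine (is_lim_seq_le _ (fun _ => sl) (Finite lx) (Finite sl) _ L (is_lim_seq_const _)).
    intros n. destruct (B n) as [Q _]. lra.
  - pose proof (is_lim_seq_plus' _ _ _ _ Ly E2) as L. rewrite Rplus_0_r in L.
    refine (is_lim_seq_le (fun _ => sl) _ (Finite sl) (Finite ly) _ (is_lim_seq_const _) L).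
    intros n. destruct (B n) as [_ Q]. lra.
Qed.

Lemma digamma_limit_lipschitz (x y lx ly : R) : 0 < x -> x < y ->
  digamma_limit x lx -> digamma_limit y ly -> ly <= lx + (y - x) * (/ x ^ 2 + 2).
Proof.
  intros Hx Hxy Lx Ly.
  pose proof (is_lim_seq_minus' _ _ _ _ Ly Lx) as L.
  assert (ly - lx <= (y - x) * (/ x ^ 2 + 2)); [|lra].
  refine (is_lim_seq_le _ (fun _ => (y - x) * (/ x ^ 2 + 2)) (Finite (ly - lx)) (Finite _) _ L (is_lim_seq_const _)).
  intros n. pose proof (shifted_harmonic_lipschitz x y (S n) Hx Hxy). lra.
Qed.

(** The slope of [ln Gamma] between [x] and [x + h] lies between the limits at these two points, and
    the limits differ by a multiple of [h]; so the difference quotient tends to [l] with an error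
    linear in [h]. *)
Lemma digamma_of_limit (x l : R) : 0 < x < 1 -> digamma_limit x l -> digamma x = l.
Proof.
  intros Hx Hl. unfold digamma. apply is_derive_unique.
  (* [d] keeps [x + h] between [x / 2] and 1, where [K] bounds the Lipschitz constants. *)
  set (d := Rmin (x / 2) (1 - x)). assert (Hd : 0 < d) by (apply Rmin_glb_lt; lra).
  set (K := / (x / 2) ^ 2 + 2).
  assert (K0 : / x ^ 2 + 2 <= K).
  { unfold K. apply Rplus_le_compat_r. apply Rinv_le_contravar; [apply pow_lt; lra|]. apply pow_incr; lra. }
  assert (Ix : 0 < / x ^ 2) by (apply Rinv_0_lt_compat, pow_lt; lra).
  enough (D : cderiv (fun s => RtoC (ln (Gamma s))) x (RtoC l)) by exact (proj1 D).
  apply (cderiv_quadratic _ _ _ K d Hd). intros h Hh.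
  pose proof (Rlt_le_trans _ _ _ Hh (Rmin_l _ _)) as H1. pose proof (Rlt_le_trans _ _ _ Hh (Rmin_r _ _)) as H2.
  rewrite <- RtoC_minus, <- RtoC_mult, <- RtoC_minus, Cmod_R, (pow2_abs h).
  apply Rabs_def2 in H1. apply Rabs_def2 in H2.
  destruct (digamma_series_integral (x + h) ltac:(lra)) as (w & _ & Lw).
  set (lh := w - euler_mascheroni) in *. fold (digamma_limit (x + h) lh) in Lw.
  destruct (Rtotal_order h 0) as [N|[->|P]].
  - pose proof (digamma_limit_slope (x + h) x lh l ltac:(lra) ltac:(lra) ltac:(lra) Lw Hl) as [S1 S2].
    pose proof (digamma_limit_lipschitz (x + h) x lh l ltac:(lra) ltac:(lra) Lw Hl) as S3.
    replace (x - (x + h)) with (- h) in * by ring.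
    set (D := ln (Gamma x) - ln (Gamma (x + h))) in *.
    assert (ED : D = D / (- h) * (- h)) by (field; lra). set (sl := D / - h) in *.
    assert (K1 : / (x + h) ^ 2 + 2 <= K).
    { unfold K. apply Rplus_le_compat_r. apply Rinv_le_contravar; [apply pow_lt; lra|]. apply pow_incr; lra. }
    replace (ln (Gamma (x + h)) - ln (Gamma x) - l * h) with (- D - l * h) by (unfold D; ring). rewrite ED.
    assert (S4 : - h * (/ (x + h) ^ 2 + 2) <= - h * K) by (apply Rmult_le_compat_l; lra).
    apply Rabs_le. nra.
  - rewrite Rplus_0_r. replace (ln (Gamma x) - ln (Gamma x) - l * 0) with 0 by ring.
    rewrite Rabs_R0. lra.
  - pose proof (digamma_limit_slope x (x + h) l lh ltac:(lra) ltac:(lra) ltac:(lra) Hl Lw) as [S1 S2].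
    pose proof (digamma_limit_lipschitz x (x + h) l lh ltac:(lra) ltac:(lra) Hl Lw) as S3.
    replace (x + h - x) with h in * by ring.
    set (D := ln (Gamma (x + h)) - ln (Gamma x)) in *.
    assert (ED : D = D / h * h) by (field; lra). set (sl := D / h) in *. rewrite ED.
    assert (S4 : h * (/ x ^ 2 + 2) <= h * K) by (apply Rmult_le_compat_l; lra).
    apply Rabs_le. nra.
Qed.

Lemma digamma_integral (x : R) : 0 < x < 1 ->
  clim (int_seq (digamma_integrand x)) (RtoC (digamma x + euler_mascheroni)).
Proof.
  intros Hx. destruct (digamma_series_integral x ltac:(lra)) as (v & Hv & Lv).
  rewrite (digamma_of_limit x _ Hx Lv). now replace (v - euler_mascheroni + euler_mascheroni) with v by ring.
Qed.

(** * The value at an integer *)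

Lemma cderiv_comp_lin (f : R -> C) (a t : R) (l : C) :
  cderiv f (a * t) l -> cderiv (fun s => f (a * s)) t (a * l)%C.
Proof.
  intros [H1 H2].
  assert (D : is_derive (fun s => a * s) t a) by (auto_derive; [easy|ring]).
  split.
  - replace (Re (a * l)%C) with (a * Re l) by (destruct l; simpl; ring).
    exact (is_derive_comp (fun u => Re (f u)) (fun s => a * s) t _ _ H1 D).
  - replace (Im (a * l)%C) with (a * Im l) by (destruct l; simpl; ring).
    exact (is_derive_comp (fun u => Im (f u)) (fun s => a * s) t _ _ H2 D).
Qed.

Lemma cdiff_comp_lin (f : R -> C) (a t : R) : cdiff f (a * t) -> cdiff (fun s => f (a * s)) t.
Proof. intros [l H]. eexists. exact (cderiv_comp_lin _ _ _ _ H). Qed.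

Lemma CI_comp_lin (f : R -> C) (k a b : R) : 0 < k -> a <= b ->
  (forall t, k * a <= t <= k * b -> cdiff f t) ->
  (k * CI (fun t => f (k * t)%R) a b)%C = CI f (k * a) (k * b).
Proof.
  intros Hk Hab Hf. assert (Hab' : k * a <= k * b) by (apply Rmult_le_compat_l; lra).
  assert (Hf' : forall t, a <= t <= b -> cdiff (fun t => f (k * t)) t)
    by (intros t Ht; apply cdiff_comp_lin, Hf; split; apply Rmult_le_compat_l; lra).
  rewrite <- CI_scal by assumption. apply CI_unique.
  assert (H : is_CI f (k * a + 0) (k * b + 0) (CI f (k * a) (k * b)))
    by (rewrite !Rplus_0_r; now apply is_CI_CI).
  apply is_RInt_comp_lin in H. revert H. apply is_RInt_ext. intros t _.
  rewrite Rplus_0_r. destruct (f (k * t)). apply C_eq; simpl; unfold scal; simpl; unfold mult; simpl; ring.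
Qed.

(** Scaling sends the truncation [[1 / N, N]] to [[J / N, J N]]. This is compared with
    [[1 / (J N), J N]], which belongs to the sequence; on the gap near 0 the bounded integrand
    contributes [O(1 / N)]. *)
Lemma int_seq_comp_lin (f : R -> C) (K q : R) (j : nat) (v : C) : (0 < j)%nat -> 0 < q -> 0 <= K ->
  (forall t, 0 < t -> cdiff f t) -> (forall t, 0 < t -> Cmod (f t) <= K * exp (- (q * t))) ->
  clim (int_seq f) v -> clim (int_seq (fun t => f (INR j * t)%R)) (v / INR j)%C.
Proof.
  intros Hj Hq HK Hf HB Hv. pose proof (le_INR 1 j Hj) as J1. change (INR 1) with 1 in J1.
  set (J := INR j) in *. assert (J0 : RtoC J <> RtoC 0) by (apply RtoC_neq_0; lra).
  (* [pred], because [int_seq] with index [n] truncates at [n + 1]. *)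
  set (u := fun n => int_seq f (pred (j * S n))).
  assert (Hu : clim u v).
  { intros eps He. destruct (Hv eps He) as [N HN]. exists N. intros n Hn. apply HN. nia. }
  assert (D : clim (fun n => u n - J * int_seq (fun t => f (J * t)%R) n)%C 0).
  { apply (clim_inv_bound _ _ (K * J)). intros n.
    pose proof (inv_INR_S n) as [P1 P2]. pose proof (INR_S_ge_1 n) as P3.
    unfold u, int_seq. rewrite Nat.succ_pred by nia. rewrite mult_INR. fold J. set (N := INR (S n)) in *.
    assert (Q : J * / N <= J * N) by (apply Rmult_le_compat_l; lra).
    assert (Q1 : / (J * N) <= J * / N).
    { rewrite Rinv_mult. apply Rmult_le_compat_r; [lra|]. apply Rle_trans with (/ 1); [|lra].
      apply Rinv_le_contravar; lra. }
    assert (Q0 : 0 < / (J * N)) by (apply Rinv_0_lt_compat; nra).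
    rewrite CI_comp_lin by (try (intros t Ht; apply Hf; nra); lra).
    rewrite (CI_Chasles f _ (J * / N)) by (try (intros t Ht; apply Hf; lra); lra).
    match goal with |- Cmod (?a + ?b - ?b - ?z)%C <= _ => replace (a + b - b - z)%C with a by ring end.
    eapply Rle_trans; [apply CI_bound_const with (K := K)|].
    - lra.
    - intros t Ht; apply Hf; lra.
    - intros t Ht. eapply Rle_trans; [apply HB; lra|].
      rewrite <- (Rmult_1_r K) at 2. apply Rmult_le_compat_l; [lra|]. apply exp_le_1. nra.
    - rewrite Rmult_assoc. apply Rmult_le_compat_l; lra. }
  pose proof (clim_scal (/ J)%C _ _ (clim_minus _ _ _ _ Hu D)) as L.
  replace (v / J)%C with (/ J * (v - 0))%C by (field; assumption).
  revert L. apply clim_ext. intros n. field. assumption.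
Qed.

Definition beta_kernel (p c t : R) : C := (exp_kernel p t / (1 - exp_kernel c t))%C.

Lemma cdiff_beta_kernel (p c t : R) : 0 < c -> 0 < t -> cdiff (beta_kernel p c) t.
Proof.
  intros Hc Ht. pose proof (one_minus_exp_kernel_neq_0 c t Hc Ht).
  unfold beta_kernel, exp_kernel in *. cdiff_tac.
Qed.

(** With [x = p / j] and [s = j t] the kernel is [exp (- s) / s] plus [r s]. The function [r],
    Euler's integrand minus Gauss's, integrates to [- digamma x], and rescaling [exp (- s) / s]
    produces [- ln j] by Frullani's integral. *)
Lemma beta_kernel_integral (p : R) (j : nat) : 0 < p < INR j ->
  clim (fun n => int_seq (beta_kernel p (INR j)) n - exp_integral 1 n / INR j)%C
    (- (digamma (p / INR j) + ln (INR j)) / INR j)%C.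
Proof.
  intros Hp. assert (Hj : (0 < j)%nat) by (apply INR_lt; simpl; lra).
  set (J := INR j) in *. assert (J0 : RtoC J <> RtoC 0) by (apply RtoC_neq_0; lra).
  set (x := p / J).
  assert (Hx : 0 < x < 1).
  { unfold x. split; [apply Rdiv_lt_0_compat; lra|]. apply Rmult_lt_reg_r with J; [lra|].
    unfold Rdiv. rewrite Rmult_assoc, Rinv_l by lra. lra. }
  set (r := fun t => (euler_integrand t - digamma_integrand x t)%C).
  assert (Cr : forall t, 0 < t -> cdiff r t).
  { intros t Ht. apply cdiff_minus; [now apply cdiff_euler_integrand|now apply cdiff_digamma_integrand]. }
  assert (Lr : clim (int_seq r) (- digamma x)%C).
  { pose proof (clim_minus _ _ _ _ (proj2 euler_limit) (digamma_integral x Hx)) as L.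
    replace (RtoC euler_mascheroni - (digamma x + euler_mascheroni)%R)%C with (- digamma x)%C in L
      by (rewrite RtoC_plus; ring).
    revert L. apply clim_ext. intros n. symmetry. apply int_seq_minus.
    - intros; now apply cdiff_euler_integrand.
    - intros; now apply cdiff_digamma_integrand. }
  assert (Br : forall t, 0 < t -> Cmod (r t) <= 2 * exp (- (x * t))).
  { intros t Ht. eapply Rle_trans; [apply Cmod_minus_le|].
    pose proof (euler_integrand_bound t Ht). pose proof (digamma_integrand_bound x t ltac:(lra) Ht).
    assert (exp (- (1 * t)) <= exp (- (x * t))) by (apply exp_le; nra). lra. }
  pose proof (int_seq_comp_lin r 2 x j _ Hj ltac:(lra) ltac:(lra) Cr Br Lr) as L1.
  pose proof (clim_scal (/ J)%C _ _ (exp_integral_limit (RtoC J) ltac:(change (0 < J); lra))) as L2.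
  rewrite Clog_pos in L2 by lra.
  pose proof (clim_plus _ _ _ _ L1 L2) as L.
  replace (- (digamma x + ln J) / J)%C with (- digamma x / J + / J * - ln J)%C by (field; assumption).
  revert L. apply clim_ext. intros n. cbv beta.
  replace (int_seq (beta_kernel p J) n) with
    (int_seq (fun t => r (J * t)%R + / J * (exp_kernel J t / t))%C n).
  - rewrite int_seq_plus, int_seq_scal.
    + unfold exp_integral. fold J. field. assumption.
    + intros; now apply cdiff_exp_integrand.
    + intros t Ht. apply cdiff_comp_lin, Cr. nra.
    + intros t Ht. apply cdiff_mult; [apply cdiff_const|now apply cdiff_exp_integrand].
  - apply int_seq_ext. intros t Ht. unfold r, euler_integrand, digamma_integrand, beta_kernel.
    assert (E : forall w : R, exp_kernel w (J * t) = exp_kernel (w * J)%R t)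
      by (intros w; unfold exp_kernel; f_equal; rewrite !RtoC_mult; ring).
    rewrite !E. rewrite Rmult_1_l. replace (x * J) with p by (unfold x; field; lra).
    pose proof (one_minus_exp_kernel_neq_0 J t ltac:(simpl; lra) Ht). pose proof (RtoC_pos_neq_0 t Ht).
    rewrite RtoC_mult. field. repeat split; assumption.
Qed.

Lemma weighted_geometric_sum (M x : C) (n : nat) :
  ((1 - x) ^ 3 * Csum (fun k => INR (S k) * (M - INR (S k)) * x ^ S k) n
   = M * (1 - x) * (x - (INR n + 1) * x ^ S n + INR n * x ^ S (S n))
     - (x + x ^ 2 - (INR n + 1) ^ 2 * x ^ S n
        + (2 * (INR n + 1) ^ 2 - 2 * (INR n + 1) - 1) * x ^ S (S n) - INR n ^ 2 * x ^ S (S (S n))))%C.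
Proof.
  induction n as [|n IH].
  - simpl Csum. simpl INR. simpl Cpow. ring.
  - change (Csum (fun k => INR (S k) * (M - INR (S k)) * x ^ S k)%C (S n)) with
      (Csum (fun k => INR (S k) * (M - INR (S k)) * x ^ S k)%C n + INR (S n) * (M - INR (S n)) * x ^ S n)%C.
    rewrite Cmult_plus_distr_l, IH, S_INR, RtoC_plus. generalize (RtoC (INR n)). intros N.
    simpl Cpow. ring.
Qed.

(** * Integration by parts and its boundary terms *)

(** Its derivative is a polynomial in it, so that the integrations by parts become polynomial
    identities. *)
Definition planck (c : C) (t : R) : C := (1 / (Cexp (c * t) - 1))%C.

Lemma cderiv_planck (c : C) (t : R) : 0 < Re c -> 0 < t ->
  cderiv (planck c) t (- c * (planck c t + planck c t ^ 2))%C.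
Proof.
  intros Hc Ht. pose proof (Cexp_ct_neq_1 c t Hc Ht) as Y0.
  assert (D : cderiv (fun s : R => (c * s)%C) t c).
  { eapply cderiv_eq; [apply cderiv_scal, cderiv_RtoC, (is_derive_id (K := R_AbsRing))|].
    unfold one; simpl. cbv beta. ring. }
  pose proof (cderiv_minus _ _ _ _ _ (cderiv_Cexp _ _ _ D) (cderiv_const 1 t)) as DX.
  eapply cderiv_eq; [exact (cderiv_div _ _ _ _ _ (cderiv_const 1 t) DX Y0)|].
  cbv beta. unfold planck. simpl Cpow. field. assumption.
Qed.

Lemma cdiff_planck (c : C) (t : R) : 0 < Re c -> 0 < t -> cdiff (planck c) t.
Proof. intros Hc Ht. eexists. now apply cderiv_planck. Qed.

(* Found by integrating [e^(-p t) q / (1 - q)^3], where [q = e^(-c t)], by parts twice and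
   summing over [p = 1 .. c]. *)
Definition primitive_infty (c : C) (t : R) : C :=
  ((1 + 2 * planck c t) * planck 1 t / (2 * c) - (planck 1 t + planck 1 t ^ 2) / (2 * c ^ 2))%C.

(** What the integrations by parts leave; for [c = j] it is the combination of beta kernels with
    weights [p (j - p) / (2 j ^ 2)]. *)
Definition remaining_infty (c : C) (t : R) : C :=
  ((planck 1 t + planck 1 t ^ 2) * ((1 + 2 * planck c t) / (2 * c) - (1 + 2 * planck 1 t) / (2 * c ^ 2)))%C.

Lemma integrand_infty_planck (c : C) (t : R) : 0 < Re c -> 0 < t ->
  integrand_infty c t = (- planck 1 t * (planck c t + planck c t ^ 2))%C.
Proof.
  intros Hc Ht. pose proof (RtoC_pos_neq_0 t Ht) as T0. pose proof (Cexp_t_neq_1 t Ht) as X0.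
  pose proof (Cexp_ct_neq_1 c t Hc Ht) as Y0.
  unfold integrand_infty, planck. rewrite Cmult_1_l. simpl Cpow. field. repeat split; assumption.
Qed.

Lemma cderiv_primitive_infty (c : C) (t : R) : 0 < Re c -> 0 < t ->
  cderiv (primitive_infty c) t (integrand_infty c t - remaining_infty c t)%C.
Proof.
  intros Hc Ht. pose proof (Re_neq_0 c Hc) as C0.
  pose proof (cderiv_planck c t Hc Ht) as Dc. pose proof (cderiv_planck 1 t ltac:(simpl; lra) Ht) as D1.
  rewrite integrand_infty_planck by assumption.
  apply (cderiv_ext (fun t => / (2 * c) * ((1 + 2 * planck c t) * planck 1 t)
     - / (2 * c ^ 2) * (planck 1 t + planck 1 t * planck 1 t))%C).
  { intros s. unfold primitive_infty. simpl Cpow. field. assumption. }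
  eapply cderiv_eq.
  - exact (cderiv_minus _ _ _ _ _ (cderiv_scal _ _ _ _ (cderiv_mult _ _ _ _ _
      (cderiv_plus _ _ _ _ _ (cderiv_const 1 t) (cderiv_scal 2 _ _ _ Dc)) D1))
      (cderiv_scal _ _ _ _ (cderiv_plus _ _ _ _ _ D1 (cderiv_mult _ _ _ _ _ D1 D1)))).
  - cbv beta. unfold remaining_infty. simpl Cpow. field. assumption.
Qed.

Lemma cdiff_remaining_infty (c : C) (t : R) : 0 < Re c -> 0 < t -> cdiff (remaining_infty c) t.
Proof.
  intros Hc Ht. pose proof (cdiff_planck c t Hc Ht). pose proof (cdiff_planck 1 t ltac:(simpl; lra) Ht).
  assert (C1 : (2 * c)%C <> RtoC 0) by (apply Cmult_neq_0; [apply RtoC_neq_0; lra|now apply Re_neq_0]).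
  assert (C2 : (2 * c ^ 2)%C <> RtoC 0)
    by (apply Cmult_neq_0; [apply RtoC_neq_0; lra|now apply Cpow_neq_0, Re_neq_0]).
  unfold remaining_infty. cdiff_tac.
Qed.

(** A primitive of the counterterms of [integrand_unit], normalised to vanish at 1, so that
    [primitive_infty] serves on both intervals. *)
Definition subtraction_primitive (c : C) (t : R) : C :=
  (- 1 / (2 * c ^ 2) * (/ t) ^ 2 + 1 / (2 * c ^ 2) * / t - (1 / 12 - 1 / (12 * c ^ 2)) * ln t)%C.

Lemma cderiv_subtraction_primitive (c : C) (t : R) : 0 < Re c -> 0 < t ->
  cderiv (subtraction_primitive c) t (integrand_unit c t - integrand_infty c t)%C.
Proof.
  intros Hc Ht. pose proof (RtoC_pos_neq_0 t Ht) as T0. pose proof (Cexp_t_neq_1 t Ht) as X0.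
  pose proof (Cexp_ct_neq_1 c t Hc Ht) as Y0. pose proof (Re_neq_0 c Hc) as C0.
  pose proof (cderiv_inv _ _ _ (cderiv_RtoC _ _ _ (is_derive_id (K := R_AbsRing) t)) T0) as Di.
  assert (D0 : is_derive ln t (/ t)) by (auto_derive; [lra|field; lra]).
  apply cderiv_RtoC in D0. unfold one in Di; simpl in Di.
  eapply cderiv_eq.
  - exact (cderiv_minus _ _ _ _ _ (cderiv_plus _ _ _ _ _ (cderiv_scal _ _ _ _ (cderiv_pow _ _ _ 2 Di))
      (cderiv_scal _ _ _ _ Di)) (cderiv_scal _ _ _ _ D0)).
  - cbv beta. unfold integrand_unit, integrand_infty. rewrite RtoC_inv by lra.
    simpl Cpow. simpl pred. simpl INR. rewrite RtoC_plus. simpl Cpow. field. repeat split; assumption.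
Qed.

(** The constant term [1 / 12 + 1 / (8 * c ^ 2)] is the source of the rational part of the closed
    form; the pole terms are those of [subtraction_primitive] with opposite sign. *)
Lemma primitive_near_0 (c : C) : 0 < Re c ->
  bounded_on (fun t => 0 < t <= 1) (fun t => (primitive_infty c t
    - (1 / (2 * c ^ 2 * t ^ 2) - 1 / (2 * c ^ 2 * t) + 1 / 12 + 1 / (8 * c ^ 2))) / t)%C.
Proof.
  intros Hc. set (Cond := fun t : R => 0 < t <= 1).
  destruct (todd_bounds_near c Hc) as (K & HK & B).
  destruct (todd_bounds_near 1 ltac:(simpl; lra)) as (K' & HK' & B').
  assert (C0 : c <> RtoC 0) by now apply Re_neq_0.
  assert (Z : forall w, Cmod (w - w)%C = 0) by (intros w; replace (w - w)%C with (RtoC 0) by ring; apply Cmod_0).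
  assert (Bt : bounded_on Cond RtoC) by (exists 1; intros t [H1 H2]; rewrite Cmod_RtoC_pos; lra).
  assert (B1 : bounded_on Cond (fun t => todd (1 * t) / t ^ 3)%C).
  { apply (bounded_on_of_power Cond _ 3 K'); [now intros t [H _]|]. intros t Ht. apply B'; [|exact Ht].
    rewrite Z. simpl. lra. }
  assert (B2 : bounded_on Cond (fun t => todd (c * t) / t ^ 3)%C).
  { apply (bounded_on_of_power Cond _ 3 K); [now intros t [H _]|]. intros t Ht. apply B; [|exact Ht].
    rewrite Z. lra. }
  assert (B3 : bounded_on Cond (fun t => todd1 (1 * t) / t ^ 2)%C).
  { apply (bounded_on_of_power Cond _ 2 K'); [now intros t [H _]|]. intros t Ht. apply B'; [|exact Ht].
    rewrite Z. simpl. lra. }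
  set (T1 := fun t : R => (todd (1 * t) / t ^ 3)%C) in *. set (T2 := fun t : R => (todd (c * t) / t ^ 3)%C) in *.
  set (T3 := fun t : R => (todd1 (1 * t) / t ^ 2)%C) in *.
  apply (bounded_on_ext Cond (fun t : R => t * / c ^ 2 * T1 t + t * / c * T2 t - 1 / 24 + t * / 144
     + t ^ 3 * / 12 * T1 t - t ^ 2 * / (2 * c) * T2 t + t ^ 3 * / (12 * c) * T2 t
     + t ^ 5 * / c * T1 t * T2 t + t * / (2 * c ^ 2) * T3 t)%C); [|bounded_tac].
  intros t [Ht Ht1]. assert (T0 : RtoC t <> RtoC 0) by now apply RtoC_pos_neq_0.
  assert (E1 : planck 1 t = (T1 t * t ^ 3 + 1 / t - 1 / 2 + t / 12)%C).
  { unfold planck. rewrite bose_factor. unfold T1. rewrite Cmult_1_l. simpl Cpow. field. assumption. }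
  assert (E2 : planck c t = (T2 t * t ^ 3 + 1 / (c * t) - 1 / 2 + c * t / 12)%C).
  { unfold planck. rewrite bose_factor. unfold T2. simpl Cpow. field. split; assumption. }
  assert (E3 : (planck 1 t + planck 1 t ^ 2)%C = (1 / t ^ 2 - 1 / 12 - T3 t * t ^ 2)%C).
  { transitivity (Cexp t / (Cexp t - 1) ^ 2)%C.
    - unfold planck. rewrite Cmult_1_l. simpl Cpow. pose proof (Cexp_t_neq_1 t Ht). field. assumption.
    - rewrite Cexp_over_square. unfold T3. rewrite Cmult_1_l. simpl Cpow. field. assumption. }
  unfold primitive_infty. rewrite E3, E1, E2. simpl Cpow. field. split; assumption.
Qed.

Lemma primitive_limits (c : C) : 0 < Re c ->
  clim (fun n => primitive_infty c (INR (S n)) - (primitive_infty c (/ INR (S n))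
      + subtraction_primitive c (/ INR (S n))) + (1 / 12 - 1 / (12 * c ^ 2)) * ln (INR (S n)))%C
    (- (1 / 12 + 1 / (8 * c ^ 2)))%C.
Proof.
  intros Hc. assert (C0 : c <> RtoC 0) by now apply Re_neq_0.
  assert (L1 : clim (fun n => primitive_infty c (INR (S n))) 0).
  { set (Cond := fun t => 1 <= t).
    assert (Bc : bounded_on Cond (planck c)).
    { exists (/ Re c). intros t Ht. unfold planck, Cdiv. rewrite Cmult_1_l. now apply inv_Cexp_ct_bound. }
    assert (B1 : bounded_on Cond (planck 1)).
    { exists (/ Re (RtoC 1)). intros t Ht. unfold planck, Cdiv. rewrite Cmult_1_l.
      apply inv_Cexp_ct_bound; [simpl; lra|exact Ht]. }
    assert (BG : bounded_on Cond (fun t => (1 + 2 * planck c t) * / (2 * c) - (1 + planck 1 t) * / (2 * c ^ 2))%C)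
      by bounded_tac.
    destruct (bounded_on_pos _ _ BG) as (K & HK & HB).
    apply (clim_inv_bound _ _ (2 * K)). intros n. pose proof (INR_S_ge_1 n) as P. set (N := INR (S n)) in *.
    replace (primitive_infty c N - 0)%C with (planck 1 N *
      ((1 + 2 * planck c N) * / (2 * c) - (1 + planck 1 N) * / (2 * c ^ 2)))%C
      by (unfold primitive_infty; simpl Cpow; field; assumption).
    rewrite Cmod_mult. replace (2 * K * / N) with (2 * / N * K) by ring.
    apply Rmult_le_compat; [apply Cmod_ge_0|apply Cmod_ge_0| |now apply HB].
    unfold planck, Cdiv. rewrite !Cmult_1_l. eapply Rle_trans; [now apply inv_Cexp_t_bound|].
    apply Rmult_le_compat_l; [lra|]. apply exp_neg_le_inv. lra. }
  assert (L2 : clim (fun n => primitive_infty c (/ INR (S n)) + subtraction_primitive c (/ INR (S n))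
     - (1 / 12 - 1 / (12 * c ^ 2)) * ln (INR (S n)) - (1 / 12 + 1 / (8 * c ^ 2)))%C 0).
  { destruct (bounded_on_pos _ _ (primitive_near_0 c Hc)) as (K & HK & HB).
    apply (clim_inv_bound _ _ K). intros n. pose proof (inv_INR_S n) as [P1 P2]. pose proof (INR_S_ge_1 n) as P3.
    specialize (HB (/ INR (S n)) ltac:(lra)). set (t := / INR (S n)) in *.
    assert (T0 : RtoC t <> RtoC 0) by now apply RtoC_pos_neq_0.
    rewrite Cmod_div, (Cmod_RtoC_pos t) in HB by (assumption || lra).
    apply Rmult_le_compat_r with (r := t) in HB; [|lra].
    unfold Rdiv in HB. rewrite Rmult_assoc, Rinv_l, Rmult_1_r in HB by lra.
    eapply Rle_trans; [|exact HB]. right. f_equal. unfold subtraction_primitive.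
    replace (ln t) with (- ln (INR (S n))) by (unfold t; rewrite ln_Rinv; lra).
    rewrite RtoC_opp. simpl Cpow. field. split; assumption. }
  pose proof (clim_minus _ _ _ _ (clim_minus _ _ _ _ L1 L2) (clim_const (1 / 12 + 1 / (8 * c ^ 2))%C)) as L.
  replace (- (1 / 12 + 1 / (8 * c ^ 2)))%C with (0 - 0 - (1 / 12 + 1 / (8 * c ^ 2)))%C by ring.
  revert L. apply clim_ext. intros n. ring.
Qed.

(** The logarithm of the counterterms and the truncated exponential integral combine to Euler's
    constant, which cancels its explicit occurrence in [dzeta_integral]. *)
Lemma remaining_infty_integral (c : C) (v : C) : 0 < Re c ->
  clim (fun n => int_seq (remaining_infty c) n - (1 / 12 - 1 / (12 * c ^ 2)) * exp_integral 1 n)%C v ->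
  dzeta_integral c = (v - (1 / 12 + 1 / (8 * c ^ 2)))%C.
Proof.
  intros Hc Hv. assert (C0 : c <> RtoC 0) by now apply Re_neq_0.
  destruct (integrals_exist c Hc) as (_ & _ & L).
  pose proof (clim_plus _ _ _ _ (clim_plus _ _ _ _ (primitive_limits c Hc) Hv)
    (clim_scal (1 / 12 - 1 / (12 * c ^ 2))%C _ _ exp_integral_1_limit)) as L'.
  unfold dzeta_integral.
  match type of L with clim _ ?s => assert (E : s = (v - (1 / 12 + 1 / (8 * c ^ 2))
    - euler_mascheroni * (1 / 12 - 1 / (12 * c ^ 2)))%C) end.
  { apply (clim_unique _ _ _ L). revert L'.
    match goal with |- clim _ ?a -> clim _ ?b => replace a with b by ring end.
    apply clim_ext. intros n. cbv beta. pose proof (inv_INR_S n) as [P1 P2]. pose proof (INR_S_ge_1 n) as P3.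
    unfold int_seq. rewrite (CI_Chasles _ _ 1) by (try (intros; apply cdiff_remaining_infty; [assumption|lra]); lra).
    set (N := INR (S n)) in *.
    assert (EU : (CI (integrand_unit c) (/ N) 1 - CI (remaining_infty c) (/ N) 1)%C
      = (primitive_infty c 1 + subtraction_primitive c 1
         - (primitive_infty c (/ N) + subtraction_primitive c (/ N)))%C).
    { rewrite <- CI_minus.
      - apply (CI_FTC (fun t => primitive_infty c t + subtraction_primitive c t)%C); [lra| |].
        + intros t Ht. eapply cderiv_eq; [apply cderiv_plus; [apply cderiv_primitive_infty|
            apply cderiv_subtraction_primitive]; assumption || lra|]. ring.
        + intros t Ht. apply cdiff_minus; [apply cdiff_integrand_unit|apply cdiff_remaining_infty]; assumption || lra.
      - lra.
      - intros; apply cdiff_integrand_unit; assumption || lra.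
      - intros; apply cdiff_remaining_infty; assumption || lra. }
    assert (EI : (CI (integrand_infty c) 1 N - CI (remaining_infty c) 1 N)%C
      = (primitive_infty c N - primitive_infty c 1)%C).
    { rewrite <- CI_minus.
      - apply (CI_FTC (primitive_infty c)); [lra| |].
        + intros t Ht. apply cderiv_primitive_infty; assumption || lra.
        + intros t Ht. apply cdiff_minus; [apply cdiff_integrand_infty|apply cdiff_remaining_infty]; assumption || lra.
      - lra.
      - intros; apply cdiff_integrand_infty; assumption || lra.
      - intros; apply cdiff_remaining_infty; assumption || lra. }
    replace (CI (integrand_unit c) (/ N) 1) with (CI (remaining_infty c) (/ N) 1 +
      (CI (integrand_unit c) (/ N) 1 - CI (remaining_infty c) (/ N) 1))%C by ring.
    replace (CI (integrand_infty c) 1 N) with (CI (remaining_infty c) 1 N +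
      (CI (integrand_infty c) 1 N - CI (remaining_infty c) 1 N))%C by ring.
    rewrite EU, EI. replace (subtraction_primitive c 1) with (RtoC 0); [ring|].
    unfold subtraction_primitive. rewrite ln_1. simpl Cpow. field. assumption. }
  rewrite E. ring.
Qed.

(** Here [j] is [S m]; the sum ends at [p = j - 1] since the weight of [p = j] is 0. *)
Lemma remaining_infty_sum (m : nat) (t : R) : 0 < t ->
  remaining_infty (INR (S m)) t = Csum (fun k => RtoC (INR (S k) * (INR (S m) - INR (S k)) / (2 * INR (S m) ^ 2))
    * beta_kernel (INR (S k)) (INR (S m)) t)%C m.
Proof.
  intros Ht. set (x := exp_kernel 1 t). pose proof (INR_S_ge_1 m) as P.
  assert (EK : forall n, exp_kernel (INR n) t = (x ^ n)%C).
  { intros n. unfold x, exp_kernel. rewrite <- Cexp_INR. f_equal. ring. }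
  pose proof (one_minus_exp_kernel_neq_0 1 t ltac:(simpl; lra) Ht) as X0. fold x in X0.
  pose proof (one_minus_exp_kernel_neq_0 (INR (S m)) t ltac:(change (0 < INR (S m)); lra) Ht) as Y0.
  assert (Q0 : x <> RtoC 0) by apply exp_kernel_neq_0.
  assert (QJ : exp_kernel (INR (S m)) t <> RtoC 0) by apply exp_kernel_neq_0.
  assert (EP : forall w, exp_kernel w t <> RtoC 0 -> (1 - exp_kernel w t)%C <> RtoC 0 ->
    planck w t = (exp_kernel w t / (1 - exp_kernel w t))%C).
  { intros w H1 H2. unfold planck. replace (Cexp (w * t)) with (/ exp_kernel w t)%C.
    - field. repeat split; try assumption.
    - unfold exp_kernel. rewrite Cexp_opp. field. apply Cexp_neq_0. }
  assert (J0 : RtoC (INR (S m)) <> RtoC 0) by (apply RtoC_neq_0; lra).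
  rewrite (Csum_ext _ (fun k => (/ (2 * INR (S m) ^ 2) * / (1 - exp_kernel (INR (S m)) t)) *
     (INR (S k) * (INR (S m) - INR (S k)) * x ^ S k))%C).
  - rewrite Csum_scal. pose proof (weighted_geometric_sum (INR (S m)) x m) as W.
    set (S0 := Csum _ m) in *.
    replace S0 with ((1 - x) ^ 3 * S0 / (1 - x) ^ 3)%C by (simpl Cpow; field; assumption).
    rewrite W. clear W S0. unfold remaining_infty. rewrite !EP by assumption. fold x. rewrite EK in *.
    replace (RtoC (INR m)) with (INR (S m) - 1)%C by (rewrite S_INR, RtoC_plus; ring).
    generalize dependent (RtoC (INR (S m))). intros J J0.
    change (x ^ S (S (S m)))%C with (x * (x * x ^ S m))%C. change (x ^ S (S m))%C with (x * x ^ S m)%C.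
    generalize dependent (x ^ S m)%C. intros y Y0 Y1. simpl Cpow. field. repeat split; assumption.
  - intros k _. unfold beta_kernel. rewrite (EK (S k)).
    rewrite RtoC_div, RtoC_mult, RtoC_minus, RtoC_mult, RtoC_pow by nra.
    field. repeat split; assumption.
Qed.

Lemma Csum_RtoC (f : nat -> R) (n : nat) : Csum (fun k => RtoC (f k)) n = RtoC (Rsum f n).
Proof. induction n as [|n IH]; [reflexivity|]. cbn [Csum Rsum]. now rewrite IH, RtoC_plus. Qed.

Lemma sum_n_m_Rsum (f : nat -> R) (n : nat) : sum_n_m f 1 (S n) = Rsum (fun k => f (S k)) (S n).
Proof.
  induction n as [|n IH].
  - rewrite sum_n_n. symmetry. apply Rplus_0_l.
  - rewrite sum_n_Sm, IH by lia. reflexivity.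
Qed.

Lemma sum_p_A_minus_p (A : R) (n : nat) : Rsum (fun k => INR (S k) * (A - INR (S k))) n
  = A * (INR n * (INR n + 1) / 2) - INR n * (INR n + 1) * (2 * INR n + 1) / 6.
Proof.
  induction n as [|n IH]; [simpl; field|]. cbn [Rsum]. rewrite IH, S_INR. field.
Qed.

(** The weights [b] sum to [J / 12 - 1 / (12 J)]. Divided by [J], this is the coefficient of the
    exponential integral to be removed; multiplied further by [- ln J], it is the logarithmic term
    of the closed form. *)
Lemma dzeta_integral_INR (j : nat) : (1 < j)%nat ->
  dzeta_integral (RtoC (INR j)) = RtoC (dzeta_closed j).
Proof.
  intros Hj. destruct j as [|m]; [lia|]. pose proof (INR_S_ge_1 m) as P.
  set (J := INR (S m)) in *. assert (J0 : RtoC J <> RtoC 0) by (apply RtoC_neq_0; lra).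
  assert (HJ : 0 < Re (RtoC J)) by (change (0 < J); lra).
  set (b := fun k => INR (S k) * (J - INR (S k)) / (2 * J ^ 2)).
  set (psi := fun k => digamma (INR (S k) / J)).
  assert (Sb : Rsum b m = J / 12 - / (12 * J)).
  { rewrite (Rsum_ext _ (fun k => / (2 * J ^ 2) * (INR (S k) * (J - INR (S k)))))
      by (intros; unfold b; field; lra).
    rewrite Rsum_scal, sum_p_A_minus_p. replace (INR m) with (J - 1) by (unfold J; rewrite S_INR; ring).
    field. lra. }
  rewrite (remaining_infty_integral (RtoC J) (RtoC (Rsum (fun k => b k * (- (psi k + ln J) / J)) m)) HJ).
  - replace (1 / 12 + 1 / (8 * J ^ 2))%C with (RtoC (1 / 12 + 1 / (8 * J ^ 2))).
    2: { rewrite RtoC_plus, !RtoC_div, RtoC_mult, RtoC_pow by nra. reflexivity. }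
    (* Unfolding [Rsum] once splits off the term [p = j], whose factor [J - J] vanishes. *)
    rewrite <- RtoC_minus. f_equal. unfold dzeta_closed. rewrite sum_n_m_Rsum. cbn [Rsum]. fold J.
    replace (Rsum (fun k => b k * (- (psi k + ln J) / J)) m) with
      (- (1 / (2 * J ^ 3)) * Rsum (fun k => INR (S k) * (J - INR (S k)) * psi k) m - ln J / J * Rsum b m).
    + rewrite Sb. unfold psi. field. lra.
    + rewrite (Rsum_ext (fun k => b k * _) (fun k => - (1 / (2 * J ^ 3)) * (INR (S k) * (J - INR (S k)) * psi k)
        + - (ln J / J) * b k)) by (intros; unfold b; field; lra).
      rewrite Rsum_plus, !Rsum_scal. ring.
  - rewrite <- Csum_RtoC.
    pose proof (clim_Csum (fun k n => RtoC (b k) * (int_seq (beta_kernel (INR (S k)) J) n - exp_integral 1 n / J))%C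
      (fun k => RtoC (b k * (- (psi k + ln J) / J))) m) as L.
    assert (H : forall k, (k < m)%nat -> 0 < INR (S k) < J).
    { intros k Hk. split; [apply (lt_INR 0); lia|apply lt_INR; lia]. }
    refine (clim_ext _ _ _ _ (L _)).
    + intros n. cbv beta. set (E := exp_integral 1 n).
      rewrite (int_seq_ext (remaining_infty J) (fun t => Csum (fun k => b k * beta_kernel (INR (S k)) J t)%C m) n
        (remaining_infty_sum m)).
      rewrite (int_seq_Csum (fun k t => RtoC (b k) * beta_kernel (INR (S k)) J t)%C).
      * rewrite (Csum_ext _ (fun k => int_seq (fun t => b k * beta_kernel (INR (S k)) J t)%C n - E / J * b k)%C).
        -- rewrite Csum_minus, Csum_scal, Csum_RtoC, Sb.
           rewrite RtoC_minus, RtoC_inv, RtoC_mult, RtoC_div by lra. simpl Cpow. field. assumption.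
        -- intros k Hk. rewrite int_seq_scal by (intros; now apply cdiff_beta_kernel). field. assumption.
      * intros k t Ht. apply cdiff_mult; [apply cdiff_const|]. apply cdiff_beta_kernel; lra.
    + intros k Hk. rewrite RtoC_mult, RtoC_div, RtoC_opp, RtoC_plus by lra.
      apply clim_scal. exact (beta_kernel_integral (INR (S k)) (S m) (H k Hk)).
Qed.

Theorem theorem1p1 :
  (forall c : C, 0 < Re c -> exists F : C -> C, is_zeta_continuation c F) /\
  (forall c : C, 0 < Re c ->
     ex_RInt_gen (V := C_R_NormedModule) (integrand_infty c)
       (at_point 1) (Rbar_locally p_infty) /\
     ex_RInt (V := C_R_NormedModule) (integrand_unit c) 0 1) /\
  (forall (zeta : C -> C -> C) (dzeta0 : C -> C),
     (forall c : C, 0 < Re c -> is_zeta_continuation c (zeta c)) ->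
     (forall c : C, 0 < Re c ->
        is_derive (K := C_AbsRing) (V := C_NormedModule)
          (zeta c) (RtoC 0) (dzeta0 c)) ->
     (forall c : C, 0 < Re c ->
        is_derive (K := C_AbsRing) (V := C_NormedModule)
          dzeta0 c (dzeta_integral c)) /\
     (forall j : nat, (1 < j)%nat ->
        is_derive (K := C_AbsRing) (V := C_NormedModule)
          dzeta0 (RtoC (INR j)) (RtoC (dzeta_closed j)))) /\
  (forall j : nat, (1 < j)%nat ->
     dzeta_integral (RtoC (INR j)) = RtoC (dzeta_closed j)).
Proof.
  split; [|split; [|split]].
  - intros c Hc. exists (zeta_ext c). now apply zeta_ext_continuation.
  - intros c Hc. destruct (integrals_exist c Hc) as (H1 & H2 & _). now split.
  - intros zeta dzeta0 Hz Hd. pose proof (zeta_deriv_is_derive zeta dzeta0 Hz Hd) as D.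
    split; [exact D|]. intros j Hj. rewrite <- dzeta_integral_INR by exact Hj. apply D.
    change (0 < INR j). apply (lt_INR 0). lia.
  - exact dzeta_integral_INR.
Qed.
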